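(* For every positive integer $k$, the series $G_o(q)=\sum_{n\geq 0}\sigma_o\mathrm{mex}(n)q^n$ is lacunary modulo $2^k$; that is, \[\lim_{X\to\infty}\frac{\#\{0\le n\leq X:\ \sigma_o\mathrm{mex}(n)\equiv 0\pmod{2^k}\}}{X}=1.\]
   Context: A partition of a nonnegative integer $n$ is a non-increasing sequence of positive integers (parts) summing to $n$; $\mathcal{P}(n)$ denotes the set of partitions of $n$. The minimal excludant $\mathrm{mex}(\pi)$ of a partition $\pi$ is the least positive integer that is not a part of $\pi$. Define $\sigma_o\mathrm{mex}(n):=\sum_{\pi\in\mathcal{P}(n),\ 2\nmid \mathrm{mex}(\pi)}\mathrm{mex}(\pi)$, the sum of the odd minimal excludants over all partitions of $n$. An integral power series $\sum a(n)q^n$ is called lacunary modulo $M$ if the proportion of $n\le X$ with $a(n)\equiv 0\pmod M$ tends to $1$ as $X\to\infty$. *)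

(* Defs.v *)
From HB Require Import structures.
From mathcomp Require Import all_boot all_order all_algebra.
From mathcomp Require Import all_classical all_reals.
From mathcomp Require Import topology normedtype sequences.

Set Implicit Arguments.
Unset Strict Implicit.
Unset Printing Implicit Defensive.

Import Order.TTheory GRing.Theory Num.Theory.
Import numFieldNormedType.Exports.

Definition is_partition (n : nat) (s : seq nat) : bool :=
  [&& sorted geq s, 0 \notin s & sumn s == n].

Record partition_of (n : nat) := PartitionOf {
  parts :> seq nat;
  partsP : is_partition n parts
}.

HB.instance Definition _ n := [isSub for @parts n].
HB.instance Definition _ n := [Countable of partition_of n by <:].

Section PartitionFinite.
Variable n : nat.

Lemma mem_leq_sumn (s : seq nat) x : x \in s -> x <= sumn s.
Proof.
elim: s => //= y s IHs; rewrite inE => /orP[/eqP->|/IHs]; first exact: leq_addr.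
by move/leq_trans; apply; apply: leq_addl.
Qed.

Lemma size_leq_sumn (s : seq nat) : 0 \notin s -> size s <= sumn s.
Proof.
elim: s => //= y s IHs; rewrite inE negb_or eq_sym -lt0n => /andP[y0 /IHs le_s].
by rewrite -add1n leq_add.
Qed.

Lemma size_parts (p : partition_of n) : size p <= n.
Proof. by case: p => s /= /and3P[_ s0 /eqP <-]; apply: size_leq_sumn. Qed.

Lemma size_pack (p : partition_of n) : size (map (@inord n) p) <= n.
Proof. by rewrite size_map size_parts. Qed.

Definition pack (p : partition_of n) : n.-bseq 'I_n.+1 := Bseq (size_pack p).

Definition unpack (b : n.-bseq 'I_n.+1) : option (partition_of n) :=
  insub (map val b).

Lemma packK : pcancel pack unpack.
Proof.
move=> p; rewrite /unpack /pack /= -map_comp.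
have -> : [seq (val \o inord (n' := n)) i | i <- p] = p.
  rewrite -[RHS]map_id; apply/eq_in_map => x xp /=; apply: inordK.
  by rewrite ltnS; case: p xp => s /= /and3P[_ _ /eqP <-]; apply: mem_leq_sumn.
exact: valK.
Qed.

End PartitionFinite.

HB.instance Definition _ n : isFinite (partition_of n) :=
  PCanIsFinite (@packK n).

Lemma ex_mex (s : seq nat) : exists m, (0 < m) && (m \notin s).
Proof.
exists (sumn s).+1 => /=; apply/negP => /mem_leq_sumn.
by rewrite ltnn.
Qed.

Definition mex (s : seq nat) : nat := ex_minn (ex_mex s).

Definition sigma_o_mex (n : nat) : nat :=
  \sum_(p : partition_of n | odd (mex p)) mex p.

(* An integral power series is represented by its coefficient sequence. *)
Definition G_o (n : nat) : int := Posz (sigma_o_mex n).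

Local Open Scope classical_set_scope.
Local Open Scope ring_scope.

Definition count_zero_mod (a : nat -> int) (M X : nat) : nat :=
  #|[set n : 'I_X.+1 | (a n == 0 %[mod M])%Z]%SET|.

Definition lacunary_mod (R : realType) (a : nat -> int) (M : nat) : Prop :=
  ((count_zero_mod a M X)%:R / X%:R : R) @[X --> \oo] --> (1 : R).

(* Main.v *)
From HB Require Import structures.
Require Import Defs.
From mathcomp Require Import all_boot all_order all_algebra.
From mathcomp Require Import all_classical all_reals.
From mathcomp Require Import topology normedtype sequences derive realfun exp trigo.
From mathcomp Require Import complex finfield.
From mathcomp Require Import zify ring lra.

(** The generating function satisfies 2 G_o phi = E_2 (phi^2 + 1), where phi = phi(-q)
    and E_2 is the Euler product in q^2.  Since phi is 1 modulo 2, this gives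
    2 G_o = E_2 phi + E_2 phi^(2r-1) modulo 2^(k+1) for r = 2^k.  The first term is the
    square of the Euler product; its n-th coefficient vanishes as soon as a prime
    p = 3 (mod 4) divides 12 n + 1 exactly once, since 24 n + 2 is then not a sum of
    two squares.  The second one is, up to signs, a modular form of even weight r in
    the family eta^t theta^(2r-t).  Hecke operators T_p with p = 3 (mod 4) preserve the
    integral span of this family (theta inversion, Gauss sums, and a Liouville-type
    bound on the order of vanishing), and modulo 2, where the forms become powers of
    eta, T_p strictly lowers the block of six consecutive exponents in which the form
    lies.  Hence a product of r/2 (k+1) such operators is divisible by 2^(k+1), and so is
    every coefficient whose index is exactly divisible by that many distinct primes
    p = 3 (mod 4).  A sieve shows that almost all 12 n + 1 have this property. *)

Set Implicit Arguments.
Unset Strict Implicit.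
Unset Printing Implicit Defensive.

Import Order.TTheory GRing.Theory Num.Theory.
Import numFieldNormedType.Exports.

Local Open Scope ring_scope.

(** * Formal power series *)

(** A form is handled as a power series in the 24th root of the nome: the translation z -> z + 1
    twists coefficients by a 24th root of unity, and z -> -1/z is known only on the imaginary axis,
    from Poisson summation. The theta factor is not invariant under the full modular group, so each
    form travels with its conjugates [E1], [E2], [E3], in which the three theta constants are
    permuted; up to roots of unity the product of the three has level one, and the valence bound
    applies to it. Integrality comes from elimination: the family has one monic member for each
    order of vanishing from 0 to 3r, so a Hecke image can be reduced over the integers until its
    order is too large. The condition p = 3 (mod 4), for p prime to 6, makes multiplication by p
    exchange the classes {1, 5} and {7, 11} modulo 12; this is what lowers the block. Since the
    theta factor and p^(r-1) are both odd constants modulo 2, the weight is invisible there, and a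
    small exponent may be treated in the smallest weight that contains it. *)

Record fps (K : Type) := Fps { fcoef :> nat -> K }.

HB.instance Definition _ K := gen_eqMixin (fps K).
HB.instance Definition _ K := gen_choiceMixin (fps K).

Lemma fpsP K (a b : fps K) : (forall n, a n = b n) -> a = b.
Proof. by case: a b => a [b] /= /funext ->. Qed.

Section FpsRing.
Variable K : comNzRingType.
Implicit Types a b : fps K.

Definition fadd a b := Fps (fun n => a n + b n).
Definition fopp a := Fps (fun n => - a n).
Definition fzero : fps K := Fps (fun _ => 0).
Definition fone : fps K := Fps (fun n => (n == 0%N)%:R).
Definition fmul a b := Fps (fun n => \sum_(i < n.+1) a i * b (n - i)%N).

Fact faddA : associative fadd.
Proof. by move=> a b c; apply: fpsP => n /=; rewrite addrA. Qed.
Fact faddC : commutative fadd.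
Proof. by move=> a b; apply: fpsP => n /=; rewrite addrC. Qed.
Fact fadd0 : left_id fzero fadd.
Proof. by move=> a; apply: fpsP => n /=; rewrite add0r. Qed.
Fact faddN : left_inverse fzero fopp fadd.
Proof. by move=> a; apply: fpsP => n /=; rewrite addNr. Qed.

HB.instance Definition _ := GRing.isZmodule.Build (fps K) faddA faddC fadd0 faddN.

Definition ftrunc n a : {poly K} := \poly_(i < n) a i.

Lemma fmul_coef n i a b : (i < n)%N -> (ftrunc n a * ftrunc n b)`_i = fmul a b i.
Proof.
move=> lt_in; rewrite coefM; apply: eq_bigr => j _.
by rewrite !coef_poly !ifT //; [lia | case: j => /=; lia].
Qed.

(** Coefficient n of a product only sees coefficients up to n, so associativity is inherited from
    polynomial truncations. *)
Fact fmulA : associative fmul.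
Proof.
move=> a b c; apply: fpsP => n.
transitivity ((ftrunc n.+1 a * (ftrunc n.+1 b * ftrunc n.+1 c))`_n).
  rewrite coefM; apply: eq_bigr => i _ /=.
  by rewrite fmul_coef ?coef_poly ?ltn_ord //; case: i => /=; lia.
rewrite mulrA coefM; apply: eq_bigr => i _ /=.
by rewrite fmul_coef ?coef_poly ?ltn_ord // ifT //; lia.
Qed.
Fact fmulC : commutative fmul.
Proof. by move=> a b; apply: fpsP => n; rewrite -!(@fmul_coef n.+1) // mulrC. Qed.
Fact fmul1 : left_id fone fmul.
Proof.
move=> a; apply: fpsP => n /=; rewrite big_ord_recl /= mul1r subn0 big1 ?addr0 //.
by move=> i _; rewrite mul0r.
Qed.
Fact fmulDl : left_distributive fmul fadd.
Proof.
move=> a b c; apply: fpsP => n /=; rewrite -big_split; apply: eq_bigr => i _.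
by rewrite /= mulrDl.
Qed.
Fact fone_neq0 : fone != 0.
Proof.
by apply/eqP => /(congr1 (fun a : fps K => a 0%N)) /eqP /=; rewrite oner_eq0.
Qed.

HB.instance Definition _ :=
  GRing.Zmodule_isComNzRing.Build (fps K) fmulA fmulC fmul1 fmulDl fone_neq0.

Lemma fpsD a b n : (a + b) n = a n + b n. Proof. by []. Qed.
Lemma fpsN a n : (- a) n = - a n. Proof. by []. Qed.
Lemma fps0 n : (0 : fps K) n = 0. Proof. by []. Qed.
Lemma fps1 n : (1 : fps K) n = (n == 0%N)%:R. Proof. by []. Qed.
Lemma fpsM a b n : (a * b) n = \sum_(i < n.+1) a i * b (n - i)%N.
Proof. by []. Qed.
Lemma fpsMn a k n : (a *+ k) n = a n *+ k.
Proof. by elim: k => [|k IHk] //; rewrite !mulrS fpsD IHk. Qed.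
Lemma fps_sum I (r : seq I) (P : pred I) (F : I -> fps K) n :
  (\sum_(i <- r | P i) F i) n = \sum_(i <- r | P i) F i n.
Proof. by elim/big_rec2: _ => // i y x _ <-. Qed.

Lemma coef0_is_multiplicative : (forall a b, (a * b) 0%N = a 0%N * b 0%N).
Proof. by move=> a b; rewrite fpsM big_ord1. Qed.

Definition fC (x : K) : fps K := Fps (fun n => if n is 0 then x else 0).

Lemma fCM x a n : (fC x * a) n = x * a n.
Proof.
rewrite fpsM big_ord_recl /= subn0 big1 ?addr0 // => i _.
by rewrite mul0r.
Qed.

Lemma fCE x n : fC x n = if n == 0%N then x else 0. Proof. by case: n. Qed.

Definition fX m : fps K := Fps (fun n => (n == m)%:R).

Lemma fXM m a n : (fX m * a) n = if (m <= n)%N then a (n - m)%N else 0.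
Proof.
rewrite fpsM; case: leqP => [le_mn|lt_nm].
  rewrite (bigD1 (Ordinal (le_mn : (m < n.+1)%N))) //= eqxx mul1r big1 ?addr0 //.
  by move=> i /eqP ni; rewrite /= (_ : (_ == _) = false) ?mul0r //; apply/eqP => e; apply: ni; apply: val_inj.
rewrite big1 // => i _; rewrite /= (_ : (_ == _) = false) ?mul0r //; apply/eqP.
by case: i => /=; lia.
Qed.

Lemma fX0 : fX 0 = 1. Proof. exact: fpsP. Qed.

Lemma fXD m n : fX (m + n)%N = fX m * fX n.
Proof.
apply: fpsP => i; rewrite fXM /=; case: leqP => h; first by congr (_%:R); lia.
by rewrite (_ : (_ == _) = false) //; lia.
Qed.

Lemma fXX m k : fX m ^+ k = fX (m * k)%N.
Proof.
by elim: k => [|k IHk]; [rewrite muln0 fX0 | rewrite exprS IHk mulnS fXD].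
Qed.

Lemma fX_inj m a b : fX m * a = fX m * b -> a = b.
Proof.
move=> e; apply: fpsP => n; have := congr1 (fun c : fps K => c (n + m)%N) e.
by rewrite !fXM leq_addl addnK.
Qed.

Lemma fX_div m a : (forall i, (i < m)%N -> a i = 0) -> exists b, a = fX m * b.
Proof.
move=> a0; exists (Fps (fun n => a (n + m)%N)); apply: fpsP => n.
by rewrite fXM; case: leqP => h /=; rewrite ?subnK // a0.
Qed.

Lemma mulf_low a b i j n : (forall k, (k < i)%N -> a k = 0) ->
  (forall k, (k < j)%N -> b k = 0) -> (n < i + j)%N -> (a * b) n = 0.
Proof.
move=> a0 b0 lt_n; rewrite fpsM big1 // => k _.
have [lt_ki|le_ik] := ltnP k i; first by rewrite a0 ?mul0r.
by rewrite b0 ?mulr0 //; case: k le_ik => k /=; lia.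
Qed.

Lemma mulf_lead a b i j : (forall k, (k < i)%N -> a k = 0) ->
  (forall k, (k < j)%N -> b k = 0) -> (a * b) (i + j)%N = a i * b j.
Proof.
move=> /fX_div[a' ->] /fX_div[b' ->].
rewrite mulrACA -fXD !fXM !leqnn !subnn; exact: coef0_is_multiplicative.
Qed.

Lemma finv_exists a : a 0%N = 1 -> exists b, a * b = 1.
Proof.
move=> a0.
(* [s n] lists the first [n] coefficients of the inverse; storing the prefix turns the
   course-of-values recursion into a structural one. *)
pose s := fix s n : seq K :=
  if n is n'.+1 then
    rcons (s n') ((n' == 0%N)%:R - \sum_(i < n') (s n')`_i * a (n' - i)%N)
  else [::].
have ss n : size (s n) = n by elim: n => //= n IHn; rewrite size_rcons IHn.
have sP i n : (i < n)%N -> (s n)`_i = (s i.+1)`_i.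
  elim: n => //= n IHn; rewrite ltnS leq_eqVlt => /orP[/eqP ->|lt_in].
    by [].
  by rewrite nth_rcons ss lt_in IHn.
exists (Fps (fun n => (s n.+1)`_n)); rewrite mulrC; apply: fpsP => n; rewrite fpsM.
rewrite big_ord_recr /= subnn a0 mulr1 nth_rcons ss ltnn eqxx.
rewrite addrC -addrA (_ : - _ + _ = 0) ?addr0 //; apply/eqP.
rewrite addrC subr_eq0; apply/eqP; apply: eq_bigr => i _; congr (_ * _).
by rewrite [RHS]sP // /=.
Qed.

(** For modular forms in the 24th root of the nome, the exponent class modulo 24 is the eigenvalue
    under z -> z + 1; forms containing theta factors only keep a class modulo 12. *)
Definition supp (m c : nat) (a : fps K) := forall n, (n != c %[mod m])%N -> a n = 0.

Lemma suppM m c d a b : supp m c a -> supp m d b -> supp m (c + d)%N (a * b).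
Proof.
move=> sa sb n nE; rewrite fpsM big1 // => i _.
have [e|ne] := eqVneq (i %% m)%N (c %% m)%N; last by rewrite sa ?mul0r.
rewrite sb ?mulr0 //; apply: contraNN nE => /eqP e'.
have -> : n = (i + (n - i))%N by case: i {e e'} => /= i; lia.
by rewrite -modnDm e e' modnDm.
Qed.

Lemma supp1 m : supp m 0 1.
Proof. by move=> [|n] //; rewrite eqxx. Qed.

Lemma suppX m c a k : supp m c a -> supp m (k * c)%N (a ^+ k).
Proof.
move=> sa; elim: k => [|k IHk]; first exact: supp1.
by rewrite exprS mulSn; apply: suppM.
Qed.

Definition dil m a := Fps (fun n => if (m %| n)%N then a (n %/ m)%N else 0).

Lemma sum_multiples (V : nmodType) (F : nat -> V) m k : (0 < m)%N ->
  \sum_(0 <= i < (k * m).+1 | (m %| i)%N) F i = \sum_(0 <= i < k.+1) F (i * m)%N.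
Proof.
move=> m0; rewrite big_mkcond; elim: k => [|k IHk].
  by rewrite mul0n !big_nat1 dvdn0 mul0n.
rewrite [RHS]big_nat_recr //= -IHk.
rewrite [LHS](@big_cat_nat _ _ _ (k * m).+1) /=; [|by []|by rewrite mulSn; lia].
congr (_ + _); rewrite mulSn addnC.
have -> : (k * m + m).+1 = ((k * m).+1 + m.-1).+1 by lia.
rewrite big_nat_recr /=; last by lia.
have -> : ((k * m).+1 + m.-1 = k * m + m)%N by lia.
rewrite big1_seq ?add0r.
  by rewrite dvdn_addr ?dvdn_mull ?dvdnn.
move=> i /andP[_]; rewrite mem_index_iota => h3; case: ifP => // /dvdnP[c e].
by exfalso; move: h3; rewrite e; case: (ltngtP c k.+1) => h; nia.
Qed.

Lemma dilM m a b : (0 < m)%N -> dil m (a * b) = dil m a * dil m b.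
Proof.
move=> m0; apply: fpsP => n; rewrite fpsM /=; case: ifP => [/dvdnP[k ->]|ndv].
  rewrite mulnK // -(big_mkord predT (fun i => a i * b (k - i)%N)).
  rewrite -(big_mkord predT (fun i => dil m a i * dil m b (k * m - i)%N)).
  rewrite [RHS](bigID (fun i => m %| i)%N) /= [X in _ = _ + X]big1 ?addr0; last first.
    by move=> i /negPf ->; rewrite mul0r.
  rewrite (sum_multiples (fun i => dil m a i * dil m b (k * m - i)%N)) //.
  apply: eq_bigr => i _ /=.
  by rewrite dvdn_mull // mulnK // -mulnBl dvdn_mull // mulnK.
rewrite big1 // => i _; case: ifP => [dvi|]; rewrite ?mul0r // dvdn_subl ?ndv ?mulr0 //.
by rewrite -ltnS.
Qed.

Lemma dil1 m : (0 < m)%N -> dil m 1 = 1.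
Proof.
move=> m0; apply: fpsP => n /=; case: n => [|n]; first by rewrite dvdn0 div0n.
case: ifP => // dv; rewrite (_ : (_ == _) = false) //; apply/negbTE.
by rewrite -lt0n divn_gt0 // dvdn_leq.
Qed.

Lemma dilX m a k : (0 < m)%N -> dil m (a ^+ k) = dil m a ^+ k.
Proof.
by move=> m0; elim: k => [|k IHk]; rewrite ?dil1 // !exprS dilM // IHk.
Qed.

Lemma dilD m a b : dil m (a + b) = dil m a + dil m b.
Proof. by apply: fpsP => n /=; case: ifP => _; rewrite ?addr0. Qed.

Lemma dil_dil m k a : (0 < m)%N -> (0 < k)%N -> dil m (dil k a) = dil (m * k)%N a.
Proof.
move=> m0 k0; apply: fpsP => n /=; case: ifP => [/dvdnP[i ->]|ndv].
  by rewrite mulnK // (mulnC m k) dvdn_pmul2r // divnMr.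
by case: ifP => // /(dvdn_trans (dvdn_mulr _ (dvdnn m))); rewrite ndv.
Qed.

Lemma dil_fX m k : (0 < m)%N -> dil m (fX k) = fX (m * k)%N.
Proof.
move=> m0; apply: fpsP => n /=; case: ifP => [/dvdnP[i ->]|ndv].
  by rewrite mulnK // mulnC eqn_pmul2l.
by case: eqP => // e; rewrite e dvdn_mulr in ndv.
Qed.

End FpsRing.

Arguments fX K m%_N.
Arguments dil {K} m%_N a.
Arguments supp {K} (m c)%_N a.

Section FpsMap.
Variables (K L : comNzRingType) (f : {rmorphism K -> L}).

Definition fmap (a : fps K) : fps L := Fps (fun n => f (a n)).

Lemma fmapE a n : fmap a n = f (a n). Proof. by []. Qed.

Lemma fmap_is_zmod : zmod_morphism fmap.
Proof. by move=> a b; apply: fpsP => n /=; rewrite raddfB. Qed.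

Lemma fmap_is_monoid : monoid_morphism fmap.
Proof.
split; first by apply: fpsP => n /=; rewrite rmorph_nat.
move=> a b; apply: fpsP => n /=; rewrite raddf_sum; apply: eq_bigr => i _.
by rewrite /= rmorphM.
Qed.

HB.instance Definition _ := GRing.isZmodMorphism.Build _ _ fmap fmap_is_zmod.
HB.instance Definition _ := GRing.isMonoidMorphism.Build _ _ fmap fmap_is_monoid.

End FpsMap.

(** * Triple product identities *)

Lemma double_bin2 n : (2 * 'C(n, 2) = n * n.-1)%N.
Proof. by rewrite -[X in (X * _)%N]/(2`!) mulnC bin_ffact ffactnS ffactn1. Qed.

Lemma expr_prod_ord (K : pzSemiRingType) (x : K) n : x ^+ n = \prod_(i < n) x.
Proof. by rewrite prodr_const card_ord. Qed.

Section QBinomial.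
Variable K : comNzRingType.
Variable q : K.

(** Gaussian binomial coefficient, given by a q-Pascal rule so that no division occurs. *)
Fixpoint qbin n k : K := match n, k with
  | _, 0 => 1
  | 0, _.+1 => 0
  | n'.+1, k'.+1 => qbin n' k'.+1 + q ^+ (n'.+1 - k'.+1) * qbin n' k'
  end.

Definition qfact n : K := \prod_(i < n) (1 - q ^+ i.+1).

Lemma qbin0 n : qbin n 0 = 1. Proof. by case: n. Qed.

Lemma qbin_small n k : (n < k)%N -> qbin n k = 0.
Proof.
elim: n k => [|n IHn] [|k] //= lt_nk.
by rewrite !IHn ?mulr0 ?addr0 // ltnW.
Qed.

Lemma qfactS n : qfact n.+1 = qfact n * (1 - q ^+ n.+1).
Proof. by rewrite /qfact big_ord_recr. Qed.

Lemma qbin_fact n k : (k <= n)%N -> qbin n k * (qfact k * qfact (n - k)) = qfact n.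
Proof.
elim: n k => [|n IHn] [|k] // le_kn.
- by rewrite /qfact !big_ord0 !mulr1.
- by rewrite qbin0 subn0 {1}/qfact big_ord0 !mul1r.
rewrite /= subSS; move: le_kn; rewrite ltnS leq_eqVlt => /orP[/eqP ->|lt_kn].
  rewrite subnn expr0 mul1r qbin_small // add0r.
  by rewrite !qfactS -{2}(IHn n) // subnn; ring.
have e : (n - k = (n - k.+1).+1)%N by lia.
have := IHn k.+1 lt_kn; rewrite [qfact n.+1]qfactS -(IHn k) 1?ltnW // e !qfactS => h.
have -> : (qbin n k.+1 + q ^+ (n - k.+1).+1 * qbin n k) *
   (qfact k * (1 - q ^+ k.+1) * (qfact (n - k.+1) * (1 - q ^+ (n - k.+1).+1))) =
   qbin n k.+1 * (qfact k * (1 - q ^+ k.+1) * qfact (n - k.+1)) * (1 - q ^+ (n - k.+1).+1)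
   + q ^+ (n - k.+1).+1 * (qbin n k * (qfact k * (qfact (n - k.+1) * (1 - q ^+ (n - k.+1).+1)))) * (1 - q ^+ k.+1) by ring.
rewrite h; have -> : n.+1 = ((n - k.+1).+1 + k.+1)%N by lia.
by rewrite exprD; ring.
Qed.

(** Homogeneous in [u] and [v], so that the later substitution u = -z q^m involves no inverse. *)
Lemma qbinomial_thm n u v : \prod_(i < n) (u + v * q ^+ i) =
  \sum_(k < n.+1) qbin n k * q ^+ 'C(k, 2) * v ^+ k * u ^+ (n - k).
Proof.
elim: n => [|n IHn]; first by rewrite big_ord0 big_ord1 /= !expr0 !mulr1.
rewrite big_ord_recr /= IHn mulrDr mulrC big_distrr /= [X in _ + X]mulrC big_distrr /=.
rewrite [X in X + _ = _]big_ord_recl /= qbin0 bin0n !expr0 !mulr1 mul1r subn0 -exprS.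
rewrite [RHS]big_ord_recl -addrA; congr (_ + _); first by rewrite /= bin0n !expr0 !mulr1 mul1r.
rewrite [X in _ = X](eq_bigr (fun i : 'I_n.+1 =>
  qbin n i.+1 * q ^+ 'C(i.+1, 2) * v ^+ i.+1 * u ^+ (n - i)
  + q ^+ (n - i) * qbin n i * q ^+ 'C(i.+1, 2) * v ^+ i.+1 * u ^+ (n - i))); last first.
  by move=> i _; rewrite lift0 subSS; ring.
rewrite big_split /=; congr (_ + _).
  rewrite big_ord_recr /= qbin_small // !mul0r addr0; apply: eq_bigr => i _.
  rewrite /bump /= add1n; have -> : (n - i = (n - i.+1).+1)%N by case: i => /=; lia.
  by rewrite [u ^+ _.+1]exprS; ring.
apply: eq_bigr => i _; rewrite binS bin1 addnC.
have {1}-> : n = ((n - i) + i)%N by case: i => /=; lia.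
by rewrite !exprD exprS; ring.
Qed.

End QBinomial.

Arguments qbin {K} q n k : simpl never.

Section TripleProduct.
Variable K : comNzRingType.
Local Notation P := (fps K).
Implicit Type z : P.

(** The triangular number (i-m)(i-m-1)/2 of the signed index i - m, split by sign to remain in
    [nat]. *)
Definition tri (m i : nat) : nat := if (m <= i)%N then 'C(i - m, 2) else 'C((m - i).+1, 2).

Lemma triE m i : (2 * tri m i + (i - m) * m.*2 + (i - m) = (i - m) * (i + m) + (m - i) * (m - i).+1)%N.
Proof.
rewrite /tri; case: leqP => h.
  rewrite -[X in (X * _)%N]/(2`!) [(m - i)%N](_ : _ = 0)%N ?mul0n ?addn0; last by lia.
  by rewrite mulnC bin_ffact ffactnS ffactn1; nia.
rewrite [(i - m)%N](_ : _ = 0)%N ?mul0n ?addn0; last by lia.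
by rewrite -[X in (X * _)%N]/(2`!) mulnC bin_ffact ffactnS ffactn1 /=; nia.
Qed.

Lemma tri_exponent m i : (i <= m.+1.*2)%N ->
  ('C(m.+1.*2 - i, 2) + m * i = 3 * 'C(m.+1, 2) + tri m.+1 i)%N.
Proof.
have dbl n : (2 * 'C(n, 2) + n = n * n)%N.
  by rewrite double_bin2; case: n => // n /=; rewrite -[X in (_ + X)%N]muln1 -mulnDr addn1.
rewrite /tri; case: ltnP => [le_mi le_im|lt_im _].
  have [k ek] : exists k, i = (m.+1 + k)%N by exists (i - m.+1)%N; lia.
  have [l el] : exists l, m.+1 = (k + l)%N by exists (m.+1 - k)%N; lia.
  have -> : (m.+1.*2 - i = l)%N by lia.
  have -> : (i - m.+1 = k)%N by lia.
  have em : (m * i + i = (k + l) * i)%N by rewrite -el mulSn addnC.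
  have := dbl l; have := dbl m.+1; have := dbl k; rewrite el in ek *; subst i.
  by move: em; rewrite !mulnDr !mulnDl; lia.
have [j ej] : exists j, m.+1 = (i + j)%N by exists (m.+1 - i)%N; lia.
have -> : (m.+1.*2 - i = i + j + j)%N by lia.
have -> : ((m.+1 - i).+1 = j.+1)%N by lia.
have em : (m * i + i = (i + j) * i)%N by rewrite -ej mulSn addnC.
have hj : (2 * 'C(j.+1, 2) = j * j + j)%N by rewrite double_bin2 mulSn addnC.
have := dbl (i + j + j)%N; have := dbl m.+1; rewrite ej.
move: em hj; move: ('C(i + j + j, 2)) ('C(i + j, 2)) ('C(j.+1, 2)) (m * i)%N => a b c d.
by rewrite !mulnDl !mulnDr; lia.
Qed.

(** The q-binomial theorem for 2m factors with u = -z q^(m-1) and v = 1: after powers of q are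
    extracted, one half of the factors becomes 1 - z q^i and the other half z - q^(i+1). The
    identity is proved after multiplication by the extracted power q^(3 C(m,2)), which keeps every
    exponent nonnegative. *)
Lemma finite_triple b m z : (0 < b)%N ->
  \prod_(i < m) ((1 - z * fX K (b * i)%N) * (z - fX K (b * i.+1)%N)) =
  \sum_(i < (m.*2).+1)
    (-1) ^+ (i + m)%N * qbin (fX K b) m.*2 (m.*2 - i) * fX K (b * tri m i)%N * z ^+ i.
Proof.
move=> b0; set q := fX K b.
have fXE k : fX K (b * k)%N = q ^+ k by rewrite fXX.
case: m => [|m]; first by rewrite big_ord0 big_ord1 /= !mulr1 !mul1r /tri /= muln0 fX0.
apply: (@fX_inj _ (b * (3 * 'C(m.+1, 2)))%N); rewrite fXE.
have -> : \prod_(i < m.+1) ((1 - z * fX K (b * i)%N) * (z - fX K (b * i.+1)%N)) =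
  (\prod_(i < m.+1) (1 - z * q ^+ i)) * \prod_(i < m.+1) (z - q ^+ i.+1).
  by rewrite -big_split; apply: eq_bigr => i _ /=; rewrite !fXE.
have sumE : \sum_(i < m.+1) (i : nat) = 'C(m.+1, 2)
  by rewrite -bin2_sum big_mkord.
have e1 : \prod_(i < m.+1.*2) (- (z * q ^+ m) + 1 * q ^+ i) =
  (-1) ^+ m.+1 * q ^+ (3 * 'C(m.+1, 2))%N *
  ((\prod_(i < m.+1) (1 - z * q ^+ i)) * \prod_(i < m.+1) (z - q ^+ i.+1)).
  rewrite -addnn big_split_ord /=.
  have -> : \prod_(i < m.+1) (- (z * q ^+ m) + 1 * q ^+ i) =
     q ^+ 'C(m.+1, 2) * \prod_(i < m.+1) (1 - z * q ^+ i).
    rewrite [in RHS](reindex_inj rev_ord_inj) /=.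
    rewrite -sumE expr_sum -big_split; apply: eq_bigr => i _ /=.
    rewrite mul1r mulrBr mulr1 addrC mulrCA -exprD; congr (_ - z * _ ^+ _).
    by case: i => /=; lia.
  have -> : \prod_(i < m.+1) (- (z * q ^+ m) + 1 * q ^+ (m.+1 + i)) =
     (-1) ^+ m.+1 * q ^+ (2 * 'C(m.+1, 2)) * \prod_(i < m.+1) (z - q ^+ i.+1).
    rewrite mul2n -addnn -bin2_sum big_mkord.
    have -> : (\sum_(i < m.+1) i + \sum_(i < m.+1) i = \sum_(i < m.+1) m)%N.
      by rewrite sum_nat_const card_ord sumE addnn -mul2n double_bin2.
    rewrite expr_sum [(-1) ^+ m.+1]expr_prod_ord -!big_split; apply: eq_bigr => i _ /=.
    by rewrite addSnnS exprD; ring.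
  by rewrite (mulSn 2) exprD; ring.
have := qbinomial_thm q m.+1.*2 (- (z * q ^+ m)) 1.
rewrite e1 => /(congr1 (fun x => (-1) ^+ m.+1 * x)).
rewrite !mulrA -exprD addnn -mul2n exprM sqrrN expr1n expr1n mul1r -mulrA => ->.
rewrite mulr_sumr [RHS]mulr_sumr (reindex_inj rev_ord_inj) mul2n /=.
apply: eq_bigr => i _; rewrite !fXE subSS expr1n mulr1.
have le_i : (i <= m.+1.*2)%N by case: i => /=; lia.
rewrite subKn // (exprNn (z * _)) exprMn -exprM.
have e2 : ('C(m.+1.*2 - i, 2) + m * i = 3 * 'C(m.+1, 2) + tri m.+1 i)%N.
  exact: tri_exponent.
rewrite exprD.
have -> : q ^+ (3 * 'C(m.+1, 2)) *
  ((-1) ^+ i * (-1) ^+ m.+1 * qbin q m.+1.*2 (m.+1.*2 - i) * q ^+ tri m.+1 i * z ^+ i) =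
  (-1) ^+ i * (-1) ^+ m.+1 * qbin q m.+1.*2 (m.+1.*2 - i) * z ^+ i *
  (q ^+ (3 * 'C(m.+1, 2) + tri m.+1 i)) by rewrite exprD; ring.
by rewrite -e2 exprD; ring.
Qed.

End TripleProduct.

(** * Coefficientwise limit of the finite triple product *)

Definition eqm (K : Type) n (a b : fps K) := forall i, (i < n)%N -> a i = b i.

Section Eqm.
Variable K : comNzRingType.

Lemma eqm_refl n (a : fps K) : eqm n a a. Proof. by []. Qed.
Lemma eqm_sym n (a b : fps K) : eqm n a b -> eqm n b a.
Proof. by move=> h i /h. Qed.
Lemma eqm_trans n (b a c : fps K) : eqm n a b -> eqm n b c -> eqm n a c.
Proof. by move=> h1 h2 i ii; rewrite h1 ?h2. Qed.
Lemma eqmM n (a b c d : fps K) : eqm n a b -> eqm n c d -> eqm n (a * c) (b * d).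
Proof.
move=> h1 h2 i lt_i; rewrite !fpsM; apply: eq_bigr => j _.
by rewrite h1 ?h2 //; case: j => /=; lia.
Qed.
Lemma eqmD n (a b c d : fps K) : eqm n a b -> eqm n c d -> eqm n (a + c) (b + d).
Proof. by move=> h1 h2 i lt_i; rewrite !fpsD h1 ?h2. Qed.
Lemma eqm_sum n I (r : seq I) (P : pred I) (F G : I -> fps K) :
  (forall i, P i -> eqm n (F i) (G i)) ->
  eqm n (\sum_(i <- r | P i) F i) (\sum_(i <- r | P i) G i).
Proof. by move=> h j lt_j; rewrite !fps_sum; apply: eq_bigr => i Pi; apply: h. Qed.
Lemma eqm_fX n m a : (n <= m)%N -> eqm n (fX K m * a) 0.
Proof. by move=> le_nm i lt_i; rewrite fXM ifF // leqNgt (leq_trans lt_i). Qed.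
Lemma eqm_fps (a b : fps K) : (forall n, eqm n a b) -> a = b.
Proof. by move=> h; apply: fpsP => n; apply: (h n.+1). Qed.
Lemma eqm_dil n m (a b : fps K) : (0 < m)%N -> eqm n a b -> eqm n (dil m a) (dil m b).
Proof.
move=> m0 h i lt_i /=; case: ifP => // _; apply: h.
by rewrite (leq_ltn_trans (leq_div _ _)).
Qed.
(** The infinite product of the 1 - q^i: coefficient n is already final in the n-th partial product,
    later factors being 1 up to order n. *)
Definition euler : fps K := Fps (fun n => qfact (fX K 1) n n).

Lemma eqm_qfactS n m : (n <= m)%N -> eqm n.+1 (qfact (fX K 1) m) (qfact (fX K 1) n).
Proof.
elim: m => [|m IHm]; first by rewrite leqn0 => /eqP ->.
rewrite leq_eqVlt => /orP[/eqP -> //|lt_nm].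
apply: eqm_trans (IHm lt_nm); rewrite qfactS fXX mul1n mulrBr mulr1 mulrC.
move=> i lt_i; rewrite fpsD fpsN fXM ifF ?subr0 //.
by apply/negbTE; rewrite -ltnNge; lia.
Qed.

Lemma eqm_euler n m : (n <= m.+1)%N -> eqm n (qfact (fX K 1) m) euler.
Proof. by move=> le_nm i lt_i; rewrite [RHS]/= (@eqm_qfactS i m) //; lia. Qed.

Lemma dil_qfact b m : (0 < b)%N -> dil b (qfact (fX K 1) m) = qfact (fX K b) m.
Proof.
move=> b0; elim: m => [|m IHm]; first by rewrite /qfact !big_ord0 dil1.
rewrite !qfactS dilM // IHm !fXX mul1n -dil_fX // -[in RHS](@dil1 _ b) //.
by congr (_ * _); apply: fpsP => n /=; case: ifP; rewrite ?subr0.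
Qed.

Lemma eqm_euler_dil b n m : (0 < b)%N -> (n <= m.+1)%N -> eqm n (qfact (fX K b) m) (dil b euler).
Proof. by move=> b0 h; rewrite -dil_qfact //; apply: eqm_dil => //; apply: eqm_euler. Qed.

Lemma euler0 b : (0 < b)%N -> dil b euler 0%N = 1.
Proof. by move=> b0 /=; rewrite dvdn0 div0n /qfact big_ord0. Qed.

(** The Gaussian binomial is a quotient of three finite products, each equal to the Euler product up
    to order n; multiplied by the square of the Euler product it becomes one Euler product, and one
    factor is then cancelled. *)
Lemma eqm_qbin b n m j : (0 < b)%N -> (j <= m)%N -> (n <= j.+1)%N -> (n <= (m - j).+1)%N ->
  eqm n (dil b euler * qbin (fX K b) m j) 1.
Proof.
move=> b0 le_jm h1 h2; have [v ve] := finv_exists (euler0 b0).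
set e := dil b euler in ve *.
have h : eqm n (qbin (fX K b) m j * (e * e)) e.
  apply: eqm_trans (_ : eqm _ _ (qfact (fX K b) m)) _; last by apply: eqm_euler_dil => //; lia.
  rewrite -(qbin_fact _ le_jm); apply: eqmM => //.
  by apply: eqm_sym; apply: eqmM; apply: eqm_euler_dil.
have -> : e * qbin (fX K b) m j = qbin (fX K b) m j * (e * e) * v.
  by rewrite mulrA -mulrA ve mulr1 mulrC.
by rewrite -ve; apply: eqmM.
Qed.

(** Exponent of q in term i after z = c q^a, counted from the centre m: b (i-m)(i-m-1)/2 + a (i-m).
    It is nonnegative for a <= b, so the truncated subtraction is exact ([bexE]). *)
Definition bex b a m i := (b * tri m i + a * i - a * m)%N.

Lemma bexE b a m i : (a <= b)%N -> (b * tri m i + a * i = bex b a m i + a * m)%N.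
Proof.
move=> le_ab; rewrite /bex subnK //.
have := triE m i; case: (leqP m i) => h; first by nia.
rewrite [(i - m)%N](_ : _ = 0)%N ?mul0n; last by lia.
move=> tE; have: (m - i <= tri m i)%N by nia.
by nia.
Qed.

Lemma bex_large b a m i n : (0 < b)%N -> (a <= b)%N ->
  ((m + n).+2 <= i)%N || (i + n.+2 <= m)%N -> (n <= bex b a m i)%N.
Proof.
move=> b0 le_ab h; have := bexE m i le_ab; have := triE m i.
case/orP: h => h.
  rewrite [(m - i)%N](_ : _ = 0)%N ?mul0n; last by lia.
  move=> tE; have : (n <= tri m i)%N by nia.
  by nia.
rewrite [(i - m)%N](_ : _ = 0)%N ?mul0n; last by lia.
move=> tE; have : (n + (m - i) <= tri m i)%N by nia.
by nia.
Qed.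

(** Far from the centre the exponents exceed n; near the centre the Gaussian binomial is the inverse
    of the Euler product up to order n. The bound 2n + 4 <= m makes these two ranges cover all
    indices. *)
Lemma qbin_lim b a n m (w : nat -> fps K) : (0 < b)%N -> (a <= b)%N -> (n.*2.+4 <= m)%N ->
  eqm n (dil b euler *
     \sum_(i < (m.*2).+1) qbin (fX K b) m.*2 (m.*2 - i) * (w i * fX K (bex b a m i)))
   (\sum_(i < (m.*2).+1) w i * fX K (bex b a m i)).
Proof.
move=> b0 le_ab le_nm; rewrite mulr_sumr; apply: eqm_sum => i _; rewrite mulrA.
have [h|h] := boolP (((m + n).+2 <= i)%N || (i + n.+2 <= m)%N).
  rewrite [w i * _]mulrC mulrCA.
  apply: eqm_trans (_ : eqm _ _ 0) _; first by apply: eqm_fX; apply: bex_large.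
  by apply: eqm_sym; apply: eqm_fX; apply: bex_large.
rewrite -[X in eqm _ _ X]mul1r; apply: eqmM => //; apply: eqm_qbin => //.
- exact: leq_subr.
- by case: i h => /= i; lia.
- by case: i h => /= i; lia.
Qed.

(** Jacobi's triple product at z = c q^a. The hypothesis c^2 = 1 lets c serve as its own inverse
    when the finite product is made symmetric. *)
Lemma triple_lim c b a n m : c * c = 1 :> K -> (0 < b)%N -> (a <= b)%N -> (n.*2.+4 <= m)%N ->
  eqm n (dil b euler * \prod_(i < m)
     ((1 - fC c * fX K (b * i + a)%N) * (1 - fC c * fX K (b * i.+1 - a)%N)))
   (\sum_(i < (m.*2).+1) fC (- c) ^+ (i + m)%N * fX K (bex b a m i)).
Proof.
move=> cc b0 le_ab le_nm.
have fcc : fC c * fC c = 1 :> fps K.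
  by apply: fpsP => k; rewrite fCM; case: k => [|k] /=; rewrite ?cc ?mulr0.
have e : \prod_(i < m) ((1 - fC c * fX K (b * i + a)%N) * (1 - fC c * fX K (b * i.+1 - a)%N))
  = \sum_(i < (m.*2).+1) qbin (fX K b) m.*2 (m.*2 - i) * (fC (- c) ^+ (i + m)%N * fX K (bex b a m i)).
  apply: (@fX_inj _ (a * m)); have := finite_triple m (fC c * fX K a) b0.
  move=> /(congr1 (fun x => fC c ^+ m * x)).
  have -> : \prod_(i < m) ((1 - fC c * fX K a * fX K (b * i)%N) * (fC c * fX K a - fX K (b * i.+1)%N)) =
    (fC c * fX K a) ^+ m * \prod_(i < m) ((1 - fC c * fX K (b * i + a)%N) * (1 - fC c * fX K (b * i.+1 - a)%N)).
    rewrite expr_prod_ord -big_split; apply: eq_bigr => i _ /=.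
    have -> : fX K (b * i.+1)%N = fX K (b * i.+1 - a)%N * fX K a by rewrite -fXD subnK //; nia.
    rewrite fXD; set x := fX K a; set y := fX K (b * i)%N; set w := fX K _; set d := fC c in fcc *.
    have -> : d * x - w * x = d * x - (d * d) * w * x by rewrite fcc mul1r.
    by ring.
  rewrite exprMn mulrA mulrA -exprMn fcc expr1n mul1r fXX => ->.
  rewrite !mulr_sumr; apply: eq_bigr => i _.
  have -> : fC (- c) = - fC c :> fps K by apply: fpsP => -[|k] //=; rewrite oppr0.
  rewrite (_ : fX K (a * m)%N * _ = qbin (fX K b) m.*2 (m.*2 - i) * ((- fC c) ^+ (i + m) * (fX K (bex b a m i + a * m)%N))); last by rewrite fXD; ring.
  by rewrite -bexE // [fX K (_ + _)%N]fXD exprMn fXX (exprNn (fC c)) (exprD (fC c)); ring.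
by rewrite e; apply: (@qbin_lim b a n m (fun i => fC (- c) ^+ (i + m))).
Qed.

End Eqm.

(** * Series supported on squares *)

Section SquareSeries.
Variable K : comNzRingType.
Implicit Types f s : nat -> K.

(** Every theta series below is brought into this shape by completing the square; identities between
    coefficients are then checked at square arguments only ([sq_cases]). *)
Definition sqs f : fps K := Fps (fun N => \sum_(x < N.+1) f x *+ (x ^ 2 == N)%N).

Lemma sqsE f x : sqs f (x ^ 2)%N = f x.
Proof.
have lx : (x < (x ^ 2).+1)%N by rewrite ltnS; nia.
rewrite /= (bigD1 (Ordinal lx)) //= eqxx mulr1n big1 ?addr0 // => i ni.
by rewrite eqn_sqr; case: eqP => // e; case/eqP: ni; apply: val_inj.
Qed.

Lemma sqs0 f N : (forall x, (x ^ 2 != N)%N) -> sqs f N = 0.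
Proof. by move=> h; rewrite /= big1 // => i _; rewrite (negPf (h i)). Qed.

Lemma sq_cases N : (exists x, N = x ^ 2)%N \/ (forall x, (x ^ 2 != N)%N).
Proof.
have [[x]|h] := pselect (exists x, N = x ^ 2)%N; first by left; exists x.
by right => x; apply/eqP => e; apply: h; exists x.
Qed.

Lemma sqs_eq N f f' : (forall x, N = (x ^ 2)%N -> f x = f' x) -> sqs f N = sqs f' N.
Proof.
have [[x ->]|h] := sq_cases N => ff'; first by rewrite !sqsE ff'.
by rewrite !sqs0.
Qed.

Definition onprog (u v : nat) s x := if (v <= x)%N && (u %| x - v)%N then s ((x - v) %/ u)%N else 0.

(** Completing the square: the exponents satisfy c g(k) + d = (u k + v)^2, so coefficient n is read
    off at the x in the progression v, v + u, ... with x^2 = c n + d. The bound M only has to exceed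
    every possible k. *)
Lemma unilateral_sqs (c d u v n M : nat) s (g : nat -> nat) :
  (0 < u)%N -> (0 < c)%N -> (c * n + d < M)%N ->
  (forall k, c * g k + d = (u * k + v) ^ 2)%N ->
  (\sum_(k < M) fC (s k) * fX K (g k)) n = sqs (onprog u v s) (c * n + d)%N.
Proof.
move=> u0 c0 ltM gE; rewrite fps_sum.
rewrite (eq_bigr (fun k : 'I_M => s k * (n == g k)%:R)) => [|k _]; last first.
  by rewrite fCM.
have gn k x : (c * n + d = x ^ 2)%N -> (n == g k) = (x == u * k + v)%N.
  by move=> e; rewrite -(eqn_sqr x) -e -gE eqn_add2r eqn_pmul2l.
have [[x e]|h] := sq_cases (c * n + d); last first.
  rewrite sqs0 // big1 // => k _; case: eqP => [e|]; rewrite ?mulr0 //.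
  by have := h (u * k + v)%N; rewrite e gE eqxx.
rewrite e sqsE /onprog; case: ifP => [/andP[le_vx /dvdnP[k0 ek]]|hx].
  have ex : x = (u * k0 + v)%N by rewrite mulnC -ek subnK.
  have lk : (k0 < M)%N by apply: leq_ltn_trans ltM; rewrite e ex; nia.
  rewrite ek mulnK // (bigD1 (Ordinal lk)) //= (gn k0 x e) ex eqxx mulr1 big1 ?addr0 //.
  move=> i ni; rewrite (gn i x e) ex eqn_add2r eqn_pmul2l //.
  by case: eqP => [e'|]; rewrite ?mulr0 //; case/eqP: ni; apply: val_inj.
rewrite big1 // => k _; rewrite (gn k x e); case: eqP => [ex|]; rewrite ?mulr0 //.
by move: hx; rewrite ex leq_addl addnK dvdn_mulr.
Qed.

Lemma bex_pos b a m k : bex b a m (m + k.+1) = (b * 'C(k.+1, 2) + a * k.+1)%N.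
Proof. by rewrite /bex /tri leq_addr addKn mulnDr addnA -addnA addnCA addKn. Qed.

Lemma bex_neg b a m j : (j <= m)%N -> (a <= b)%N ->
  bex b a m (m - j) = (b * 'C(j.+1, 2) - a * j)%N.
Proof.
move=> le_jm le_ab; rewrite /bex /tri; case: j le_jm => [|j] le_jm.
  by rewrite subn0 leqnn subnn !bin_small // !muln0 add0n subnn.
rewrite ifF; last by lia.
by rewrite subKn // mulnBr; have := leq_mul (leqnn a) le_jm; lia.
Qed.

(** The indices above the centre m and those up to m run over two progressions of the same step u,
    starting at [vp] and [vm]. *)
Lemma bilateral_sqs b a c d u vp vm n m (s sp sm : nat -> K) :
  (a <= b)%N -> (0 < u)%N -> (0 < c)%N -> (c * n + d < m)%N ->
  (forall k, c * (b * 'C(k.+1, 2) + a * k.+1) + d = (u * k + vp) ^ 2)%N ->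
  (forall k, c * (b * 'C(k.+1, 2) - a * k) + d = (u * k + vm) ^ 2)%N ->
  (forall k, s (m + k.+1)%N = sp k) -> (forall j, (j <= m)%N -> s (m - j)%N = sm j) ->
  (\sum_(i < m.*2.+1) fC (s i) * fX K (bex b a m i)) n =
  sqs (fun x => onprog u vp sp x + onprog u vm sm x) (c * n + d)%N.
Proof.
move=> le_ab u0 c0 ltm gp gm sE sE'.
have -> : sqs (fun x => onprog u vp sp x + onprog u vm sm x) (c * n + d)%N =
  sqs (onprog u vp sp) (c * n + d)%N + sqs (onprog u vm sm) (c * n + d)%N.
  by rewrite /= -big_split; apply: eq_bigr => i _ /=; rewrite mulrnDl.
rewrite -(unilateral_sqs sp u0 c0 ltm gp) -(unilateral_sqs sm u0 c0 (ltnW ltm : _ < m.+1)%N gm).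
have -> : m.*2.+1 = (m.+1 + m)%N by rewrite addSn addnn.
rewrite !fps_sum big_split_ord /= addrC; congr (_ + _).
  apply: eq_bigr => k _.
  by rewrite addSnnS sE bex_pos.
rewrite (reindex_inj rev_ord_inj) /=; apply: eq_bigr => j _.
have lj : (j <= m)%N by case: j.
by rewrite subSS sE' // bex_neg.
Qed.

End SquareSeries.

(** The Dirichlet character (12/x), whose theta series is eta(24 z). *)
Definition chi12 (x : nat) : int :=
  match (x %% 12)%N with 1 | 11 => 1 | 5 | 7 => -1 | _ => 0 end.
(** Coefficients of phi(-q), the sum of (-1)^x q^(x^2) over all integers, folded onto x >= 0. *)
Definition sgn2 (x : nat) : int := if x == 0%N then 1 else 2 * (-1) ^+ x.
Definition oddf (x : nat) : int := (odd x)%:R.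
Definition jacf (x : nat) : int := if odd x then (-1) ^+ x./2 * x%:R else 0.

(** * Product expansions of the theta series *)

Section ThetaIdentities.
Local Notation E := (euler int).
Definition phim : fps int := sqs sgn2.
Definition psi : fps int := Fps (fun n => sqs oddf (8 * n + 1)%N).
Definition jac : fps int := Fps (fun n => sqs jacf (8 * n + 1)%N).

Lemma fCX (K : comNzRingType) (c : K) n : fC c ^+ n = fC (c ^+ n).
Proof.
elim: n => [|n IHn]; first by apply: fpsP => -[|n].
by rewrite !exprS IHn; apply: fpsP => k; rewrite fCM; case: k => [|k] /=; rewrite ?mulr0.
Qed.

Lemma signr_double (m k : nat) : (-1) ^+ (m + m + k)%N = (-1) ^+ k :> int.
Proof. by rewrite exprD addnn -mul2n exprM sqrrN !expr1n mul1r. Qed.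

Lemma fC1M (a : fps int) : fC 1 * a = a.
Proof. by apply: fpsP => n; rewrite fCM mul1r. Qed.

Lemma triple_sqs (c : int) b a cc d u vp vm n : c * c = 1 ->
  (0 < b)%N -> (a <= b)%N -> (0 < u)%N -> (0 < cc)%N ->
  (forall k, cc * (b * 'C(k.+1, 2) + a * k.+1) + d = (u * k + vp) ^ 2)%N ->
  (forall k, cc * (b * 'C(k.+1, 2) - a * k) + d = (u * k + vm) ^ 2)%N ->
  forall m, (cc * n + d + n.*2 + 8 < m)%N ->
  (dil b E * \prod_(i < m)
     ((1 - fC c * fX int (b * i + a)%N) * (1 - fC c * fX int (b * i.+1 - a)%N))) n =
  sqs (fun x => onprog u vp (fun k => (- c) ^+ k.+1) x + onprog u vm (fun k => (- c) ^+ k) x)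
     (cc * n + d)%N.
Proof.
move=> c1 b0 le_ab u0 cc0 gp gm m ltm.
rewrite (@triple_lim _ c b a n.+1 m) //; last by lia.
rewrite (eq_bigr (fun i : 'I_(m.*2.+1) => fC ((- c) ^+ (i + m)) * fX int (bex b a m i)));
  last by move=> i _; rewrite fCX.
have c2 k : (- c) ^+ (m + m + k)%N = (- c) ^+ k.
  by rewrite exprD addnn -mul2n exprM sqrrN expr2 c1 expr1n mul1r.
apply: (@bilateral_sqs _ b a cc d u vp vm n m (fun i => (- c) ^+ (i + m))) => //; first by lia.
  by move=> k; rewrite -(c2 k.+1); congr (_ ^+ _); lia.
move=> j le_j; rewrite -[RHS](c2 j); have -> : (m + m + j = (m - j) + m + (j + j))%N by lia.
by rewrite [RHS]exprD addnn -mul2n exprM sqrrN expr2 c1 expr1n mulr1.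
Qed.

(** Triple product with b = 3, a = 1: grouping the exponents of the Euler product modulo 3 leaves
    the factor in q^3 and the two classes 1 and 2. The generalised pentagonal numbers n are those
    for which 24 n + 1 is the square of some 6k + 1 or 6k + 5. *)
Lemma pentagonal n : E n = sqs chi12 (24 * n + 1)%N.
Proof.
pose m := (24 * n + 1 + n.*2 + 8).+1.
have e : qfact (fX int 1) (3 * m) = \prod_(i < m)
   ((1 - fX int (3 * i + 1)%N) * (1 - fX int (3 * i.+1 - 1)%N)) * qfact (fX int 3) m.
  rewrite /qfact -big_split /= mulnC.
  elim: (m) => [|k IHk]; first by rewrite !big_ord0.
  rewrite (_ : k.+1 * 3 = (k * 3).+3)%N; last by lia.
  rewrite !big_ord_recr /= IHk !fXX !mul1n -!mulrA.
  by congr (_ * (_ * _)); [congr (1 - fX _ _); lia | congr (_ * _); congr (1 - fX _ _); lia].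
have h := @triple_sqs 1 3 1 24 1 6 5 1 n (mul1r 1) isT isT isT isT.
rewrite -(@eqm_euler _ n.+1 (3 * m)) //; last by lia.
rewrite e mulrC (@eqmM _ n.+1 _ _ _ _ (@eqm_euler_dil _ 3 n.+1 m isT _) (@eqm_refl _ _ _)) //; last by lia.
rewrite (eq_bigr (fun i : 'I_m => (1 - fC 1 * fX int (3 * i + 1)%N) * (1 - fC 1 * fX int (3 * i.+1 - 1)%N))); last first.
  by move=> i _; rewrite !fC1M.
rewrite h //; last 2 first.
- by move=> k; have := double_bin2 k.+1; rewrite /=; nia.
- by move=> k; have := double_bin2 k.+1; rewrite /=; nia.
apply: sqs_eq => x ex; rewrite /onprog /chi12.
have x1 : (x ^ 2 %% 24 = 1)%N by rewrite -ex; lia.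
have xd := divn_eq x 12; set r := (x %% 12)%N in xd *; set y := (x %/ 12)%N in xd.
have r12 : (r < 12)%N by rewrite ltn_mod.
have er : (r ^ 2 %% 24 = 1)%N.
  rewrite -[RHS]x1 [in RHS]xd (_ : (y * 12 + r) ^ 2 = (6 * y ^ 2 + y * r) * 24 + r ^ 2)%N; last by ring.
  by rewrite modnMDl.
move: r12 er xd; case: (r) => [|[|[|[|[|[|[|[|[|[|[|[|r']]]]]]]]]]]] //= _ _ xd.
- rewrite ifF; last by lia. rewrite ifT; last by lia.
  have -> : ((x - 1) %/ 6 = 2 * y)%N by lia.
  by rewrite exprM sqrrN !expr1n add0r.
- rewrite ifT; last by lia. rewrite ifF; last by lia.
  have -> : ((x - 5) %/ 6 = 2 * y)%N by lia.
  by rewrite exprS exprM sqrrN !expr1n addr0 mulr1.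
- rewrite ifF; last by lia. rewrite ifT; last by lia.
  have -> : ((x - 1) %/ 6 = (2 * y).+1)%N by lia.
  by rewrite exprS exprM sqrrN !expr1n add0r mulr1.
- rewrite ifT; last by lia. rewrite ifF; last by lia.
  have -> : ((x - 5) %/ 6 = (2 * y).+1)%N by lia.
  by rewrite 2!exprS exprM sqrrN !expr1n addr0 mulr1.
Qed.

(** With A the product over odd exponents, E = A E_2, and E_2 A^2 is the triple product with b = 2,
    a = 1. *)
Lemma euler_sq : E ^+ 2 = dil 2 E * phim.
Proof.
apply: fpsP => n.
pose m := (n + n.*2 + 8).+1.
pose A := \prod_(i < m) (1 - fX int (2 * i + 1)%N).
have e : qfact (fX int 1) (2 * m) = A * qfact (fX int 2) m.
  rewrite /A /qfact -big_split /= mulnC.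
  elim: (m) => [|k IHk]; first by rewrite !big_ord0.
  rewrite mulSn addnC addn2 !big_ord_recr /= IHk !fXX !mul1n -!mulrA.
  by congr (_ * (_ * _)); congr (1 - fX _ _); lia.
have hE : eqm n.+1 E (A * dil 2 E).
  apply: eqm_trans (_ : eqm _ _ (qfact (fX int 1) (2 * m))) _.
    by apply: eqm_sym; apply: eqm_euler; rewrite /m; lia.
  by rewrite e; apply: eqmM => //; apply: eqm_euler_dil => //; rewrite /m; lia.
have h2 : eqm n.+1 (E ^+ 2) (dil 2 E * (dil 2 E * (A * A))).
  have -> : dil 2 E * (dil 2 E * (A * A)) = (A * dil 2 E) * (A * dil 2 E) by ring.
  by apply: eqmM.
suff h3 : eqm n.+1 (dil 2 E * (A * A)) phim.
  by rewrite h2 // (@eqmM _ n.+1 _ _ _ _ (@eqm_refl _ _ _) h3).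
move=> i le_i.
have -> : A * A = \prod_(i < m) ((1 - fC 1 * fX int (2 * i + 1)%N) * (1 - fC 1 * fX int (2 * i.+1 - 1)%N)).
  rewrite -big_split; apply: eq_bigr => j _ /=; rewrite !fC1M.
  by congr (_ * (1 - fX _ _)); lia.
rewrite (@triple_sqs 1 2 1 1 0 1 1 0 i) //; last 1 first.
- by rewrite /m; lia.
- rewrite /phim mul1n addn0; apply: sqs_eq => x _; rewrite /onprog /sgn2 !divn1 !dvd1n.
  case: x => [|x]; first by rewrite add0r expr0.
  by rewrite /= subn1 subn0 /=; lia.
- by move=> k; have := double_bin2 k.+1; rewrite /=; nia.
- by move=> k; have := double_bin2 k.+1; rewrite /=; nia.
Qed.

(** The triple product with b = 1, a = 0, c = -1 counts every triangular number twice, and its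
    product side contains the factor 1 + q^0 = 2. The identity is therefore proved doubled and
    halved at the end. *)
Lemma psi_euler : psi * E = dil 2 E ^+ 2.
Proof.
apply: fpsP => n.
pose m := (8 * n + 1 + n.*2 + 8).+1.
pose A k := \prod_(i < k) (1 + fX int (i.+1)%N).
have AE k : A k * qfact (fX int 1) k = qfact (fX int 2) k.
  rewrite /A /qfact -big_split; apply: eq_bigr => i _ /=; rewrite !fXX mul1n.
  by rewrite mul2n -addnn fXD; ring.
have hA k : (m.-1 <= k)%N -> eqm n.+1 (A k * E) (dil 2 E).
  move=> le_mk; apply: eqm_trans (_ : eqm _ _ (qfact (fX int 2) k)) _.
    rewrite -AE; apply: eqmM => //; apply: eqm_sym; apply: eqm_euler.
    by move: le_mk; rewrite /m /=; lia.
  by apply: eqm_euler_dil => //; move: le_mk; rewrite /m /=; lia.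
have h2 : eqm n.+1 ((psi + psi) * E) (E * (E * ((A m.-1 + A m.-1) * A m))).
  rewrite mulrC; apply: eqmM => // i lt_i.
  have -> : (A m.-1 + A m.-1) * A m = \prod_(i < m) ((1 - fC (-1) * fX int (1 * i + 0)%N) * (1 - fC (-1) * fX int (1 * i.+1 - 0)%N)).
    have fN (a : fps int) : 1 - fC (-1) * a = 1 + a.
      by apply: fpsP => k; rewrite fpsD fpsN fCM mulN1r opprK.
    rewrite big_split /=; congr (_ * _); last first.
      by apply: eq_bigr => j _; rewrite fN subn0 mul1n.
    rewrite /m /= big_ord_recl fN muln0 fX0 mulrDl mul1r.
    by congr (_ + _); apply: eq_bigr => j _; rewrite fN mul1n addn0.
  rewrite -[E in RHS](_ : dil 1 E = E); last first.
    by apply: fpsP => k /=; rewrite dvd1n divn1.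
  rewrite (@triple_sqs (-1) 1 0 8 1 2 1 1 i) //; last 1 first.
  - by rewrite /m; lia.
  - have -> : (psi + psi) i = sqs (fun x => oddf x + oddf x) (8 * i + 1)%N.
      by rewrite fpsD /= -big_split; apply: eq_bigr => x _; rewrite /= mulrnDl.
    apply: sqs_eq => x _; rewrite /onprog /oddf opprK !expr1n.
    by case: (boolP (odd x)) => ox; [rewrite ifT //; lia | rewrite ifF //; lia].
  - by move=> k; have := double_bin2 k.+1; rewrite /=; nia.
  - by move=> k; have := double_bin2 k.+1; rewrite /=; nia.
have h3 : eqm n.+1 ((psi + psi) * E) (dil 2 E ^+ 2 + dil 2 E ^+ 2).
  apply: eqm_trans h2 _.
  have -> : E * (E * ((A m.-1 + A m.-1) * A m)) =
    (A m.-1 * E) * (A m * E) + (A m.-1 * E) * (A m * E) by ring.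
  by apply: eqmD; apply: eqmM; apply: hA => //; rewrite leq_pred.
have := h3 n (ltnSn n); rewrite mulrDl !fpsD; lia.
Qed.

Definition derat1 (a : fps {poly int}) : fps int := Fps (fun n => (a n)^`().[1]).

Lemma derat1E a n : derat1 a n = (a n)^`().[1]. Proof. by []. Qed.

Lemma qbin_map (f : {rmorphism int -> {poly int}}) n k :
  qbin (fX {poly int} 1) n k = fmap f (qbin (fX int 1) n k).
Proof.
have fXm : fX {poly int} 1 = fmap f (fX int 1).
  by apply: fpsP => i /=; rewrite rmorph_nat.
elim: n k => [|n IHn] [|k]; rewrite /qbin -/(@qbin _ _) ?rmorph1 ?rmorph0 //.
by rewrite rmorphD rmorphM rmorphXn !IHn fXm.
Qed.

(** The finite triple product is differentiated in z at z = 1. The factor 1 - z coming from i = 0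
    vanishes there, so only its own derivative survives and the remaining factors are evaluated at
    1. *)
Lemma jacobi_cube : E ^+ 3 = jac.
Proof.
apply: fpsP => n.
pose m := (8 * n + 1 + n.*2 + 8).+1.
have fin : - (qfact (fX int 1) m.-1 * qfact (fX int 1) m) =
  \sum_(i < m.*2.+1) qbin (fX int 1) m.*2 (m.*2 - i) *
     (fC ((-1) ^+ (i + m) * i%:R) * fX int (bex 1 0 m i)).
  have := congr1 derat1 (@finite_triple {poly int} 1 m (fC 'X) isT).
  have -> : derat1 (\prod_(i < m)
     ((1 - fC 'X * fX {poly int} (1 * i)) * (fC 'X - fX {poly int} (1 * i.+1)))) =
     - (qfact (fX int 1) m.-1 * qfact (fX int 1) m).
    pose B := \prod_(i < m.-1) (1 - fC 'X * fX {poly int} (1 * i.+1)) *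
       \prod_(i < m) (fC 'X - fX {poly int} (1 * i.+1)).
    have -> : \prod_(i < m)
     ((1 - fC 'X * fX {poly int} (1 * i)) * (fC 'X - fX {poly int} (1 * i.+1))) = fC (1 - 'X) * B.
      rewrite /B big_split /= {1}/m big_ord_recl mulrA; congr (_ * _ * _).
      by rewrite fX0 mulr1; apply: fpsP => -[|k] /=; rewrite ?subr0 ?oppr0.
    have -> : qfact (fX int 1) m.-1 * qfact (fX int 1) m = fmap (horner_eval 1) B.
      rewrite /B rmorphM !rmorph_prod /qfact; congr (_ * _); apply: eq_bigr => i _;
        rewrite rmorphB; congr (_ - _); apply: fpsP => k.
      - by rewrite /= /horner_eval; case: k => [|k]; rewrite ?hornerC.
      - rewrite fXX mul1n [RHS](_ : _ = ((fC 'X * fX {poly int} i.+1) k).[1]) //.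
        by rewrite fCM /= hornerM hornerX mul1r hornerMn hornerC.
      - by rewrite /= /horner_eval; case: k => [|k]; rewrite ?hornerC ?hornerX.
      - by rewrite fXX mul1n /= /horner_eval hornerMn hornerC.
    apply: fpsP => k; rewrite derat1E fpsN fmapE /horner_eval fCM derivM derivB derivX derivC sub0r.
    by rewrite mulN1r hornerD hornerN hornerM hornerD hornerN hornerX -polyC1 hornerC subrr mul0r addr0.
  move=> ->; apply: fpsP => k; rewrite derat1E !fps_sum raddf_sum horner_sum.
  apply: eq_bigr => i _.
  have -> : (-1) ^+ (i + m) * qbin (fX {poly int} 1) m.*2 (m.*2 - i) *
     fX {poly int} (1 * tri m i) * fC 'X ^+ i =
     fC 'X^i * fmap polyC ((-1) ^+ (i + m) * qbin (fX int 1) m.*2 (m.*2 - i) * fX int (tri m i)).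
    rewrite mulrC fCX; congr (_ * _); rewrite (qbin_map polyC) mul1n !rmorphM rmorphXn rmorphN1.
    by congr (_ * _); apply: fpsP => j /=; rewrite rmorph_nat.
  rewrite fCM fmapE; set c := fcoef (_ * fX int _) k.
  rewrite [LHS]/= derivM derivC mulr0 addr0 derivXn hornerM hornerC hornerMn hornerXn expr1n {}/c.
  rewrite [in RHS]mulrCA fCM /bex !mul0n addn0 subn0 mul1n.
  have -> : (-1) ^+ (i + m) * qbin (fX int 1) m.*2 (m.*2 - i) * fX int (tri m i) =
    fC ((-1) ^+ (i + m)) * (qbin (fX int 1) m.*2 (m.*2 - i) * fX int (tri m i)).
    by rewrite -mulrA -fCX; congr (_ ^+ _ * _); apply: fpsP => -[|j].
  by rewrite fCM; ring.
have h : eqm n.+1 (- (E ^+ 3)) (E * - (qfact (fX int 1) m.-1 * qfact (fX int 1) m)).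
  rewrite exprS mulrN => i lt_i; rewrite !fpsN; congr (- _); move: i lt_i.
  by apply: eqmM => //; apply: eqmM; apply: eqm_sym; apply: eqm_euler; rewrite /m /=; lia.
have dE : dil 1 E = E by apply: fpsP => k /=; rewrite dvd1n divn1.
apply: oppr_inj; rewrite -[LHS]fpsN (h n) // fin -{1}dE.
rewrite (@qbin_lim _ 1 0 n.+1 m (fun i => fC ((-1) ^+ (i + m) * i%:R))) //; last by rewrite /m; lia.
(* Terms m+k+1 and m-k have the same exponent; their coefficients m+k+1 and m-k enter with opposite
   signs, so m cancels and 2k+1 remains. *)
rewrite (@bilateral_sqs _ 1 0 8 1 2 1 1 n m (fun i => (-1) ^+ (i + m) * i%:R)
  (fun k => (-1) ^+ k.+1 * (m + k.+1)%:R) (fun j => (-1) ^+ j * (m%:R - j%:R))) //.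
- have -> : - jac n = sqs (fun x => - jacf x) (8 * n + 1)%N.
    by rewrite /= -sumrN; apply: eq_bigr => x _; rewrite mulNrn.
  apply: sqs_eq => x _; rewrite /onprog /jacf.
  have -> : ((0 < x)%N && (2 %| x - 1)%N) = odd x by clear; lia.
  case: (boolP (odd x)) => ox; last by rewrite addr0 oppr0.
  have [k ->] : exists k, x = (2 * k).+1 by exists x./2; move: ox; clear; lia.
  have -> : (((2 * k).+1 - 1) %/ 2 = k)%N by clear; lia.
  have -> : ((2 * k).+1./2 = k)%N by clear; lia.
  by rewrite exprS; ring.
- by rewrite /m; lia.
- by move=> k; have := double_bin2 k.+1; rewrite /=; nia.
- by move=> k; have := double_bin2 k.+1; rewrite /=; nia.
- by move=> k; rewrite (_ : m + k.+1 + m = m + m + k.+1)%N ?signr_double //; lia.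
- move=> j le_j; rewrite -(signr_double (m - j)%N j) natrB //.
  by congr ((-1) ^+ _ * _); lia.
Qed.

End ThetaIdentities.

(** * The generating function of the odd minimal excludants *)

Lemma geq_total : total geq. Proof. by move=> x y; apply: leq_total. Qed.
Lemma geq_trans : transitive geq.
Proof. by move=> y x z /= h1 h2; apply: leq_trans h2 h1. Qed.
Lemma geq_anti : antisymmetric geq.
Proof. by move=> x y /andP[h1 h2]; apply/eqP; rewrite eqn_leq; apply/andP. Qed.

Lemma perm_sumn (s t : seq nat) : perm_eq s t -> sumn s = sumn t.
Proof. by move=> p; rewrite !sumnE; apply: perm_big. Qed.

Lemma sort_partition n (s : seq nat) : 0 \notin s -> sumn s = n ->
  is_partition n (sort geq s).
Proof.
move=> s0 sn; apply/and3P; split; first exact: (sort_sorted geq_total).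
  by rewrite mem_sort.
by apply/eqP; rewrite -sn; apply: perm_sumn; rewrite perm_sort.
Qed.

Lemma partition_eq n (p q : partition_of n) : perm_eq p q -> p = q.
Proof.
move=> e; apply: val_inj; apply: (sorted_eq geq_trans geq_anti) e.
  by case: p => s /= /and3P[].
by case: q => s /= /and3P[].
Qed.

Lemma part_notin0 n (p : partition_of n) : 0 \notin (p : seq nat).
Proof. by case: p => s /= /and3P[]. Qed.

Lemma part_sumn n (p : partition_of n) : sumn p = n.
Proof. by case: p => s /= /and3P[_ _ /eqP]. Qed.

(** Inserting a part k and sorting is a bijection onto the partitions that contain k. The predicate
    has to be blind to order because of the sorting. *)
Lemma partition_with_part n k (Q : seq nat -> bool) : (0 < k)%N ->
  (forall s t, perm_eq s t -> Q s = Q t) ->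
  #|[set p : partition_of (n + k)%N | (k \in (p : seq nat)) && Q p]%SET| =
  #|[set p : partition_of n | Q (k :: p)]%SET|.
Proof.
move=> k0 Qp.
have insP (p : partition_of n) : is_partition (n + k)%N (sort geq (k :: p)).
  apply: sort_partition; first by rewrite inE negb_or eq_sym -lt0n k0 part_notin0.
  by rewrite /= part_sumn addnC.
pose ins p := PartitionOf (insP p).
have pins p : perm_eq (ins p) (k :: p) by rewrite /= perm_sort.
have inj : injective ins.
  move=> p q e; apply: partition_eq; rewrite -(perm_cons k).
  by rewrite -(permPl (pins p)) e pins.
rewrite -(card_imset _ inj); congr #|pred_of_set _|; apply/setP => p; rewrite !inE.
apply/andP/imsetP => [[kp Qpp]|[q]]; last first.
  by rewrite inE => Qq ->; rewrite (perm_mem (pins q)) inE eqxx (Qp _ _ (pins q)).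
have rP : is_partition n (sort geq (rem k p)).
  apply: sort_partition.
    by apply: contra (part_notin0 p); apply: mem_rem.
  have := perm_sumn (perm_to_rem kp); rewrite part_sumn /=; lia.
exists (PartitionOf rP).
  rewrite inE -(Qp p) //; apply: (perm_trans (perm_to_rem kp)).
  by rewrite perm_cons perm_sym /= perm_sort.
apply: partition_eq; rewrite (permPl (perm_to_rem kp)) perm_sym (permPl (pins _)).
by rewrite perm_cons /= perm_sort.
Qed.

Lemma partition_with_part_le n k (Q : seq nat -> bool) : (0 < k)%N ->
  (forall s t, perm_eq s t -> Q s = Q t) ->
  #|[set p : partition_of n | (k \in (p : seq nat)) && Q p]%SET| =
  (if (k <= n)%N then #|[set p : partition_of (n - k)%N | Q (k :: p)]%SET| else 0).
Proof.
move=> k0 Qp; case: leqP => [le_kn|lt_nk].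
  by move: (@partition_with_part (n - k) k Q k0 Qp); rewrite subnK.
apply/eqP; rewrite cards_eq0; apply/eqP/setP => p; rewrite !inE; apply/negP => /andP[kp _].
by have := mem_leq_sumn kp; rewrite part_sumn; lia.
Qed.

Definition npart n : nat := #|{: partition_of n}|.

Definition npart_le k n : nat := #|[set p : partition_of n | all (fun x => x <= k)%N p]%SET|.

Lemma npart_le0 n : npart_le 0 n = (n == 0%N).
Proof.
rewrite /npart_le; have nilP : is_partition 0 [::] by [].
case: n => [|n] /=; last first.
  apply/eqP; rewrite cards_eq0; apply/eqP/setP => p; rewrite !inE; apply/negP.
  move=> /allP a0; have := part_sumn p; have := part_notin0 p.
  by case: (parts p) a0 => // x s /(_ x (mem_head _ _)); rewrite leqn0 => /eqP ->; rewrite inE.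
apply/eqP/cards1P; exists (PartitionOf nilP); apply/setP => p; rewrite !inE.
have -> : p = PartitionOf nilP.
  apply: partition_eq; have := size_parts p; rewrite leqn0 size_eq0 => /eqP ->.
  exact: perm_refl.
by rewrite eqxx.
Qed.

(** Split by the presence of a part k+1, and remove one copy of it if there is one. *)
Lemma npart_leS k n : npart_le k.+1 n =
  (npart_le k n + (if (k < n)%N then npart_le k.+1 (n - k.+1)%N else 0))%N.
Proof.
rewrite /npart_le -(cardsID [set p : partition_of n | k.+1 \in (p : seq nat)]%SET) addnC.
congr (_ + _)%N.
  apply: eq_card => p; rewrite !inE; apply/andP/idP => [[np /allP a]|a].
    apply/allP => x xp; have := a x xp; rewrite leq_eqVlt ltnS => /orP[/eqP e|//].
    by rewrite e in xp; rewrite xp in np.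
  split; last by apply: sub_all a => x /leqW.
  by apply/negP => /(allP a); rewrite ltnn.
rewrite -(@eq_card _ (mem [set p : partition_of n | (k.+1 \in (p : seq nat)) && all (fun x => x <= k.+1)%N p]%SET)).
  rewrite partition_with_part_le //; last by move=> s t p; apply: perm_all.
  case: ifP => // _; congr #|pred_of_set _|; apply/setP => p; rewrite !inE /=.
  by rewrite leqnn.
by move=> p; rewrite !inE andbC.
Qed.

Definition has_upto m (s : seq nat) := all (fun i => i.+1 \in s) (iota 0 m).

Lemma has_uptoS m s : has_upto m.+1 s = (m.+1 \in s) && has_upto m s.
Proof. by rewrite /has_upto -{1}addn1 iotaD all_cat /= add0n andbT andbC. Qed.

Definition ncnt m n : nat := #|[set p : partition_of n | has_upto m p]%SET|.

(** Removing one part of each size 1, ..., m leaves an arbitrary partition of n - m(m+1)/2. *)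
Lemma ncntE m n : ncnt m n = (if 'C(m.+1, 2) <= n then npart (n - 'C(m.+1, 2)) else 0)%N.
Proof.
elim: m n => [|m IHm] n.
  by rewrite /ncnt /npart /= subn0 -cardsT; congr #|pred_of_set _|; apply/setP => p; rewrite !inE.
have -> : ncnt m.+1 n = (if (m < n)%N then ncnt m (n - m.+1)%N else 0).
  rewrite /ncnt -(@eq_card _ (mem [set p : partition_of n | (m.+1 \in (p : seq nat)) && has_upto m p]%SET)).
    rewrite partition_with_part_le //; last first.
      by move=> s t p; apply: eq_all => i; rewrite (perm_mem p).
    case: ifP => // _; congr #|pred_of_set _|; apply/setP => p; rewrite !inE.
    apply: eq_in_all => i; rewrite mem_iota add0n => /andP[_ lt_im].
    by rewrite inE eqSS ltn_eqF.
  by move=> p; rewrite !inE has_uptoS.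
rewrite IHm [in RHS]binS bin1; case: ltnP => h; last by rewrite ifF //; lia.
case: leqP => h1; last by rewrite ifF //; lia.
by rewrite ifT ?subnDA; [congr npart; lia | lia].
Qed.

Lemma mex_has n (p : partition_of n) m :
  (mex p == m.+1) = has_upto m p && ~~ has_upto m.+1 p.
Proof.
rewrite /mex has_uptoS; case: ex_minnP => k /andP[k0 kp] kmin.
apply/eqP/andP => [ek|[hm]].
  rewrite ek in kp kmin; split; last by rewrite negb_and kp.
  apply/allP => i; rewrite mem_iota add0n => /andP[_ lt_im].
  by apply: contraT => ni; have := kmin i.+1; rewrite ni => /(_ isT); rewrite ltnS leqNgt lt_im.
rewrite negb_and hm orbF => nm; have := kmin m.+1; rewrite nm => /(_ isT).
rewrite leq_eqVlt => /orP[/eqP //|]; rewrite ltnS => lt_km.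
have := allP hm k.-1; rewrite mem_iota add0n prednK // lt_km (negPf kp) => /(_ _).
by move=> /(_ isT).
Qed.

Lemma mex_le n (p : partition_of n) : (0 < mex p <= n.+1)%N.
Proof.
rewrite /mex; case: ex_minnP => k /andP[k0 kp] kmin; rewrite k0.
apply: kmin => /=; apply/negP => /mem_leq_sumn; rewrite part_sumn; lia.
Qed.

(** The minimal excludant is m+1 exactly when 1, ..., m occur and m+1 does not, so each value is
    counted by a difference of two consecutive [ncnt]; odd values correspond to m = 2j. *)
Lemma sigma_o_mexE n : G_o n =
  \sum_(j < n.+1) (2 * j + 1)%:R * ((ncnt (2 * j) n)%:R - (ncnt (2 * j + 1) n)%:R).
Proof.
have nm m : ((ncnt m n)%:R - (ncnt m.+1 n)%:R : int) = #|[set p : partition_of n | mex p == m.+1]%SET|%:R.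
  rewrite -natrB; last first.
    by apply: subset_leq_card; apply/fintype.subsetP => p; rewrite !inE has_uptoS => /andP[].
  congr (_%:R); rewrite /ncnt -cardsDS; last first.
    by apply/fintype.subsetP => p; rewrite !inE has_uptoS => /andP[].
  by congr #|pred_of_set _|; apply/setP => p; rewrite !inE mex_has andbC.
have -> : G_o n = \sum_(p : partition_of n | odd (mex p)) (mex p)%:R.
  by rewrite /G_o /sigma_o_mex -natz natr_sum.
rewrite (partition_big (fun p : partition_of n => inord (mex p)./2 : 'I_n.+1) predT) //=.
apply: eq_bigr => j _; rewrite addn1 nm.
rewrite (eq_big (fun p : partition_of n => mex p == (2 * j).+1) (fun _ => (2 * j).+1%:R)).
- rewrite sumr_const -[LHS]mulr_natr; congr (_ * _).
  by congr (_%:R); apply: eq_card => p; rewrite !inE.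
- move=> p; have /andP[m0 mn] := mex_le p; rewrite -val_eqE /= inordK; last by lia.
  by apply/andP/eqP => [[o /eqP e]|->]; [lia | split; [|apply/eqP]; lia].
- move=> p /andP[o]; have /andP[m0 mn] := mex_le p; rewrite -val_eqE /= inordK; last by lia.
  by move=> /eqP e; congr (_%:R); lia.
Qed.

Definition Pser : fps int := Fps (fun n => (npart n)%:R).
Definition Gser : fps int := Fps G_o.
Section MexGeneratingFunction.
Local Notation E := (euler int).

Lemma Pser_euler : Pser * E = 1.
Proof.
pose L k : fps int := Fps (fun n => (npart_le k n)%:R).
have L0 : L 0%N = 1 by apply: fpsP => n /=; rewrite npart_le0.
have LS k : L k.+1 * (1 - fX int k.+1) = L k.
  rewrite mulrBr mulr1 mulrC; apply/eqP; rewrite subr_eq; apply/eqP; apply: fpsP => n.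
  by rewrite fpsD fXM [LHS]/= npart_leS natrD; case: ifP.
have LE k : L k * qfact (fX int 1) k = 1.
  elim: k => [|k IHk]; first by rewrite L0 /qfact big_ord0 mulr1.
  by rewrite qfactS fXX mul1n mulrCA LS mulrC.
apply: eqm_fps => n; rewrite -(LE n); apply: eqmM; last by apply: eqm_sym; apply: eqm_euler.
move=> i lt_i /=; congr (_%:R); rewrite /npart /npart_le -cardsT.
congr #|pred_of_set _|; apply/setP => p; rewrite !inE; apply/esym/allP => x xp.
by have := mem_leq_sumn xp; rewrite part_sumn; lia.
Qed.

(** With T(i) the triangular numbers, E G_o is the sum of (2j+1)(q^T(2j) - q^T(2j+1)). Twice the two
    coefficients are (4j+1) + 1 and -(4j+3) + 1: the coefficients of Jacobi's E^3, each increased by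
    the coefficient 1 of psi. *)
Lemma Gser_euler : (Gser + Gser) * E = E ^+ 3 + psi.
Proof.
pose M n := (8 * n + 2)%N.
pose H n := \sum_(j < M n) (fC (2 * j + 1)%:R * fX int 'C((2 * j).+1, 2)) -
            \sum_(j < M n) (fC (2 * j + 1)%:R * fX int 'C((2 * j + 1).+1, 2)).
have hG n : eqm n.+1 Gser (H n * Pser).
  move=> i lt_i; rewrite [LHS]/= sigma_o_mexE /H mulrBl !mulr_suml fpsD fpsN !fps_sum -sumrB.
  have nc m : (ncnt m i)%:R = (fX int 'C(m.+1, 2) * Pser) i.
    by rewrite ncntE fXM; case: leqP.
  rewrite (big_ord_widen (M n) (fun j => (2 * j + 1)%:R * ((ncnt (2 * j) i)%:R - (ncnt (2 * j + 1) i)%:R))); last by rewrite /M; lia.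
  rewrite big_mkcond; apply: eq_bigr => j _.
  rewrite -!mulrA !fCM -!nc -mulrBr; case: ifP => // h.
  rewrite !ncntE !ifF ?subrr ?mulr0 //; last by have := double_bin2 (2 * j).+1; nia.
  by have := double_bin2 (2 * j + 1).+1; nia.
rewrite jacobi_cube; apply: fpsP => n.
have -> : ((Gser + Gser) * E) n = ((H n + H n) * Pser * E) n.
  apply: (@eqmM _ n.+1) => //; rewrite mulrDl; apply: eqmD; exact: hG.
rewrite -mulrA Pser_euler mulr1 fpsD /H fpsD fpsN.
rewrite (@unilateral_sqs _ 8 1 4 1 n (M n) (fun j => (2 * j + 1)%:R) (fun j => 'C((2 * j).+1, 2))) //; last 2 first.
- by rewrite /M; lia.
- by move=> k; have := double_bin2 (2 * k).+1; rewrite /=; nia.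
rewrite (@unilateral_sqs _ 8 1 4 3 n (M n) (fun j => (2 * j + 1)%:R) (fun j => 'C((2 * j + 1).+1, 2))) //; last 2 first.
- by rewrite /M; lia.
- by move=> k; have := double_bin2 (2 * k + 1).+1; rewrite /=; nia.
rewrite fpsD (_ : jac n = sqs jacf (8 * n + 1)%N) // (_ : psi n = sqs oddf (8 * n + 1)%N) //.
have [[x e]|h] := sq_cases (8 * n + 1); last by rewrite !sqs0.
rewrite e !sqsE /onprog /jacf /oddf.
have xo : odd x by have := congr1 odd e; rewrite oddD oddM oddX /= => <-.
rewrite xo; have [y [->|->]] : exists y, x = (4 * y + 1)%N \/ x = (4 * y + 3)%N.
    exists (x %/ 4)%N; lia.
- rewrite ifT; last by lia. rewrite ifF; last by lia.
  have -> : ((4 * y + 1 - 1) %/ 4 = y)%N by lia.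
  have -> : ((4 * y + 1)./2 = 2 * y)%N by lia.
  by rewrite exprM sqrrN !expr1n; lia.
- rewrite ifF; last by lia. rewrite ifT; last by lia.
  have -> : ((4 * y + 3 - 3) %/ 4 = y)%N by lia.
  have -> : ((4 * y + 3)./2 = (2 * y).+1)%N by lia.
  by rewrite exprS exprM sqrrN !expr1n; lia.
Qed.

(* [phim] is invertible, so this determines [2 G_o = E_2 (phim + 1 / phim)]. *)
Lemma Gser_phim : (Gser + Gser) * phim = dil 2 E * (phim ^+ 2 + 1).
Proof.
have [v ve] := finv_exists (@euler0 int 1 isT).
have dE : dil 1 E = E by apply: fpsP => k /=; rewrite dvd1n divn1.
rewrite dE in ve.
have [w we] := finv_exists (@euler0 int 2 isT).
have h1 := Gser_euler; have h2 := euler_sq; have h3 := psi_euler.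
set g := Gser + Gser in h1 *; set e := euler int in h1 h2 h3 ve we *; set d := dil 2 e in h2 h3 we *.
have ph : phim = e ^+ 2 * w by rewrite h2 mulrAC we mul1r.
have ps : psi = d ^+ 2 * v by rewrite -h3 -mulrA ve mulr1.
have -> : g = e ^+ 2 + d ^+ 2 * v ^+ 2.
  have : g * e * v = (e ^+ 3 + psi) * v by rewrite h1.
  rewrite -mulrA ve mulr1 ps => ->.
  have -> : (e ^+ 3 + d ^+ 2 * v) * v = e ^+ 2 * (e * v) + d ^+ 2 * v ^+ 2 by ring.
  by rewrite ve mulr1.
rewrite ph.
have -> : (e ^+ 2 + d ^+ 2 * v ^+ 2) * (e ^+ 2 * w) =
  e ^+ 4 * w + (d * w) * d * (e * v) ^+ 2 by ring.
rewrite we ve.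
have -> : d * ((e ^+ 2 * w) ^+ 2 + 1) = e ^+ 4 * w * (d * w) + d by ring.
by rewrite we; ring.
Qed.

End MexGeneratingFunction.

(** * Density of integers exactly divisible by many primes *)

Section PrimesThreeModFour.
Variable R : realType.

Definition pi3 : nat_pred := [pred p | p %% 4 == 3]%N.

Definition chi4 (k : nat) : R := if (k %% 4 == 1)%N then 1 else if (k %% 4 == 3)%N then -1 else 0.

Lemma chi4_block j : [/\ chi4 (4 * j) = 0, chi4 (4 * j).+1 = 1, chi4 (4 * j).+2 = 0 & chi4 (4 * j).+3 = -1].
Proof.
rewrite /chi4; have -> : (4 * j %% 4 = 0)%N by lia.
have -> : ((4 * j).+1 %% 4 = 1)%N by lia.
have -> : ((4 * j).+2 %% 4 = 2)%N by lia.
by have -> : ((4 * j).+3 %% 4 = 3)%N by lia.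
Qed.

(** Partial sums of 1 - 1/3 + 1/5 - ... stay below the first term. *)
Lemma chi4_sum_le1 m : \sum_(0 <= k < m) chi4 k / k%:R <= 1.
Proof.
(* The slack 1/(4j+1) pays for the positive term of the next block. *)
have S j : \sum_(0 <= k < 4 * j) chi4 k / k%:R <= 1 - (4 * j).+1%:R^-1.
  elim: j => [|j IHj]; first by rewrite muln0 big_geq // invr1 subrr.
  have -> : (4 * j.+1 = (4 * j).+4)%N by lia.
  rewrite !big_nat_recr //=; have [-> -> -> ->] := chi4_block j.
  rewrite !mul0r !addr0 mul1r mulN1r.
  apply: (@le_trans _ _ (1 - (4 * j).+3%:R^-1)).
    by rewrite -addrA; apply: (le_trans (lerD IHj (lexx _))); rewrite addrA subrK.
  by rewrite lerD2l lerN2 lef_pV2 ?posrE ?ltr0n // ler_nat; lia.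
have [j [r [lr ->]]] : exists j r, (r < 4)%N /\ m = (4 * j + r)%N.
  by exists (m %/ 4)%N, (m %% 4)%N; split; [rewrite ltn_mod | lia].
have p1 k : 0 <= k.+1%:R^-1 :> R by rewrite invr_ge0 ler0n.
have [c0 c1 c2 c3] := chi4_block j.
have S1 : \sum_(0 <= k < 4 * j) chi4 k / k%:R <= 1.
  by apply: le_trans (S j) _; rewrite gerBl.
have S2 : \sum_(0 <= k < 4 * j) chi4 k / k%:R + (4 * j).+1%:R^-1 <= 1.
  by apply: (le_trans (lerD (S j) (lexx _))); rewrite subrK.
by case: r lr => [|[|[|[|//]]]] _; rewrite ?addnS addn0 ?big_nat_recr //=;
  rewrite ?c0 ?c1 ?c2 ?mul0r ?mul1r ?addr0.
Qed.

Lemma chi4M3 p m : (p %% 4 = 3)%N -> chi4 (p * m) = - chi4 m.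
Proof.
move=> p3; rewrite /chi4; have -> : (p * m %% 4 = (3 * m) %% 4)%N by rewrite -modnMml p3.
have : (m %% 4 < 4)%N by rewrite ltn_mod.
rewrite -modnMmr; case: (m %% 4)%N => [|[|[|[|//]]]] _ //=; rewrite ?oppr0 ?opprK //.
Qed.

Lemma chi4_pi' n : odd n -> pi3^'.-nat n -> chi4 n = 1.
Proof.
move=> on pn; have n0 : (0 < n)%N by case/andP: pn.
suff n1 : (n %% 4 = 1)%N by rewrite /chi4 n1.
rewrite (prod_prime_decomp n0) prime_decompE big_map big_seq.
elim/big_rec: _ => [|p x pin xE]; first by [].
rewrite /= -modnMm xE muln1 modn_mod -modnXm.
have dp : (p %| n)%N by move: pin; rewrite mem_primes => /and3P[].
have pp : prime p by move: pin; rewrite mem_primes => /and3P[].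
have : p \in pi3^' by move/allP: (andP pn).2 => /(_ p pin).
rewrite !inE /= => np; have op : odd p by apply: dvdn_odd dp on.
have -> : (p %% 4 = 1)%N by move: np op; lia.
by rewrite exp1n.
Qed.

Lemma pnat_pos (pi : nat_pred) n : pi.-nat n -> (0 < n)%N.
Proof. by case/andP. Qed.

Definition sqfree v := ~~ has (fun d => (d ^ 2 %| v)%N) (iota 2 v).

Lemma sqfreeP v d : (0 < v)%N -> sqfree v -> (1 < d)%N -> ~~ (d ^ 2 %| v)%N.
Proof.
move=> v0 /hasPn h d1; apply/negP => dv; have := h d; rewrite mem_iota d1 dv.
have : (d ^ 2 <= v)%N by apply: dvdn_leq.
by move=> le_dv; rewrite (_ : (d < 2 + v)%N) => [/(_ isT)//|]; nia.
Qed.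

Lemma sqfreeN v : (0 < v)%N -> ~~ sqfree v -> exists2 p, prime p & (p ^ 2 %| v)%N.
Proof.
move=> v0; rewrite negbK => /hasP[d]; rewrite mem_iota => /andP[d2 _] dv.
exists (pdiv d); first exact: pdiv_prime.
by apply: dvdn_trans dv; apply: dvdn_exp2r; apply: pdiv_dvd.
Qed.

Lemma sqfree_mul p v : prime p -> (0 < v)%N -> ~~ (p %| v)%N -> sqfree (p * v) = sqfree v.
Proof.
move=> pp v0 npv; have pv0 : (0 < p * v)%N by rewrite muln_gt0 prime_gt0.
apply/idP/idP => [s|s]; apply: contraT => /sqfreeN[] // r pr rv.
  by have := sqfreeP pv0 s (prime_gt1 pr); rewrite dvdn_mull.
have := sqfreeP v0 s (prime_gt1 pr).
have [e|ne] := eqVneq r p.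
  by move: rv; rewrite e expnS expn1 dvdn_pmul2l ?prime_gt0 // (negPf npv).
by rewrite -(@Gauss_dvdr _ p) ?rv // coprime_sym coprimeXr // prime_coprime // dvdn_prime2 // eq_sym.
Qed.

(** If a prime p = 3 (mod 4) divides n, the divisors v prime to p cancel against p v, because the
    character is -1 at p. Otherwise only v = 1 remains, and an odd n composed of primes 1 (mod 4) is
    itself 1 modulo 4. For even n every n/v is even. *)
Lemma chi4_divisor_sum X n : (0 < n < X)%N ->
  \sum_(0 <= v < X | [&& (v %| n)%N, sqfree v & pi3.-nat v]) chi4 (n %/ v)%N =
  (odd n && pi3^'.-nat n)%:R.
Proof.
move=> /andP[n0 nX].
have inX v : (v %| n)%N -> v \in index_iota 0 X.
  by move=> /(dvdn_leq n0); rewrite mem_index_iota; lia.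
have [/andP[on pn]|hn] := boolP (odd n && pi3^'.-nat n).
  rewrite -big_filter (_ : [seq v <- index_iota 0 X | _] = [:: 1%N]).
    by rewrite big_seq1 divn1 chi4_pi'.
  apply: perm_small_eq => //; apply: uniq_perm; rewrite ?filter_uniq ?iota_uniq // => v.
  rewrite mem_filter inE; apply/andP/eqP => [[/and3P[vn sv pv] _]|->].
    by apply/eqP; rewrite -(@pnat_1 pi3 v pv (pnat_dvd vn pn)).
  by split; [rewrite dvd1n /sqfree /= /pnat | apply: inX].
have [en|on] := boolP (odd n); last first.
  rewrite big1 // => v /and3P[vn sv pv].
  have ov : odd v.
    apply: contraT; rewrite -dvdn2 => v2.
    have v0 : (0 < v)%N by case/andP: pv.
    have := allP (andP pv).2 2%N; rewrite mem_primes /= v0 v2 => /(_ isT).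
    by rewrite inE.
  rewrite /chi4; have : ~~ odd (n %/ v)%N.
    by apply: contra on => o; rewrite -(divnK vn) oddM o ov.
  by move=> o; rewrite !ifF //; lia.
rewrite en /= in hn.
have [p [pp pn p3]] : exists p, [/\ prime p, (p %| n)%N & (p %% 4 = 3)%N].
  have [p pin np] : exists2 p, p \in primes n & p \notin pi3^'.
    by apply/allPn; move: hn; rewrite /pnat n0.
  move: pin; rewrite mem_primes => /and3P[pp _ pn]; exists p; split=> //.
  by move: np; rewrite !inE /= negbK => /eqP.
have p0 := prime_gt0 pp.
rewrite (bigID (fun v => p %| v)%N) /= -big_filter -[X in _ + X]big_filter.
set r := index_iota 0 X in inX *.
rewrite (perm_big (map (muln p) [seq v <- r | [&& (v %| n)%N, sqfree v & pi3.-nat v] && ~~ (p %| v)%N])) /=.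
  rewrite big_map -big_split /= big1_seq //= => v.
  rewrite mem_filter => /andP[/andP[/and3P[vn sv pv] npv] _].
  have /dvdnP[k ek] : (p * v %| n)%N by rewrite Gauss_dvd ?pn // prime_coprime.
  have v0 : (0 < v)%N by case/andP: pv.
  have -> : (n %/ v = p * k)%N by rewrite ek mulnA mulnK // mulnC.
  by rewrite ek mulnK ?muln_gt0 ?p0 // chi4M3 // subrr.
apply: uniq_perm; rewrite ?map_inj_uniq ?filter_uniq ?iota_uniq //.
  by move=> x y /eqP; rewrite eqn_pmul2l // => /eqP.
move=> v; rewrite mem_filter; apply/idP/mapP.
  move=> /andP[/andP[/and3P[vn sv pv] /dvdnP[w ew]] _].
  have v0 : (0 < v)%N by case/andP: pv.
  have w0 : (0 < w)%N by move: v0; rewrite ew muln_gt0 => /andP[].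
  have npw : ~~ (p %| w)%N.
    apply/negP => /dvdnP[y ey]; have := sqfreeP v0 sv (prime_gt1 pp).
    by rewrite ew ey -mulnA dvdn_mull.
  have wn : (w %| n)%N by apply: dvdn_trans vn; rewrite ew dvdn_mulr.
  exists w; last by rewrite mulnC.
  rewrite mem_filter (inX w wn) wn npw andbT /=; rewrite ew mulnC in sv pv.
  by rewrite -(@sqfree_mul p) // sv (pnat_dvd _ pv) // dvdn_mull.
move=> [w]; rewrite mem_filter => /andP[/andP[/and3P[wn sw pw] npw] _] ->.
have w0 : (0 < w)%N by case/andP: pw.
have pwn : (p * w %| n)%N by rewrite Gauss_dvd ?pn // prime_coprime.
rewrite pwn (inX _ pwn) sqfree_mul // sw pnatM pw dvdn_mulr // andbT.
by rewrite pnatE // inE p3.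
Qed.

Lemma sum_mult_le X v (F : nat -> R) : (0 < v)%N -> (0 < X)%N ->
  \sum_(0 <= n < X | (v %| n)%N) F n = \sum_(0 <= k < (X.-1 %/ v).+1) F (k * v)%N.
Proof.
move=> v0 X0; rewrite -sum_multiples //.
have le : ((X.-1 %/ v * v).+1 <= X)%N by have := leq_trunc_div X.-1 v; lia.
rewrite (@big_cat_nat _ _ _ (X.-1 %/ v * v).+1 0 X) //= [X in _ + X]big_nat_cond [X in _ + X]big1 ?addr0 //.
move=> n /andP[/andP[h1 h2] /dvdnP[c e]]; exfalso; move: h1; rewrite e ltnNge leq_mul2r.
by rewrite -[c](mulnK _ v0) -e leq_div2r ?orbT //; lia.
Qed.

(** Every odd integer factors uniquely into one index of [Usum] and one index of [Vsum]: its part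
    prime to the primes 3 (mod 4) and the complementary part. *)
Definition Usum X : R := \sum_(0 <= n < X | odd n && pi3^'.-nat n) n%:R^-1.
Definition Vsum X : R := \sum_(0 <= v < X | pi3.-nat v) v%:R^-1.

(** The indicator in [Usum] is replaced by the divisor sum; for fixed v the sum over the multiples n
    = k v is 1/v times a partial sum of 1 - 1/3 + 1/5 - ..., which is at most 1. *)
Lemma Usum_le X : (0 < X)%N -> Usum X <= Vsum X.
Proof.
move=> X0; rewrite /Usum big_mkcond.
have -> : \sum_(0 <= n < X) (if odd n && pi3^'.-nat n then n%:R^-1 else 0) =
  \sum_(0 <= n < X) \sum_(0 <= v < X | (sqfree v && pi3.-nat v) && (v %| n)%N) chi4 (n %/ v)%N / n%:R :> R.
  apply: eq_big_nat => n /andP[_ nX]; rewrite -mulr_suml.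
  case: n nX => [|n] nX; first by rewrite invr0 mulr0.
  rewrite (eq_bigl (fun v => [&& (v %| n.+1)%N, sqfree v & pi3.-nat v])); last by move=> v; rewrite andbC.
  by rewrite chi4_divisor_sum ?nX //; case: ifP; rewrite ?mul1r ?mul0r.
rewrite (exchange_big_dep_nat (fun v => sqfree v && pi3.-nat v)) /=; last by move=> n v _ _ _ /andP[].
rewrite /Vsum [X in _ <= X]big_mkcond [X in X <= _]big_mkcond /=; apply: ler_sum => v _.
case: ifP => [/andP[sv pv]|_]; last by case: ifP; rewrite // invr_ge0.
rewrite pv; have v0 : (0 < v)%N by case/andP: pv.
rewrite (eq_bigl (fun n => v %| n)%N); last by move=> n; rewrite sv.
rewrite sum_mult_le // (eq_bigr (fun k => v%:R^-1 * (chi4 k / k%:R))) => [|k _]; last first.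
  by rewrite mulnK // natrM invfM; ring.
by rewrite -mulr_sumr ler_piMr ?invr_ge0 // chi4_sum_le1.
Qed.

Lemma odd_sum_le X : (0 < X)%N -> \sum_(0 <= n < X | odd n) n%:R^-1 <= Vsum X * Usum X.
Proof.
move=> X0.
have -> : \sum_(0 <= n < X | odd n) n%:R^-1 =
  \sum_(0 <= n < X) \sum_(0 <= v < X | pi3.-nat v && [&& (v %| n)%N, odd n & pi3^'.-nat (n %/ v)%N]) n%:R^-1 :> R.
  rewrite big_mkcond; apply: eq_big_nat => n /andP[_ nX].
  case: n nX => [|n] nX; first by rewrite invr0 /= big1.
  case: ifP => on; last first.
    by rewrite big_pred0 // => v; rewrite andbF /= andbF.
  rewrite -big_filter (_ : [seq v <- _ | _] = [:: n.+1`_pi3]%N) ?big_seq1 //.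
  apply: perm_small_eq => //; apply: uniq_perm; rewrite ?filter_uniq ?iota_uniq // => v.
  rewrite mem_filter inE; apply/andP/eqP => [[/andP[pv /and3P[vn _ pn]] _]|->].
    rewrite -[X in (X`_pi3)%N](divnK vn) partnM; last 2 first.
    - by rewrite divn_gt0 ?(pnat_pos pv) // dvdn_leq.
    - exact: pnat_pos pv.
    by rewrite part_p'nat // part_pnat_id // mul1n.
  split; last by rewrite mem_index_iota /=; have := dvdn_leq (ltn0Sn n) (dvdn_part pi3 n.+1); lia.
  rewrite part_pnat dvdn_part /= -{1}(@partnC pi3 n.+1) // mulKn ?part_gt0 //.
  by rewrite part_pnat.
rewrite (exchange_big_dep_nat (fun v => pi3.-nat v)) /=; last by move=> n v _ _ _ /andP[].
rewrite /Vsum mulr_suml big_mkcond [X in _ <= X]big_mkcond; apply: ler_sum => v _.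
case: ifP => // pv; have v0 : (0 < v)%N by case/andP: pv.
rewrite (eq_bigl (fun n => (v %| n)%N && (odd n && pi3^'.-nat (n %/ v)%N))); last by move=> n; rewrite pv.
rewrite big_mkcondr sum_mult_le // /Usum mulr_sumr [X in _ <= X]big_mkcond /=.
rewrite (@big_cat_nat _ _ _ (X.-1 %/ v).+1 0 X) //=; last first.
  by have := leq_div X.-1 v; lia.
rewrite -[X in X <= _]addr0; apply: lerD; last first.
  by apply: sumr_ge0 => n _; case: ifP => // _; rewrite mulr_ge0 ?invr_ge0.
apply: ler_sum => k _; rewrite mulnK // oddM natrM invfM mulrC.
case: (odd k) => /=; last by [].
by case: (odd v) => //=; case: ifP => // _; rewrite mulr_ge0 ?invr_ge0.
Qed.

Lemma harmonic_odd_unbounded (C : R) : exists X, (0 < X)%N /\ C <= \sum_(0 <= n < X | odd n) n%:R^-1.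
Proof.
have H k : k.+1%:R / 4 <= \sum_(0 <= n < (2 ^ k.+1).+1 | odd n) n%:R^-1 :> R.
  elim: k => [|k IHk].
    by rewrite expn1 big_mkcond !big_nat_recr //= big_geq //= invr1; lra.
  rewrite (@big_cat_nat _ _ _ (2 ^ k.+1).+1 0 (2 ^ k.+2).+1) //=; last by rewrite ltnS leq_exp2l.
  rewrite -natr1 mulrDl mul1r; apply: lerD => //.
  have e : (2 ^ k.+2 = 2 ^ k.+1 + 2 ^ k * 2)%N by rewrite !expnS; lia.
  have E m : \sum_((2 ^ k.+1).+1 <= n < ((2 ^ k.+1) + m * 2).+1 | odd n) n%:R^-1 >=
     m%:R * (2 ^ k.+1 + m * 2)%:R^-1 :> R.
    apply: (@le_trans _ _ (\sum_((2 ^ k.+1).+1 <= n < ((2 ^ k.+1) + m * 2).+1 | odd n) (2 ^ k.+1 + m * 2)%:R^-1)); last first.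
      rewrite big_nat_cond [X in _ <= X]big_nat_cond; apply: ler_sum => n /andP[/andP[h1 h2] _].
      by rewrite lef_pV2 ?posrE ?ltr0n ?ler_nat; lia.
    move: (_^-1) => c; elim: m => [|m IHm].
      by rewrite mul0r addn0 big_geq.
    have -> : ((2 ^ k.+1 + m.+1 * 2).+1 = ((2 ^ k.+1 + m * 2).+1).+2)%N by lia.
    have o : odd (2 ^ k.+1 + m * 2) = false by rewrite oddD oddX oddM andbF.
    rewrite big_mkcond big_nat_recr; last by lia.
    rewrite big_nat_recr /= -?big_mkcond; last by lia.
    by rewrite o /= addr0 -natr1 mulrDl mul1r; apply: lerD.
  rewrite e; apply: le_trans (E _); rewrite -e natrX natrX !exprS.
  have : 0 < 2 ^+ k :> R by rewrite exprn_gt0.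
  by move=> h; rewrite le_eqVlt; apply/orP; left; apply/eqP; field; rewrite gt_eqF.
have hk : C * 4 <= (Num.bound `|C * 4|).+1%:R.
  apply: le_trans (ler_norm _) _; apply: le_trans (ltW (archi_boundP (normr_ge0 _))) _.
  by rewrite ler_nat.
exists (2 ^ (Num.bound `|C * 4|).+1).+1; split=> //; apply: le_trans (H _); lra.
Qed.

Definition primes3 X := [seq p <- index_iota 0 X | prime p && (p %% 4 == 3)%N].

(** Finite Euler product. In the induction on the list of primes, the multiples of p contribute at
    most 1/p of the whole sum, so 1 - 1/p times the whole is at most the sum over v prime to p. *)
Lemma Vsum_le X : (0 < X)%N -> Vsum X <= \prod_(p <- primes3 X) (1 - p%:R^-1)^-1.
Proof.
move=> X0.
have T (s : seq nat) : all prime s ->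
  \sum_(0 <= v < X | ([pred p | p \in s] : nat_pred).-nat v) v%:R^-1 <= \prod_(p <- s) (1 - p%:R^-1)^-1 :> R.
  elim: s => [_|p s IHs /= /andP[pp ps]].
    rewrite big_nil big_mkcond /=; case: X X0 => // -[|X] _; first by rewrite big_nat1.
    rewrite big_ltn // big_ltn //= big1_seq ?invr1 ?addr0 ?add0r //.
    move=> v /=; rewrite mem_index_iota => /andP[v2 _]; case: ifP => // h.
    by have := allP (andP h).2 (pdiv v); rewrite mem_primes pdiv_prime // pdiv_dvd (ltn_trans _ v2) // => /(_ isT).
  set T1 := \sum_(0 <= v < X | _) _; have p1 : 1 < p%:R :> R by rewrite ltr1n prime_gt1.
  have pi1 : 0 < 1 - p%:R^-1 :> R by rewrite subr_gt0 invf_lt1 // (lt_trans _ p1).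
  rewrite big_cons mulrC ler_pdivlMr //; apply: le_trans (IHs ps); rewrite mulrBr mulr1 lerBlDr.
  rewrite {1}/T1 (bigID (fun v => p %| v)%N) /= addrC; apply: lerD.
    rewrite big_mkcond [X in _ <= X]big_mkcond; apply: ler_sum => v _.
    case: ifP => [/andP[pv npv]|_]; last by case: ifP; rewrite // invr_ge0.
    rewrite ifT //; have v0 := pnat_pos pv; apply/andP; split=> //; apply/allP => q qv.
    have := allP (andP pv).2 q qv; rewrite !inE => /orP[/eqP e|//].
    by move: qv npv; rewrite e mem_primes => /and3P[_ _ ->].
  rewrite (eq_bigl _ _ (fun v => andbC _ _)) big_mkcondr sum_mult_le ?(prime_gt0 pp) //.
  rewrite /T1 mulr_suml [X in _ <= X]big_mkcond (@big_cat_nat _ _ _ (X.-1 %/ p).+1 0 X) //=; last first.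
    by have := leq_div X.-1 p; lia.
  rewrite -[X in X <= _]addr0; apply: lerD; last first.
    by apply: sumr_ge0 => v _; case: ifP => // _; rewrite mulr_ge0 ?invr_ge0.
  apply: ler_sum => v _; case: ifP => [pv|_]; last by case: ifP => // _; rewrite mulr_ge0 ?invr_ge0.
  by rewrite (pnat_dvd _ pv) ?dvdn_mulr // natrM invfM.
apply: le_trans (T _ _); last by apply/allP => p; rewrite mem_filter => /andP[/andP[]].
rewrite /Vsum big_nat_cond [X in _ <= X]big_nat_cond big_mkcond [X in _ <= X]big_mkcond.
apply: ler_sum => v _; case: ifP => [/andP[vX pv]|_]; last by case: ifP; rewrite // invr_ge0.
have v0 := pnat_pos pv; rewrite ifT //; apply/andP; split=> //; apply/andP; split=> //.
apply/allP => q qv.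
have := allP (andP pv).2 q qv; rewrite !inE /= mem_filter => -> /=.
move: qv; rewrite mem_primes => /and3P[-> _ /(dvdn_leq v0) qv] /=.
by rewrite mem_index_iota /=; lia.
Qed.

(** If the sum of 1/p were bounded by C, then V <= exp(2C), since (1 - 1/p)^-1 <= exp(2/p). But the
    odd harmonic sum is at most V U <= V^2, and it is unbounded. *)
Lemma sum_primes3_unbounded (C : R) : exists X, C <= \sum_(p <- primes3 X) p%:R^-1.
Proof.
apply: contrapT => h.
have hC X : \sum_(p <- primes3 X) p%:R^-1 <= C.
  by rewrite leNgt; apply/negP => lt; apply: h; exists X; apply: ltW.
have V X : (0 < X)%N -> Vsum X <= expR (2 * C).
  move=> X0; apply: le_trans (Vsum_le X0) _.
  apply: (@le_trans _ _ (expR (2 * \sum_(p <- primes3 X) p%:R^-1))); last first.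
    by rewrite ler_expR ler_pM2l.
  rewrite mulr_sumr expR_sum big_seq [X in _ <= X]big_seq; apply: ler_prod => p.
  rewrite mem_filter => /andP[/andP[pp p3] _].
  have p2 : 2 <= p%:R :> R by rewrite ler_nat prime_gt1.
  have p0 : 0 < p%:R :> R by lra.
  have i2 : p%:R^-1 <= 2^-1 :> R by rewrite lef_pV2 ?posrE.
  have ip : 0 < p%:R^-1 :> R by rewrite invr_gt0.
  rewrite invr_ge0 subr_ge0 (le_trans i2) ?invf_le1 //=; last by lra.
  apply: le_trans (expR_ge1Dx _); rewrite -[X in X <= _]mul1r ler_pdivrMr; last by lra.
  by nra.
have [X [X0 hX]] := harmonic_odd_unbounded (expR (2 * C) * expR (2 * C) + 1).
have := le_trans hX (odd_sum_le X0).
have V0 : 0 <= Vsum X by apply: sumr_ge0 => v _; rewrite invr_ge0.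
have U0 : 0 <= Usum X by apply: sumr_ge0 => v _; rewrite invr_ge0.
have := V X X0; have := Usum_le X0; nra.
Qed.

End PrimesThreeModFour.

(** * Sieving by exact divisibility of 12 n + 1 *)

Lemma crt_sum (V : nmodType) a b (F : nat -> nat -> V) : (0 < a)%N -> (0 < b)%N -> coprime a b ->
  \sum_(n < a * b) F (n %% a)%N (n %% b)%N = \sum_(i < a) \sum_(j < b) F i j.
Proof.
move=> a0 b0 cab; rewrite pair_bigA /=.
pose h (n : 'I_(a * b)) := (Ordinal (ltn_pmod n a0), Ordinal (ltn_pmod n b0)).
have hi : injective h.
  move=> n n' [/eqP e1 /eqP e2]; apply: val_inj.
  have : n == n' %[mod a * b] by rewrite chinese_remainder // e1 e2.
  by rewrite !modn_small // => /eqP.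
have hb : bijective h by apply: inj_card_bij => //; rewrite card_prod !card_ord.
by rewrite (reindex h) /=; last exact: onW_bij.
Qed.

Section Density.
Variable R : realType.

Definition hits p n := (p %| 12 * n + 1)%N && ~~ (p ^ 2 %| 12 * n + 1)%N.
Definition nohit (s : seq nat) n := all (fun p => ~~ hits p n) s.
Definition good_prime p := [&& prime p, (p %% 4 == 3)%N & (3 < p)%N].

Lemma hits_mod p n : hits p (n %% p ^ 2)%N = hits p n.
Proof.
rewrite /hits; have e : (12 * (n %% p ^ 2) + 1 = 12 * n + 1 %[mod p ^ 2])%N.
  by rewrite -modnDml modnMmr modnDml.
have dv d : (d %| p ^ 2)%N -> (d %| 12 * (n %% p ^ 2) + 1)%N = (d %| 12 * n + 1)%N.
  by move=> dp; rewrite /dvdn -(modn_dvdm _ dp) e modn_dvdm.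
by rewrite !dv // dvdn_exp.
Qed.

(** Modulo p^2 the map n -> 12 n + 1 is a permutation, so the hits correspond to the p - 1 nonzero
    multiples of p. *)
Lemma count_hits p : good_prime p -> (\sum_(n < p ^ 2) (~~ hits p n) + p = (p ^ 2).+1)%N.
Proof.
move=> /and3P[pp p3 p4]; have p0 := prime_gt0 pp.
have q0 : (0 < p ^ 2)%N by rewrite expn_gt0 p0.
have c12 : coprime (p ^ 2) 12.
  rewrite coprimeXl // prime_coprime // (_ : 12 = 2 ^ 2 * 3)%N // Euclid_dvdM // Euclid_dvdX // !dvdn_prime2 //.
  by apply/negP => /orP[/andP[/eqP e _]|/eqP e]; rewrite e in p3 p4.
pose h (n : 'I_(p ^ 2)) := Ordinal (ltn_pmod (12 * n + 1) q0).
have hi : injective h.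
  move=> n n' [/eqP]; rewrite eqn_modDr => e; apply: val_inj; apply/eqP.
  have [le|/ltnW le] := leqP n n'.
    move: e; rewrite eq_sym eqn_mod_dvd ?leq_mul2l ?le ?orbT // -mulnBr Gauss_dvdr //.
    by rewrite -eqn_mod_dvd // !modn_small // eq_sym.
  move: e; rewrite eqn_mod_dvd ?leq_mul2l ?le ?orbT // -mulnBr Gauss_dvdr //.
  by rewrite -eqn_mod_dvd // !modn_small.
have e : (\sum_(n < p ^ 2) (~~ hits p n) = \sum_(m < p ^ 2) (~~ ((p %| m) && ~~ (p ^ 2 %| m))))%N.
  rewrite [RHS](reindex_inj hi) /=; apply: eq_bigr => n _; congr (nat_of_bool (~~ _)).
  by rewrite /hits /dvdn modn_mod modn_dvdm // dvdn_exp.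
rewrite e -(big_mkord predT (fun m => nat_of_bool (~~ ((p %| m) && ~~ (p ^ 2 %| m))%N))).
have -> : (\sum_(0 <= m < p ^ 2) (~~ ((p %| m) && ~~ (p ^ 2 %| m))))%N =
  (\sum_(0 <= m < p ^ 2) (1 - (p %| m)) + 1)%N.
  rewrite big_ltn // [in RHS]big_ltn // !dvdn0 /= add0n addnC; congr (_ + _)%N.
  apply: eq_big_nat => m /andP[m0 mp]; rewrite [(p ^ 2 %| m)%N](_ : _ = false) ?andbT; first by case: (p %| m)%N.
  by apply/negbTE/negP => /(dvdn_leq m0); rewrite leqNgt mp.
have : (\sum_(0 <= m < p ^ 2) (1 - (p %| m)) + \sum_(0 <= m < p ^ 2) (p %| m) = p ^ 2)%N.
  rewrite -big_split /= (eq_bigr (fun=> 1%N)); last by move=> m _; case: (p %| m)%N.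
  by rewrite sum_nat_const_nat subn0 muln1.
have -> : (\sum_(0 <= m < p ^ 2) (p %| m) = p)%N.
  have -> : (\sum_(0 <= m < p ^ 2) (p %| m) = \sum_(0 <= m < (p.-1 * p).+1 | (p %| m)%N) 1)%N.
    rewrite [RHS]big_mkcond /= [LHS](@big_cat_nat _ _ _ (p.-1 * p).+1) //=; last by nia.
    rewrite [X in (_ + X)%N]big1_seq ?addn0.
      by apply: eq_bigr => m _; case: ifP.
    move=> m /=; rewrite mem_index_iota => /andP[h1 h2]; case: (boolP (p %| m)%N) => // /dvdnP[c ec].
    by exfalso; move: h1 h2; rewrite ec; case: (ltngtP c p) => hc; nia.
  by rewrite (sum_multiples (fun=> 1%N)) // sum_nat_const_nat subn0 muln1 prednK.
lia.
Qed.

Definition blk (s : seq nat) : nat := \prod_(p <- s) (p ^ 2)%N.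

Lemma count_nohit s : all good_prime s -> uniq s ->
  (\sum_(n < blk s) (nohit s n))%N = \prod_(p <- s) ((p ^ 2).+1 - p)%N.
Proof.
elim: s => [|p s IHs] /=; first by rewrite /blk !big_nil big_ord1.
move=> /andP[gp gs] /andP[ps us]; rewrite /blk !big_cons -/(blk s).
have s0 : (0 < blk s)%N.
  rewrite /blk big_seq; elim/big_rec: _ => // q x qs x0; rewrite muln_gt0 x0 andbT.
  by rewrite expn_gt0 prime_gt0 //; case/and3P: (allP gs q qs).
have pp : prime p by case/and3P: gp.
have cps : coprime (p ^ 2) (blk s).
  rewrite /blk big_seq; elim/big_rec: _ => [|q x qs cx]; first by rewrite coprimen1.
  rewrite coprimeMr cx andbT coprimeXl // coprimeXr // prime_coprime // dvdn_prime2 //.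
    by apply/eqP => e; rewrite e qs in ps.
  by case/and3P: (allP gs q qs).
rewrite -(IHs gs us) -(count_hits gp) addnK big_distrl /=.
have nhm n : nohit s (n %% blk s)%N = nohit s n.
  apply: eq_in_all => q qs; rewrite -hits_mod -[in RHS]hits_mod modn_dvdm //.
  by rewrite /blk (big_rem q) //= dvdn_mulr.
rewrite (eq_bigr (fun i : 'I_(p ^ 2) => \sum_(j < blk s) (~~ hits p i) * nohit s j)%N); last first.
  by move=> i _; rewrite big_distrr.
rewrite -(crt_sum (fun i j => (~~ hits p i) * nohit s j)%N) //; last by rewrite expn_gt0 prime_gt0.
apply: eq_bigr => n _; rewrite hits_mod nhm; case: (hits p n) => //=.
by rewrite mul1n.
Qed.

Lemma count_periodic (P : nat -> bool) D X : (0 < D)%N -> (forall n, P (n %% D)%N = P n) ->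
  (\sum_(0 <= n < X) P n <= (X %/ D).+1 * \sum_(n < D) P n)%N.
Proof.
move=> D0 PD.
have e k : (\sum_(0 <= n < k * D) P n = k * \sum_(n < D) P n)%N.
  elim: k => [|k IHk]; first by rewrite !mul0n big_geq.
  rewrite (@big_cat_nat _ _ _ (k * D)) //=; last by rewrite leq_mul2r leqnSn orbT.
  rewrite IHk mulSn addnC; congr (_ + _)%N.
  rewrite -{1}[(k * D)%N]add0n big_addn addnK big_mkord.
  by apply: eq_bigr => n _; rewrite -PD addnC modnMDl PD.
rewrite -e [X in (_ <= X)%N](@big_cat_nat _ _ _ X) //=; first exact: leq_addr.
by rewrite ltnW // -ltn_divLR.
Qed.

(** The proportion of integers missed by every p in s is the product of 1 - 1/p + 1/p^2, which the
    divergence of the sum of 1/p makes arbitrarily small; discarding the primes up to z costs only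
    the fixed amount [C0]. *)
Lemma block_small (e : R) z : 0 < e -> exists s : seq nat,
  [/\ all good_prime s, uniq s, all (fun p => z < p)%N s &
     \prod_(p <- s) ((p ^ 2).+1 - p)%:R <= e * (blk s)%:R].
Proof.
move=> e0; pose z' := maxn z 3.
pose C0 : R := \sum_(p <- primes3 z'.+1) p%:R^-1.
have [X hX] := sum_primes3_unbounded (C0 + 2 * e^-1 : R).
pose s := [seq p <- primes3 X | (z' < p)%N]; exists s.
have gs : all good_prime s.
  apply/allP => p; rewrite !mem_filter => /andP[zp /andP[/andP[pp p3] _]].
  by rewrite /good_prime pp p3; move: zp; rewrite /z'; lia.
split=> //; first by rewrite !filter_uniq ?iota_uniq.
  by apply/allP => p; rewrite mem_filter => /andP[]; rewrite /z'; lia.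
have sum_s : 2 * e^-1 <= \sum_(p <- s) p%:R^-1.
  rewrite -(lerD2l C0); apply: le_trans hX _.
  rewrite (bigID (fun p => z' < p)%N) /= addrC big_filter; apply: lerD => //.
  rewrite /C0 /primes3 !big_filter big_filter_cond.
  rewrite (@big_nat_widen _ _ _ 0 X (maxn X z'.+1)) ?leq_maxl //.
  rewrite (@big_nat_widen _ _ _ 0 z'.+1 (maxn X z'.+1)) ?leq_maxr //.
  rewrite big_mkcond [X in _ <= X]big_mkcond; apply: ler_sum => p _ /=.
  case: ifP => [/andP[/andP[-> h] _]|_]; first by rewrite ltnS leqNgt h.
  by case: ifP => // _; rewrite invr_ge0.
(* Each factor satisfies (1 - 1/p + 1/p^2)(1 + S + 1/(2p)) <= 1 + S, so the proportion missed is at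
   most 1/(1 + S) with S half the sum of 1/p. *)
have prodle (t : seq nat) : all good_prime t ->
  \prod_(p <- t) ((p ^ 2).+1 - p)%:R * (1 + \sum_(p <- t) p%:R^-1 / 2) <= (blk t)%:R :> R.
  elim: t => [|p t IHt] /=; first by rewrite /blk !big_nil addr0 mulr1.
  move=> /andP[/and3P[pp _ p3] gt]; rewrite /blk !big_cons natrM -/(blk t).
  have IH := IHt gt; set S := \sum_(q <- t) _ in IH *; set Q := \prod_(q <- t) _ in IH *.
  have S0 : 0 <= S by apply: sumr_ge0 => q _; rewrite divr_ge0 ?invr_ge0.
  have Q0 : 0 <= Q by apply: prodr_ge0.
  apply: le_trans (_ : (p ^ 2)%:R * (Q * (1 + S)) <= _); last by rewrite ler_pM2l // ltr0n expn_gt0 prime_gt0.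
  rewrite [X in X <= _](_ : _ = Q * (((p ^ 2).+1 - p)%:R * (1 + (p%:R^-1 / 2 + S)))); last by ring.
  rewrite [X in _ <= X]mulrCA; apply: ler_wpM2l => //.
  have p1 : (3 < p%:R :> R) by rewrite ltr_nat.
  have pi : p%:R * p%:R^-1 = 1 :> R by rewrite divff // gt_eqF // (lt_trans _ p1).
  have -> : ((p ^ 2).+1 - p)%:R = p%:R ^+ 2 + 1 - p%:R :> R.
    by rewrite natrB ?natrX; [rewrite -natr1 natrX | apply: leqW; rewrite expnS expn1 leq_pmulr ?prime_gt0].
  rewrite natrX; set x : R := p%:R in p1 pi *; set y : R := x^-1 in pi *.
  have y0 : 0 < y by rewrite invr_gt0; lra.
  have -> : (x ^+ 2 + 1 - x) * (1 + (y / 2 + S)) =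
    (x ^+ 2 + 1 - x) * (1 + S) + x * (x * y) / 2 + y / 2 - (x * y) / 2 by ring.
  rewrite pi; have : y <= 1 by rewrite invf_le1; lra.
  by nra.
have := prodle s gs; set S := \sum_(p <- s) _ / 2; set Q := \prod_(p <- s) _; set B := (blk s)%:R.
have hS : e^-1 <= S by rewrite /S -mulr_suml; lra.
have Q0 : 0 <= Q by apply: prodr_ge0.
have B0 : 0 <= B by rewrite /B.
move=> h; have : Q * e^-1 <= B.
  apply: le_trans h; apply: ler_wpM2l => //; lra.
by rewrite ler_pdivrMr // mulrC.
Qed.

Definition good_hits h n := exists ps : seq nat,
  [/\ size ps = h, uniq ps, all good_prime ps & all (hits^~ n) ps].

(** Induction on h: either the whole block s misses n, or some prime of s hits n and is adjoined to
    h hits by larger primes. Both exceptional sets receive e/2; the constant absorbs the incomplete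
    period of the block. *)
Lemma bad_density h (e : R) : 0 < e -> exists C : R, forall X,
  (\sum_(0 <= n < X) (~~ `[< good_hits h n >]))%:R <= e * X%:R + C.
Proof.
(* The primes are required to exceed z, so that those supplied by the induction hypothesis lie
   beyond the block s and are distinct from its members. *)
suff H z : 0 < e -> exists C : R, forall X, (\sum_(0 <= n < X)
   (~~ `[< exists ps : seq nat, [/\ size ps = h, uniq ps, all good_prime ps, all (fun p => z < p)%N ps & all (hits^~ n) ps] >]))%:R
   <= e * X%:R + C.
  move=> /(H 0%N)[C hC]; exists C => X; apply: le_trans (hC X); rewrite ler_nat.
  apply: leq_sum => n _; case: (asboolP (good_hits h n)) => //= nb.
  by case: asboolP => //= -[ps [p1 p2 p3 _ p4]]; case: nb; exists ps.
elim: h z e => [|h IHh] z e e0.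
  exists 0 => X; rewrite addr0 big1 ?mulr_ge0 ?(ltW e0) // => n _.
  by case: asboolP => //; case; exists [::].
have e2 : 0 < e / 2 by lra.
have [s [gs us zs hs]] := block_small z e2.
pose z' := (\max_(p <- s) p + z)%N.
have [C hC] := IHh z' (e / 2) e2.
exists (C + (\prod_(p <- s) ((p ^ 2).+1 - p)%N)%:R) => X.
have s0 : (0 < blk s)%N.
  rewrite /blk big_seq; elim/big_rec: _ => // q x qs x0; rewrite muln_gt0 x0 andbT.
  by rewrite expn_gt0 prime_gt0 //; case/and3P: (allP gs q qs).
apply: (@le_trans _ _ ((\sum_(0 <= n < X) (~~ `[< exists ps : seq nat, [/\ size ps = h, uniq ps, all good_prime ps, all (fun p => z' < p)%N ps & all (hits^~ n) ps] >]))%:R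
   + (\sum_(0 <= n < X) nohit s n)%:R)).
  rewrite -natrD ler_nat -big_split; apply: leq_sum => n _ /=.
  case: asboolP => //= nex; case: asboolP => //= -[ps [p1 p2 p3 p4 p5]].
  case: (boolP (nohit s n)) => // /allPn[p ps' /negPn hp]; case: nex.
  exists (p :: ps); split=> /=; rewrite ?p1 ?p2 ?p3 ?p5 ?hp ?(allP gs p ps') ?(allP zs p ps') ?andbT //=.
    apply/negP => /(allP p4); rewrite /z' ltnNge => /negP; apply.
    by apply: leq_trans (leq_addr _ _); apply: leq_bigmax_seq.
  by apply: sub_all p4 => q; rewrite /z' => /(leq_ltn_trans _); apply; apply: leq_addl.
have -> : e * X%:R + (C + (\prod_(p <- s) ((p ^ 2).+1 - p)%N)%:R) =
  (e / 2 * X%:R + C) + (e / 2 * X%:R + (\prod_(p <- s) ((p ^ 2).+1 - p)%N)%:R) by field.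
apply: lerD => //.
have nhm n : nohit s (n %% blk s)%N = nohit s n.
  apply: eq_in_all => q qs; rewrite -hits_mod -[in RHS]hits_mod modn_dvdm //.
  by rewrite /blk (big_rem q) //= dvdn_mulr.
apply: (@le_trans _ _ (((X %/ blk s).+1 * \sum_(n < blk s) nohit s n)%N)%:R).
  by rewrite ler_nat; apply: count_periodic.
rewrite count_nohit // mulSn natrD addrC lerD2r natrM.
apply: (@le_trans _ _ ((X %/ blk s)%:R * (e / 2 * (blk s)%:R))).
  by apply: ler_wpM2l => //; rewrite natr_prod.
rewrite mulrCA; apply: ler_wpM2l; first exact: ltW.
by rewrite -natrM ler_nat leq_trunc_div.
Qed.

End Density.

(** * Evaluation of power series in the unit disc *)

Section ComplexSums.
Variable R : realType.
Local Notation C := R[i].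
Local Open Scope complex_scope.
Implicit Types (f g : nat -> C) (a b : fps C) (z w : C).

(** The modulus as an element of [R], the norm on [R[i]] being itself complex valued. *)
Definition nrm z : R := complex.Re `|z|.

Lemma nrmE z : `|z| = (nrm z)%:C.
Proof. by rewrite /nrm normc_def. Qed.
Lemma nrm_def z : nrm z = Num.sqrt (complex.Re z ^+ 2 + complex.Im z ^+ 2).
Proof. by rewrite /nrm normc_def. Qed.
Lemma nrmM z w : nrm (z * w) = nrm z * nrm w.
Proof. by apply: complexI; rewrite -nrmE normrM !nrmE -rmorphM. Qed.
Lemma nrm_ge0 z : 0 <= nrm z. Proof. by rewrite nrm_def sqrtr_ge0. Qed.
Lemma nrm0 : nrm 0 = 0. Proof. by rewrite /nrm normr0. Qed.
Lemma nrm1 : nrm 1 = 1. Proof. by rewrite /nrm normr1. Qed.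
Lemma nrmN z : nrm (- z) = nrm z. Proof. by rewrite /nrm normrN. Qed.
Lemma nrmX z n : nrm (z ^+ n) = nrm z ^+ n.
Proof. by elim: n => [|n IHn]; rewrite ?nrm1 // !exprS nrmM IHn. Qed.
Lemma nrmD z w : nrm (z + w) <= nrm z + nrm w.
Proof. by rewrite -lecR rmorphD /= -!nrmE ler_normD. Qed.
Lemma nrmB z w : nrm (z - w) <= nrm z + nrm w.
Proof. by rewrite -[nrm w]nrmN nrmD. Qed.
Lemma nrm_distC z w : nrm (z - w) = nrm (w - z).
Proof. by rewrite -nrmN opprB. Qed.
Lemma nrm_eq0 z : nrm z = 0 -> z = 0.
Proof. by move=> h; apply/eqP; rewrite -normr_eq0 nrmE h. Qed.
Lemma nrm_real (x : R) : nrm x%:C = `|x|.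
Proof. by rewrite nrm_def /= expr0n addr0 sqrtr_sqr. Qed.
Lemma nrm_nat n : nrm n%:R = n%:R.
Proof. by rewrite -(rmorph_nat (real_complex R)) nrm_real ger0_norm. Qed.
Lemma nrmV z : nrm z^-1 = (nrm z)^-1.
Proof.
by apply: complexI; rewrite -nrmE normfV nrmE fmorphV.
Qed.
Lemma Re_le_nrm z : `|complex.Re z| <= nrm z.
Proof.
by rewrite nrm_def -sqrtr_sqr ler_sqrt ?addr_ge0 ?sqr_ge0 // lerDl sqr_ge0.
Qed.
Lemma Im_le_nrm z : `|complex.Im z| <= nrm z.
Proof.
by rewrite nrm_def -sqrtr_sqr ler_sqrt ?addr_ge0 ?sqr_ge0 // lerDr sqr_ge0.
Qed.
Lemma nrm_le_ReIm z : nrm z <= `|complex.Re z| + `|complex.Im z|.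
Proof.
rewrite {1}(complexE z); apply: le_trans (nrmD _ _) _; rewrite nrm_real nrmM nrm_real.
by rewrite (_ : nrm 'i = 1) ?mul1r // nrm_def /= expr0n expr1n add0r sqrtr1.
Qed.
Lemma nrm_sum I (r : seq I) (P : pred I) (F : I -> C) :
  nrm (\sum_(i <- r | P i) F i) <= \sum_(i <- r | P i) nrm (F i).
Proof.
elim/big_rec2: _ => [|i y x _ le]; first by rewrite nrm0.
by apply: le_trans (nrmD _ _) _; rewrite lerD2l.
Qed.

Lemma le_eps (x y : R) : (forall e, 0 < e -> x <= y + e) -> x <= y.
Proof. by move=> h; apply/ler_addgt0Pr => e /h. Qed.

Definition hsum f (s : C) := forall e : R, 0 < e ->
  exists K0, forall K, (K0 <= K)%N -> nrm (\sum_(n < K) f n - s) <= e.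

Lemma hsum_uniq f s s' : hsum f s -> hsum f s' -> s = s'.
Proof.
move=> h h'; apply/eqP; rewrite -subr_eq0; apply/eqP; apply: nrm_eq0.
apply/eqP; rewrite eq_le nrm_ge0 andbT; apply: le_eps => e e0; rewrite add0r.
have e2 : 0 < e / 2 by lra.
have [K hK] := h _ e2; have [K' hK'] := h' _ e2.
have h1 := hK _ (leq_maxl K K'); have h2 := hK' _ (leq_maxr K K').
set S := \sum_(n < _) _ in h1 h2.
have -> : s - s' = (S - s') - (S - s) by ring.
by apply: le_trans (nrmB _ _) _; lra.
Qed.

(** Takes the default value 0 on a divergent series. *)
Definition csum f : C := xget 0 [set s | hsum f s].

Lemma csumE f s : hsum f s -> csum f = s.
Proof. move=> h; apply: (@hsum_uniq f) => //.
exact: (@xgetPex _ 0 [set s | hsum f s] (ex_intro _ s h)). Qed.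

Definition asum f (M : R) := forall K, \sum_(n < K) nrm (f n) <= M.

Lemma real_cvg (u : nat -> R) (M : R) : (forall K, \sum_(n < K) `|u n| <= M) ->
  exists l, forall e : R, 0 < e -> exists K0, forall K, (K0 <= K)%N ->
  `|\sum_(n < K) u n - l| <= e.
Proof.
move=> h.
have c : cvgn (series u).
  suff : cvgn (series (fun n => `|u n|)) by apply: normed_cvg.
  apply: nondecreasing_is_cvgn.
    by apply: nondecreasing_series => n _ _; rewrite normr_ge0.
  by exists M; apply/ubP => _ [K _ <-]; rewrite seriesEord /=; apply: h.
exists (limn (series u)) => e e0.
have /cvgrPdist_le/(_ _ e0)[K0 _ hK] := c.
exists K0 => K leK; have := hK K leK.
by rewrite /series /= big_mkord distrC.
Qed.

Lemma asum_hsum f M : asum f M -> hsum f (csum f).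
Proof.
move=> h.
have [l hl] : exists l, forall e : R, 0 < e -> exists K0, forall K, (K0 <= K)%N ->
   `|\sum_(n < K) complex.Re (f n) - l| <= e.
  apply: (@real_cvg (fun n => complex.Re (f n)) M) => K; apply: le_trans (h K).
  by apply: ler_sum => n _; apply: Re_le_nrm.
have [l' hl'] : exists l, forall e : R, 0 < e -> exists K0, forall K, (K0 <= K)%N ->
   `|\sum_(n < K) complex.Im (f n) - l| <= e.
  apply: (@real_cvg (fun n => complex.Im (f n)) M) => K; apply: le_trans (h K).
  by apply: ler_sum => n _; apply: Im_le_nrm.
have hs : hsum f (l +i* l').
  move=> e e0; have e2 : 0 < e / 2 by lra.
  have [K hK] := hl _ e2; have [K' hK'] := hl' _ e2.
  exists (maxn K K') => N; rewrite geq_max => /andP[/hK h1 /hK' h2].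
  apply: le_trans (nrm_le_ReIm _) _.
  have -> : \sum_(n < N) f n = (\sum_(n < N) complex.Re (f n)) +i* (\sum_(n < N) complex.Im (f n)).
    elim: (N) => [|k IHk]; first by rewrite !big_ord0.
    by rewrite !big_ord_recr /= IHk; case: (f k).
  by move: h1 h2; rewrite /=; lra.
by rewrite (csumE hs).
Qed.

Lemma hsumD f g s t : hsum f s -> hsum g t -> hsum (fun n => f n + g n) (s + t).
Proof.
move=> hf hg e e0; have e2 : 0 < e / 2 by lra.
have [K hK] := hf _ e2; have [K' hK'] := hg _ e2.
exists (maxn K K') => N; rewrite geq_max => /andP[/hK h1 /hK' h2].
rewrite big_split /= (_ : _ - _ = (\sum_(n < N) f n - s) + (\sum_(n < N) g n - t)); last by ring.
by apply: le_trans (nrmD _ _) _; lra.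
Qed.

Lemma hsumZ f s c : hsum f s -> hsum (fun n => c * f n) (c * s).
Proof.
move=> hf e e0; have c0 : 0 < nrm c + 1 by have := nrm_ge0 c; lra.
have [K hK] := hf (e / (nrm c + 1)) (divr_gt0 e0 c0).
exists K => N /hK h; rewrite -mulr_sumr -mulrBr nrmM.
apply: (@le_trans _ _ ((nrm c + 1) * (e / (nrm c + 1)))); last first.
  by rewrite mulrC divfK // gt_eqF.
by apply: ler_pM => //; rewrite ?nrm_ge0 // lerDl.
Qed.

Lemma hsum_fin f K : (forall n, (K <= n)%N -> f n = 0) -> hsum f (\sum_(n < K) f n).
Proof.
move=> h e e0; exists K => N leN.
have -> : \sum_(n < N) f n = \sum_(n < K) f n.
  rewrite -!(big_mkord predT f) (@big_cat_nat _ _ _ K 0 N) //= [X in _ + X]big_nat_cond [X in _ + X]big1 ?addr0 //.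
  by move=> n /andP[/andP[/h]].
by rewrite subrr nrm0 ltW.
Qed.

Lemma hsum_sub f s (u : nat -> nat) : (forall k, (k <= u k)%N) -> hsum f s ->
  forall e : R, 0 < e -> exists K0, forall K, (K0 <= K)%N -> nrm (\sum_(n < u K) f n - s) <= e.
Proof.
move=> hu hf e /hf[K0 hK]; exists K0 => K le; apply: hK; exact: leq_trans (hu K).
Qed.

Lemma hsum_le f s M : asum f M -> hsum f s -> nrm s <= M.
Proof.
move=> h hs; apply: le_eps => e /hs[K /(_ _ (leqnn K)) hK].
have -> : s = \sum_(n < K) f n - (\sum_(n < K) f n - s) by ring.
apply: le_trans (nrmB _ _) _; apply: lerD => //.
by apply: le_trans (nrm_sum _ _ _) (h K).
Qed.

(** A bound for the weighted l^1 norm, the sum of |a_n| rho^n. This norm is submultiplicative, so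
    evaluation at |z| <= rho is a ring morphism on series of finite norm. *)
Definition nle (rho : R) a (M : R) := forall K, \sum_(n < K) nrm (a n) * rho ^+ n <= M.

Section Fixed.
Variable rho : R.
Hypothesis rho0 : 0 <= rho.

Lemma nle_ge0 a M : nle rho a M -> 0 <= M.
Proof. by move=> h; have := h 0%N; rewrite big_ord0. Qed.

Lemma nle_le a M M' : M <= M' -> nle rho a M -> nle rho a M'.
Proof. by move=> le h K; apply: le_trans (h K) le. Qed.

Lemma nleD a b M M' : nle rho a M -> nle rho b M' -> nle rho (a + b) (M + M').
Proof.
move=> ha hb K; apply: le_trans (lerD (ha K) (hb K)); rewrite -big_split.
apply: ler_sum => n _ /=; rewrite -mulrDl; apply: ler_wpM2r; first exact: exprn_ge0.
exact: nrmD.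
Qed.

Lemma nleN a M : nle rho a M -> nle rho (- a) M.
Proof. by move=> h K; apply: le_trans (h K); apply: ler_sum => n _; rewrite fpsN nrmN. Qed.

(** The truncated series of moduli are polynomials; at 1 their product takes a value bounded by the
    product of the norms, and its coefficients dominate those of a b. *)
Lemma nleM a b M M' : nle rho a M -> nle rho b M' -> nle rho (a * b) (M * M').
Proof.
move=> ha hb K; have M0 := nle_ge0 ha; have M0' := nle_ge0 hb.
pose A n := nrm (a n) * rho ^+ n; pose B n := nrm (b n) * rho ^+ n.
have A0 n : 0 <= A n by rewrite mulr_ge0 ?nrm_ge0 ?exprn_ge0.
have B0 n : 0 <= B n by rewrite mulr_ge0 ?nrm_ge0 ?exprn_ge0.
pose p := \poly_(i < K) A i; pose q := \poly_(i < K) B i.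
have pE : p.[1] = \sum_(n < K) A n.
  by rewrite horner_poly; apply: eq_bigr => i _; rewrite expr1n mulr1.
have qE : q.[1] = \sum_(n < K) B n.
  by rewrite horner_poly; apply: eq_bigr => i _; rewrite expr1n mulr1.
have pq0 n : 0 <= (p * q)`_n.
  rewrite coefM; apply: sumr_ge0 => i _; rewrite !coef_poly.
  by rewrite mulr_ge0 //; case: ifP.
have sz : (size (p * q)%R <= K + K)%N.
  apply: leq_trans (size_polyMleq _ _) _; rewrite -subn1 leq_subLR addnC.
  by apply: leqW; apply: leq_add; apply: size_poly.
apply: (@le_trans _ _ ((p * q).[1])); last first.
  rewrite hornerM pE qE; apply: ler_pM => //; try exact: ha; try exact: hb.
    by apply: sumr_ge0.
  by apply: sumr_ge0.
rewrite (horner_coef_wide _ sz) big_split_ord -[X in X <= _]addr0; apply: lerD; last first.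
  by apply: sumr_ge0 => n _; rewrite expr1n mulr1.
apply: ler_sum => n _; rewrite expr1n mulr1 coefM fpsM.
rewrite (_ : val (lshift K n) = n) //.
apply: le_trans (ler_wpM2r _ (nrm_sum _ _ _)) _; first exact: exprn_ge0.
rewrite mulr_suml; apply: ler_sum => i _; rewrite !coef_poly.
have lin : (i <= n)%N by rewrite -ltnS.
rewrite (leq_ltn_trans lin) // (leq_ltn_trans (leq_subr _ _)) //.
by rewrite /A /B nrmM mulrACA -exprD subnKC.
Qed.

Lemma nle_fC c : nle rho (fC c) (nrm c).
Proof.
move=> [|K]; first by rewrite big_ord0 nrm_ge0.
by rewrite big_ord_recl /= mulr1 big1 ?addr0 // => i _; rewrite nrm0 mul0r.
Qed.

Lemma nle1 : nle rho 1 1.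
Proof.
have -> : 1 = fC 1 :> fps C by apply: fpsP => -[].
by rewrite -[X in nle _ _ X]nrm1; apply: nle_fC.
Qed.

Lemma nleX a M k : nle rho a M -> nle rho (a ^+ k) (M ^+ k).
Proof.
by move=> h; elim: k => [|k IHk]; [apply: nle1 | rewrite !exprS; apply: nleM].
Qed.

Lemma nle_fX m : nle rho (fX C m) (rho ^+ m).
Proof.
move=> K; have [lt|le] := ltnP m K; last first.
  rewrite big1 ?exprn_ge0 // => i _ /=; rewrite (_ : (_ == _) = false) ?nrm0 ?mul0r //.
  by case: i => /= i; lia.
rewrite (bigD1 (Ordinal lt)) //= eqxx nrm1 mul1r big1 ?addr0 // => i ni.
rewrite (_ : (_ == _) = false) ?nrm0 ?mul0r //.
by apply/eqP => e; case/eqP: ni; apply: val_inj.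
Qed.

Definition ftr K a : fps C := Fps (fun n => if (n < K)%N then a n else 0).

Lemma nle_ftr K a M : nle rho a M -> nle rho (ftr K a) M.
Proof.
move=> h N; apply: le_trans (h N); apply: ler_sum => n _ /=; case: ifP => // _.
by rewrite nrm0 mul0r mulr_ge0 ?nrm_ge0 ?exprn_ge0.
Qed.

Lemma ftrE K a : ftr K a = \sum_(n < K) fC (a n) * fX C n.
Proof.
apply: fpsP => m; rewrite fps_sum.
rewrite (eq_bigr (fun n : 'I_K => a n * (m == n)%:R)); last by move=> n _; rewrite fCM.
rewrite [LHS]/=.
case: ltnP => h.
  rewrite (bigD1 (Ordinal h)) //= eqxx mulr1 big1 ?addr0 // => i ni.
  rewrite (_ : (_ == _) = false) ?mulr0 //.
  by apply/eqP => e; case/eqP: ni; apply: val_inj.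
rewrite big1 // => i _; rewrite (_ : (_ == _) = false) ?mulr0 //.
by case: i => /= i; lia.
Qed.

Lemma nle_tail a M : nle rho a M -> forall e : R, 0 < e ->
  exists K0, forall K, (K0 <= K)%N -> nle rho (a - ftr K a) e.
Proof.
move=> h e e0.
have [l hl] : exists l, forall e : R, 0 < e -> exists K0, forall K, (K0 <= K)%N ->
   `|\sum_(n < K) (nrm (a n) * rho ^+ n) - l| <= e.
  apply: (@real_cvg (fun n => nrm (a n) * rho ^+ n) M) => K.
  apply: le_trans (h K); apply: ler_sum => n _.
  by rewrite ger0_norm // mulr_ge0 ?nrm_ge0 ?exprn_ge0.
have e2 : 0 < e / 2 by lra.
have [K0 hK] := hl _ e2; exists K0 => K le N.
have t0 n : 0 <= nrm (a n) * rho ^+ n by rewrite mulr_ge0 ?nrm_ge0 ?exprn_ge0.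
apply: (@le_trans _ _ (\sum_(n < maxn K N) (nrm (a n) * rho ^+ n) - \sum_(n < K) (nrm (a n) * rho ^+ n))).
  have -> : \sum_(n < maxn K N) nrm (a n) * rho ^+ n - \sum_(n < K) nrm (a n) * rho ^+ n =
    \sum_(n < maxn K N) nrm ((a - ftr K a) n) * rho ^+ n.
    rewrite (@big_ord_widen _ _ _ K (maxn K N) (fun n => nrm (a n) * rho ^+ n)) ?leq_maxl //.
    rewrite [X in _ - X]big_mkcond -sumrB; apply: eq_bigr => n _ /=.
    by case: ifP => _; rewrite ?subrr ?subr0 ?nrm0 ?mul0r.
  rewrite (@big_ord_widen _ _ _ N (maxn K N) (fun n => nrm ((a - ftr K a) n) * rho ^+ n)) ?leq_maxr //.
  rewrite big_mkcond; apply: ler_sum => n _; case: ifP => // _.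
  by rewrite mulr_ge0 ?nrm_ge0 ?exprn_ge0.
have h1 := hK K le; have h2 := hK (maxn K N) (leq_trans le (leq_maxl _ _)).
by move: h1 h2; rewrite !ler_norml => /andP[? ?] /andP[? ?]; lra.
Qed.

Definition ev a z := csum (fun n => a n * z ^+ n).

Lemma ev_asum a z M : nrm z <= rho -> nle rho a M -> asum (fun n => a n * z ^+ n) M.
Proof.
move=> zr h K; apply: le_trans (h K); apply: ler_sum => n _; rewrite nrmM nrmX.
by rewrite ler_wpM2l ?nrm_ge0 // lerXn2r ?nnegrE ?nrm_ge0.
Qed.

Lemma ev_hsum a z M : nrm z <= rho -> nle rho a M -> hsum (fun n => a n * z ^+ n) (ev a z).
Proof. by move=> zr h; apply: asum_hsum (ev_asum zr h). Qed.

Lemma ev_le a z M : nrm z <= rho -> nle rho a M -> nrm (ev a z) <= M.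
Proof. by move=> zr h; apply: hsum_le (ev_asum zr h) (ev_hsum zr h). Qed.

Lemma evD a b z M M' : nrm z <= rho -> nle rho a M -> nle rho b M' ->
  ev (a + b) z = ev a z + ev b z.
Proof.
move=> zr ha hb; apply: csumE; have := hsumD (ev_hsum zr ha) (ev_hsum zr hb).
by rewrite (_ : (fun n => a n * _ + _) = (fun n => (a + b) n * z ^+ n)) //; apply/funext => n; rewrite fpsD mulrDl.
Qed.

Lemma evZ c a z M : nrm z <= rho -> nle rho a M -> ev (fC c * a) z = c * ev a z.
Proof.
move=> zr ha; apply: csumE; have := hsumZ c (ev_hsum zr ha).
by rewrite (_ : (fun n => c * _) = (fun n => (fC c * a) n * z ^+ n)) //; apply/funext => n; rewrite fCM mulrA.
Qed.

Lemma evN a z M : nrm z <= rho -> nle rho a M -> ev (- a) z = - ev a z.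
Proof.
move=> zr ha; rewrite (_ : - a = fC (-1) * a); first by rewrite (evZ _ zr ha) mulN1r.
by apply: fpsP => n; rewrite fCM mulN1r.
Qed.

Lemma evB a b z M M' : nrm z <= rho -> nle rho a M -> nle rho b M' ->
  ev (a - b) z = ev a z - ev b z.
Proof. by move=> zr ha hb; rewrite (evD zr ha (nleN hb)) (evN zr hb). Qed.

Lemma ev_fX m z : ev (fX C m) z = z ^+ m.
Proof.
apply: csumE; rewrite [X in hsum _ X](_ : _ = \sum_(n < m.+1) fX C m n * z ^+ n).
  apply: hsum_fin => n lt; rewrite /= (_ : (_ == _) = false) ?mul0r //; lia.
rewrite big_ord_recr /= eqxx mul1r big1 ?add0r // => i _.
by rewrite (_ : (_ == _) = false) ?mul0r //; case: i => /= i; lia.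
Qed.

Lemma ev_fXM m a z M : nrm z <= rho -> nle rho a M -> ev (fX C m * a) z = z ^+ m * ev a z.
Proof.
move=> zr ha; apply: csumE => e e0.
have [K0 hK] := hsumZ (z ^+ m) (ev_hsum zr ha) e0.
exists (K0 + m)%N => K le; have := hK (K - m)%N; rewrite leq_subRL; last by lia.
rewrite addnC le => /(_ isT); congr (nrm (_ - _) <= _).
have lemK : (m <= K)%N by lia.
rewrite -[in RHS](subnKC lemK) big_split_ord [X in _ = X + _]big1 ?add0r.
  by apply: eq_bigr => i _; rewrite fXM leq_addr addKn exprD mulrCA.
by move=> i _; rewrite fXM ifF ?mul0r //=; case: i => /= i; lia.
Qed.

Lemma ev0 z : ev 0 z = 0.
Proof.
apply: csumE; have := @hsum_fin (fun n => (0 : fps C) n * z ^+ n) 0.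
by rewrite big_ord0; apply=> n _; rewrite mul0r.
Qed.

Lemma ev1 z : ev 1 z = 1.
Proof. by rewrite -fX0 ev_fX. Qed.

Lemma ev_fC c z : nrm z <= rho -> ev (fC c) z = c.
Proof. by move=> zr; rewrite -[fC c]mulr1 (evZ c zr nle1) ev1 mulr1. Qed.

Lemma nle_sum I (r : seq I) (F : I -> fps C) (M : I -> R) :
  (forall i, nle rho (F i) (M i)) -> nle rho (\sum_(i <- r) F i) (\sum_(i <- r) M i).
Proof.
move=> h; elim: r => [|i r IHr]; last by rewrite !big_cons; apply: nleD.
by rewrite !big_nil => K; rewrite big1 // => n _; rewrite nrm0 mul0r.
Qed.

Lemma ev_sum I (r : seq I) (F : I -> fps C) (M : I -> R) z : nrm z <= rho ->
  (forall i, nle rho (F i) (M i)) -> ev (\sum_(i <- r) F i) z = \sum_(i <- r) ev (F i) z.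
Proof.
move=> zr h; elim: r => [|i r IHr]; first by rewrite !big_nil ev0.
by rewrite !big_cons (evD zr (h i) (nle_sum r h)) IHr.
Qed.

(** Linearity settles the case where the second factor is a truncation of b; the remaining tail has
    arbitrarily small norm and so has its product with a. *)
Lemma evM a b z M M' : nrm z <= rho -> nle rho a M -> nle rho b M' ->
  ev (a * b) z = ev a z * ev b z.
Proof.
move=> zr ha hb.
have evtr K : ev (a * ftr K b) z = ev a z * ev (ftr K b) z.
  rewrite ftrE mulr_sumr.
  have hm (n : 'I_K) : nle rho (fC (b n) * fX C n) (nrm (b n) * rho ^+ n).
    by apply: nleM; [apply: nle_fC | apply: nle_fX].
  rewrite (ev_sum _ zr (fun n => nleM ha (hm n))) (ev_sum _ zr hm) mulr_sumr.
  apply: eq_bigr => n _.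
  rewrite (evZ _ zr (@nle_fX n)) ev_fX mulrCA.
  by rewrite (evZ _ zr (nleM ha (@nle_fX n))) mulrC (mulrC a) (ev_fXM _ zr ha); ring.
have M0 := nle_ge0 ha.
apply/eqP; rewrite -subr_eq0; apply/eqP; apply: nrm_eq0.
apply/eqP; rewrite eq_le nrm_ge0 andbT; apply: le_eps => e e0; rewrite add0r.
have d0 : 0 < e / (2 * (M + 1)) by rewrite divr_gt0 // mulr_gt0 //; lra.
have [K /(_ K (leqnn K)) hK] := nle_tail hb d0; set d := e / _ in d0 hK.
have hbK := nle_ftr K hb.
have e1 : ev (a * b) z = ev (a * ftr K b) z + ev (a * (b - ftr K b)) z.
  by rewrite -(evD zr (nleM ha hbK) (nleM ha hK)) -mulrDr addrC subrK.
have e2 : ev b z = ev (ftr K b) z + ev (b - ftr K b) z.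
  by rewrite -(evD zr hbK hK) addrC subrK.
rewrite e1 e2 evtr (_ : _ - _ = ev (a * (b - ftr K b)) z - ev a z * ev (b - ftr K b) z); last by ring.
apply: le_trans (nrmB _ _) _; rewrite nrmM.
have h1 := ev_le zr (nleM ha hK).
have h2 : nrm (ev a z) * nrm (ev (b - ftr K b) z) <= M * d.
  by apply: ler_pM; rewrite ?nrm_ge0 // (ev_le zr).
have : d * (2 * (M + 1)) = e by rewrite /d divfK // gt_eqF // mulr_gt0 //; lra.
by nra.
Qed.

Lemma evX a z M k : nrm z <= rho -> nle rho a M -> ev (a ^+ k) z = ev a z ^+ k.
Proof.
move=> zr ha; elim: k => [|k IHk]; first by rewrite !expr0 ev1.
by rewrite !exprS (evM zr ha (nleX k ha)) IHk.
Qed.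

End Fixed.

(** The substitution of u q for q. For u a root of unity this is a real translation in the upper
    half plane. *)
Definition tw (u : C) a : fps C := Fps (fun n => u ^+ n * a n).

Lemma twM u a b : tw u (a * b) = tw u a * tw u b.
Proof.
apply: fpsP => n; rewrite fpsM /= mulr_sumr; apply: eq_bigr => i _.
have {1}-> : n = (i + (n - i))%N by case: i => /= i; lia.
by rewrite exprD; ring.
Qed.
Lemma tw1 u : tw u 1 = 1.
Proof. by apply: fpsP => -[|n] /=; rewrite ?mulr0 ?mul1r. Qed.
Lemma twX u a k : tw u (a ^+ k) = tw u a ^+ k.
Proof. by elim: k => [|k IHk]; rewrite ?tw1 // !exprS twM IHk. Qed.
Lemma twZ u c a : tw u (fC c * a) = fC c * tw u a.
Proof. by apply: fpsP => n; rewrite fCM [LHS](_ : _ = u ^+ n * (fC c * a) n) // fCM /=; ring. Qed.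

Lemma ev_tw u a z : ev (tw u a) z = ev a (u * z).
Proof. by rewrite /ev (_ : (fun _ => _) = (fun n => a n * (u * z) ^+ n)) //; apply/funext => n /=; rewrite exprMn; ring. Qed.

Lemma nle_tw rho u a M : nrm u = 1 -> nle rho a M -> nle rho (tw u a) M.
Proof.
move=> u1 h K; apply: le_trans (h K); apply: ler_sum => n _ /=.
by rewrite nrmM nrmX u1 expr1n mul1r.
Qed.

End ComplexSums.

(** * Poisson summation for theta series *)

Section Trig.
Variable R : realType.
Local Notation C := R[i].
Local Open Scope complex_scope.
Implicit Types x y : R.

Lemma derive_nneg_le (f df : R -> R) b : 0 <= b -> (forall x, is_derive x 1 f (df x)) ->
  (forall x, 0 <= x <= b -> 0 <= df x) -> f 0 <= f b.
Proof.
move=> b0 d h; have [|c] := @MVT_segment R f df 0 b b0.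
  apply: continuous_subspaceT => x; apply: differentiable_continuous.
  by apply/derivable1_diffP; case: (d x).
rewrite in_itv /= => /h; rewrite subr0 => dc e; rewrite -subr_ge0 e.
by rewrite mulr_ge0.
Qed.

Lemma sin_le x : 0 <= x -> sin x <= x.
Proof.
move=> x0; have := @derive_nneg_le (fun x => x - sin x) (fun x => 1 - cos x) x x0.
rewrite sin0 subr0 subr_ge0; apply=> t _; by rewrite subr_ge0 cos_le1.
Qed.

(** The product of exp(x^2/2) and cos x decreases, since x cos x <= sin x on the interval. *)
Lemma cos_le_expR x : 0 <= x <= pi / 2 -> cos x <= expR (- (x ^+ 2 / 2)).
Proof.
move=> /andP[x0 xp].
have h1 (t : R) : 0 <= t <= pi / 2 -> t * cos t <= sin t.
  move=> /andP[t0 tp].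
  have := @derive_nneg_le (fun x => sin x - x * cos x) (fun x => x * sin x) t t0.
  rewrite sin0 mul0r subr0 subr_ge0; apply=> [u|u /andP[u0 ut]].
    by apply: is_derive_eq; rewrite /GRing.scale /=; ring.
  rewrite mulr_ge0 // sin_ge0_pi // u0; have := pi_ge0 R; lra.
have := @derive_nneg_le (fun x => - (expR (x ^+ 2 / 2) * cos x))
  (fun x => expR (x ^+ 2 / 2) * (sin x - x * cos x)) x x0.
rewrite expr0n mul0r expR0 cos0 mulr1 lerN2 expRN => h.
rewrite -[X in _ <= X]mul1r ler_pdivlMr ?expR_gt0 // mulrC; apply: h => [u|u /andP[u0 ux]].
  by apply: is_derive_eq; rewrite /GRing.scale /=; field.
by rewrite mulr_ge0 ?expR_ge0 // subr_ge0 h1 // u0; apply: le_trans xp.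
Qed.

Lemma cos_ge_quad x : 0 <= x <= pi -> 1 - x ^+ 2 / 2 <= cos x.
Proof.
move=> /andP[x0 xp].
have -> : cos x = 1 - sin (x / 2) ^+ 2 *+ 2.
  rewrite [X in cos X](_ : x = (x / 2) *+ 2); last by rewrite mulr2n; field.
  by rewrite cos_mulr2n sin2cos2; ring.
have s0 : 0 <= sin (x / 2) by apply: sin_ge0_pi; lra.
have s1 : sin (x / 2) <= x / 2 by apply: sin_le; lra.
by nra.
Qed.

Definition cis x : C := (cos x) +i* (sin x).

Lemma cisD x y : cis (x + y) = cis x * cis y.
Proof. by rewrite /cis cosD sinD; apply/eqP; rewrite eq_complex /= !eqxx /= addrC eqxx. Qed.
Lemma cis0 : cis 0 = 1.
Proof. by rewrite /cis cos0 sin0. Qed.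
Lemma nrm_cis x : nrm (cis x) = 1.
Proof. by rewrite nrm_def /= cos2Dsin2 sqrtr1. Qed.
Lemma cisX x n : cis x ^+ n = cis (n%:R * x).
Proof.
by elim: n => [|n IHn]; rewrite ?mul0r ?cis0 // exprS IHn -cisD -[in RHS]addn1 natrD; congr cis; ring.
Qed.
Lemma cis2pi : cis (pi *+ 2) = 1.
Proof. by rewrite /cis cos2pi sin2pi. Qed.
Lemma cis_cos x : cis x + cis (- x) = (cos x *+ 2)%:C.
Proof. by rewrite /cis cosN sinN; apply/eqP; rewrite eq_complex /= mulr2n subrr !eqxx. Qed.
Lemma cis_neq1 x : 0 < x < pi *+ 2 -> cis x != 1.
Proof.
move=> /andP[x0 xp]; apply/eqP => /eqP; rewrite eq_complex /= => /andP[/eqP c1 /eqP s0].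
have [lt|gt|e] := ltgtP x pi.
- by have := @sin_gt0_pi R x; rewrite x0 lt s0 ltxx => /(_ isT).
- have := @sin_gt0_pi R (x - pi); rewrite subr_gt0 gt ltrBlDr -mulr2n xp => /(_ isT).
  by rewrite -sinN opprB sinB sinpi s0 mul0r cospi mulr0 subrr ltxx || rewrite sinB cospi sinpi s0; nra.
- by move: c1; rewrite e cospi; lra.
Qed.

(** Weight that folds the sum of an even function over all integers onto n >= 0. *)
Definition wt n : R := if n is 0 then 1 else 2.

(* e(k/l) in the usual notation *)
Definition ez (l k : nat) : C := cis (pi *+ 2 * k%:R / l%:R).

Lemma ezD l j k : ez l (j + k) = ez l j * ez l k.
Proof. by rewrite /ez -cisD natrD; congr cis; rewrite mulrDr mulrDl. Qed.
Lemma ez0 l : ez l 0 = 1.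
Proof. by rewrite /ez mulr0 mul0r cis0. Qed.
Lemma ezM l j k : ez l (j * k) = ez l j ^+ k.
Proof. by rewrite /ez cisX natrM; congr cis; rewrite mulrA; ring. Qed.
Lemma nrm_ez l k : nrm (ez l k) = 1. Proof. exact: nrm_cis. Qed.
Lemma ez_l l k : (0 < l)%N -> ez l (l * k) = 1.
Proof.
move=> l0; rewrite ezM /ez mulfK ?pnatr_eq0 -?lt0n // cis2pi expr1n //.
Qed.
Lemma ez_mod l k : (0 < l)%N -> ez l (k %% l) = ez l k.
Proof. by move=> l0; rewrite {2}(divn_eq k l) ezD mulnC ez_l // mul1r. Qed.
Lemma ez_eqm l j k : (0 < l)%N -> (j = k %[mod l])%N -> ez l j = ez l k.
Proof. by move=> l0 e; rewrite -ez_mod // e ez_mod. Qed.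
Lemma ez_neq1 l k : (0 < l)%N -> ~~ (l %| k)%N -> ez l k != 1.
Proof.
move=> l0 nd; rewrite -ez_mod //; have k0 : (0 < k %% l)%N by rewrite lt0n.
have lr : 0 < l%:R :> R by rewrite ltr0n.
have p0 := pi_gt0 R; apply: cis_neq1; apply/andP; split.
  by rewrite divr_gt0 // mulr_gt0 ?ltr0n // mulr2n addr_gt0.
rewrite ltr_pdivrMr // ltr_pM2l ?ltr_nat ?ltn_pmod // mulr2n addr_gt0 //.
Qed.
Lemma ez_sum l k : (0 < l)%N -> \sum_(i < l) ez l (k * i) = (if (l %| k)%N then l%:R else 0).
Proof.
move=> l0; case: ifP => [/dvdnP[c ->]|/negbT nd].
  rewrite (eq_bigr (fun=> 1)) ?sumr_const ?card_ord // => i _.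
  by rewrite -mulnA mulnCA ez_l.
have e : \sum_(i < l) ez l (k * i) = \sum_(i < l) ez l k ^+ i.
  by apply: eq_bigr => i _; rewrite ezM.
apply/eqP; rewrite e; have := subrX1 (ez l k) l.
rewrite -ezM mulnC ez_l // subrr => /esym/eqP; rewrite mulf_eq0 subr_eq0.
by rewrite (negPf (ez_neq1 l0 nd)).
Qed.

Lemma Re_sum I (r : seq I) (P : pred I) (F : I -> C) :
  complex.Re (\sum_(i <- r | P i) F i) = \sum_(i <- r | P i) complex.Re (F i).
Proof. exact: raddf_sum. Qed.

Lemma fold_sum (V : nmodType) (F : nat -> V) m :
  \sum_(i < (2 * m).+1) F i = F m + \sum_(k < m) (F (m - k.+1)%N + F (m + k.+1)%N).
Proof.
rewrite (_ : (2 * m).+1 = (m + m.+1)%N); last by lia.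
rewrite -(big_mkord predT F) (@big_cat_nat _ _ _ m) /=; [|lia|lia].
have -> : \sum_(m <= i < m + m.+1) F i = \sum_(0 <= i < m.+1) F (i + m)%N.
  by rewrite -{1}[m]add0n big_addn addKn.
rewrite big_nat_recl // add0n addrCA; congr (_ + _).
rewrite big_split big_nat_rev big_mkord; congr (_ + _).
rewrite big_mkord; apply: eq_bigr => i _; congr F; lia.
Qed.

(** Binomial expansion of (e^(ix) + e^(-ix))^(2m) with opposite frequencies folded together. Any
    cutoff K > m is admissible since the extra binomials vanish. *)
Lemma cos_pow x m K : (m < K)%N ->
  cos x ^+ (2 * m) * 4 ^+ m = \sum_(k < K) wt k * 'C(2 * m, m + k)%:R * cos (2 * k%:R * x).
Proof.
move=> mK.
have -> : \sum_(k < K) wt k * 'C(2 * m, m + k)%:R * cos (2 * k%:R * x) =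
  \sum_(k < m.+1) wt k * 'C(2 * m, m + k)%:R * cos (2 * k%:R * x).
  rewrite [RHS](@big_ord_widen _ _ _ m.+1 K (fun k => wt k * 'C(2 * m, m + k)%:R * cos (2 * k%:R * x))) //.
  rewrite [RHS]big_mkcond; apply: eq_bigr => k _; case: ifP => // lt.
  by rewrite bin_small ?mulr0 ?mul0r //; lia.
have h : (cis x + cis (- x)) ^+ (2 * m) =
   \sum_(i < (2 * m).+1) cis (((2 * m - i)%N%:R - i%:R) * x) *+ 'C(2 * m, i).
  rewrite exprDn; apply: eq_bigr => i _; congr (_ *+ _).
  by rewrite !cisX -cisD; congr cis; ring.
have := congr1 (@complex.Re R) h; rewrite cis_cos -rmorphXn /= Re_sum.
rewrite (eq_bigr (fun i : 'I_(2 * m).+1 => cos (((2 * m - i)%N%:R - i%:R) * x) *+ 'C(2 * m, i))); last first.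
  by move=> i _; rewrite raddfMn.
rewrite (fold_sum (fun i => cos (((2 * m - i)%N%:R - i%:R) * x) *+ 'C(2 * m, i))) => e.
transitivity ((cos x *+ 2) ^+ (2 * m)).
  by rewrite -[cos x *+ 2]mulr_natr exprMn (exprM (2%:R : R) 2 m); congr (_ * _ ^+ m); ring.
rewrite e big_ord_recl addn0 mulr0 mul0r cos0 !mulr1 mul1r; congr (_ + _).
  by rewrite (_ : (2 * m - m = m)%N) ?subrr ?mul0r ?cos0 //; lia.
apply: eq_bigr => k _; have lk := ltn_ord k.
rewrite lift0 /wt.
have -> : 'C(2 * m, m - k.+1) = 'C(2 * m, m + k.+1).
  by rewrite -bin_sub; [congr 'C(_, _); lia | lia].
have -> : (2 * m - (m - k.+1) = m + k.+1)%N by lia.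
have -> : (2 * m - (m + k.+1) = m - k.+1)%N by lia.
have -> : ((m - k.+1)%N%:R - (m + k.+1)%N%:R) * x = - (2 * k.+1%:R * x).
  by rewrite natrB // natrD; ring.
have -> : ((m + k.+1)%N%:R - (m - k.+1)%N%:R) * x = 2 * k.+1%:R * x.
  by rewrite natrB // natrD; ring.
by rewrite cosN -mulr_natl; ring.
Qed.

Lemma sum_blocks (V : nmodType) (F : nat -> V) l L :
  \sum_(n < l * L) F n = \sum_(i < l) \sum_(j < L) F (i * L + j)%N.
Proof.
elim: l => [|l IHl]; first by rewrite !big_ord0.
rewrite big_ord_recr -IHl -!(big_mkord predT F) mulSn addnC.
rewrite (@big_cat_nat _ _ _ (l * L)) ?leq_addr //=; congr (_ + _).
rewrite -{1}[(l * L)%N]add0n big_addn addKn big_mkord.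
by apply: eq_bigr => i _; rewrite addnC.
Qed.

Lemma fold_even h (g : nat -> C) : (0 < h)%N -> g h = 0 -> (forall n, (n <= 2 * h)%N -> g (2 * h - n)%N = g n) ->
  \sum_(n < 2 * h) g n = \sum_(n < h) g n * (wt n)%:C.
Proof.
move=> h0 gh sym; apply: (addIr (g (2 * h)%N)).
rewrite -(big_ord_recr (2 * h) (fun i => g (nat_of_ord i)) : _ = _ + g (2 * h)%N) fold_sum gh add0r.
rewrite (_ : g (2 * h)%N = g 0%N); last by rewrite -[RHS]sym // subn0.
rewrite (eq_bigr (fun k : 'I_h => g (h - k.+1)%N *+ 2)); last first.
  move=> k _; have lk := ltn_ord k; rewrite mulr2n; congr (_ + _).
  by rewrite -sym; [congr g; lia | lia].
rewrite -(big_mkord predT (fun k => g (h - k.+1)%N *+ 2)) big_nat_rev /=.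
rewrite big_nat_cond (eq_bigr (fun i => g i *+ 2)) -?big_nat_cond; last first.
  by move=> i /andP[/andP[_ lt] _]; congr (g _ *+ _); lia.
rewrite big_mkord; case: h h0 {gh sym} => // h _; rewrite big_ord_recl [in RHS]big_ord_recl /= mulr1 [RHS]addrAC -mulr2n; congr (_ + _).
by apply: eq_bigr => i _ /=; rewrite (rmorph_nat (real_complex R) 2) mulr_natr.
Qed.

Lemma theta_param (p t l : R) : 0 < p -> 0 < t -> 0 < l ->
  [/\ l / (p * t) * (p / l) ^+ 2 = p / (l * t), (l / (p * t))^-1 = p * t / l &
      p^-1 / (l / (p * t)) = t / l].
Proof.
move=> /lt0r_neq0 p0 /lt0r_neq0 t0 /lt0r_neq0 l0.
by split; field; rewrite ?p0 ?t0 ?l0.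
Qed.

(** * Polya's finite form of Poisson summation *)

Section Periodic.
Variables (f : nat -> C) (L : nat).
Hypothesis L0 : (0 < L)%N.
Hypothesis per : forall n, f (n + L)%N = f n.

Lemma per_mul i n : f (i * L + n)%N = f n.
Proof. by elim: i => // i IHi; rewrite mulSn addnC addnA addnAC per addnC. Qed.

Hypothesis sym : forall n, (n <= L)%N -> f (L - n)%N = f n.

Lemma per_sym l n : (n <= l * L)%N -> f (l * L - n)%N = f n.
Proof using L0 per sym.
elim: l n => [|l IHl] n; first by rewrite mul0n leqn0 => /eqP ->.
rewrite mulSn => le; have [h|h] := leqP n (l * L)%N.
  by rewrite -addnBA // addnC per IHl.
rewrite (_ : (L + l * L - n = L - (n - l * L))%N); last by lia.
rewrite sym; last by lia.
by rewrite -(per_mul l) subnKC // ltnW.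
Qed.

(** Cosine transform over one period; for symmetric f it is the discrete Fourier transform, see
    [fhat_ez]. *)
Definition fhat k : C := \sum_(n < L) f n * (cos (pi *+ 2 * (k * n)%:R / L%:R))%:C.

Lemma fhat_blocks l k : (0 < l)%N ->
  \sum_(n < l * L) f n * (cos (pi *+ 2 * (k * n)%:R / (l * L)%:R))%:C =
  if (l %| k)%N then l%:R * fhat (k %/ l) else 0.
Proof.
move=> l0; have lr : l%:R != 0 :> R by rewrite pnatr_eq0 -lt0n.
have Lr : L%:R != 0 :> R by rewrite pnatr_eq0 -lt0n.
rewrite (sum_blocks (fun n => f n * (cos (pi *+ 2 * (k * n)%:R / (l * L)%:R))%:C)) exchange_big.
have h (j : 'I_L) : \sum_(i < l) f (i * L + j)%N * (cos (pi *+ 2 * (k * (i * L + j))%:R / (l * L)%:R))%:C =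
   f j * (complex.Re (cis (pi *+ 2 * (k * j)%:R / (l * L)%:R) * \sum_(i < l) ez l (k * i)))%:C.
  rewrite mulr_sumr Re_sum rmorph_sum mulr_sumr; apply: eq_bigr => i _.
  rewrite per_mul; congr (_ * _%:C); rewrite /ez -cisD /=; congr cos.
  by rewrite mulnDr natrD !natrM; field; rewrite lr Lr.
rewrite (eq_bigr _ (fun j _ => h j)) ez_sum //; case: ifP => [/dvdnP[c ->]|_].
  rewrite mulnK // /fhat mulr_sumr; apply: eq_bigr => j _.
  rewrite -(rmorph_nat (real_complex R)) mulrCA; congr (_ * _).
  rewrite -rmorphM; congr (_%:C); rewrite /= mulr0 subr0 mulrC; congr (_ * cos _).
  by rewrite !natrM; field; rewrite lr Lr.
by rewrite big1 // => j _; rewrite mulr0 /= mulr0.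
Qed.

(** Insert the binomial expansion of cos^(2m); summation over l periods of f retains only the
    frequencies divisible by l. With m proportional to l^2 and l tending to infinity, both the
    powers of the cosine and the normalised binomials become Gaussian. *)
Lemma polya l m : (0 < l)%N ->
  \sum_(n < l * L) f n * (cos (pi * n%:R / (l * L)%:R) ^+ (2 * m))%:C =
  \sum_(k < m.+1) fhat k * (l%:R * (4 ^+ m)^-1 * (wt k * 'C(2 * m, m + k * l)%:R))%:C.
Proof.
move=> l0; have q0 : 4 ^+ m != 0 :> R by rewrite expf_neq0 // pnatr_eq0.
pose K := (m * l).+1; have mK : (m < K)%N by rewrite ltnS leq_pmulr.
pose W k : R := wt k * 'C(2 * m, m + k)%:R.
transitivity (\sum_(k < K) ((4 ^+ m)^-1 * W k)%:C *
   \sum_(n < l * L) f n * (cos (pi *+ 2 * (k * n)%:R / (l * L)%:R))%:C).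
  under [RHS]eq_bigr do rewrite mulr_sumr.
  rewrite exchange_big /=; apply: eq_bigr => n _.
  rewrite (_ : cos _ ^+ _ = (4 ^+ m)^-1 * (cos (pi * n%:R / (l * L)%:R) ^+ (2 * m) * 4 ^+ m)); last first.
    by rewrite mulrCA mulVf ?mulr1.
  rewrite (@cos_pow _ _ K) // mulr_sumr rmorph_sum mulr_sumr; apply: eq_bigr => k _.
  rewrite (_ : (4 ^+ m)^-1 * _ = ((4 ^+ m)^-1 * W k) * cos (pi *+ 2 * (k * n)%:R / (l * L)%:R)).
    by rewrite rmorphM mulrCA.
  rewrite /W -[RHS]mulrA; congr (_ * (_ * cos _)).
  by rewrite natrM mulr2n; ring.
under eq_bigr do rewrite fhat_blocks //.
rewrite -(big_mkord predT (fun k => ((4 ^+ m)^-1 * W k)%:C * (if (l %| k)%N then l%:R * fhat (k %/ l) else 0))).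
rewrite (bigID (fun i => l %| i)%N) /= [X in _ + X]big1 ?addr0; last by move=> i /negPf ->; rewrite mulr0.
rewrite (sum_multiples (fun k => ((4 ^+ m)^-1 * W k)%:C * (if (l %| k)%N then l%:R * fhat (k %/ l) else 0))) //.
rewrite big_mkord; apply: eq_bigr => k _.
rewrite dvdn_mull // mulnK // -(rmorph_nat (real_complex R)) mulrA -rmorphM mulrC.
rewrite /W (_ : wt (k * l) = wt k); last by case: (val k) => // k'; case: (l) l0.
by rewrite /=; congr (_ * _%:C); ring.
Qed.

End Periodic.

(** * Passage to the limit in the finite identity *)

Definition ctends (u : nat -> C) (s : C) := forall e : R, 0 < e ->
  exists K0, forall K, (K0 <= K)%N -> nrm (u K - s) <= e.

Lemma ctends_uniq u s s' : ctends u s -> ctends u s' -> s = s'.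
Proof.
move=> h h'; apply/eqP; rewrite -subr_eq0; apply/eqP; apply: nrm_eq0.
apply/eqP; rewrite eq_le nrm_ge0 andbT; apply: le_eps => e e0; rewrite add0r.
have e2 : 0 < e / 2 by lra.
have [K hK] := h _ e2; have [K' hK'] := h' _ e2.
have h1 := hK _ (leq_maxl K K'); have h2 := hK' _ (leq_maxr K K').
set S := u _ in h1 h2.
have -> : s - s' = (S - s') - (S - s) by ring.
by apply: le_trans (nrmB _ _) _; lra.
Qed.

Lemma cvg_eps (u : nat -> R) s : (u @ \oo --> s)%classic -> forall e : R, 0 < e ->
  exists K0, forall K, (K0 <= K)%N -> `|u K - s| <= e.
Proof.
move=> /cvgrPdist_le h e /h[K0 _ hK]; exists K0 => K le; rewrite distrC; exact: hK.
Qed.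

Lemma ctendsZ (r : nat -> R) (a : R) u s : (r @ \oo --> a)%classic -> ctends u s ->
  ctends (fun l => (r l)%:C * u l) (a%:C * s).
Proof.
move=> hr hu e e0; pose B := nrm s + 1; pose A := `|a| + 1.
have B0 : 0 < B by rewrite ltr_wpDl ?nrm_ge0.
have A0 : 0 < A by rewrite ltr_wpDl ?normr_ge0.
have [K1 h1] := cvg_eps hr (divr_gt0 e0 (mulr_gt0 B0 (ltr0n R 2))).
have [K2 h2] := hu _ (divr_gt0 e0 (mulr_gt0 A0 (ltr0n R 2))).
have [K3 h3] := hu 1 ltr01.
exists (maxn K1 (maxn K2 K3)) => K; rewrite !geq_max => /and3P[/h1 {}h1 /h2 {}h2 /h3 {}h3].
have -> : (r K)%:C * u K - a%:C * s = (r K - a)%:C * u K + a%:C * (u K - s).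
  by rewrite rmorphB /=; ring.
apply: le_trans (nrmD _ _) _; rewrite !nrmM !nrm_real.
have uB : nrm (u K) <= B.
  by have := nrmD s (u K - s); rewrite subrKC /B; lra.
have t1 : `|r K - a| * nrm (u K) <= e / (B * 2) * B.
  by apply: ler_pM => //; rewrite ?nrm_ge0 ?normr_ge0.
have t2 : `|a| * nrm (u K - s) <= A * (e / (A * 2)).
  by apply: ler_pM => //; rewrite ?nrm_ge0 ?normr_ge0 // lerDl.
apply: le_trans (lerD t1 t2) _.
have -> : e / (B * 2) * B = e / 2 by field; rewrite gt_eqF.
have -> : A * (e / (A * 2)) = e / 2 by field; rewrite gt_eqF.
by rewrite -splitr.
Qed.

(** Dominated convergence for series: a head of fixed length converges termwise, and the tails on
    both sides are controlled by the summable majorant |f| d. *)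
Lemma tannery (u : nat -> nat -> R) (v d : nat -> R) (f : nat -> C) (N : nat -> nat) M :
  (forall l j, 0 <= u l j <= d j) -> (forall l j, (N l <= j)%N -> u l j = 0) ->
  (forall j, ((fun l => u l j) @ \oo --> v j)%classic) ->
  (forall K, \sum_(j < K) nrm (f j) * d j <= M) ->
  ctends (fun l => \sum_(j < N l) f j * (u l j)%:C) (csum (fun j => f j * (v j)%:C)).
Proof.
move=> ud uN uv fM.
have vd j : 0 <= v j <= d j.
  apply/andP; split; apply: le_eps => e e0; have [K /(_ _ (leqnn K))] := cvg_eps (uv j) e0;
  by rewrite ler_norml => /andP[? ?]; have /andP[? ?] := ud K j; lra.
have d0 j : 0 <= d j by have /andP[a b] := ud 0%N j; apply: le_trans b.
have hs : hsum (fun j => f j * (v j)%:C) (csum (fun j => f j * (v j)%:C)).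
  apply: (@asum_hsum _ _ M) => K; apply: le_trans (fM K); apply: ler_sum => j _.
  by rewrite nrmM nrm_real ler_wpM2l ?nrm_ge0 //; have /andP[? ?] := vd j; rewrite ger0_norm.
have fin J e : 0 < e -> exists L0, forall l, (L0 <= l)%N ->
   \sum_(j < J) nrm (f j) * `|u l j - v j| <= e.
  elim: J e => [|J IHJ] e e0; first by exists 0%N => l _; rewrite big_ord0 ltW.
  have e2 : 0 < e / 2 by lra.
  have [L1 h1] := IHJ _ e2.
  have n0 : 0 < nrm (f J) + 1 by rewrite ltr_wpDl ?nrm_ge0.
  have [L2 h2] := cvg_eps (uv J) (divr_gt0 e2 n0).
  exists (maxn L1 L2) => l; rewrite geq_max => /andP[/h1 {}h1 /h2 {}h2].
  rewrite big_ord_recr /= (splitr e); apply: lerD => //.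
  apply: (@le_trans _ _ ((nrm (f J) + 1) * (e / 2 / (nrm (f J) + 1)))).
    by apply: ler_pM => //; rewrite ?nrm_ge0 ?normr_ge0 // lerDl.
  by rewrite mulrC divfK // gt_eqF.
move=> e e0; have e4 : 0 < e / 4 by lra.
have e8 : 0 < e / 8 by lra.
have [s hK] : exists l, forall e : R, 0 < e -> exists K0, forall K, (K0 <= K)%N ->
   `|\sum_(n < K) (nrm (f n) * d n) - l| <= e.
  apply: (@real_cvg _ (fun n => nrm (f n) * d n) M) => K; apply: le_trans (fM K).
  by apply: ler_sum => j _; rewrite ger0_norm // mulr_ge0 ?nrm_ge0.
have [K1 h1] := hK _ e8; have [K2 h2] := hs _ e4; pose J := maxn K1 K2.
have [L0 hL] := fin J _ e4; exists L0 => l /hL {}hL.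
pose n := maxn (N l) J; pose S := csum (fun j => f j * (v j)%:C).
have e1 : \sum_(j < N l) f j * (u l j)%:C = \sum_(j < J) f j * (u l j)%:C +
    \sum_(J <= j < n) f j * (u l j)%:C.
  rewrite -!(big_mkord predT (fun j => f j * (u l j)%:C)) -big_cat_nat ?leq_maxr //=.
  rewrite [RHS](@big_cat_nat _ _ _ (N l)) ?leq_maxl //= [X in _ = _ + X]big_nat_cond [X in _ = _ + X]big1 ?addr0 //.
  by move=> j /andP[/andP[/uN -> _] _]; rewrite mulr0.
have e2 : \sum_(j < N l) f j * (u l j)%:C - S =
   (\sum_(j < J) f j * (v j)%:C - S) + \sum_(j < J) f j * (u l j - v j)%:C +
    \sum_(J <= j < n) f j * (u l j)%:C.
  have -> : \sum_(j < J) f j * (u l j - v j)%:C = \sum_(j < J) f j * (u l j)%:C - \sum_(j < J) f j * (v j)%:C.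
    by rewrite -sumrB; apply: eq_bigr => j _; rewrite rmorphB mulrBr.
  by rewrite e1; ring.
rewrite -/S e2; apply: le_trans (nrmD _ _) _; apply: le_trans (lerD (nrmD _ _) (lexx _)) _.
have t1 : nrm (\sum_(j < J) f j * (v j)%:C - S) <= e / 4 by apply: h2; apply: leq_maxr.
have t2 : nrm (\sum_(j < J) f j * (u l j - v j)%:C) <= e / 4.
  apply: le_trans (nrm_sum _ _ _) _; apply: le_trans hL; apply: ler_sum => j _.
  by rewrite nrmM nrm_real.
have t3 : nrm (\sum_(J <= j < n) f j * (u l j)%:C) <= e / 4.
  apply: le_trans (nrm_sum _ _ _) _.
  apply: (@le_trans _ _ (\sum_(J <= j < n) nrm (f j) * d j)).
    apply: ler_sum => j _; rewrite nrmM nrm_real ler_wpM2l ?nrm_ge0 //.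
    by have /andP[? ?] := ud l j; rewrite ger0_norm.
  have hJ := h1 J (leq_maxl _ _); have hn := h1 n (leq_trans (leq_maxl _ _) (leq_maxr _ _)).
  have : \sum_(j < n) nrm (f j) * d j = \sum_(j < J) nrm (f j) * d j + \sum_(J <= j < n) nrm (f j) * d j.
    by rewrite -!(big_mkord predT (fun j => nrm (f j) * d j)) -big_cat_nat ?leq_maxr.
  move: hJ hn; rewrite !ler_norml => /andP[? ?] /andP[? ?]; lra.
by lra.
Qed.

Lemma expR_le_inv (t : R) : t < 1 -> expR (- (t / (1 - t))) <= 1 - t.
Proof.
move=> t1; have p : 0 < 1 - t by lra.
rewrite expRN -[X in _ <= X]invrK lef_pV2 ?posrE ?invr_gt0 ?expR_gt0 //.
rewrite [leLHS](_ : _ = 1 + t / (1 - t)); last by field; rewrite gt_eqF.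
exact: expR_ge1Dx.
Qed.

Definition bratio m K : R := 'C(2 * m, m + K)%:R / 'C(2 * m, m)%:R.

Lemma bin_mid_gt0 m : 0 < 'C(2 * m, m)%:R :> R.
Proof. by rewrite ltr0n bin_gt0; lia. Qed.

Lemma bratio0 m : bratio m 0 = 1.
Proof. by rewrite /bratio addn0 divff // gt_eqF ?bin_mid_gt0. Qed.

Lemma bratioS m K : (K <= m)%N -> bratio m K.+1 = bratio m K * (1 - (2 * K).+1%:R / (m + K).+1%:R).
Proof.
move=> le; have := mul_bin_left (2 * m) (m + K).
rewrite (_ : (2 * m - (m + K) = m - K)%N); last by lia.
move/(congr1 (fun n => n%:R : R)); rewrite !natrM natrB // => e.
have n0 : (m + K).+1%:R != 0 :> R by rewrite pnatr_eq0.
have -> : 1 - (2 * K).+1%:R / (m + K).+1%:R = (m%:R - K%:R) / (m + K).+1%:R :> R.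
  have e1 : (m + K).+1%:R = m%:R + K%:R + 1 :> R by rewrite -(natrD _ m K) natr1.
  have e2 : (2 * K).+1%:R = 2 * K%:R + 1 :> R by rewrite -natrM natr1.
  apply: (mulIf n0); rewrite mulrBl mul1r !divfK // e1 e2; ring.
apply: (mulfI n0); rewrite /bratio addnS mulrA e.
move: (lt0r_neq0 (bin_mid_gt0 m)) {e} n0.
move: ('C(2 * m, m)%:R : R) ('C(2 * m, m + K)%:R : R) ((m + K).+1%:R : R) => A B X A0 X0.
by field; rewrite A0 X0.
Qed.

Lemma bratio_ge0 m K : 0 <= bratio m K.
Proof. by rewrite divr_ge0. Qed.

(** The ratio is the product of 1 - (2j+1)/(m+j+1) over j < K; the odd numbers add up to K^2, and
    each denominator is at most m + K0. *)
Lemma bratio_le m K K0 : (K <= K0)%N -> (K0 <= m)%N ->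
  bratio m K <= expR (- (K%:R ^+ 2 / (m + K0)%:R)).
Proof.
move=> le0 le1; elim: K le0 => [|K IHK] lt; first by rewrite bratio0 expr0n mul0r oppr0 expR0.
rewrite bratioS; last by lia.
have -> : - (K.+1%:R ^+ 2 / (m + K0)%:R) = - (K%:R ^+ 2 / (m + K0)%:R) + - ((2 * K).+1%:R / (m + K0)%:R) :> R.
  by rewrite -opprD -mulrDl -(natrX R K.+1) -(natrX R K) -natrD; congr (- (_%:R / _)); lia.
rewrite expRD; apply: ler_pM; rewrite ?bratio_ge0 //.
- rewrite subr_ge0 ler_pdivrMr ?ltr0n // mul1r ler_nat; lia.
- by apply: IHK; lia.
- apply: le_trans (expR_ge1Dx _); rewrite lerD2l lerN2 ler_wpM2l // lef_pV2 ?posrE ?ltr0n ?ler_nat //; lia.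
Qed.

Lemma bratio_ge m K K0 : (K <= K0)%N -> (K0 < m)%N ->
  expR (- (K%:R ^+ 2 / (m - K0)%:R)) <= bratio m K.
Proof.
move=> le0 le1; elim: K le0 => [|K IHK] lt; first by rewrite bratio0 expr0n mul0r oppr0 expR0.
rewrite bratioS; last by lia.
have -> : - (K.+1%:R ^+ 2 / (m - K0)%:R) = - (K%:R ^+ 2 / (m - K0)%:R) + - ((2 * K).+1%:R / (m - K0)%:R) :> R.
  by rewrite -opprD -mulrDl -(natrX R K.+1) -(natrX R K) -natrD; congr (- (_%:R / _)); lia.
rewrite expRD; apply: ler_pM; rewrite ?expR_ge0 //; first by apply: IHK; lia.
have p1 : 0 < (m + K).+1%:R :> R by rewrite ltr0n.
have p2 : 0 < (m - K0)%:R :> R by rewrite ltr0n; lia.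
apply: le_trans (expR_le_inv _); last by rewrite ltr_pdivrMr // mul1r ltr_nat; lia.
rewrite ler_expR lerN2.
have -> : (2 * K).+1%:R / (m + K).+1%:R / (1 - (2 * K).+1%:R / (m + K).+1%:R) = (2 * K).+1%:R / (m - K)%:R :> R.
  have e : (m - K)%:R = (m + K).+1%:R - (2 * K).+1%:R :> R by rewrite -natrB; [congr _%:R; lia|lia].
  have bd : (m + K).+1%:R - (2 * K).+1%:R != 0 :> R by rewrite -e pnatr_eq0; lia.
  rewrite e; move: (lt0r_neq0 p1) bd; move: ((m + K).+1%:R : R) ((2 * K).+1%:R : R) => b a b0 bd.
  by field; rewrite ?b0 ?bd.
by rewrite ler_wpM2l // lef_pV2 ?posrE ?ltr0n ?ler_nat //; lia.
Qed.

Definition cmid m : R := 'C(2 * m, m)%:R / 4 ^+ m.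

Lemma cmidS m : cmid m.+1 = cmid m * ((2 * m).+1%:R / (2 * m).+2%:R).
Proof.
have e : (m.+1 * 'C(2 * m.+1, m.+1) = (4 * m + 2) * 'C(2 * m, m))%N.
  have h1 := mul_bin_diag (2 * m).+2 m; have h4 := mul_bin_down (2 * m).+1 m.
  have -> : (2 * m.+1 = (2 * m).+2)%N by lia.
  move: h1 h4; rewrite (_ : ((2 * m).+1 - m = m.+1)%N) /=; last by lia.
  move: ('C((2 * m).+2, m.+1)) ('C((2 * m).+1, m)) ('C(2 * m, m)) => A B E; clear; nia.
move/(congr1 (fun n => n%:R : R)): e; rewrite !natrM natrD natrM => e.
have n0 : m.+1%:R != 0 :> R by rewrite pnatr_eq0.
have n2 : (2 * m).+2%:R = 2 * m.+1%:R :> R by rewrite -natrM; congr _%:R; lia.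
have n1 : (2 * m).+1%:R = 2 * m%:R + 1 :> R by rewrite -natrM -natr1.
apply: (mulfI n0); rewrite /cmid mulrA e exprS n2 n1; field.
by rewrite nat1r pnatr_eq0 expf_neq0 ?pnatr_eq0.
Qed.

Lemma cmid_ge0 m : 0 <= cmid m. Proof. by rewrite divr_ge0 // exprn_ge0. Qed.

(** As in Wallis's product, m c_m^2 increases while (2m+1) c_m^2 decreases, for c_m = C(2m,m)/4^m.
    The value of the limit is identified later, in [cmid_lim]. *)
Lemma cmid_cvg : exists c : R, ((fun m => m%:R * cmid m ^+ 2) @ \oo --> c)%classic.
Proof.
suff : cvgn (fun m : nat => m%:R * cmid m ^+ 2 : R) by move=> h; eexists; exact: h.
apply: nondecreasing_is_cvgn.
  apply/nondecreasing_seqP => m /=; rewrite cmidS; move: (cmid m) => c; rewrite exprMn [leRHS]mulrCA [leLHS]mulrC.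
  apply: ler_wpM2l; first exact: sqr_ge0.
  have n2 : (2 * m).+2%:R = 2 * m%:R + 2 :> R by rewrite -natrM -natrD addn2.
  have n1 : (2 * m).+1%:R = 2 * m%:R + 1 :> R by rewrite -natrM -natr1.
  rewrite n1 n2 -natr1 expr_div_n mulrA ler_pdivlMr; have := ler0n R m; move: (m%:R : R) => t t0; nra.
exists 1; apply/ubP => _ [m _ <-].
have h : (2 * m).+1%:R * cmid m ^+ 2 <= 1 :> R.
  elim: m => [|m IHm]; first by rewrite /cmid bin0 expr0 divr1 mul1r expr1n.
  apply: le_trans IHm; rewrite cmidS; move: (cmid m) => c; rewrite exprMn [leLHS]mulrCA [leRHS]mulrC.
  apply: ler_wpM2l; first exact: sqr_ge0.
  have n2 : (2 * m).+2%:R = 2 * m%:R + 2 :> R by rewrite -natrM -natrD addn2.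
  have n1 : (2 * m).+1%:R = 2 * m%:R + 1 :> R by rewrite -natrM -natr1.
  have n3 : (2 * m.+1).+1%:R = 2 * m%:R + 3 :> R by rewrite -natrM -natrD; congr _%:R; lia.
  rewrite n1 n2 n3 expr_div_n mulrA ler_pdivrMr; have := ler0n R m; move: (m%:R : R) => t t0; nra.
apply: le_trans h; rewrite ler_wpM2r ?sqr_ge0 // ler_nat; lia.
Qed.

Lemma geom_le (q : R) K : 0 <= q < 1 -> \sum_(j < K) q ^+ j <= (1 - q)^-1.
Proof.
move=> /andP[q0 q1]; have p : 0 < 1 - q by lra.
rewrite -[leRHS]mul1r ler_pdivlMr //; have := subrX1 q K.
have := exprn_ge0 K q0; move: (\sum_(i < K) _) (q ^+ K) => s t; nra.
Qed.

Lemma expR_sq_le (c : R) n : 0 <= c -> expR (- (c * n%:R ^+ 2)) <= expR (- c) ^+ n.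
Proof.
move=> c0; rewrite -expRM_natl ler_expR mulrN lerN2 mulrC ler_wpM2l //.
by case: n => [|n]; rewrite ?expr0n // expr2 ler_peMr // ler1n.
Qed.

Lemma wt_gauss_summable (f : nat -> C) B (c : R) (g : nat -> R) : 0 < c -> (forall n, nrm (f n) <= B) ->
  (forall n, 0 <= g n <= expR (- (c * n%:R ^+ 2))) ->
  forall K, \sum_(j < K) nrm (f j * (wt j)%:C) * g j <= B * 2 * (1 - expR (- c))^-1.
Proof.
move=> c0 fB hg K.
have q : 0 <= expR (- c) < 1 by rewrite expR_ge0 expR_lt1 oppr_lt0.
have B0 : 0 <= B by apply: le_trans (fB 0%N); apply: nrm_ge0.
apply: le_trans (_ : _ <= B * 2 * \sum_(j < K) expR (- c) ^+ j) _; last first.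
  by rewrite ler_wpM2l ?geom_le // mulr_ge0.
rewrite mulr_sumr; apply: ler_sum => j _; have /andP[g0 gle] := hg j.
apply: ler_pM => //; rewrite ?nrm_ge0 //; last exact: le_trans gle (expR_sq_le _ (ltW c0)).
rewrite nrmM nrm_real; apply: ler_pM; rewrite ?nrm_ge0 ?normr_ge0 //.
by rewrite /wt; case: (val j) => [|i]; rewrite ger0_norm ?ler1n // ler_nat.
Qed.

Lemma hsum_even (f : nat -> C) s : (forall n, odd n -> f n = 0) -> hsum f s ->
  hsum (fun n => f (2 * n)%N) s.
Proof.
move=> f0 hs e /hs[K0 hK]; exists K0 => K le.
have -> : \sum_(n < K) f (2 * n)%N = \sum_(n < 2 * K) f n.
  elim: K {le} => [|K IHK]; first by rewrite !big_ord0.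
  rewrite big_ord_recr IHK (_ : (2 * K.+1 = (2 * K).+2)%N); last by lia.
  by rewrite !big_ord_recr /= [f (2 * K).+1]f0 ?addr0 //= oddM.
by apply: hK; lia.
Qed.

Section GaussLimit.
Variables (sigma : R) (l0 : nat).
Hypothesis s0 : 0 < sigma.
Hypothesis l01 : (0 < l0)%N.
Hypothesis l0s : 2 <= sigma * l0%:R ^+ 2.

(** The number of periods is shifted by [l0] so that sigma l^2 >= 2 always. With m the integer part
    of sigma l^2, the ratio [zq] = m / l^2 tends to sigma and never falls below sigma/2, which
    yields majorants uniform in l. *)
Let lq l := (l + l0)%N.
Let mq l := Num.truncn (sigma * (lq l)%:R ^+ 2).
Let zq l : R := (mq l)%:R / (lq l)%:R ^+ 2.
Let eps l : R := (lq l)%:R^-1.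

Let lq0 l : 0 < (lq l)%:R :> R. Proof. by rewrite ltr0n addn_gt0 l01 orbT. Qed.
Let lqN0 l : (lq l)%:R != 0 :> R. Proof. by rewrite gt_eqF. Qed.

Let s_lq l : 0 <= sigma * (lq l)%:R ^+ 2.
Proof. by rewrite mulr_ge0 ?sqr_ge0 // ltW. Qed.

Let mq_le l : (mq l)%:R <= sigma * (lq l)%:R ^+ 2.
Proof. by have /andP[] := truncn_itv (s_lq l). Qed.

Let mq_gt l : sigma * (lq l)%:R ^+ 2 - 1 < (mq l)%:R.
Proof. by have /andP[_] := truncn_itv (s_lq l); rewrite -natr1 ltrBlDr. Qed.

Let s_ge2 l : 2 <= sigma * (lq l)%:R ^+ 2.
Proof.
apply: le_trans l0s _; rewrite ler_pM2l // lerXn2r ?nnegrE // ler_nat; exact: leq_addl.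
Qed.

Let zq_le l : zq l <= sigma.
Proof. by rewrite ler_pdivrMr ?exprn_gt0. Qed.

Let zq_ge l : sigma - eps l ^+ 2 <= zq l.
Proof.
rewrite ler_pdivlMr ?exprn_gt0 // mulrBl /eps exprVn mulVf ?expf_neq0 //.
exact: ltW (mq_gt l).
Qed.

Let zq_half l : sigma / 2 <= zq l.
Proof.
rewrite ler_pdivlMr ?exprn_gt0 //; move: (s_ge2 l) (mq_gt l).
by move: ((lq l)%:R ^+ 2 : R) ((mq l)%:R : R) => X M; lra.
Qed.

Let zq_gt0 l : 0 < zq l. Proof. by apply: lt_le_trans (zq_half l); rewrite divr_gt0. Qed.

Let mqE l : (mq l)%:R = zq l * (lq l)%:R ^+ 2 :> R.
Proof. by rewrite /zq divfK // expf_neq0. Qed.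

Let eps_ge0 l : 0 <= eps l. Proof. by rewrite invr_ge0 ltW. Qed.
Let eps_le1 l : eps l <= 1.
Proof. by rewrite invf_le1 // ler1n -(ltr0n R). Qed.

Let eps_cvg : (eps @ \oo --> (0 : R))%classic.
Proof.
apply: (squeeze_cvgr _ (cvg_cst 0) (@cvg_harmonic R)).
near=> l; rewrite eps_ge0 /eps /harmonic /= lef_pV2 ?posrE // ler_nat /lq; lia.
Unshelve. all: by end_near.
Qed.

Let eps2_cvg : ((fun l => eps l ^+ 2) @ \oo --> (0 : R))%classic.
Proof.
rewrite [X in (_ --> X)%classic](_ : 0 = 0 * 0); last by rewrite mulr0.
exact: cvgM.
Qed.

Let zq_cvg : (zq @ \oo --> sigma)%classic.
Proof.
apply: (@squeeze_cvgr _ _ _ _ (fun l => sigma - eps l ^+ 2) (fun=> sigma)).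
- by near=> l; rewrite zq_ge zq_le.
- rewrite -[X in (_ --> X)%classic]subr0; apply: cvgB => //; exact: cvg_cst.
- exact: cvg_cst.
Unshelve. all: by end_near.
Qed.

Lemma expR_cvg (u : nat -> R) (a : R) : (u @ \oo --> a)%classic ->
  ((fun l => expR (- u l)) @ \oo --> expR (- a))%classic.
Proof.
move=> h; apply: continuous_cvg; first exact: continuous_expR.
exact: cvgN.
Qed.

Let bq l k := bratio (mq l) (k * lq l).

Let bq_le l k : 0 <= bq l k <= expR (- ((2 * sigma)^-1 * k%:R ^+ 2)).
Proof.
rewrite bratio_ge0 /=; have [lt|le] := ltnP (mq l) (k * lq l)%N.
  by rewrite /bq /bratio bin_small ?mul0r ?expR_ge0 //; lia.
apply: le_trans (bratio_le (leqnn _) le) _; rewrite ler_expR lerN2.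
have m0 : 0 < (mq l)%:R :> R by rewrite mqE mulr_gt0 // exprn_gt0.
apply: (@le_trans _ _ ((k * lq l)%:R ^+ 2 / (2 * (mq l)%:R))); last first.
  rewrite ler_wpM2l ?sqr_ge0 // lef_pV2 ?posrE ?mulr_gt0 //.
    by rewrite -natrM ler_nat; lia.
  by rewrite ltr0n addn_gt0 -(ltr0n R) m0.
rewrite natrM exprMn [leLHS]mulrC -[leRHS]mulrA; apply: ler_wpM2l; first exact: sqr_ge0.
rewrite ler_pdivlMr ?mulr_gt0 // mulrC ler_pdivrMr ?mulr_gt0 //.
by move: (mq_le l); move: ((lq l)%:R ^+ 2 : R) ((mq l)%:R : R) => X M; lra.
Qed.

Let kden l k (s : R) : (k * lq l)%:R ^+ 2 / ((mq l)%:R + s * (k * lq l)%:R) =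
   k%:R ^+ 2 / (zq l + s * (k%:R * eps l)).
Proof.
have -> : (mq l)%:R + s * (k * lq l)%:R = (zq l + s * (k%:R * eps l)) * (lq l)%:R ^+ 2.
  by rewrite mqE natrM /eps; field.
by rewrite natrM exprMn -mulf_div divff ?mulr1 // expf_neq0.
Qed.

Let kden_cvg k (s : R) :
  ((fun l => k%:R ^+ 2 / (zq l + s * (k%:R * eps l)) : R) @ \oo --> k%:R ^+ 2 / sigma)%classic.
Proof.
apply: cvgM; first exact: cvg_cst.
apply: cvgV; first by rewrite gt_eqF.
rewrite -[X in (_ --> X)%classic]addr0; apply: cvgD => //.
rewrite -[X in (_ --> X)%classic](mulr0 s); apply: cvgM; first exact: cvg_cst.
by rewrite -[X in (_ --> X)%classic](mulr0 (k%:R : R)); apply: cvgM => //; exact: cvg_cst.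
Qed.

Let bq_cvg k : ((fun l => bq l k) @ \oo --> expR (- (sigma^-1 * k%:R ^+ 2)))%classic.
Proof.
rewrite (mulrC sigma^-1).
apply: (@squeeze_cvgr _ _ _ _ (fun l => expR (- (k%:R ^+ 2 / (zq l + -1 * (k%:R * eps l)))))
  (fun l => expR (- (k%:R ^+ 2 / (zq l + 1 * (k%:R * eps l)))))); last 2 first.
- apply: (@expR_cvg (fun l => k%:R ^+ 2 / (zq l + -1 * (k%:R * eps l))) (k%:R ^+ 2 / sigma)).
  exact: kden_cvg.
- apply: (@expR_cvg (fun l => k%:R ^+ 2 / (zq l + 1 * (k%:R * eps l))) (k%:R ^+ 2 / sigma)).
  exact: kden_cvg.
have se : 0 < sigma / (2 * k.+1%:R) by rewrite divr_gt0 // mulr_gt0 // ltr0n.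
have [K0 hK] := cvg_eps eps_cvg se.
near=> l; have lK : (K0 <= l)%N by near: l; exact: nbhs_infty_ge.
have := hK l lK; rewrite subr0 ger0_norm // ler_pdivlMr ?mulr_gt0 ?ltr0n // => he.
have lt : (k * lq l < mq l)%N.
  rewrite -(ltr_nat R) natrM mqE expr2 mulrA ltr_pM2r //.
  apply: (@lt_le_trans _ _ (sigma / 2 * (lq l)%:R)); last by rewrite ler_pM2r.
  have e1 : eps l * (lq l)%:R = 1 by rewrite /eps mulVf.
  have k1 : k.+1%:R = k%:R + 1 :> R by rewrite natr1.
  have : eps l * (2 * k.+1%:R) * (lq l)%:R <= sigma * (lq l)%:R by rewrite ler_pM2r.
  by rewrite mulrAC e1 mul1r k1; lra.
rewrite -!kden mul1r mulN1r -natrD -natrB; last exact: ltnW.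
by rewrite bratio_ge // bratio_le // ltnW.
Unshelve. all: by end_near.
Qed.

(** Upper bound from cos x <= exp(-x^2/2); lower bound from cos x >= 1 - t >= exp(-t/(1-t)) with t =
    x^2/2. *)
Lemma cos_gauss (x : R) m : 0 <= x -> x ^+ 2 / 2 < 1 -> x <= pi / 2 ->
  expR (- (m%:R * x ^+ 2 / (1 - x ^+ 2 / 2))) <= cos x ^+ (2 * m) <= expR (- (m%:R * x ^+ 2)).
Proof.
move=> x0 x1 xp; have xp' : 0 <= x <= pi / 2 by rewrite x0.
have c0 : 0 <= cos x by apply: cos_ge0_pihalf; have := pi_ge0 R; lra.
have e (t : R) : expR (- ((2 * m)%:R * t)) = expR (- t) ^+ (2 * m) by rewrite -expRM_natl mulrN.
apply/andP; split.
  have -> : m%:R * x ^+ 2 / (1 - x ^+ 2 / 2) = (2 * m)%:R * (x ^+ 2 / 2 / (1 - x ^+ 2 / 2)).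
    by rewrite natrM; field; move: x1; rewrite ltr_pdivrMr // mul1r => ?; rewrite gt_eqF //; lra.
  rewrite e; apply: lerXn2r; rewrite ?nnegrE ?expR_ge0 //.
  apply: le_trans (expR_le_inv x1) _; apply: cos_ge_quad; have := pi_ge0 R; lra.
have -> : m%:R * x ^+ 2 = (2 * m)%:R * (x ^+ 2 / 2) by rewrite natrM; field.
by rewrite e; apply: lerXn2r; rewrite ?nnegrE ?expR_ge0 // cos_le_expR.
Qed.

Section Half.
Variable L2 : nat.
Hypothesis L20 : (0 < L2)%N.
Let L := (2 * L2)%N.
Let bb n : R := pi * n%:R / L%:R.

Let Lr : 0 < L%:R :> R. Proof. by rewrite ltr0n muln_gt0. Qed.

(** The even power of the cosine is large again near the far end n = l L. The symmetric sum is
    therefore folded at the half period l [L2], where the cosine vanishes, and only angles below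
    pi/2 remain. *)
Let cq l n : R := if (n < lq l * L2)%N then cos (pi * n%:R / (lq l * L)%:R) ^+ (2 * mq l) else 0.

Let angE l n : pi * n%:R / (lq l * L)%:R = bb n * eps l.
Proof. by rewrite /bb /eps natrM; field; rewrite lqN0 gt_eqF. Qed.

Let bb_ge0 n : 0 <= bb n. Proof. by rewrite divr_ge0 ?mulr_ge0 ?pi_ge0 // ltW. Qed.

Let ang_le l n : (n < lq l * L2)%N -> 0 <= bb n * eps l <= pi / 2.
Proof.
move=> lt; rewrite mulr_ge0 //= -angE ler_pdivrMr; last by rewrite natrM mulr_gt0.
rewrite -mulrA ler_pM2l ?pi_gt0 // ler_pdivlMl // -natrM ler_nat /L; nia.
Qed.

Let mang l n : (mq l)%:R * (bb n * eps l) ^+ 2 = zq l * bb n ^+ 2.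
Proof. by rewrite mqE /eps; field. Qed.

Let cq_le l n : 0 <= cq l n <= expR (- ((sigma * (pi / L%:R) ^+ 2 / 2) * n%:R ^+ 2)).
Proof.
rewrite /cq; case: ifP => [lt|_]; last by rewrite lexx expR_ge0.
have h := ang_le lt; rewrite angE; have /andP[h0 h1] := h.
have c0 : 0 <= cos (bb n * eps l) by apply: cos_ge0_pihalf; have := pi_ge0 R; lra.
rewrite exprn_ge0 //=; apply: (@le_trans _ _ (expR (- ((bb n * eps l) ^+ 2 / 2)) ^+ (2 * mq l))).
  by apply: lerXn2r; rewrite ?nnegrE ?expR_ge0 // cos_le_expR.
rewrite -expRM_natl ler_expR mulrN lerN2.
have -> : (2 * mq l)%:R * ((bb n * eps l) ^+ 2 / 2) = zq l * bb n ^+ 2.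
  by rewrite -mang natrM; field.
have -> : sigma * (pi / L%:R) ^+ 2 / 2 * n%:R ^+ 2 = sigma / 2 * bb n ^+ 2 by rewrite /bb; field; rewrite gt_eqF.
by rewrite ler_wpM2r ?sqr_ge0.
Qed.

Let cq_cvg n : ((fun l => cq l n) @ \oo --> expR (- (sigma * (pi / L%:R) ^+ 2 * n%:R ^+ 2)))%classic.
Proof.
have -> : sigma * (pi / L%:R) ^+ 2 * n%:R ^+ 2 = sigma * bb n ^+ 2 by rewrite /bb; field; rewrite gt_eqF.
have lo : ((fun l => zq l * bb n ^+ 2 / (1 - bb n ^+ 2 / 2 * eps l ^+ 2)) @ \oo --> sigma * bb n ^+ 2)%classic.
  rewrite -[X in (_ --> X)%classic]mulr1; apply: cvgM; first by apply: cvgM => //; exact: cvg_cst.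
  rewrite -[X in (_ --> X)%classic]invr1; apply: cvgV; first exact: oner_neq0.
  rewrite -[X in (_ --> X)%classic]subr0; apply: cvgB; first exact: cvg_cst.
  by rewrite -[X in (_ --> X)%classic](mulr0 (bb n ^+ 2 / 2)); apply: cvgM => //; exact: cvg_cst.
have hi : ((fun l => zq l * bb n ^+ 2) @ \oo --> sigma * bb n ^+ 2)%classic.
  by apply: cvgM => //; exact: cvg_cst.
apply: (squeeze_cvgr _ (expR_cvg lo) (expR_cvg hi)).
have b1 : 0 < bb n ^+ 2 + 1 by rewrite ltr_wpDl ?sqr_ge0.
have [K0 hK] := cvg_eps eps2_cvg (divr_gt0 (ltr01) b1).
near=> l; have lK : (K0 <= l)%N by near: l; exact: nbhs_infty_ge.
have ln : (n < l)%N by near: l; exact: nbhs_infty_gt.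
have lt : (n < lq l * L2)%N by rewrite /lq; nia.
have := hK l lK; rewrite subr0 ger0_norm ?sqr_ge0 // ler_pdivlMr // => he.
rewrite /cq lt angE; have /andP[h0 h1] := ang_le lt.
have := @cos_gauss (bb n * eps l) (mq l) h0; rewrite mang.
have -> : (bb n * eps l) ^+ 2 / 2 = bb n ^+ 2 / 2 * eps l ^+ 2 by field.
by apply=> //; have := sqr_ge0 (eps l); nra.
Unshelve. all: by end_near.
Qed.

Let gq l : R := (lq l)%:R * cmid (mq l).

Let gq_cvg (c : R) : ((fun m => m%:R * cmid m ^+ 2) @ \oo --> c)%classic ->
  (gq @ \oo --> Num.sqrt (c / sigma))%classic.
Proof.
move=> hc.
have e l : gq l = Num.sqrt ((mq l)%:R * cmid (mq l) ^+ 2 / zq l).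
  have -> : (mq l)%:R * cmid (mq l) ^+ 2 / zq l = gq l ^+ 2.
    by rewrite mqE /gq; field; rewrite gt_eqF.
  by rewrite sqrtr_sqr ger0_norm // mulr_ge0 // cmid_ge0.
rewrite (_ : gq = fun l => Num.sqrt ((mq l)%:R * cmid (mq l) ^+ 2 / zq l)); last exact/funext.
apply: continuous_cvg; first exact: sqrt_continuous.
apply: cvgM; last by apply: cvgV => //; rewrite gt_eqF.
apply: (@cvg_comp _ _ _ mq (fun m : nat => m%:R * cmid m ^+ 2 : R) _ _ _ _ hc).
apply/cvgnyPge => A.
have [K0 hK] := cvg_eps eps_cvg (divr_gt0 s0 (ltr0n R (2 * A.+1))).
near=> l; have lK : (K0 <= l)%N by near: l; exact: nbhs_infty_ge.
have := hK l lK; rewrite subr0 ger0_norm // ler_pdivlMr ?ltr0n // => he.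
have e1 : eps l * (lq l)%:R = 1 by rewrite /eps mulVf.
have : eps l * (2 * A.+1)%:R * (lq l)%:R <= sigma * (lq l)%:R by rewrite ler_pM2r.
rewrite mulrAC e1 mul1r => h1; rewrite -(ler_nat R) mqE expr2 mulrA.
have l1 : 1 <= (lq l)%:R :> R by rewrite ler1n -(ltr0n R).
have h2 : sigma / 2 * (lq l)%:R <= zq l * (lq l)%:R by rewrite ler_pM2r.
have h3 : (2 * A.+1)%:R = 2 * A%:R + 2 :> R by rewrite -natrM -natrD; congr _%:R; lia.
have h4 : A%:R <= zq l * (lq l)%:R by lra.
by apply: le_trans h4 _; rewrite ler_peMr // mulr_ge0 // ltW.
Unshelve. all: by end_near.
Qed.

(** Both sides of [polya], the left one folded, converge by [tannery]. The remaining factor l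
    C(2m,m)/4^m has square m c_m^2 / [zq], hence tends to sqrt(c/sigma). *)
Lemma theta_limit (c : R) (f : nat -> C) : ((fun m => m%:R * cmid m ^+ 2) @ \oo --> c)%classic ->
  (forall n, f (n + L)%N = f n) -> (forall n, (n <= L)%N -> f (L - n)%N = f n) ->
  csum (fun n => f n * (wt n)%:C * (expR (- (sigma * (pi / L%:R) ^+ 2 * n%:R ^+ 2)))%:C) =
  (Num.sqrt (c / sigma))%:C * csum (fun k => fhat f L k * (wt k)%:C * (expR (- (sigma^-1 * k%:R ^+ 2)))%:C).
Proof.
move=> hc per sym; have L0 : (0 < L)%N by rewrite -(ltr0n R).
pose B := \sum_(n < L) nrm (f n).
have fB n : nrm (f n) <= B.
  rewrite (divn_eq n L) per_mul // /B (bigD1 (Ordinal (ltn_pmod n L0))) //= lerDl.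
  by apply: sumr_ge0 => i _; apply: nrm_ge0.
have fhB k : nrm (fhat f L k) <= B.
  apply: le_trans (nrm_sum _ _ _) _; apply: ler_sum => i _; rewrite nrmM nrm_real.
  by rewrite ler_piMr ?nrm_ge0 // cos_max.
have c1 : 0 < sigma * (pi / L%:R) ^+ 2 / 2.
  by rewrite !mulr_gt0 ?exprn_gt0 ?divr_gt0 ?pi_gt0 ?invr_gt0.
have c2 : 0 < (2 * sigma)^-1 by rewrite invr_gt0 mulr_gt0.
have t1 := @tannery cq _ _ (fun n => f n * (wt n)%:C) (fun l => lq l * L2)%N _ cq_le _ cq_cvg
  (wt_gauss_summable c1 fB (fun n => proj1 (conj (_ : 0 <= expR (- ((sigma * (pi / L%:R) ^+ 2 / 2) * n%:R ^+ 2)) <= expR (- ((sigma * (pi / L%:R) ^+ 2 / 2) * n%:R ^+ 2))) I))).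
have t2 := @tannery bq _ _ (fun n => fhat f L n * (wt n)%:C) (fun l => (mq l).+1)%N _ bq_le _ bq_cvg
  (wt_gauss_summable c2 fhB (fun n => proj1 (conj (_ : 0 <= expR (- ((2 * sigma)^-1 * n%:R ^+ 2)) <= expR (- ((2 * sigma)^-1 * n%:R ^+ 2))) I))).
apply: (ctends_uniq (t1 _ _)).
- by move=> l j le; rewrite /cq ltnNge le.
- by move=> n; rewrite expR_ge0 lexx.
have z2 l j : ((mq l).+1 <= j)%N -> bq l j = 0.
  move=> le; rewrite /bq /bratio bin_small ?mul0r //.
  by have : (0 < lq l)%N by [rewrite -(ltr0n R)]; nia.
have e2 n : 0 <= expR (- ((2 * sigma)^-1 * n%:R ^+ 2)) <= expR (- ((2 * sigma)^-1 * n%:R ^+ 2)).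
  by rewrite expR_ge0 lexx.
have := ctendsZ (gq_cvg hc) (t2 z2 e2).
congr (ctends _ _); apply/funext => l.
have l1 : (0 < lq l)%N by rewrite -(ltr0n R).
have h0 : (0 < lq l * L2)%N by rewrite muln_gt0 l1.
transitivity (\sum_(n < lq l * L) f n * (cos (pi * n%:R / (lq l * L)%:R) ^+ (2 * mq l))%:C).
  rewrite (polya L0 per _ l1) mulr_sumr; apply: eq_bigr => k _.
  rewrite -mulrA -!rmorphM /= mulrCA -rmorphM /=; congr (_ * _%:C); rewrite /gq /cmid /bq /bratio.
  have := lt0r_neq0 (bin_mid_gt0 (mq l)); have : 4 ^+ mq l != 0 :> R by rewrite expf_neq0 ?pnatr_eq0.
  move: ('C(2 * mq l, mq l)%:R : R) (4 ^+ mq l : R) ('C(2 * mq l, mq l + k * lq l)%:R : R) ((lq l)%:R : R) (wt k).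
  by move=> D E Bn Lq w E0 D0; field; rewrite D0 E0.
have m0 : (0 < mq l)%N by rewrite -(ltr0n R) mqE mulr_gt0 // exprn_gt0.
rewrite (_ : (lq l * L = 2 * (lq l * L2))%N); last by rewrite /L mulnCA.
have PL : (2 * (lq l * L2))%:R != 0 :> R by rewrite pnatr_eq0 -lt0n muln_gt0 h0.
rewrite (@fold_even (lq l * L2) (fun n => f n * (cos (pi * n%:R / (2 * (lq l * L2))%:R) ^+ (2 * mq l))%:C)) //.
- apply: eq_bigr => n _; rewrite /cq ltn_ord mulrAC; congr (_ * _ * (cos (_ / _) ^+ _)%:C).
  by congr (_%:R); rewrite /L mulnCA.
- have -> : pi * (lq l * L2)%:R / (2 * (lq l * L2))%:R = pi / 2 :> R.
    move: PL; rewrite natrM; move: ((lq l * L2)%:R : R) => X; rewrite mulf_eq0 negb_or => /andP[_ X0].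
    by field.
  by rewrite cos_pihalf expr0n muln_eq0 /= eqn0Ngt m0 mulr0.
move=> n le; congr (_ * _).
  have -> : (2 * (lq l * L2) = lq l * L)%N by rewrite /L mulnCA.
  by apply: per_sym => //; rewrite /L mulnCA.
rewrite natrB // mulrBr mulrBl mulfK // cosB cospi sinpi mul0r addr0 mulN1r.
by rewrite exprM sqrrN -exprM.
Qed.

End Half.
End GaussLimit.

Lemma gauss_start (sigma : R) : 0 < sigma -> exists l0, (0 < l0)%N /\ 2 <= sigma * l0%:R ^+ 2.
Proof.
move=> s0; pose n := (Num.truncn (2 / sigma)).+1; exists n; split=> //.
have h : 2 / sigma < n%:R by have /andP[] := truncn_itv (divr_ge0 (ler0n R 2) (ltW s0)).
rewrite mulrC -ler_pdivrMr //; apply: le_trans (ltW h) _.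
by rewrite expr2 ler_peMr // ler1n.
Qed.

Definition gsum (f : nat -> C) (x : R) : C := csum (fun n => f n * (wt n)%:C * (expR (- (x * n%:R ^+ 2)))%:C).

Lemma gsum_hsum f B (x : R) : 0 < x -> (forall n, nrm (f n) <= B) ->
  hsum (fun n => f n * (wt n)%:C * (expR (- (x * n%:R ^+ 2)))%:C) (gsum f x).
Proof.
move=> x0 fB; apply: (@asum_hsum _ _ (B * 2 * (1 - expR (- x))^-1)) => K.
have hg n : 0 <= expR (- (x * n%:R ^+ 2)) <= expR (- (x * n%:R ^+ 2)) by rewrite expR_ge0 lexx.
apply: le_trans (@wt_gauss_summable f B x _ x0 fB hg K).
by apply: ler_sum => n _; rewrite nrmM [X in _ * X]nrm_real [X in _ * X]ger0_norm ?expR_ge0.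
Qed.

(** The limit formula determines its own constant: for f = 1, L = 2, sigma = 4/pi the two theta sums
    are S and 2S, and S is nonzero, so 2 sqrt(c pi/4) = 1. *)
Lemma cmid_lim : ((fun m => m%:R * cmid m ^+ 2 : R) @ \oo --> (pi^-1 : R))%classic.
Proof.
have [c hc] := cmid_cvg; suff <- : c = pi^-1 by [].
have p0 : 0 < pi :> R := pi_gt0 R.
have s0 : 0 < 4 / pi :> R by rewrite divr_gt0.
have [l0 [l01 l0s]] := gauss_start s0.
have := @theta_limit _ _ s0 l01 l0s 1 isT c (fun=> 1) hc (fun _ => erefl) (fun _ _ => erefl).
rewrite muln1 (_ : 4 / pi * (pi / 2%:R) ^+ 2 = pi); last first.
  by move: (lt0r_neq0 p0); move: (pi : R) => p pn0; field.
rewrite -/(gsum (fun=> 1) pi) -/(gsum (fhat (fun=> 1) 2) (4 / pi)^-1).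
set S := gsum (fun=> 1) pi; set S2 := gsum _ (4 / pi)^-1.
have hS : hsum (fun n => 1 * (wt n)%:C * (expR (- (pi * n%:R ^+ 2)))%:C) S.
  by apply: (@gsum_hsum _ 1) => // n; rewrite nrm1.
have h2 n : fhat (fun=> 1) 2 n = if odd n then 0 else 2.
  rewrite /fhat !big_ord_recl big_ord0 /= !mul1r addr0 muln0 mulr0 mul0r cos0.
  rewrite (_ : pi *+ 2 * (n * bump 0 0)%:R / 2%:R = pi *+ n); last first.
    by rewrite /bump /= muln1 -[RHS]mulr_natl mulr2n; field.
  have -> : cos (pi *+ n) = (-1) ^+ n :> R.
    by elim: n => [|n IHn]; rewrite ?cos0 // mulrSr cosDpi IHn exprS mulN1r.
  by rewrite -signr_odd; case: odd; apply/eqP; rewrite eq_complex /= ?expr1 ?expr0 ?subrr ?addr0 ?eqxx // -natrD eqxx.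
have S20 : S2 = 2 * S.
  have hb n : nrm (fhat (fun=> 1) 2 n) <= 2.
    by rewrite h2; case: odd; rewrite ?nrm0 // nrm_nat.
  have hs2 := @gsum_hsum (fhat (fun=> 1) 2) 2 (4 / pi)^-1 _ hb.
  apply: (hsum_uniq _ (hsumZ 2 hS)).
  have := @hsum_even _ S2 _ (hs2 _).
  have -> : (fun n => fhat (fun=> 1) 2 (2 * n) * (wt (2 * n))%:C * (expR (- ((4 / pi)^-1 * (2 * n)%:R ^+ 2)))%:C) =
     (fun n => 2 * (1 * (wt n)%:C * (expR (- (pi * n%:R ^+ 2)))%:C)).
    apply/funext => n; rewrite h2 oddM /= mul1r -mulrA.
    rewrite (_ : wt (2 * n) = wt n); last by case: n.
    by rewrite (_ : (4 / pi)^-1 * (2 * n)%:R ^+ 2 = pi * n%:R ^+ 2) ?mulrA // natrM; move: (lt0r_neq0 p0); move: (pi : R) => p pn0; field.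
  apply; last by rewrite invr_gt0.
  by move=> n on; rewrite h2 on !mul0r.
rewrite S20 mulrCA => e.
have S0 : S != 0.
  apply/eqP => S0; have := hS (1 / 2); rewrite S0 divr_gt0 // => /(_ isT)[K /(_ K.+1)].
  rewrite leqnSn subr0 => /(_ isT) h.
  have : 1 <= complex.Re (\sum_(n < K.+1) 1 * (wt n)%:C * (expR (- (pi * n%:R ^+ 2)))%:C).
    rewrite Re_sum (eq_bigr (fun n : 'I_K.+1 => wt n * expR (- (pi * n%:R ^+ 2)))); last first.
      by move=> n _; rewrite mul1r -rmorphM.
    rewrite big_ord_recl [X in _ <= X + _](_ : _ = 1); last first.
      by rewrite /= mulr0n expr0n /= mulr0 oppr0 expR0 mulr1.
    by rewrite lerDl; apply: sumr_ge0 => i _; rewrite mulr_ge0 ?expR_ge0.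
  have := Re_le_nrm (\sum_(n < K.+1) 1 * (wt n)%:C * (expR (- (pi * n%:R ^+ 2)))%:C).
  by move: h; rewrite ler_norml => h /andP[_ h'] h''; lra.
have {e} : 2 * (Num.sqrt (c / (4 / pi)))%:C = 1 :> C.
  by apply: (mulIf S0); rewrite mul1r {2}e; ring.
rewrite -(rmorph_nat (real_complex R) 2) -rmorphM => /eqP; rewrite eq_complex /= => /andP[/eqP h _].
have c0 : 0 <= c / (4 / pi).
  have [//|n0] := leP 0 (c / (4 / pi)); move: h; rewrite ler0_sqrtr ?ltW // mulr0 => h.
  by have := @ltr01 R; rewrite -h ltxx.
have : (Num.sqrt (c / (4 / pi))) ^+ 2 = c / (4 / pi) by rewrite sqr_sqrtr.
have -> : Num.sqrt (c / (4 / pi)) = 2^-1 by apply: (@mulfI _ 2); rewrite ?pnatr_eq0 // h divff ?pnatr_eq0.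
move=> h'; apply: (mulIf (lt0r_neq0 p0)); rewrite mulVf ?gt_eqF //.
have : c * pi / 4 = 4^-1 by rewrite -[RHS](_ : 2^-1 ^+ 2 = _); [rewrite h'; move: (lt0r_neq0 p0); move: (pi : R) => p pn0; field | field].
by lra.
Qed.

Theorem theta_law (f : nat -> C) L (y : R) : (0 < L)%N -> ~~ odd L -> 0 < y ->
  (forall n, f (n + L)%N = f n) -> (forall n, (n <= L)%N -> f (L - n)%N = f n) ->
  gsum f (pi / (L%:R * y)) = (Num.sqrt (y / L%:R))%:C * gsum (fhat f L) (pi * y / L%:R).
Proof.
move=> L0 evL y0 per sym; have p0 : 0 < pi :> R := pi_gt0 R.
have Lr : 0 < L%:R :> R by rewrite ltr0n.
pose s : R := L%:R / (pi * y); have s0 : 0 < s by rewrite divr_gt0 // mulr_gt0.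
have [l0 [l01 l0s]] := gauss_start s0.
have eL : L = (2 * L./2)%N by rewrite -[LHS]odd_double_half (negPf evL) -mul2n.
have L20 : (0 < L./2)%N by lia.
have := @theta_limit _ _ s0 l01 l0s _ L20 _ f cmid_lim; rewrite -eL => /(_ per sym).
by have [-> -> ->] := theta_param p0 y0 Lr.
Qed.

End Trig.

(** * Gauss sums and twisted theta series *)

Section GaussSums.
Variable R : realType.
Local Notation C := R[i].
Local Open Scope complex_scope.
Local Notation ez := (@ez R).
Variables (F : finFieldType) (p : nat) (ep : F -> C).
Hypothesis cardF : #|F| = p.
Hypothesis epD : forall a b, ep (a + b) = ep a * ep b.
Hypothesis ep0 : ep 0 = 1.
Hypothesis sum_ep : forall a, \sum_x ep (a * x) = if a == 0 then p%:R else 0.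
Implicit Types a b s : F.

Definition gs a : C := \sum_x ep (a * x ^+ 2).

Lemma gs_sq a s : s != 0 -> gs (a * s ^+ 2) = gs a.
Proof.
move=> s0; rewrite [RHS](reindex_inj (mulfI s0)) /=; apply: eq_bigr => x _.
by congr ep; ring.
Qed.

Lemma gs_complete a b : (2 : F) * a != 0 ->
  \sum_x ep (a * x ^+ 2 + b * x) = ep (- (b ^+ 2 / (4 * a))) * gs a.
Proof using epD.
rewrite mulf_eq0 negb_or => /andP[n2 a0].
have n4 : (4 : F) != 0 by rewrite (_ : 4 = 2 * 2) ?mulf_neq0 // -natrM.
rewrite mulr_sumr (reindex_inj (addIr (- (b / (2 * a))))) /=; apply: eq_bigr => x _.
by rewrite -epD; congr ep; field; rewrite ?n2 ?a0 ?n4.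
Qed.

(** In the double sum replace x by x + y: the form a (x+y)^2 - a y^2 is linear in y, and
    orthogonality leaves only x = 0. *)
Lemma gs_mulN a : (2 : F) * a != 0 -> gs a * gs (- a) = p%:R.
Proof.
rewrite mulf_eq0 negb_or => /andP[n2 a0].
transitivity (\sum_x \sum_y ep (a * x ^+ 2) * ep (2 * a * x * y)).
  rewrite /gs mulr_suml; under eq_bigr do rewrite mulr_sumr.
  rewrite exchange_big [RHS]exchange_big; apply: eq_bigr => y _.
  rewrite [LHS](reindex_inj (addIr y)); apply: eq_bigr => x _.
  by rewrite -!epD; congr ep; ring.
rewrite (bigD1 0) //= [X in _ + X]big1 ?addr0 => [|x x0].
  rewrite (eq_bigr (fun=> 1)) => [|y _]; last by rewrite expr0n !mulr0 mul0r ep0 mulr1.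
  by rewrite sumr_const cardF.
by rewrite -mulr_sumr sum_ep ifF ?mulr0 //; apply/negbTE; rewrite !mulf_neq0.
Qed.

Hypothesis p_pr : prime p.
Hypothesis charF : p \in [pchar F].
Hypothesis p3 : (p %% 4 = 3)%N.
Hypothesis p_gt3 : (3 < p)%N.

Lemma Fp_nat_neq0 n : (0 < n < p)%N -> (n%:R : F) != 0.
Proof.
move=> /andP[n0 np]; rewrite -(dvdn_pcharf charF); apply/negP => /dvdn_leq.
by move=> /(_ n0); rewrite leqNgt np.
Qed.

Let n2 : (2 : F) != 0. Proof. by apply: Fp_nat_neq0; lia. Qed.

Lemma Fp_expp1 a : a != 0 -> a ^+ p.-1 = 1.
Proof.
move=> a0; apply: (mulfI a0); rewrite -exprS prednK ?prime_gt0 // mulr1.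
by rewrite -[X in _ ^+ X]cardF expf_card.
Qed.

Let q := (p %/ 4)%N.
Let pE : p = (4 * q + 3)%N. Proof. by rewrite {1}(divn_eq p 4) p3 mulnC. Qed.

(** For p = 3 (mod 4) the power a^((p+1)/4) squares to a or -a. *)
Lemma Fp_sqrt a : a != 0 -> exists2 s, s != 0 & s ^+ 2 = a \/ s ^+ 2 = - a.
Proof.
move=> a0; exists (a ^+ q.+1); first by rewrite expf_neq0.
have : (a ^+ (2 * q).+1) ^+ 2 = 1.
  by rewrite -exprM -(Fp_expp1 a0); congr (_ ^+ _); lia.
move/eqP; rewrite sqrf_eq1 -exprM (_ : (q.+1 * 2 = (2 * q).+1.+1)%N) ?exprS; last by lia.
by move=> /orP[] /eqP ->; [left; rewrite mulr1 | right; rewrite mulrN1].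
Qed.

Lemma Fp_sqN1 s : s ^+ 2 != -1.
Proof.
apply/eqP => e; have s0 : s != 0.
  by apply/eqP => s0; move: e; rewrite s0 expr0n => /eqP; rewrite eq_sym oppr_eq0 oner_eq0.
have := Fp_expp1 s0; rewrite (_ : p.-1 = (2 * (2 * q).+1)%N); last by lia.
rewrite exprM e -signr_odd /= oddM /= expr1 => /eqP.
by rewrite eq_sym -addr_eq0 -(natrD _ 1 1) (negPf n2).
Qed.

(** One of a, -a is a square, so gs(a) + gs(-a) is the same for all a != 0. The sum of all gs(a) is
    p, already attained by a = 0, hence the common value times p - 1 vanishes. *)
Lemma gs_N1 : gs 1 + gs (-1) = 0.
Proof.
have h a : a != 0 -> gs a + gs (- a) = gs 1 + gs (-1).
  move=> a0; have [s s0 [<-|e]] := Fp_sqrt a0.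
    by rewrite -(gs_sq 1 s0) mul1r -(gs_sq (-1) s0) mulN1r.
  have -> : a = - s ^+ 2 by rewrite e opprK.
  by rewrite opprK -(gs_sq 1 s0) mul1r -(gs_sq (-1) s0) mulN1r addrC.
have tot : \sum_a gs a = p%:R.
  rewrite /gs exchange_big /= (bigD1 0) //= [X in _ + X]big1 ?addr0 => [|x x0].
    rewrite (eq_bigr (fun=> 1)) => [|y _]; last by rewrite expr0n mulr0 ep0.
    by rewrite sumr_const cardF.
  under eq_bigr do rewrite mulrC.
  by rewrite sum_ep ifF //; apply/negbTE; rewrite expf_neq0.
have g0 : gs 0 = p%:R.
  rewrite /gs (eq_bigr (fun=> 1)) => [|y _]; last by rewrite mul0r ep0.
  by rewrite sumr_const cardF.
have tot' : \sum_(a | a != 0) gs a = 0.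
  by move: tot; rewrite (bigD1 0) //= g0 => /eqP; rewrite -subr_eq0 addrAC subrr add0r => /eqP.
have : \sum_(a | a != 0) (gs a + gs (- a)) = 0.
  rewrite big_split /= tot' add0r -[RHS]tot' [RHS](reindex_inj oppr_inj) /=.
  by apply: eq_bigl => a; rewrite oppr_eq0.
rewrite (eq_bigr _ h) sumr_const => /eqP; rewrite mulrn_eq0 => /orP[|/eqP //].
rewrite (eq_card (B := predC1 (0 : F))) // cardC1 cardF; move: p_gt3; clear; lia.
Qed.

Lemma gs_sqr a : a != 0 -> gs a ^+ 2 = - p%:R.
Proof.
have g1 : gs 1 ^+ 2 = - p%:R.
  have := @gs_mulN 1; rewrite mulr1 n2 => /(_ isT); have /eqP := gs_N1.
  by rewrite addrC addr_eq0 => /eqP ->; rewrite mulrN -expr2 => <-; rewrite opprK.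
move=> a0; have [s s0 [<-|e]] := Fp_sqrt a0; first by rewrite -[s ^+ 2]mul1r gs_sq.
have -> : a = -1 * s ^+ 2 by rewrite mulN1r e opprK.
rewrite gs_sq //; have /eqP := gs_N1.
by rewrite addrC addr_eq0 => /eqP ->; rewrite sqrrN.
Qed.

Lemma gs_N a : a != 0 -> gs (- a) = - gs a.
Proof.
move=> a0; have /eqP g := gs_N1; rewrite addrC addr_eq0 in g.
have [s s0 [<-|e]] := Fp_sqrt a0; first by rewrite -[s ^+ 2]mul1r -mulNr !gs_sq // (eqP g).
have -> : a = -1 * s ^+ 2 by rewrite mulN1r e opprK.
by rewrite -mulNr opprK !gs_sq // (eqP g) opprK.
Qed.

(** A square root s of -3 amounts to a primitive cube root of unity (s - 1)/2, which exists exactly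
    when 3 divides p - 1. *)
Lemma Fp_sqN3 : (exists s : F, s ^+ 2 = -3) <-> (p %% 3 = 1)%N.
Proof.
have n3 : (3 : F) != 0 by apply: Fp_nat_neq0; lia.
split=> [[s e]|e].
  have n4 : (4 : F) != 0 by rewrite (_ : 4 = 2 * 2) ?mulf_neq0 // -natrM.
  have [w w3] : exists w : F, w ^+ 2 + w + 1 = 0.
    exists ((s - 1) / 2).
    have -> : ((s - 1) / 2) ^+ 2 + (s - 1) / 2 + 1 = (s ^+ 2 + 3) / 4 by field; rewrite ?n2 ?n4.
    by rewrite e addNr mul0r.
  have w31 : w ^+ 3 = 1.
    have -> : w ^+ 3 = (w - 1) * (w ^+ 2 + w + 1) + 1 by ring.
    by rewrite w3 mulr0 add0r.
  have w0 : w != 0 by apply/eqP => w0; move: w31; rewrite w0 expr0n => /eqP; rewrite eq_sym oner_eq0.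
  have : w ^+ p = w by rewrite -[p in LHS]prednK ?prime_gt0 // exprS Fp_expp1 // mulr1.
  rewrite {1}(divn_eq p 3) exprD mulnC exprM w31 expr1n mul1r.
  have : (p %% 3 < 3)%N by rewrite ltn_pmod.
  case h : (p %% 3)%N => [|[|[|//]]] _ // ew.
    have : (3 %| p)%N by rewrite /dvdn h.
    by rewrite dvdn_prime2 // => /eqP h3; move: p_gt3; rewrite -h3.
  have w1 : w = 1 by apply: (mulfI w0); rewrite -expr2 ew mulr1.
  by case/eqP: n3; rewrite -w3 w1; ring.
have [m pm] : exists m, p.-1 = (3 * m)%N by exists (p %/ 3)%N; rewrite {1}(divn_eq p 3) e; lia.
have [u u0 um] : exists2 u : F, u != 0 & u ^+ m != 1.
  apply: contrapT => h; have {}h (u : F) : u != 0 -> u ^+ m = 1.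
    by move=> u0; apply: contrapT => /eqP um; apply: h; exists u.
  have m0 : (0 < m)%N by lia.
  pose P : {poly F} := 'X^m - 1.
  have szP : size P = m.+1 by rewrite /P -polyC1 size_XnsubC.
  have Pn0 : P != 0 by rewrite -size_poly_eq0 szP.
  have rt : all (root P) (enum (predC1 (0 : F))).
    apply/allP => u; rewrite mem_enum !inE => u0; have um := h u u0.
    by rewrite /root /P !hornerE um subrr.
  have := max_poly_roots Pn0 rt (enum_uniq _).
  by rewrite -cardE cardC1 cardF szP; lia.
have [w w3 um'] : exists2 w : F, w ^+ 3 = 1 & w != 1.
  by exists (u ^+ m) => //; rewrite -exprM mulnC -pm Fp_expp1.
have : (w - 1) * (w ^+ 2 + w + 1) = 0.
  have -> : (w - 1) * (w ^+ 2 + w + 1) = w ^+ 3 - 1 by ring.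
  by rewrite w3 subrr.
move/eqP; rewrite mulf_eq0 subr_eq0 (negPf um') /= => /eqP w2.
exists (2 * w + 1); apply/eqP; rewrite -subr_eq0 opprK; apply/eqP.
have -> : (2 * w + 1) ^+ 2 + 3 = 4 * (w ^+ 2 + w + 1) by ring.
by rewrite w2 mulr0.
Qed.

(** Since -1 is not a square, 3 is a square exactly when -3 is not, that is when p = 2 (mod 3);
    [chi12 p] records this. *)
Lemma gs_3 a : a != 0 -> gs (3 * a) = (chi12 p)%:~R * gs a.
Proof.
have n3 : (3 : F) != 0 by apply: Fp_nat_neq0; lia.
have p12 : (p %% 3 = 1 -> p %% 12 = 7)%N /\ (p %% 3 = 2 -> p %% 12 = 11)%N by lia.
have np3 : (p %% 3 != 0)%N.
  by apply/negP; rewrite -/(dvdn 3 p) dvdn_prime2 // => /eqP h3; move: p_gt3; rewrite -h3.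
move=> a0; have [s s0 [e|e]] := Fp_sqrt n3.
  rewrite mulrC -e gs_sq // /chi12.
  have : (p %% 3 != 1)%N.
    apply/eqP => /Fp_sqN3[t et]; have := Fp_sqN1 (t / s).
    by rewrite expr_div_n et e mulNr divff ?eqxx.
  move=> h; have h12 : (p %% 12 = 11)%N by lia.
  by rewrite h12 /= mul1r.
have -> : 3 * a = - a * s ^+ 2 by rewrite e; ring.
rewrite gs_sq // gs_N //; have h12 : (p %% 12 = 7)%N.
  by apply: p12.1; apply/Fp_sqN3; exists s.
by rewrite /chi12 h12 /= mulN1r.
Qed.

End GaussSums.

Section PrimeField.
Variable R : realType.
Local Notation C := R[i].
Local Open Scope complex_scope.
Local Notation ez := (@ez R).
Variable p : nat.
Hypothesis p_pr : prime p.
Let p0 : (0 < p)%N := prime_gt0 p_pr.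

Definition ep (x : 'F_p) : C := ez p (nat_of_ord x).

Lemma ez_ep n : ez p n = ep n%:R.
Proof. by rewrite /ep val_Fp_nat // ez_mod. Qed.

Lemma epD (a b : 'F_p) : ep (a + b) = ep a * ep b.
Proof.
have -> : a + b = ((nat_of_ord a) + (nat_of_ord b))%N%:R by rewrite natrD !natr_Zp.
by rewrite -ez_ep ezD.
Qed.

Lemma ep0 : ep 0 = 1. Proof. by rewrite /ep ez0. Qed.

Lemma sum_Fp (V : nmodType) (F : nat -> V) : \sum_(i < p) F i = \sum_(x : 'F_p) F x.
Proof. by rewrite -(big_mkord predT F) -[in LHS](Fp_cast p_pr) big_mkord. Qed.

Lemma sum_ep (a : 'F_p) : \sum_x ep (a * x) = if a == 0 then p%:R else 0.
Proof.
transitivity (\sum_(i < p) ez p (nat_of_ord a * i)).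
  by rewrite (sum_Fp (fun i => ez p (nat_of_ord a * i))); apply: eq_bigr => x _; rewrite ez_ep natrM !natr_Zp.
rewrite ez_sum //; congr (if _ then _ else _).
by rewrite (dvdn_pcharf (pchar_Fp p_pr)) natr_Zp.
Qed.

Definition gauss n : C := gs ep n%:R.

(** The divisibility hypothesis says that c represents -b^2/(4a) modulo p, so that completing the
    square can be stated without inverses. *)
Lemma gauss_complete a b c : ~~ (p %| 2 * a)%N -> (p %| b ^ 2 + 4 * a * c)%N ->
  \sum_(x < p) ez p (a * x ^ 2 + b * x) = ez p c * gauss a.
Proof.
rewrite !(dvdn_pcharf (pchar_Fp p_pr)) natrM => n2a e.
rewrite (sum_Fp (fun x => ez p (a * x ^ 2 + b * x))).
rewrite (eq_bigr (fun x : 'F_p => ep (a%:R * x ^+ 2 + b%:R * x))); last first.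
  by move=> x _; rewrite ez_ep natrD !natrM natr_Zp.
rewrite (gs_complete epD) //; congr (_ * _); rewrite ez_ep; congr ep.
move: n2a e; rewrite natrD !natrM mulf_eq0 negb_or.
move: (a%:R : 'F_p) (b%:R : 'F_p) (c%:R : 'F_p) => A B D /andP[n2 A0] /eqP e.
have n4 : (4 : 'F_p) != 0 by rewrite (_ : 4 = 2 * 2) ?mulf_neq0 // -natrM.
have n4A : 4 * A != 0 by rewrite mulf_neq0.
apply: (mulfI n4A); rewrite mulrN mulrCA mulfV // mulr1; apply/eqP.
by rewrite eq_sym -addr_eq0 addrC expr2 e.
Qed.

Hypothesis p3 : (p %% 4 = 3)%N.
Hypothesis p_gt3 : (3 < p)%N.

Lemma gauss_sqr a : ~~ (p %| a)%N -> gauss a ^+ 2 = - p%:R.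
Proof.
rewrite (dvdn_pcharf (pchar_Fp p_pr)).
by move=> h; apply: (gs_sqr _ _ _ _ _ _ _ _ h); first [exact: (card_Fp p_pr) | exact: epD | exact: ep0 | exact: sum_ep | exact: p_pr | exact: (pchar_Fp p_pr) | exact: p3 | exact: p_gt3].
Qed.

Lemma gauss_3 a : ~~ (p %| a)%N -> gauss (3 * a) = (chi12 p)%:~R * gauss a.
Proof.
rewrite (dvdn_pcharf (pchar_Fp p_pr)) /gauss natrM.
by move=> h; apply: gs_3; first [exact: h | exact: (card_Fp p_pr) | exact: epD | exact: ep0 | exact: sum_ep | exact: p_pr | exact: (pchar_Fp p_pr) | exact: p3 | exact: p_gt3].
Qed.

End PrimeField.

(** * Inversion of twisted theta series *)

Section Theta.
Variable R : realType.
Local Notation C := R[i].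
Local Open Scope complex_scope.
Local Notation ez := (@ez R).

Lemma ez_scale l m k : (0 < m)%N -> (0 < l)%N -> ez (l * m) (k * m) = ez l k.
Proof.
move=> m0 l0; rewrite /ez !natrM; congr cis.
have : l%:R != 0 :> R by rewrite pnatr_eq0 -lt0n.
have : m%:R != 0 :> R by rewrite pnatr_eq0 -lt0n.
move: (l%:R : R) (m%:R : R) (k%:R : R) (pi : R) => x y z t y0 x0.
by field; rewrite x0 y0.
Qed.

Lemma fhat_ez (f : nat -> C) L k : (0 < L)%N ->
  (forall n, f (n + L)%N = f n) -> (forall n, (n <= L)%N -> f (L - n)%N = f n) ->
  fhat f L k = \sum_(n < L) f n * ez L (k * n).
Proof.
move=> L0 per sym; pose x n : R := pi *+ 2 * (k * n)%:R / L%:R.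
have Lr : L%:R != 0 :> R by rewrite pnatr_eq0 -lt0n.
have xL : cis (- x L) = 1.
  apply: (mulIf (_ : cis (x L) != 0)); last first.
    rewrite mul1r -cisD addNr cis0 /x natrM mulrA mulfK // mulrC -cisX cis2pi expr1n //.
  by apply/eqP => h; have := @nrm_cis R (x L); rewrite h nrm0 => /eqP; rewrite eq_sym oner_eq0.
pose H n := f n * cis (- x n).
have HL : H L = H 0%N by rewrite /H -{1}[L]add0n per xL /x muln0 mulr0 mul0r oppr0 cis0.
have rev : \sum_(n < L) H n = \sum_(n < L) f n * ez L (k * n).
  transitivity (\sum_(n < L) H n.+1).
    apply: (addrI (H 0%N)); rewrite -[RHS](big_ord_recl L (fun i => H (nat_of_ord i)) : _ = _ + _).
    by rewrite big_ord_recr /= HL addrC.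
  rewrite -(big_mkord predT (fun n => H n.+1)) big_nat_rev /= big_mkord.
  apply: eq_bigr => n _; have ln := ltn_ord n.
  rewrite (_ : (0 + L - n.+1).+1 = (L - n)%N); last by lia.
  rewrite /H (sym n (ltnW ln)) (_ : - x (L - n)%N = - x L + x n); first by rewrite cisD xL mul1r.
  rewrite /x (_ : (k * (L - n))%:R = k%:R * L%:R - k%:R * n%:R :> R) ?natrM; first by ring.
  by rewrite natrB 1?ltnW // mulrBr.
have n2 : (2 : C) != 0 by rewrite pnatr_eq0.
apply: (mulfI n2).
have -> : 2 * (\sum_(n < L) f n * ez L (k * n)) = \sum_(n < L) f n * ez L (k * n) + \sum_(n < L) H n.
  by rewrite rev; ring.
rewrite -big_split /fhat mulr_sumr; apply: eq_bigr => n _ /=.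
by rewrite /H -mulrDr mulrCA /ez -/(x n) cis_cos rmorphMn /= -[in RHS]mulr_natl.
Qed.

Lemma gsumZ f B c (x : R) : 0 < x -> (forall n, nrm (f n) <= B) ->
  gsum (fun n => c * f n) x = c * gsum f x.
Proof.
move=> x0 fB; apply: csumE; have := hsumZ c (gsum_hsum x0 fB).
by rewrite (_ : (fun n => c * _) = (fun n => c * f n * (wt R n)%:C * (expR (- (x * n%:R ^+ 2)))%:C)) //; apply/funext => n; rewrite !mulrA.
Qed.

Section Twist.
Variables (p M mu j j' : nat) (B B' : nat -> C) (c : C).
Hypotheses (p_pr : prime p) (p_gt3 : (3 < p)%N).
Hypotheses (muM : (mu * M = 12)%N) (M0 : (0 < M)%N) (evM : ~~ odd M).
Hypothesis perB : forall n, B (n + M)%N = B n.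
Hypothesis symB : forall n, (n <= M)%N -> B (M - n)%N = B n.
Hypothesis ppM : (p * p = 1 %[mod M])%N.
Hypothesis hB : forall k, \sum_(a < M) B a * ez M (k * p * a) = c * B' k.
Hypothesis jj : (p %| 576 * j * j' + 1)%N.

(** Coefficients of a theta series in q^(mu n^2) after the twist by e(j/p). The condition mu M = 12
    covers eta (M = 12, mu = 1) and the three theta constants (M = 4, mu = 3). *)
Let f n := B n * ez p (j * (mu * n ^ 2)).
Let p0 : (0 < p)%N := prime_gt0 p_pr.
Let L := (M * p)%N.
Let L0 : (0 < L)%N. Proof. by rewrite muln_gt0 M0. Qed.

Lemma tw_per n : f (n + L)%N = f n.
Proof.
rewrite /f /L addnC mulnC per_mul //; congr (_ * _); apply: ez_eqm => //.
have -> : (j * (mu * (p * M + n) ^ 2) = (j * mu * (p * M * M + 2 * M * n)) * p + j * (mu * n ^ 2))%N by ring.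
by rewrite modnMDl.
Qed.

Lemma tw_sym n : (n <= L)%N -> f (L - n)%N = f n.
Proof.
move=> le; rewrite /f; congr (_ * _).
  by rewrite /L mulnC per_sym // mulnC.
apply: ez_eqm => //; apply/eqP; rewrite -(eqn_modDr (j * (mu * (2 * (L - n) * n)))); apply/eqP.
have -> : (j * (mu * (L - n) ^ 2) + j * (mu * (2 * (L - n) * n)) =
    (j * mu * L + j * mu * n) * (L - n))%N.
  rewrite -{3}(subnK le); move: (L - n)%N => t; ring.
have -> : (j * (mu * n ^ 2) + j * (mu * (2 * (L - n) * n)) = j * mu * n * (n + 2 * (L - n)))%N by ring.
have -> : ((j * mu * L + j * mu * n) * (L - n) = j * mu * (L - n) * M * p + j * mu * n * (L - n))%N.
  by rewrite {1}/L; ring.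
have -> : (j * mu * n * (n + 2 * (L - n)) = j * mu * n * M * p + j * mu * n * (L - n))%N.
  rewrite (_ : (n + 2 * (L - n) = L + (L - n))%N); last by lia.
  by rewrite {1}/L; ring.
by rewrite !modnMDl.
Qed.

Lemma coprime_Mp : coprime M p.
Proof.
rewrite coprime_sym prime_coprime //; apply/negP => d.
have : (p %| 12)%N by rewrite -muM dvdn_mull.
rewrite (_ : 12 = 2 ^ 2 * 3)%N // Euclid_dvdM // Euclid_dvdX // andbT.
by move=> /orP[] /dvdn_leq; lia.
Qed.

(** With v M = 1 (mod p) and p^2 = 1 (mod M), e(kn/(Mp)) = e(kpn/M) e(kvn/p), so by the Chinese
    remainder theorem the transform splits into that of B modulo M and a quadratic Gauss sum modulo
    p. Completing the square asks for p dividing (kv)^2 + 4 j j' mu^2 k^2; multiplied by M^2 this is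
    k^2 (1 + 576 j j') modulo p, where 576 = 4 * 12^2. *)
Lemma tw_fhat k : fhat f L k = c * gauss R p (j * mu) * (B' k * ez p (j' * (mu * k ^ 2))).
Proof.
have cMp := coprime_Mp.
rewrite (fhat_ez _ L0 tw_per tw_sym).
have [v [t vM]] : exists v t, (v * M = t * p + 1)%N.
  case: (egcdnP p M0) => v t e _; exists v, t.
  by rewrite e; congr (_ + _)%N; apply/eqP.
have ezL n : ez L (k * n) = ez M (k * p * n) * ez p (k * v * n).
  rewrite -(@ez_scale M p (k * p * n)) // -(@ez_scale p M (k * v * n)) // [(p * M)%N]mulnC -ezD.
  apply: ez_eqm => //; apply/eqP; rewrite chinese_remainder //.
  apply/andP; split; apply/eqP.
    rewrite (_ : (k * p * n * p + k * v * n * M = k * v * n * M + k * n * (p * p))%N); last by ring.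
    by rewrite modnMDl -[in RHS]modnMmr ppM modnMmr muln1.
  rewrite (_ : (k * p * n * p + k * v * n * M = k * p * n * p + k * n * (v * M))%N); last by ring.
  by rewrite modnMDl vM mulnDr muln1 mulnA modnMDl.
pose G a b := B a * ez M (k * p * a) * ez p (j * mu * b ^ 2 + k * v * b).
transitivity (\sum_(n < M * p) G (n %% M)%N (n %% p)%N).
  apply: eq_bigr => n _; rewrite ezL /f /G.
  have -> : B (n %% M)%N = B n by rewrite {2}(divn_eq n M) per_mul.
  have -> : ez M (k * p * (n %% M)) = ez M (k * p * n) by apply: ez_eqm => //; rewrite modnMmr.
  have -> : ez p (j * mu * (n %% p) ^ 2 + k * v * (n %% p)) = ez p (j * (mu * n ^ 2) + k * v * n).
    by apply: ez_eqm => //; rewrite -modnDm !modnMmr -modnMmr modnXm modnMmr mulnA modnDm.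
  by rewrite ezD; ring.
rewrite crt_sum // /G.
under eq_bigr do rewrite -mulr_sumr.
rewrite -mulr_suml hB (@gauss_complete _ _ p_pr (j * mu) (k * v) (j' * (mu * k ^ 2))).
- by rewrite [RHS]mulrACA [gauss _ _ _ * _]mulrC.
- have pj : ~~ (p %| j)%N.
    apply/negP => d; move: jj; rewrite dvdn_addr ?dvdn1; first by move/eqP; lia.
    by rewrite dvdn_mulr // dvdn_mull.
  rewrite Euclid_dvdM // negb_or; apply/andP; split.
    by apply/negP => /dvdn_leq; lia.
  rewrite Euclid_dvdM // negb_or pj /=; apply/negP => d.
  have : (p %| 12)%N by rewrite -muM dvdn_mulr.
  rewrite (_ : 12 = 2 ^ 2 * 3)%N // Euclid_dvdM // Euclid_dvdX // andbT.
  by move=> /orP[] /dvdn_leq; lia.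
have cM2 : coprime p (M ^ 2) by rewrite coprime_sym coprimeXl.
rewrite -(Gauss_dvdr _ cM2).
have -> : (M ^ 2 * ((k * v) ^ 2 + 4 * (j * mu) * (j' * (mu * k ^ 2))) =
   k ^ 2 * (v * M) ^ 2 + 4 * j * j' * k ^ 2 * (mu * M) ^ 2)%N by ring.
rewrite vM muM.
have -> : (k ^ 2 * (t * p + 1) ^ 2 + 4 * j * j' * k ^ 2 * 12 ^ 2 =
   k ^ 2 * (t * (t * p + 2)) * p + k ^ 2 * (576 * j * j' + 1))%N by ring.
by rewrite dvdn_addr ?dvdn_mull.
Qed.

Lemma twisted_theta_law B0 (y : R) : 0 < y -> (forall k, nrm (B' k) <= B0) ->
  gsum f (pi / (L%:R * y)) =
  (Num.sqrt (y / L%:R))%:C * (c * gauss R p (j * mu)) *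
  gsum (fun k => B' k * ez p (j' * (mu * k ^ 2))) (pi * y / L%:R).
Proof.
move=> y0 hB0; rewrite (theta_law L0 _ y0 tw_per tw_sym); last by rewrite /L oddM (negPf evM).
have -> : fhat f L = (fun k => c * gauss R p (j * mu) * (B' k * ez p (j' * (mu * k ^ 2)))).
  by apply/funext => k; rewrite tw_fhat.
rewrite (@gsumZ _ B0) ?mulrA // => [|n]; last by rewrite nrmM nrm_ez mulr1.
by rewrite divr_gt0 ?mulr_gt0 ?pi_gt0 ?ltr0n.
Qed.

End Twist.

Lemma hsum_squares (g : nat -> C) s mu : (0 < mu)%N -> hsum g s ->
  hsum (fun N => \sum_(n < N.+1) g n *+ (mu * n ^ 2 == N)%N) s.
Proof.
move=> mu0 hs e /hs[n0 hn]; exists (mu * n0 ^ 2)%N => K leK.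
have [m hm] : exists m, forall n, (n < m)%N = (mu * n ^ 2 < K)%N.
  have ex : exists m, (K <= mu * m ^ 2)%N by exists K; case: (K) => // k; nia.
  exists (ex_minn ex) => n; case: ex_minnP => m mK mmin; apply/idP/idP => [lt|lt].
    by rewrite ltnNge; apply/negP => /mmin; rewrite leqNgt lt.
  by rewrite ltnNge; apply/negP => le; have : (m ^ 2 <= n ^ 2)%N by [rewrite leq_exp2r]; nia.
have mK : (m <= K)%N.
  by rewrite leqNgt hm -leqNgt; case: (K) => // k; nia.
have -> : \sum_(N < K) \sum_(n < N.+1) g n *+ (mu * n ^ 2 == N)%N = \sum_(n < m) g n.
  transitivity (\sum_(N < K) \sum_(n < K) g n *+ (mu * n ^ 2 == N)%N).
    apply: eq_bigr => N _; have lN := ltn_ord N.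
    rewrite (@big_ord_widen _ _ _ N.+1 K (fun n => g n *+ (mu * n ^ 2 == N)%N)) // big_mkcond.
    apply: eq_bigr => n _; case: ifP => // /negbT; rewrite -leqNgt => le.
    by rewrite (_ : (_ == _) = false) //; apply/negbTE; nia.
  rewrite exchange_big /= [RHS](@big_ord_widen _ _ _ m K g) // [RHS]big_mkcond; apply: eq_bigr => n _.
  case: ifP; rewrite hm => h.
    rewrite (bigD1 (Ordinal h)) //= eqxx big1 ?addr0 // => N nN.
    by rewrite (_ : (_ == _) = false) //; apply/negbTE; apply: contra nN => /eqP E; apply/eqP/val_inj.
  rewrite big1 // => N _; rewrite (_ : (_ == _) = false) //; apply/negbTE.
  by apply/eqP => E; move: h; rewrite E ltn_ord.
apply: hn; have := hm m; rewrite ltnn => /esym/negbT; rewrite -leqNgt => h.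
by have := leq_trans leK h; rewrite leq_pmul2l // leq_exp2r.
Qed.

(** For even B, the theta series with terms B(n) q^(mu n^2) over all integers n, folded by [wt]. *)
Definition th mu (B : nat -> C) : fps C := dil mu (sqs (fun n => B n * (wt R n)%:C)).

Lemma th_coef mu B N : (0 < mu)%N ->
  th mu B N = \sum_(n < N.+1) (B n * (wt R n)%:C) *+ (mu * n ^ 2 == N)%N.
Proof.
move=> mu0; rewrite /th [LHS]/=; case: ifP => [/dvdnP[k ->]|nd].
  rewrite mulnK // mulnC.
  rewrite (@big_ord_widen _ _ _ k.+1 (mu * k).+1 (fun n => (B n * (wt R n)%:C) *+ (n ^ 2 == k)%N)); last by nia.
  rewrite big_mkcond; apply: eq_bigr => n _; rewrite eqn_pmul2l //.
  by case: ifP => // /negbT; rewrite -leqNgt => le; rewrite (_ : (_ == _) = false) //; apply/negbTE; nia.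
rewrite big1 // => n _; rewrite (_ : (_ == _) = false) //; apply/negbTE/eqP => E.
by rewrite -E dvdn_mulr in nd.
Qed.

Lemma ev_th mu B B0 u (x : R) : (0 < mu)%N -> 0 < x -> (forall n, nrm (B n) <= B0) -> nrm u = 1 ->
  ev (tw u (th mu B)) (expR (- x))%:C = gsum (fun n => B n * u ^+ (mu * n ^ 2)) (x * mu%:R).
Proof.
move=> mu0 x0 hB u1; apply: csumE.
have xm : 0 < x * mu%:R by rewrite mulr_gt0 ?ltr0n.
have hb n : nrm (B n * u ^+ (mu * n ^ 2)) <= B0 by rewrite nrmM nrmX u1 expr1n mulr1.
have := hsum_squares mu0 (gsum_hsum xm hb).
rewrite (_ : (fun N => \sum_(n < N.+1) _) = (fun n => tw u (th mu B) n * (expR (- x))%:C ^+ n)) //.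
apply/funext => N; rewrite (_ : tw u (th mu B) N = u ^+ N * th mu B N) // th_coef // mulrAC mulr_sumr; apply: eq_bigr => n _.
case: eqP => [e|_]; last by rewrite !mulr0n mulr0.
have -> : u ^+ N * (expR (- x))%:C ^+ N = u ^+ (mu * n ^ 2) * (expR (- x))%:C ^+ (mu * n ^ 2) by rewrite e.
rewrite !mulr1n.
have E : expR (- x) ^+ (mu * n ^ 2) = expR (- (x * mu%:R * n%:R ^+ 2)).
  by rewrite -expRM_natl; congr expR; rewrite natrM natrX; ring.
by rewrite -E rmorphXn /=; ring.
Qed.

Definition disc (a : fps C) := forall rho : R, 0 <= rho < 1 -> exists M, nle rho a M.

Lemma disc_bound (a : fps C) (A : R) : (forall n, nrm (a n) <= A) -> disc a.
Proof.
move=> h rho /andP[r0 r1]; exists (A * (1 - rho)^-1) => K.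
have A0 : 0 <= A by apply: le_trans (h 0%N); apply: nrm_ge0.
apply: (@le_trans _ _ (A * \sum_(n < K) rho ^+ n)); last by rewrite ler_wpM2l ?geom_le ?r0.
by rewrite mulr_sumr; apply: ler_sum => n _; rewrite ler_wpM2r ?exprn_ge0.
Qed.

Lemma discD a b : disc a -> disc b -> disc (a + b).
Proof.
move=> ha hb rho hr; have [M hM] := ha _ hr; have [M' hM'] := hb _ hr; have /andP[r0 _] := hr.
by exists (M + M'); apply: nleD.
Qed.
Lemma discN a : disc a -> disc (- a).
Proof. by move=> ha rho hr; have [M hM] := ha _ hr; exists M; apply: nleN. Qed.
Lemma discM a b : disc a -> disc b -> disc (a * b).
Proof.
move=> ha hb rho hr; have [M hM] := ha _ hr; have [M' hM'] := hb _ hr; have /andP[r0 _] := hr.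
by exists (M * M'); apply: nleM.
Qed.
Lemma disc_fC c : disc (fC c).
Proof. by move=> rho hr; exists (nrm c); apply: nle_fC. Qed.
Lemma disc1 : disc 1.
Proof. by move=> rho hr; exists 1; apply: nle1. Qed.
Lemma discX a k : disc a -> disc (a ^+ k).
Proof.
by move=> h; elim: k => [|k IHk]; [rewrite expr0; apply: disc1 | rewrite exprS; apply: discM].
Qed.
Lemma disc_tw u a : nrm u = 1 -> disc a -> disc (tw u a).
Proof. by move=> u1 h rho hr; have [M hM] := h _ hr; exists M; apply: nle_tw. Qed.
Lemma disc_th mu B B0 : (0 < mu)%N -> (forall n, nrm (B n) <= B0) -> disc (th mu B).
Proof.
move=> mu0 hB; have B00 : 0 <= B0 by apply: le_trans (hB 0%N); apply: nrm_ge0.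
have wB n : nrm (B n * (wt R n)%:C) <= B0 * 2.
  rewrite nrmM nrm_real; apply: ler_pM; rewrite ?nrm_ge0 ?normr_ge0 //.
  by rewrite /wt; case: n => [|n]; rewrite ger0_norm ?ler1n // ler_nat.
apply: (@disc_bound _ (B0 * 2)) => N.
rewrite (_ : th mu B N = if (mu %| N)%N then sqs (fun n => B n * (wt R n)%:C) (N %/ mu)%N else 0) //.
case: ifP => _; last by rewrite nrm0 mulr_ge0.
have [[k ->]|h] := sq_cases (N %/ mu); first by rewrite sqsE.
by rewrite sqs0 // nrm0 mulr_ge0.
Qed.

(** The value of e(z/24) at z = i y. *)
Definition Qy (y : R) : C := (expR (- (pi * y / 12)))%:C.

Lemma nrm_Qy y : 0 < y -> nrm (Qy y) < 1.
Proof.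
move=> y0; rewrite nrm_real ger0_norm ?expR_ge0 // expR_lt1 oppr_lt0.
by rewrite divr_gt0 // mulr_gt0 // pi_gt0.
Qed.

(** Inversion law of weight m/2 with multiplier k on the imaginary axis. For al = 1 and u = v = 1 it
    describes z -> -1/z; for al = 1/p, u = e(j/p), v = e(j'/p) it compares two terms of the Hecke
    operator at p. *)
Definition slaw (al : R) (u v : C) (m : nat) (k : C) (a a' : fps C) :=
  forall y, 0 < y -> ev (tw u a) (Qy (al / y)) = (Num.sqrt y ^+ m)%:C * k * ev (tw v a') (Qy (al * y)).

Lemma evM_disc a b z : disc a -> disc b -> nrm z < 1 -> ev (a * b) z = ev a z * ev b z.
Proof.
move=> ha hb z1; have hr : 0 <= nrm z < 1 by rewrite nrm_ge0.
by have [M hM] := ha _ hr; have [M' hM'] := hb _ hr; apply: (evM (nrm_ge0 z) (lexx _) hM hM').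
Qed.
Lemma evD_disc a b z : disc a -> disc b -> nrm z < 1 -> ev (a + b) z = ev a z + ev b z.
Proof.
move=> ha hb z1; have hr : 0 <= nrm z < 1 by rewrite nrm_ge0.
by have [M hM] := ha _ hr; have [M' hM'] := hb _ hr; apply: (evD (nrm_ge0 z) (lexx _) hM hM').
Qed.
Lemma evX_disc a k z : disc a -> nrm z < 1 -> ev (a ^+ k) z = ev a z ^+ k.
Proof.
move=> ha z1; have hr : 0 <= nrm z < 1 by rewrite nrm_ge0.
by have [M hM] := ha _ hr; apply: (evX (nrm_ge0 z) k (lexx _) hM).
Qed.
Lemma evZ_disc c a z : disc a -> nrm z < 1 -> ev (fC c * a) z = c * ev a z.
Proof.
move=> ha z1; have hr : 0 <= nrm z < 1 by rewrite nrm_ge0.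
by have [M hM] := ha _ hr; apply: (evZ (nrm_ge0 z) c (lexx _) hM).
Qed.

Lemma slawM al u v m k a a' n l b b' : 0 < al -> nrm u = 1 -> nrm v = 1 ->
  disc a -> disc a' -> disc b -> disc b' ->
  slaw al u v m k a a' -> slaw al u v n l b b' -> slaw al u v (m + n) (k * l) (a * b) (a' * b').
Proof.
move=> al0 u1 v1 da da' db db' ha hb y y0; rewrite !twM.
rewrite !evM_disc ?nrm_Qy ?divr_gt0 ?mulr_gt0 //; try exact: disc_tw.
by rewrite ha // hb // exprD rmorphM /=; ring.
Qed.

Lemma slawX al u v m k a a' n : 0 < al -> nrm u = 1 -> nrm v = 1 ->
  disc a -> disc a' -> slaw al u v m k a a' -> slaw al u v (n * m) (k ^+ n) (a ^+ n) (a' ^+ n).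
Proof.
move=> al0 u1 v1 da da' ha; elim: n => [|n IHn].
  by rewrite mul0n => y y0; rewrite !expr0 !tw1 !(ev1 ler01) !mulr1.
by rewrite mulSn !exprS; apply: slawM => //; apply: discX.
Qed.

Lemma slaw_twist p M mu j j' (B B' : nat -> C) c B0 :
  prime p -> (3 < p)%N -> (mu * M = 12)%N -> ~~ odd M ->
  (forall n, B (n + M)%N = B n) -> (forall n, (n <= M)%N -> B (M - n)%N = B n) ->
  (p * p = 1 %[mod M])%N -> (forall k, \sum_(a < M) B a * ez M (k * p * a) = c * B' k) ->
  (p %| 576 * j * j' + 1)%N -> (forall n, nrm (B n) <= B0) -> (forall n, nrm (B' n) <= B0) ->
  slaw p%:R^-1 (ez p j) (ez p j') 1
    (c / (Num.sqrt M%:R)%:C * (gauss R p (j * mu) / (Num.sqrt p%:R)%:C)) (th mu B) (th mu B').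
Proof.
move=> p_pr p3 muM evM per sym ppM hB jj b1 b2 y y0.
have p0 := prime_gt0 p_pr.
have M0 : (0 < M)%N by case: (M) muM => //; rewrite muln0.
have mu0 : (0 < mu)%N by case: (mu) muM.
have pr0 : 0 < p%:R :> R by rewrite ltr0n.
have Mr0 : 0 < M%:R :> R by rewrite ltr0n.
have e12 : (12 : R) = mu%:R * M%:R by rewrite -natrM muM.
have mur : mu%:R != 0 :> R by rewrite pnatr_eq0 -lt0n.
rewrite (ev_th mu0 _ b1 (nrm_ez _ _ _)); last by rewrite !divr_gt0 ?mulr_gt0 ?pi_gt0 ?invr_gt0.
rewrite (ev_th mu0 _ b2 (nrm_ez _ _ _)); last by rewrite !divr_gt0 ?mulr_gt0 ?pi_gt0 ?invr_gt0.
have [x1 x2] : pi * (p%:R^-1 / y) / 12 * mu%:R = pi / ((M * p)%:R * y) :> R /\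
   pi * (p%:R^-1 * y) / 12 * mu%:R = pi * y / (M * p)%:R :> R.
  move: (lt0r_neq0 pr0) (lt0r_neq0 Mr0) (lt0r_neq0 y0) mur; rewrite natrM e12.
  move: (p%:R : R) (M%:R : R) (mu%:R : R) (pi : R) => P N m t P0 N0 y00 m0.
  by split; field; rewrite ?P0 ?N0 ?y00 ?m0.
rewrite x1 x2.
under [fun n => B n * _]funext => n do rewrite -ezM.
under [fun n => B' n * _]funext => n do rewrite -ezM.
rewrite (twisted_theta_law p_pr p3 muM M0 evM per sym ppM hB jj y0 b2) expr1; congr (_ * _).
rewrite sqrtrM ?ltW // sqrtrV ?ltW ?ltr0n ?muln_gt0 ?M0 // natrM sqrtrM ?ltW //.
rewrite rmorphM fmorphV rmorphM /= invfM.
by ring.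
Qed.

Lemma slaw_base M mu (B B' : nat -> C) c B0 :
  (mu * M = 12)%N -> ~~ odd M ->
  (forall n, B (n + M)%N = B n) -> (forall n, (n <= M)%N -> B (M - n)%N = B n) ->
  (forall k, \sum_(a < M) B a * ez M (k * a) = c * B' k) ->
  (forall n, nrm (B n) <= B0) -> (forall n, nrm (B' n) <= B0) ->
  slaw 1 1 1 1 (c / (Num.sqrt M%:R)%:C) (th mu B) (th mu B').
Proof.
move=> muM evM per sym hB b1 b2 y y0.
have M0 : (0 < M)%N by case: (M) muM => //; rewrite muln0.
have mu0 : (0 < mu)%N by case: (mu) muM.
have Mr0 : 0 < M%:R :> R by rewrite ltr0n.
have e12 : (12 : R) = mu%:R * M%:R by rewrite -natrM muM.
have mur : mu%:R != 0 :> R by rewrite pnatr_eq0 -lt0n.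
rewrite (ev_th mu0 _ b1 (nrm1 _)); last by rewrite !divr_gt0 ?mulr_gt0 ?pi_gt0 ?invr_gt0.
rewrite (ev_th mu0 _ b2 (nrm1 _)); last by rewrite !divr_gt0 ?mulr_gt0 ?pi_gt0 ?invr_gt0.
have [x1 x2] : pi * (1 / y) / 12 * mu%:R = pi / (M%:R * y) :> R /\
   pi * (1 * y) / 12 * mu%:R = pi * y / M%:R :> R.
  move: (lt0r_neq0 Mr0) (lt0r_neq0 y0) mur; rewrite e12.
  move: (M%:R : R) (mu%:R : R) (pi : R) => N m t N0 y00 m0.
  by split; field; rewrite ?N0 ?y00 ?m0.
rewrite x1 x2.
under [fun n => B n * _]funext => n do rewrite expr1n mulr1.
under [fun n => B' n * _]funext => n do rewrite expr1n mulr1.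
rewrite (theta_law M0 evM y0 per sym).
have -> : fhat B M = (fun k => c * B' k) by apply/funext => k; rewrite fhat_ez.
rewrite (@gsumZ _ B0) //; last by rewrite divr_gt0 ?mulr_gt0 ?pi_gt0.
rewrite expr1 mulrA; congr (_ * _); rewrite sqrtrM ?ltW // sqrtrV ?ltW // rmorphM fmorphV /=.
by ring.
Qed.

Lemma chi12_mod n : chi12 (n %% 12) = chi12 n.
Proof. by rewrite /chi12 modn_mod. Qed.

Lemma chi12M m n : chi12 (m * n) = chi12 m * chi12 n.
Proof.
rewrite -chi12_mod -modnMm chi12_mod -(chi12_mod m) -(chi12_mod n).
have := ltn_pmod m (isT : (0 < 12)%N); have := ltn_pmod n (isT : (0 < 12)%N).
move: (m %% 12)%N (n %% 12)%N => a b.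
by do 12! (case: b => [|b]; first by do 12! (case: a => [|a] //)).
Qed.

Lemma cos_pi6 : 0 < cos (pi / 6 : R) /\ cos (pi / 6 : R) ^+ 2 = 3 / 4.
Proof.
have p0 := pi_gt0 R.
have c0 : 0 < cos (pi / 6 : R) by apply: cos_gt0_pihalf; apply/andP; split; lra.
split=> //; have : cis (pi / 6 : R) ^+ 3 = cis (pi / 2).
  by rewrite cisX; congr cis; field.
move/(congr1 (@complex.Re R)); rewrite /cis /= cos_pihalf; have := cos2Dsin2 (pi / 6 : R).
move: (cos _) (sin _) c0 => c s c0 cs h.
have : c * (4 * c ^+ 2 - 3) = 0 by rewrite -[RHS]h /=; nra.
move/eqP; rewrite mulf_eq0 gt_eqF //= subr_eq0 => /eqP h'.
by apply: (@mulfI _ 4); rewrite ?pnatr_eq0 // h'; field.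
Qed.

(** The primitive character is its own Fourier transform up to sqrt 12. With z = e(1/12) this is a
    finite check, from z^6 = -1 and z - z^5 = sqrt(12)/2. *)
Lemma sum_chi12 k : \sum_(a < 12) (chi12 a)%:~R / 2 * ez 12 (k * a) = (Num.sqrt 12%:R)%:C * ((chi12 k)%:~R / 2).
Proof.
pose z := ez 12 1; have zE n : ez 12 n = z ^+ n by rewrite -ezM mul1n.
have z12 : z ^+ 12 = 1 by rewrite -zE -[12%N]muln1 ez_l.
have z6 : z ^+ 6 = -1.
  rewrite -zE /ez (_ : _ / _ = pi); first by rewrite /cis cospi sinpi; apply/eqP; rewrite eq_complex /= oppr0 !eqxx.
  by rewrite -mulr_natl; field.
have h1 : z - z ^+ 5 = (Num.sqrt 12%:R / 2)%:C.
  have zc : z = cis (pi / 6) by rewrite /z /ez; congr cis; rewrite -mulr_natl; field.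
  have z5 : z ^+ 5 = cis (pi - pi / 6) by rewrite zc cisX; congr cis; field.
  have [c0 c2] := cos_pi6.
  have -> : Num.sqrt 12%:R = cos (pi / 6) *+ 4 :> R.
    have -> : (12%:R : R) = (cos (pi / 6) *+ 4) ^+ 2 by rewrite exprMn_n c2; field.
    by rewrite sqrtr_sqr ger0_norm // mulrn_wge0 // ltW.
  rewrite z5 zc /cis cosB sinB cospi sinpi; apply/eqP; rewrite eq_complex /=; apply/andP; split; apply/eqP.
    by field.
  by ring.
have z7 n : z ^+ (n + 6) = - z ^+ n by rewrite exprD z6 mulrN1.
transitivity ((z ^+ (1 * k) - z ^+ (5 * k) - z ^+ (7 * k) + z ^+ (11 * k)) / 2).
  do 12! rewrite big_ord_recl; rewrite big_ord0 /= /bump /= !zE /chi12 /= !mul0r !muln1 mul1n !(mulnC k).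
  by ring.
rewrite -(chi12_mod k).
have zk c : z ^+ (c * k) = z ^+ (c * (k %% 12)).
  by rewrite -!zE; apply: ez_eqm => //; rewrite modnMmr.
rewrite !zk.
have : (k %% 12 < 12)%N by rewrite ltn_pmod.
have n2 : (2 : C) != 0 by rewrite pnatr_eq0.
have s12 : (Num.sqrt 12%:R)%:C = 2 * (z - z ^+ 5).
  by rewrite h1 rmorphM fmorphV /= rmorph_nat; field.
rewrite s12; move: (k %% 12)%N => m.
pose zt n := match n with 0 => 1 | 1 => z | 2 => z ^+ 2 | 3 => z ^+ 3 | 4 => z ^+ 4 | 5 => z ^+ 5
  | 6 => -1 | 7 => - z | 8 => - z ^+ 2 | 9 => - z ^+ 3 | 10 => - z ^+ 4 | _ => - z ^+ 5 end.
have zm c : z ^+ c = zt (c %% 12)%N.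
  rewrite {1}(divn_eq c 12) exprD mulnC exprM z12 expr1n mul1r.
  have : (c %% 12 < 12)%N by rewrite ltn_pmod.
  by case: (c %% 12)%N => [|[|[|[|[|[|[|[|[|[|[|[|//]]]]]]]]]]]] _ //;
    rewrite /zt -?[RHS]z7 // -[RHS](z7 1%N).
rewrite !(zm (_ * m)%N); case: m => [|[|[|[|[|[|[|[|[|[|[|[|//]]]]]]]]]]]] _;
 (repeat match goal with |- context [zt ?a] => let v := eval vm_compute in a in progress (change (zt a) with (zt v)) end);
 rewrite /zt /chi12 /=; by field.
Qed.

(** Even n carry theta_4 and theta_3, odd n carry half of theta_2, whose coefficients become 1 once
    weighted by [wt]. In this common indexing the Fourier transform modulo 4 fixes theta_3 and
    exchanges the other two, up to constants. *)
Definition th4f n : C := if odd n then 0 else (-1) ^+ n./2.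
Definition th3f n : C := if odd n then 0 else 1.
Definition th2f n : C := if odd n then 2^-1 else 0.

Definition ii : C := 0 +i* 1.

Lemma ii2 : ii ^+ 2 = -1.
Proof. by rewrite expr2; apply/eqP; rewrite eq_complex /= !mul0r !mulr0 !mulr1 !addr0 sub0r oppr0 !eqxx. Qed.

Lemma sum4 (B : nat -> C) k : \sum_(a < 4) B a * ez 4 (k * a) =
  B 0%N + B 1%N * ii ^+ k + B 2%N * (-1) ^+ k + B 3%N * (- ii) ^+ k.
Proof.
have i1 : ez 4 1 = ii.
  rewrite /ez (_ : _ / _ = pi / 2); last by rewrite -mulr_natl; field.
  by rewrite /cis cos_pihalf sin_pihalf.
have zE n : ez 4 n = ii ^+ n by rewrite -i1 -ezM mul1n.
have i2 := ii2.
rewrite !big_ord_recl big_ord0 /= /bump /= !zE muln0 expr0 mulr1 muln1 addr0 -!addrA.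
congr (_ + (_ + (_ * _ + _ * _))); rewrite mulnC exprM ?i2 //.
by rewrite exprS i2 mulrN1.
Qed.

Lemma i_even k : ~~ odd k -> ii ^+ k = (-1) ^+ k./2 :> C.
Proof.
move=> ev; rewrite -{1}[k]odd_double_half (negPf ev) -mul2n exprM; congr (_ ^+ _).
exact: ii2.
Qed.

Lemma sum_th3 k : \sum_(a < 4) th3f a * ez 4 (k * a) = 2 * th3f k.
Proof.
rewrite sum4 /th3f /= !mul0r !addr0 !mul1r -signr_odd.
by case: odd; rewrite ?expr0 ?expr1; ring.
Qed.
Lemma sum_th4 k : \sum_(a < 4) th4f a * ez 4 (k * a) = 4 * th2f k.
Proof.
rewrite sum4 /th4f /th2f /= -[(-1) ^+ k]signr_odd.
by case: odd; rewrite ?expr0 ?expr1; field.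
Qed.
Lemma sum_th2 k : \sum_(a < 4) th2f a * ez 4 (k * a) = 1 * th4f k.
Proof.
rewrite sum4 /th4f /th2f /= !mul0r add0r addr0 mul1r [(- ii) ^+ k]exprNn -[(-1) ^+ k]signr_odd.
case: ifP => o; first by rewrite expr1; ring.
by rewrite expr0 mul1r i_even ?o //; field.
Qed.

Lemma th3f_odd k p : odd p -> th3f (k * p) = th3f k.
Proof. by move=> op; rewrite /th3f oddM op andbT. Qed.
Lemma th2f_odd k p : odd p -> th2f (k * p) = th2f k.
Proof. by move=> op; rewrite /th2f oddM op andbT. Qed.
Lemma th4f_odd k p : odd p -> th4f (k * p) = th4f k.
Proof.
move=> op; rewrite /th4f oddM op andbT; case: ifP => // o.
by rewrite -!i_even ?oddM ?o // exprM i_even ?o // -signr_odd; case: odd; rewrite ?expr0 ?expr1n // expr1 -signr_odd op.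
Qed.
End Theta.

(** * A valence bound *)

Section Liouville.
Variable R : realType.
Local Notation C := R[i].
Local Open Scope complex_scope.
Local Notation ez := (@ez R).
Implicit Types (a b : fps C) (z w : C).

Lemma fps_first a : a <> 0 -> exists m, a m != 0 /\ forall n, (n < m)%N -> a n = 0.
Proof.
move=> a0; have ex : exists m, a m != 0.
  apply: contrapT => h; apply: a0; apply: fpsP => n; apply: contrapT => /eqP an.
  by apply: h; exists n.
exists (ex_minn ex); case: ex_minnP => m am min; split=> // n lt.
by apply/eqP/negPn/negP => /min; rewrite leqNgt lt.
Qed.

Lemma fps_domain a b : a * b = 0 -> a = 0 \/ b = 0.
Proof.
move=> ab; apply: contrapT => /not_orP[/fps_first[m [am hm]] /fps_first[n [bn hn]]].
have := mulf_lead hm hn; rewrite ab => /esym/eqP.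
by rewrite mulf_eq0 (negPf am) (negPf bn).
Qed.

(** Identity theorem on a real interval: divided by its leading power of x, a nonzero series tends
    to a nonzero constant at 0, so it cannot vanish at every small x. *)
Lemma ev_small a (rho M : R) : 0 < rho -> nle rho a M ->
  (forall x : R, 0 < x <= rho -> ev a x%:C = 0) -> a = 0.
Proof.
move=> r0 hM h; apply: contrapT => /fps_first[m [am hm]].
have [b ab] := fX_div hm.
have bm : b 0%N = a m by rewrite ab fXM leqnn subnn.
have hb : nle rho b (M / rho ^+ m).
  move=> K; rewrite ler_pdivlMr ?exprn_gt0 //; apply: le_trans (hM (m + K)%N).
  rewrite big_split_ord -[X in X <= _]add0r; apply: lerD.
    by apply: sumr_ge0 => i _; rewrite mulr_ge0 ?nrm_ge0 ?exprn_ge0 // ltW.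
  rewrite mulr_suml; apply: ler_sum => i _; rewrite ab fXM /= leq_addr addKn.
  by rewrite exprD [rho ^+ m * _]mulrC mulrA.
have b1 : nle rho (b - fC (b 0%N)) (M / rho ^+ m + nrm (b 0%N)).
  by apply: nleD => //; [exact: ltW | apply: nleN; apply: nle_fC].
have [c bc] : exists c, b - fC (b 0%N) = fX C 1 * c.
  by apply: fX_div => -[|//] _; rewrite fpsD fpsN /= subrr.
have hc : nle rho c ((M / rho ^+ m + nrm (b 0%N)) / rho).
  move=> K; rewrite ler_pdivlMr //; apply: le_trans (b1 K.+1); rewrite bc.
  rewrite big_ord_recl -[X in X <= _]add0r; apply: lerD.
    by rewrite mulr_ge0 ?nrm_ge0 ?exprn_ge0 // ltW.
  rewrite mulr_suml; apply: ler_sum => i _; rewrite fXM lift0 /= subn1 /=.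
  by rewrite exprS [rho * _]mulrC mulrA.
set D := (_ / rho) in hc.
have D0 := nle_ge0 hc; have n0 : 0 < nrm (b 0%N).
  by rewrite lt_neqAle nrm_ge0 andbT eq_sym; apply/eqP => /nrm_eq0; rewrite bm; apply/eqP.
pose x := Num.min rho (nrm (b 0%N) / (2 * (D + 1))).
have D1 : 0 < 2 * (D + 1) by rewrite mulr_gt0 // ltr_wpDl.
have x0 : 0 < x by rewrite lt_min r0 divr_gt0.
have xr : x <= rho by rewrite ge_min lexx.
have zr : nrm x%:C <= rho by rewrite nrm_real (ger0_norm (ltW x0)).
have := h x; rewrite x0 xr => /(_ isT); rewrite ab (ev_fXM (ltW r0) _ zr hb) => /eqP.
rewrite mulf_eq0 expf_eq0 => /orP[/andP[_ /eqP/complexI xx]|/eqP evb]; first by rewrite xx ltxx in x0.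
have eb : b = fC (b 0%N) + fX C 1 * c by rewrite -bc addrC subrK.
have b1' := b1; rewrite bc in b1'.
have := evb; rewrite eb (evD (ltW r0) zr (@nle_fC R rho (b 0%N)) b1').
rewrite (ev_fC (ltW r0) _ zr) (ev_fXM (ltW r0) _ zr hc) expr1 => /eqP; rewrite addr_eq0 => /eqP e.
have h1 := ev_le (ltW r0) zr hc; have : nrm (b 0%N) <= x * D.
  rewrite {1}e nrmN nrmM nrm_real (ger0_norm (ltW x0)); apply: ler_wpM2l => //; exact: ltW.
have : x * (2 * (D + 1)) <= nrm (b 0%N) by rewrite -ler_pdivlMr // ge_min lexx orbT.
by nra.
Qed.

Section Comp.
Variables (X : fps C) (rho sigma : R).
Hypothesis rho0 : 0 < rho.
Hypothesis hX : nle rho X sigma.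

Let sig0 : 0 <= sigma := nle_ge0 hX.

(** Substitution of X into a, where X may have a nonzero constant term: each coefficient is an
    infinite sum, convergent because X^N has norm at most sigma^N. *)
Definition comp a : fps C := Fps (fun n => csum (fun N => a N * (X ^+ N) n)).

Let powX N n : nrm ((X ^+ N) n) * rho ^+ n <= sigma ^+ N.
Proof.
have := nleX (ltW rho0) N hX n.+1; rewrite big_ord_recr /=.
by apply: le_trans; rewrite lerDr; apply: sumr_ge0 => i _; rewrite mulr_ge0 ?nrm_ge0 ?exprn_ge0 // ltW.
Qed.

Lemma comp_hsum a M n : nle sigma a M -> hsum (fun N => a N * (X ^+ N) n) (comp a n).
Proof.
move=> ha; apply: (@asum_hsum _ _ (M / rho ^+ n)) => K.
rewrite ler_pdivlMr ?exprn_gt0 // mulr_suml; apply: le_trans (ha K); apply: ler_sum => N _.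
by rewrite nrmM -mulrA ler_wpM2l ?nrm_ge0.
Qed.

Definition pcomp K a : fps C := \sum_(N < K) fC (a N) * X ^+ N.

Lemma nle_pcomp K a M : nle sigma a M -> nle rho (pcomp K a) M.
Proof.
move=> ha; apply: nle_le (ha K) _; apply: (nle_sum (ltW rho0)) => N.
by apply: nleM; [exact: ltW | exact: nle_fC | apply: nleX => //; exact: ltW].
Qed.

Lemma nle_comp a M : nle sigma a M -> nle rho (comp a) M.
Proof.
move=> ha K; apply: le_eps => e e0.
have [J hJ] : exists J, \sum_(n < K) nrm (comp a n - pcomp J a n) * rho ^+ n <= e.
  suff [J0 hJ] : exists J0, forall J, (J0 <= J)%N -> \sum_(n < K) nrm (comp a n - pcomp J a n) * rho ^+ n <= e.
    by exists J0; apply: hJ.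
  elim: (K) e e0 => [|k IHk] e e0; first by exists 0%N => J _; rewrite big_ord0 ltW.
  have e2 : 0 < e / 2 by lra.
  have [J1 h1] := IHk _ e2.
  have [J2 h2] := comp_hsum k ha (divr_gt0 e2 (exprn_gt0 k rho0)).
  exists (maxn J1 J2) => J; rewrite geq_max => /andP[/h1 {}h1 /h2 {}h2].
  rewrite big_ord_recr /= (splitr e); apply: lerD => //.
  rewrite -ler_pdivlMr ?exprn_gt0 // nrm_distC; apply: le_trans h2.
  by rewrite /pcomp fps_sum; under eq_bigr do rewrite fCM.
apply: le_trans (_ : _ <= \sum_(n < K) nrm (pcomp J a n) * rho ^+ n + \sum_(n < K) nrm (comp a n - pcomp J a n) * rho ^+ n) _.
  rewrite -big_split; apply: ler_sum => n _.
  apply: le_trans (_ : _ <= (nrm (pcomp J a n) + nrm (comp a n - pcomp J a n)) * rho ^+ n) _; last by rewrite mulrDl.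
  apply: ler_wpM2r; first by rewrite exprn_ge0 // ltW.
  by have := nrmD (pcomp J a n) (comp a n - pcomp J a n); rewrite subrKC.
by apply: lerD => //; apply: nle_pcomp.
Qed.

Lemma comp_tail K a M : nle sigma a M -> comp (a - ftr K a) = comp a - pcomp K a.
Proof.
move=> ha; apply: fpsP => n; apply: csumE => e e0.
have [J0 h] := comp_hsum n ha e0; exists (maxn J0 K) => J; rewrite geq_max => /andP[/h {}h KJ].
apply: le_trans h; rewrite fpsD fpsN /pcomp fps_sum.
have -> : \sum_(N < J) (a - ftr K a) N * (X ^+ N) n =
   \sum_(N < J) a N * (X ^+ N) n - \sum_(N < K) (fC (a N) * X ^+ N) n.
  rewrite (eq_bigr (fun N : 'I_K => a N * (X ^+ N) n) (fun N _ => fCM _ _ _)).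
  rewrite (@big_ord_widen _ _ _ K J (fun N => a N * (X ^+ N) n)) // [Z in _ = _ - Z]big_mkcond -sumrB.
  apply: eq_bigr => N _; rewrite fpsD fpsN (_ : ftr K a N = if (N < K)%N then a N else 0) //.
  by case: ifP; rewrite ?subrr ?mul0r ?subr0.
by rewrite opprB addrA subrK.
Qed.

Lemma ev_comp a M w : nle sigma a M -> nrm w <= rho -> ev (comp a) w = ev a (ev X w).
Proof.
move=> ha wr; have Xw := ev_le (ltW rho0) wr hX.
apply/eqP; rewrite -subr_eq0; apply/eqP; apply: nrm_eq0.
apply/eqP; rewrite eq_le nrm_ge0 andbT; apply: le_eps => e e0; rewrite add0r.
have e2 : 0 < e / 2 by lra.
have [K1 h1] := nle_tail sig0 ha e2; have [K2 h2] := ev_hsum sig0 Xw ha e2.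
pose K := maxn K1 K2; have {}h1 := h1 K (leq_maxl _ _); have {}h2 := h2 K (leq_maxr _ _).
have -> : comp a = pcomp K a + comp (a - ftr K a) by rewrite (comp_tail K ha) subrKC.
rewrite (evD (ltW rho0) wr (nle_pcomp K ha) (nle_comp h1)).
have -> : ev (pcomp K a) w = \sum_(N < K) a N * ev X w ^+ N.
  rewrite /pcomp (ev_sum (M := fun N : 'I_K => nrm (a N) * sigma ^+ N) (ltW rho0) _ wr).
    by apply: eq_bigr => N _; rewrite (evZ (ltW rho0) _ wr (nleX (ltW rho0) N hX)) (evX (ltW rho0) N wr hX).
  by move=> N; apply: nleM; [exact: ltW | exact: nle_fC | apply: nleX => //; exact: ltW].
have t := ev_le (ltW rho0) wr (nle_comp h1).
rewrite addrAC; apply: le_trans (nrmD _ _) _.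
by rewrite (splitr e); apply: lerD; [exact: h2 | exact: t].
Qed.

End Comp.

Definition fe (d : C) : fps C := Fps (fun n => d ^+ n / n`!%:R).

Lemma nle_fe d (rho : R) : 0 <= rho -> nle rho (fe d) (expR (nrm d * rho)).
Proof.
move=> r0 K; have x0 : 0 <= nrm d * rho by rewrite mulr_ge0 ?nrm_ge0.
have -> : \sum_(n < K) nrm (fe d n) * rho ^+ n = series (exp_coeff (nrm d * rho)) K.
  rewrite /series /= big_mkord; apply: eq_bigr => n _.
  by rewrite nrmM nrmX nrmV nrm_nat /exp_coeff /= exprMn mulrAC.
apply: nondecreasing_cvgn_le; last exact: is_cvg_series_exp_coeff.
by apply: nondecreasing_series => n _ _; rewrite /exp_coeff /= divr_ge0 // exprn_ge0.
Qed.

Lemma feM d e : fe d * fe e = fe (d + e).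
Proof.
apply: fpsP => n; rewrite fpsM [RHS](_ : _ = (e + d) ^+ n / n`!%:R); last by rewrite addrC.
rewrite exprDn mulr_suml; apply: eq_bigr => i _.
have le : (i <= n)%N by rewrite -ltnS.
have := bin_fact le; move/(congr1 (fun n => n%:R : C)); rewrite !natrM => h.
have f0 k : k`!%:R != 0 :> C by rewrite pnatr_eq0 -lt0n fact_gt0.
have b0 : 'C(n, i)%:R != 0 :> C by rewrite pnatr_eq0 -lt0n bin_gt0.
rewrite -h -mulr_natr /=; move: b0 (f0 i) (f0 (n - i)%N) {h}.
move: ('C(n, i)%:R : C) (i`!%:R : C) ((n - i)`!%:R : C) => B I J B0 I0 J0.
by field; rewrite ?B0 ?I0 ?J0.
Qed.

Definition cexp (s : C) : C := ev (fe s) 1.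

Lemma cexpE s t : ev (fe s) t = cexp (s * t).
Proof.
rewrite /cexp /ev; congr csum; apply/funext => n /=.
by rewrite expr1n mulr1 exprMn mulrAC.
Qed.

Lemma cexpD s t : cexp (s + t) = cexp s * cexp t.
Proof.
rewrite /cexp -feM (evM (rho := 1) ler01 _ (nle_fe _ ler01) (nle_fe _ ler01)) //.
by rewrite nrm1.
Qed.

Lemma cexp_real (x : R) : cexp x%:C = (expR x)%:C.
Proof.
apply: csumE => e e0.
have : (series (exp_coeff x) @ \oo --> expR x)%classic by apply: is_cvg_series_exp_coeff.
move/cvg_eps/(_ _ e0) => [K0 h]; exists K0 => K /h; apply: le_trans.
have -> : \sum_(n < K) fe x%:C n * 1 ^+ n = (series (exp_coeff x) K)%:C.
  rewrite /series /= big_mkord rmorph_sum; apply: eq_bigr => n _ /=.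
  by rewrite expr1n mulr1 /exp_coeff /= rmorphM rmorphXn fmorphV rmorph_nat.
by rewrite -rmorphB nrm_real.
Qed.

Lemma cexp_im (x : R) : cexp (ii R * x%:C) = cis x.
Proof.
apply: csumE => e e0; have e2 : 0 < e / 2 by lra.
have : (series (cos_coeff x) @ \oo --> cos x)%classic.
  by rewrite cos.unlock; exact: (@is_cvg_series_cos_coeff R x).
move/cvg_eps/(_ _ e2) => [K1 h1].
have : (series (sin_coeff x) @ \oo --> sin x)%classic.
  by rewrite sin.unlock; exact: (@is_cvg_series_sin_coeff R x).
move/cvg_eps/(_ _ e2) => [K2 h2].
exists (maxn K1 K2) => K; rewrite geq_max => /andP[/h1 {}h1 /h2 {}h2].
have -> : \sum_(n < K) fe (ii R * x%:C) n * 1 ^+ n = (series (cos_coeff x) K) +i* (series (sin_coeff x) K).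
  rewrite /series /= !big_mkord; elim: (K) => [|k IHk]; first by rewrite !big_ord0.
  rewrite !big_ord_recr /= IHk expr1n mulr1.
  have -> : (ii R * x%:C) ^+ k / k`!%:R = (cos_coeff x k) +i* (sin_coeff x k).
    rewrite exprMn /cos_coeff /sin_coeff /=.
    have fE : (k`!%:R : C)^-1 = (k`!%:R^-1)%:C by rewrite fmorphV rmorph_nat.
    have ke : k = (odd k + k./2.*2)%N by rewrite odd_double_half.
    have iE : ii R ^+ k = if odd k then 0 +i* (-1) ^+ k./2 else ((-1) ^+ k./2)%:C.
      rewrite {1}ke exprD -mul2n exprM ii2; case: (odd k); rewrite ?expr0 ?mul1r ?expr1.
        by rewrite -[(-1) ^+ k./2 in RHS]signr_odd -[(-1) ^+ k./2 in LHS]signr_odd; case: odd; rewrite ?expr0 ?expr1; apply/eqP; rewrite eq_complex /=; apply/andP; split; apply/eqP; ring.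
      by rewrite rmorphXn rmorphN rmorph1.
    have kp : odd k -> k.-1./2 = k./2 by move=> o; rewrite {1}ke o /= doubleK.
    rewrite iE -rmorphXn fE; case: (boolP (odd k)) => o /=; rewrite ?(kp o) -exprnP.
      by apply/eqP; rewrite eq_complex /=; apply/andP; split; apply/eqP; ring.
    by apply/eqP; rewrite eq_complex /=; apply/andP; split; apply/eqP; ring.
  by [].
apply: le_trans (nrm_le_ReIm _) _; rewrite /cis /=.
by rewrite (splitr e); apply: lerD.
Qed.

Lemma cexpRI (x y : R) : cexp (x +i* y) = (expR x)%:C * cis y.
Proof.
rewrite -cexp_im -cexp_real -cexpD; congr cexp.
by apply/eqP; rewrite eq_complex /=; apply/andP; split; apply/eqP; ring.
Qed.

Lemma nrm_cexp s : nrm (cexp s) = expR (complex.Re s).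
Proof. by case: s => x y; rewrite cexpRI nrmM nrm_cis nrm_real mulr1 ger0_norm ?expR_ge0. Qed.

(** Averaging over the K-th roots of unity isolates one coefficient of the truncation at K, and the
    tail is small in norm. *)
Lemma cauchy_estimate a (rho M B : R) n : 0 <= rho -> nle rho a M ->
  (forall z, nrm z = rho -> nrm (ev a z) <= B) -> nrm (a n) * rho ^+ n <= B.
Proof.
move=> r0 hM hB; apply: le_eps => e e0.
have [K0 hK] := nle_tail r0 hM e0; pose K := maxn K0 n.+1.
have {}hK := hK K (leq_maxl _ _); have nK : (n < K)%N by rewrite leq_max leqnn orbT.
have K_gt0 : (0 < K)%N by apply: leq_ltn_trans nK.
pose z k := rho%:C * ez K k.
have zr k : nrm (z k) = rho by rewrite nrmM nrm_ez mulr1 nrm_real ger0_norm.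
have htr := nle_ftr r0 K hM.
have evtr k : nrm (ev (ftr K a) (z k)) <= B + e.
  have -> : ev (ftr K a) (z k) = ev a (z k) - ev (a - ftr K a) (z k).
    rewrite (evB r0 _ hM htr) ?zr ?lexx //; ring.
  apply: le_trans (nrmB _ _) _; apply: lerD; first exact: hB (zr k).
  by apply: (ev_le r0 _ hK); rewrite zr.
have evE k : ev (ftr K a) (z k) = \sum_(N < K) a N * rho%:C ^+ N * ez K (N * k).
  apply: csumE; have := @hsum_fin _ (fun N => ftr K a N * z k ^+ N) K.
  rewrite (eq_bigr (fun N : 'I_K => a N * rho%:C ^+ N * ez K (N * k))).
    by apply=> N le; rewrite (_ : ftr K a N = 0) ?mul0r //= ltnNge le.
  move=> N _; rewrite (_ : ftr K a N = a N) /=; last by rewrite ltn_ord.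
  by rewrite /z exprMn -ezM mulnC mulrA.
have avg : \sum_(k < K) ev (ftr K a) (z k) * ez K ((K - n) * k) = K%:R * (a n * rho%:C ^+ n).
  under eq_bigr do rewrite evE mulr_suml.
  rewrite exchange_big /= (bigD1 (Ordinal nK)) //= [Z in _ + Z]big1 ?addr0 => [|N nN].
    rewrite (eq_bigr (fun=> a n * rho%:C ^+ n)); last first.
      by move=> k _; rewrite -mulrA -ezD -mulnDl (subnKC (ltnW nK)) (@ez_l R K k K_gt0); exact: mulr1.
    by rewrite sumr_const card_ord mulr_natl.
  rewrite (eq_bigr (fun k : 'I_K => a N * rho%:C ^+ N * ez K ((N + (K - n)) * k))); last first.
    by move=> k _; rewrite -mulrA -ezD -mulnDl.
  rewrite -mulr_sumr ez_sum // ifF ?mulr0 //; apply/negbTE/negP => /dvdnP[q e1].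
  have lN := ltn_ord N; have : nat_of_ord N != n by apply: contraNN nN => /eqP h; apply/eqP/val_inj.
  have : (q = 1)%N by nia.
  by move=> q1; move: e1; rewrite q1; lia.
have Kr : 0 < K%:R :> R by rewrite ltr0n.
have : nrm (\sum_(k < K) ev (ftr K a) (z k) * ez K ((K - n) * k)) <= K%:R * (B + e).
  apply: le_trans (nrm_sum _ _ _) _; apply: le_trans (_ : _ <= \sum_(k < K) (B + e)) _.
    by apply: ler_sum => k _; rewrite nrmM nrm_ez mulr1.
  by rewrite sumr_const card_ord mulr_natl.
by rewrite avg nrmM nrm_nat ler_pM2l // nrmM nrmX nrm_real ger0_norm.
Qed.

(** From b = 1 + g b, the partial norm s satisfies s <= 1 + m s. Truncations are used since the norm
    of b is not known to be finite; g(0) = 0 makes the first K coefficients of b determine those of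
    g b. *)
Lemma nle_inv g b (rho m : R) : 0 <= rho -> m < 1 -> nle rho g m -> (1 - g) * b = 1 -> g 0%N = 0 ->
  nle rho b (1 - m)^-1.
Proof.
move=> r0 m1 hg gb g0 K; have p : 0 < 1 - m by rewrite subr_gt0.
have m0 := nle_ge0 hg.
pose s := \sum_(n < K) nrm (b n) * rho ^+ n; rewrite -[leLHS]/s.
have hs : nle rho (ftr K b) s.
  move=> N; have [le|lt] := leqP N K.
    apply: le_trans (_ : _ <= \sum_(n < N) nrm (b n) * rho ^+ n) _.
      by apply: ler_sum => n _ /=; rewrite (leq_trans (ltn_ord n) le).
    rewrite /s (@big_ord_widen _ _ _ N K (fun n => nrm (b n) * rho ^+ n)) // big_mkcond.
    by apply: ler_sum => n _; case: ifP => // _; rewrite mulr_ge0 ?nrm_ge0 ?exprn_ge0.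
  rewrite /s (@big_ord_widen _ _ _ K N (fun n => nrm (b n) * rho ^+ n)) ?(ltnW lt) // [leRHS]big_mkcond.
  by apply: ler_sum => n _ /=; case: ifP => // _; rewrite nrm0 mul0r.
have bE n : (n < K)%N -> b n = (1 + g * ftr K b) n.
  move=> lt; have bb : b = 1 + g * b by rewrite -gb mulrBl mul1r subrK.
  rewrite {1}bb !fpsD; congr (_ + _); rewrite [LHS]fpsM [RHS]fpsM; apply: eq_bigr => -[[|i] hi] _ /=.
    by rewrite g0 !mul0r.
  by rewrite (_ : (n - i.+1 < K)%N) //; lia.
have h := nleD r0 (@nle1 R rho) (nleM r0 hg hs).
have : s <= 1 + m * s.
  apply: le_trans (h K); rewrite /s; apply: ler_sum => n _; rewrite bE //.
by move=> hle; rewrite -[leRHS]mul1r ler_pdivlMr //; nra.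
Qed.

Lemma nle_dil m a (rho M : R) : (0 < m)%N -> 0 <= rho -> nle (rho ^+ m) a M -> nle rho (dil m a) M.
Proof.
move=> m0 r0 h K; apply: le_trans (h K.+1).
apply: le_trans (_ : _ <= \sum_(n < (K * m).+1) nrm (dil m a n) * rho ^+ n) _.
  rewrite (@big_ord_widen _ _ _ K (K * m).+1 (fun n => nrm (dil m a n) * rho ^+ n)) ?(leqW (leq_pmulr _ _)) // [leLHS]big_mkcond.
  by apply: ler_sum => n _; case: ifP => // _; rewrite mulr_ge0 ?nrm_ge0 ?exprn_ge0.
rewrite -(big_mkord predT (fun n => nrm (dil m a n) * rho ^+ n)).
rewrite (bigID (fun i => m %| i)%N) /= [Z in _ + Z]big1 ?addr0; last by move=> i /negPf ->; rewrite nrm0 mul0r.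
rewrite (sum_multiples (fun n => nrm (dil m a n) * rho ^+ n)) // big_mkord.
by apply: ler_sum => n _ /=; rewrite dvdn_mull // mulnK // [(n * m)%N]mulnC exprM.
Qed.

(** The series w/(1-w), which enters through (1+w)/(1-w) = 1 + 2w/(1-w). *)
Definition geomf : fps C := Fps (fun n => (n != 0%N)%:R).

Lemma nle_geomf (rho : R) : 0 <= rho < 1 -> nle rho geomf (rho / (1 - rho)).
Proof.
move=> hr [|K]; have /andP[r0 r1] := hr.
  by rewrite big_ord0 divr_ge0 // subr_ge0 ltW.
rewrite big_ord_recl /= nrm0 mul0r add0r.
rewrite (eq_bigr (fun i : 'I_K => rho * rho ^+ i)); last by move=> i _; rewrite nrm1 mul1r /bump /= exprS.
by rewrite -mulr_sumr ler_wpM2l // geom_le.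
Qed.

Lemma ev_geomf w : nrm w < 1 -> ev geomf w = w / (1 - w).
Proof.
move=> w1; have hr : 0 <= nrm w < 1 by rewrite nrm_ge0.
have w0 : 1 - w != 0.
  by apply/eqP => /subr0_eq h; move: w1; rewrite -h nrm1 ltxx.
have e : geomf = fX C 1 + fX C 1 * geomf.
  apply: fpsP => -[|[|n]]; rewrite fpsD fXM //=; [by rewrite addr0| by rewrite addr0|by rewrite add0r].
have h := nle_geomf hr.
have r0 := nrm_ge0 w.
apply: (mulIf w0); rewrite divfK // mulrBr mulr1.
rewrite {1}e (evD r0 (lexx _) (nle_fX r0 1) (nleM r0 (nle_fX r0 1) h)) (ev_fX r0) (ev_fXM r0 _ (lexx _) h) expr1.
by ring.
Qed.

(** * Continuation of the inversion law off the imaginary axis *)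

Definition cc : R := pi / 12.

(* The nome [exp (- cc z)] at [z = (1 + w) / (1 - w)], as a series in [w] *)
Definition Xw : fps C := fC (expR (- cc))%:C * comp geomf (fe (- (2 * cc))%:C).

(** On the segment Re s = 3/4, |Im s| <= 1/2 the modulus of w = (s-1)/(s+1) is at most sqrt(5/53),
    just under 31/100. On the other side the radius has to stay under 1/3, since then 2 rw/(1 - rw)
    < 1 and [sw] < 1. *)
Definition rw : R := 31 / 100.
Definition sw : R := expR (- cc) * expR (2 * cc * (rw / (1 - rw))).

Lemma cc0 : 0 < cc. Proof. by rewrite divr_gt0 ?pi_gt0. Qed.
Lemma rw0 : 0 < rw. Proof. by rewrite divr_gt0. Qed.
Lemma rw01 : 0 <= rw < 1. Proof. by rewrite /rw; lra. Qed.

Lemma nle_Xw : nle rw Xw sw.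
Proof.
have r0 := ltW rw0; apply: nleM => //.
  have h := @nle_fC R rw (expR (- cc))%:C.
  by rewrite nrm_real ger0_norm ?expR_ge0 in h.
apply: (nle_comp rw0 (nle_geomf rw01)).
have d0 : 0 <= rw / (1 - rw) by have /andP[_ r1] := rw01; rewrite divr_ge0 // subr_ge0 ltW.
have := nle_fe (- (2 * cc))%:C d0; rewrite nrm_real normrN ger0_norm // mulr_ge0 //.
exact: ltW cc0.
Qed.

Lemma sw1 : 0 <= sw < 1.
Proof.
rewrite /sw mulr_ge0 ?expR_ge0 //= -expRD expR_lt1.
have c0 := cc0; have : rw / (1 - rw) = 31 / 69 by rewrite /rw; field.
by move=> ->; lra.
Qed.

Lemma ev_Xw w : nrm w <= rw -> ev Xw w = cexp (- cc%:C * ((1 + w) / (1 - w))).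
Proof.
move=> wr; have r0 := ltW rw0; have /andP[_ r1] := rw01.
have w0 : 1 - w != 0.
  by apply/eqP => /subr0_eq h; move: wr; rewrite -h nrm1 leNgt r1.
have d0 : 0 <= rw / (1 - rw) by rewrite divr_ge0 // subr_ge0 ltW.
have hf := nle_fe (- (2 * cc))%:C d0.
rewrite (evZ r0 _ wr (nle_comp rw0 (nle_geomf rw01) hf)) (ev_comp rw0 (nle_geomf rw01) hf wr).
rewrite cexpE -cexp_real -cexpD (ev_geomf (le_lt_trans wr r1)).
have -> : (- cc)%:C + (- (2 * cc))%:C * (w / (1 - w)) = - cc%:C * ((1 + w) / (1 - w)); last by [].
have -> : (- (2 * cc))%:C = - (2 * cc%:C) by rewrite rmorphN rmorphM (rmorph_nat (real_complex R) 2).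
have -> : (- cc)%:C = - cc%:C by rewrite rmorphN.
by move: w0 (cc%:C : C) => w0 c; field.
Qed.

Definition zlaw r a b := forall y : R, 0 < y -> ev a (Qy (1 / y)) = (y ^+ r)%:C * ev b (Qy y).

(* Both sides are power series in w that agree for small real w. *)
Lemma continuation r a b w : disc a -> disc b -> zlaw r a b -> nrm w <= rw ->
  ev a (ev Xw (- w)) * (1 - w) ^+ r = (1 + w) ^+ r * ev b (ev Xw w).
Proof.
move=> da db h wr; have r0 := ltW rw0; have /andP[_ r1] := rw01.
have [Ma ha] := da _ sw1; have [Mb hb] := db _ sw1.
have n1 : nrm (-1 : C) = 1 by rewrite nrmN nrm1.
have [A [hA' evA]] : exists A, nle rw A Ma /\ forall v, nrm v <= rw -> ev A v = ev a (ev Xw (- v)).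
  exists (tw (-1) (comp Xw a)); split; first exact: nle_tw n1 (nle_comp rw0 nle_Xw ha).
  move=> v vr; have vr' : nrm (- v) <= rw by rewrite nrmN.
  by rewrite ev_tw mulN1r (ev_comp rw0 nle_Xw ha vr').
have [B [hB' hevB]] : exists B, nle rw B Mb /\ forall v, nrm v <= rw -> ev B v = ev b (ev Xw v).
  exists (comp Xw b); split; first exact: (nle_comp rw0 nle_Xw hb).
  by move=> v vr; rewrite (ev_comp rw0 nle_Xw hb vr).
pose um : fps C := 1 - fX C 1; pose up : fps C := 1 + fX C 1.
have hum : nle rw um (1 + rw ^+ 1) by apply: nleD => //; [exact: nle1 | apply: nleN; exact: nle_fX].
have hup : nle rw up (1 + rw ^+ 1) by apply: nleD => //; [exact: nle1 | exact: nle_fX].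
have evum v : nrm v <= rw -> ev um v = 1 - v.
  by move=> vr; rewrite (evB r0 vr (@nle1 R rw) (nle_fX r0 1)) (ev1 r0) (ev_fX r0) expr1.
have evup v : nrm v <= rw -> ev up v = 1 + v.
  by move=> vr; rewrite (evD r0 vr (@nle1 R rw) (nle_fX r0 1)) (ev1 r0) (ev_fX r0) expr1.
have lhs v : nrm v <= rw -> ev (A * um ^+ r) v = ev a (ev Xw (- v)) * (1 - v) ^+ r.
  move=> vr; rewrite (evM r0 vr hA' (nleX r0 r hum)) (evX r0 r vr hum) (evum v vr) (evA v vr).
  by [].
have rhs v : nrm v <= rw -> ev (up ^+ r * B) v = (1 + v) ^+ r * ev b (ev Xw v).
  move=> vr; rewrite (evM r0 vr (nleX r0 r hup) hB') (evX r0 r vr hup) (evup v vr) (hevB v vr).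
  by [].
suff E : A * um ^+ r = up ^+ r * B by rewrite -(lhs w wr) E (rhs w wr).
apply/eqP; rewrite -subr_eq0; apply/eqP.
have hd := nleD r0 (nleM r0 hA' (nleX r0 r hum)) (nleN (nleM r0 (nleX r0 r hup) hB')).
apply: (ev_small rw0 hd) => x /andP[x0 xr].
have xr' : nrm x%:C <= rw by rewrite nrm_real ger0_norm // ltW.
rewrite (evB r0 xr' (nleM r0 hA' (nleX r0 r hum)) (nleM r0 (nleX r0 r hup) hB')) (lhs _ xr') (rhs _ xr').
have x1 : x < 1 by apply: le_lt_trans xr r1.
(* In the Cayley coordinate the inversion y -> 1/y is the sign change x -> -x. *)
pose y := (1 + x) / (1 - x).
have p1 : 0 < 1 - x by rewrite subr_gt0.
have p2 : 0 < 1 + x by rewrite addr_gt0.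
have y0 : 0 < y by rewrite divr_gt0.
have c1 : 1 - x%:C = (1 - x)%:C by rewrite rmorphB rmorph1.
have c2 : 1 + x%:C = (1 + x)%:C by rewrite rmorphD rmorph1.
have X1 : ev Xw x%:C = Qy y.
  rewrite (ev_Xw xr').
  have -> : - cc%:C * ((1 + x%:C) / (1 - x%:C)) = (- (cc * y))%:C.
    by rewrite c1 c2 -(fmorphV (real_complex R)) -rmorphM mulNr -rmorphM -rmorphN.
  by rewrite cexp_real /Qy /cc mulrAC.
have xrN : nrm (- x%:C) <= rw by rewrite nrmN.
have X2 : ev Xw (- x%:C) = Qy (1 / y).
  rewrite (ev_Xw xrN) opprK.
  have -> : - cc%:C * ((1 - x%:C) / (1 + x%:C)) = (- (cc * (1 / y)))%:C.
    have -> : 1 / y = (1 - x) / (1 + x) by rewrite /y; field; rewrite !gt_eqF.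
    by rewrite c1 c2 -(fmorphV (real_complex R)) -rmorphM mulNr -rmorphM -rmorphN.
  by rewrite cexp_real /Qy /cc mulrAC.
rewrite X1 X2 (h _ y0) c1 c2 -!rmorphXn mulrAC -rmorphM.
have -> : y ^+ r * (1 - x) ^+ r = (1 + x) ^+ r by rewrite -exprMn /y divfK // gt_eqF.
by rewrite subrr.
Qed.

Lemma nle_div m b (rho M : R) : 0 < rho -> nle rho (fX C m * b) M -> nle rho b (M / rho ^+ m).
Proof.
move=> r0 h K; rewrite ler_pdivlMr ?exprn_gt0 //; apply: le_trans (h (m + K)%N).
rewrite big_split_ord -[leLHS]add0r; apply: lerD.
  by apply: sumr_ge0 => i _; rewrite mulr_ge0 ?nrm_ge0 ?exprn_ge0 // ltW.
rewrite mulr_suml; apply: ler_sum => i _; rewrite fXM /= leq_addr addKn.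
by rewrite exprD [rho ^+ m * _]mulrC mulrA.
Qed.

Lemma fps_X0 a k : a ^+ k = 0 -> a = 0.
Proof.
elim: k => [|k IHk]; first by move=> /eqP; rewrite expr0 oner_eq0.
by rewrite exprS => /fps_domain[|/IHk].
Qed.

Lemma ev_tw_law u e a b z : tw u a = fC e * b -> disc b -> nrm z < 1 -> ev a (u * z) = e * ev b z.
Proof. by move=> h db z1; rewrite -ev_tw h evZ_disc. Qed.

Lemma nrm_cancel (u u' d d' a a' : C) : u' * d' = a' -> u * d = a -> nrm a' = nrm a ->
  nrm d' = nrm d -> nrm d != 0 -> nrm u' = nrm u.
Proof. by move=> <- <- h hd d0; apply: (mulIf d0); rewrite -{1}hd -!nrmM. Qed.

(** The eta function as a series in e(z/24), written as the theta series of (12/n) so that Poisson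
    summation applies to it. *)
Definition Beta : fps C := th 1 (fun n => (chi12 n)%:~R / 2).
Definition zeta : C := ez 24 1.

Lemma nrm_zeta : nrm zeta = 1. Proof. exact: nrm_ez. Qed.

Lemma chi12_bound n : nrm ((chi12 n)%:~R / 2 : C) <= 1.
Proof.
rewrite nrmM nrmV nrm_nat /chi12.
have h2 : (2 : R)^-1 <= 1 by rewrite invf_le1 // ler1n.
by case: (n %% 12)%N => [|[|[|[|[|[|[|[|[|[|[|[|m]]]]]]]]]]]]; rewrite ?mulrN1z ?nrmN ?mulr1z ?mulr0z ?nrm1 ?nrm0 ?mul1r ?mul0r.
Qed.

Lemma disc_Beta : disc Beta.
Proof. exact: disc_th (isT : (0 < 1)%N) chi12_bound. Qed.

Lemma Beta_coef N : Beta N = (sqs chi12 N)%:~R.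
Proof.
rewrite /Beta th_coef // [sqs _ _]/= rmorph_sum; apply: eq_bigr => n _; rewrite mul1n raddfMn; congr (_ *+ _).
case: (nat_of_ord n) => [|m]; first by rewrite /chi12 /= mul0r mul0r.
by rewrite /wt -(rmorph_nat (real_complex R)) divfK // rmorph_nat pnatr_eq0.
Qed.

Lemma chi12_sq x : chi12 x != 0 -> (x ^ 2 %% 24 = 1)%N.
Proof.
move=> h; have : (x %% 12 \in [:: 1; 5; 7; 11])%N.
  by move: h; rewrite /chi12; case: (x %% 12)%N => [|[|[|[|[|[|[|[|[|[|[|[|m]]]]]]]]]]]].
rewrite !inE => h'; rewrite {1}(divn_eq x 12); move: (x %/ 12)%N => q.
move: h' => /or4P[] /eqP ->.
- by rewrite (_ : ((q * 12 + 1) ^ 2 = (6 * q ^ 2 + q) * 24 + 1)%N) ?modnMDl //; ring.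
- by rewrite (_ : ((q * 12 + 5) ^ 2 = (6 * q ^ 2 + 5 * q + 1) * 24 + 1)%N) ?modnMDl //; ring.
- by rewrite (_ : ((q * 12 + 7) ^ 2 = (6 * q ^ 2 + 7 * q + 2) * 24 + 1)%N) ?modnMDl //; ring.
- by rewrite (_ : ((q * 12 + 11) ^ 2 = (6 * q ^ 2 + 11 * q + 5) * 24 + 1)%N) ?modnMDl //; ring.
Qed.

Lemma sqs_chi12 N : (N %% 24 != 1)%N -> sqs chi12 N = 0.
Proof.
move=> h; have [[x e]|hx] := sq_cases N; last exact: sqs0.
rewrite e sqsE; apply/eqP/negPn/negP => /chi12_sq; rewrite -e => h'.
by rewrite h' eqxx in h.
Qed.

Definition eulerC : fps C := Fps (fun n => (euler int n)%:~R).

Lemma Beta_euler : Beta = fX C 1 * dil 24 eulerC.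
Proof.
apply: fpsP => N; rewrite Beta_coef fXM; case: N => [|N]; first by rewrite sqs_chi12.
rewrite ltnS leq0n (_ : (N.+1 - 1 = N)%N); last by rewrite subn1.
rewrite (_ : dil 24 eulerC N = if (24 %| N)%N then (euler int (N %/ 24)%N)%:~R else 0) //.
case: ifP => [/dvdnP[k ->]|nd].
  by rewrite mulnK // pentagonal mulnC addn1.
rewrite sqs_chi12 // -addn1; apply/negP => /eqP h; move: nd; rewrite /dvdn; lia.
Qed.

(** All coefficients of the Euler product are 0 or of modulus 1, so the terms beyond the constant
    one weigh at most q/(1-q) <= 1/3. *)
Lemma nle_eulerC (q : R) : 0 <= q <= 4^-1 -> nle q (1 - eulerC) 3^-1.
Proof.
move=> /andP[q0 q1] [|K]; first by rewrite big_ord0 invr_ge0.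
have e0 : eulerC 0%N = 1.
  rewrite [eulerC 0%N](_ : _ = (euler int 0)%:~R) // pentagonal (_ : (24 * 0 + 1 = 1 ^ 2)%N) // sqsE //.
rewrite big_ord_recl fpsD fpsN fps1 e0 subrr nrm0 mul0r add0r.
have q01 : 0 <= q < 1 by rewrite q0 (le_lt_trans q1) // invf_lt1 // ltr1n.
apply: le_trans (_ : _ <= \sum_(i < K) q * q ^+ i) _.
  apply: ler_sum => i _; rewrite lift0 fpsD fpsN fps1 (_ : (i.+1 == 0)%N = false) // sub0r nrmN exprS.
  rewrite [eulerC _](_ : _ = (euler int i.+1)%:~R) // pentagonal.
  rewrite -[leRHS]mul1r ler_wpM2r ?mulr_ge0 ?exprn_ge0 //.
  have [[x ->]|h] := sq_cases (24 * i.+1 + 1); last by rewrite sqs0 // nrm0.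
  rewrite sqsE /chi12.
  by case: (x %% 12)%N => [|[|[|[|[|[|[|[|[|[|[|[|m]]]]]]]]]]]]; rewrite ?mulrN1z ?nrmN ?mulr1z ?mulr0z ?nrm1 ?nrm0.
rewrite -mulr_sumr; apply: le_trans (ler_wpM2l q0 (geom_le K q01)) _.
rewrite ler_pdivrMr; last by lra.
by lra.
Qed.

Lemma tw_Beta : tw zeta Beta = fC zeta * Beta.
Proof.
apply: fpsP => N; rewrite fCM [LHS](_ : _ = zeta ^+ N * Beta N) // Beta_coef.
have [e|ne] := eqVneq (N %% 24)%N 1%N; last by rewrite sqs_chi12 // !mulr0.
by congr (_ * _); rewrite /zeta -ezM mul1n -(@ez_mod R 24 N) // e.
Qed.

Lemma slaw_Beta : slaw 1 1 1 1 1 Beta Beta.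
Proof.
have := @slaw_base R 12 1 (fun n => (chi12 n)%:~R / 2) (fun n => (chi12 n)%:~R / 2) (Num.sqrt 12%:R)%:C 1.
rewrite divff; last first.
  by apply/eqP => /complexI /eqP; rewrite sqrtr_eq0 leNgt ltr0n.
apply=> //; try exact: chi12_bound.
- by move=> n; rewrite -chi12_mod modnDr chi12_mod.
- move=> n le; congr (_%:~R / _).
  by do 13! (case: n le => [|n] // le).
- exact: sum_chi12.
Qed.

Lemma sqrt_pow (y : R) r : 0 < y -> Num.sqrt y ^+ (2 * r) = y ^+ r.
Proof. by move=> y0; rewrite exprM sqr_sqrtr // ltW. Qed.

Lemma zlaw_slaw r a b : slaw 1 1 1 (2 * r) 1 a b -> zlaw r a b.
Proof.
move=> h y y0; have := h y y0; rewrite !ev_tw !mul1r mulr1 sqrt_pow //.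
Qed.

Lemma zlaw_Beta r : zlaw (3 * r) (Beta ^+ (6 * r)) (Beta ^+ (6 * r)).
Proof.
apply: zlaw_slaw.
have := @slawX R 1 1 1 1 1 Beta Beta (6 * r) ltr01 (nrm1 R) (nrm1 R) disc_Beta disc_Beta slaw_Beta.
by rewrite expr1n muln1 (_ : (6 * r = 2 * (3 * r))%N) // mulnA.
Qed.

(** Moduli of e(z/24) at heights 3/4 and 4/5. For s = 3/4 + iu with |u| <= 1/2 the real part of 1/s
    is at least 12/13, so 4/5 leaves room. *)
Definition rho1 : R := expR (- (cc * (3 / 4))).
Definition rho2 : R := expR (- (cc * (4 / 5))).

Lemma rho1_01 : 0 < rho1 < 1.
Proof. by rewrite /rho1 expR_gt0 expR_lt1 oppr_lt0 mulr_gt0 ?cc0 ?divr_gt0. Qed.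

Lemma rho1_24 : 0 <= rho1 ^+ 24 <= 4^-1.
Proof.
have /andP[h0 _] := rho1_01; rewrite (exprn_ge0 _ (ltW h0)) /= /rho1 -expRM_natl mulrN expRN.
rewrite lef_pV2 ?posrE ?expR_gt0 //; apply: le_trans (expR_ge1Dx _).
have := pi_ge2 R; rewrite /cc; lra.
Qed.

Lemma rho21 : 0 < rho2 / rho1 < 1.
Proof.
rewrite /rho1 /rho2 divr_gt0 ?expR_gt0 //= ltr_pdivrMr ?expR_gt0 // mul1r ltr_expR.
by have := cc0; lra.
Qed.

(* Every point of the circle of radius [rho1] is the nome of some [s] with
   [Re s = 3/4] and [|Im s| <= 1/2], up to a 24th root of unity. *)
Lemma circle_point z : nrm z = rho1 -> exists n (u : R),
  [/\ `|u| <= 1 / 2 & z = zeta ^+ n * cexp (- cc%:C * (3 / 4 +i* u))].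
Proof.
move=> hz; have /andP[r0 _] := rho1_01; have p0 := pi_gt0 R.
have [th [th0 hth]] : exists th : R, 0 <= th /\ z = rho1%:C * cis th.
  pose A := complex.Re z / rho1; pose B := complex.Im z / rho1.
  have AB : A ^+ 2 + B ^+ 2 = 1.
    have : nrm z ^+ 2 = rho1 ^+ 2 by rewrite hz.
    rewrite nrm_def sqr_sqrtr ?addr_ge0 ?sqr_ge0 // /A /B !expr_div_n -mulrDl => ->.
    by rewrite divff // expf_neq0 // gt_eqF.
  have A1 : -1 <= A <= 1 by have sB := sqr_ge0 B; apply/andP; split; nra.
  have sB : sin (acos A) = `|B|.
    by rewrite sin_acos // -sqrtr_sqr; congr Num.sqrt; lra.
  have cA : cos (acos A) = A by rewrite acosK // in_itv.
  have zE (t : R) : cos t = A -> sin t = B -> z = rho1%:C * cis t.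
    move=> ct st; rewrite /cis ct st /A /B; case: (z) => a b /=; apply/eqP; rewrite eq_complex /=.
    by apply/andP; split; apply/eqP; field; rewrite gt_eqF.
  have [B0|B0] := leP 0 B.
    exists (acos A); split; first exact: acos_ge0.
    by apply: zE => //; rewrite sB ger0_norm.
  exists (- acos A + pi *+ 2); split.
    by have := acos_lepi A1; rewrite mulr2n; lra.
  apply: zE; first by rewrite cosD2pi cosN cA.
  by rewrite sinD2pi sinN sB ltr0_norm // opprK.
pose n := Num.truncn (th * 12 / pi + 1 / 2).
have x0 : 0 <= th * 12 / pi + 1 / 2 by rewrite addr_ge0 // divr_ge0 ?mulr_ge0 // ltW.
have /andP[n1 n2] := truncn_itv x0; rewrite -/n -natr1 in n1 n2.
pose u : R := n%:R - th * 12 / pi.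
exists n, u; split; first by rewrite ler_norml /u; lra.
have -> : - cc%:C * (3 / 4 +i* u) = (- (cc * (3 / 4))) +i* (- (cc * u)).
  by apply/eqP; rewrite eq_complex /=; apply/andP; split; apply/eqP; ring.
rewrite cexpRI -/rho1 hth mulrCA; congr (_ * _).
rewrite /zeta -ezM mul1n /ez -cisD; congr cis; rewrite /u /cc mulr2n.
by move: (lt0r_neq0 p0); move: (pi : R) => p pn0; field.
Qed.

Lemma region (u : R) (s : C) : s = 3 / 4 +i* u -> `|u| <= 1 / 2 ->
  exists w, [/\ nrm w <= rw, 1 - w != 0, 1 + w != 0, (1 + w) / (1 - w) = s & 4 / 5 <= complex.Re ((1 - w) / (1 + w))].
Proof.
move=> hs hu; have hu2 : u ^+ 2 <= 1 / 4.
  by move: hu; rewrite ler_norml => /andP[h1 h2]; nra.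
have s1 : s + 1 != 0.
  apply/eqP => /(congr1 (@complex.Re R)); rewrite hs /=; lra.
have s0 : s != 0.
  by apply/eqP => /(congr1 (@complex.Re R)); rewrite hs /=; lra.
have n2 : (2 : C) != 0 by rewrite pnatr_eq0.
have w1 : 1 - (s - 1) / (s + 1) = 2 / (s + 1) by field.
have w2 : 1 + (s - 1) / (s + 1) = 2 * s / (s + 1) by field.
exists ((s - 1) / (s + 1)); split.
- rewrite nrmM nrmV ler_pdivrMr; last first.
    by rewrite lt_neqAle nrm_ge0 andbT eq_sym; apply/eqP => /nrm_eq0/eqP; rewrite (negPf s1).
  have h0 : 0 <= rw * nrm (s + 1) := mulr_ge0 (ltW rw0) (nrm_ge0 _).
  rewrite -(ler_pXn2r (isT : (0 < 2)%N)) ?nnegrE ?nrm_ge0 //.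
  rewrite exprMn !nrm_def !sqr_sqrtr ?addr_ge0 ?sqr_ge0 // hs /= /rw; nra.
- by rewrite w1 mulf_neq0 ?invr_eq0.
- by rewrite w2 !mulf_neq0 ?invr_eq0.
- by rewrite w1 w2; field; rewrite ?s1 ?n2 ?s0.
have -> : (1 - (s - 1) / (s + 1)) / (1 + (s - 1) / (s + 1)) = s^-1.
  by rewrite w1 w2; field; rewrite ?s1 ?n2 ?s0.
rewrite hs /= ler_pdivlMr; last by nra.
by nra.
Qed.

Local Opaque ev cexp Xw zeta.

Lemma triple_law (m p x1 x2 x3 y1 y2 y3 : C) r :
  x1 * m ^+ r = p ^+ r * y1 -> x2 * m ^+ r = p ^+ r * y3 -> x3 * m ^+ r = p ^+ r * y2 ->
  x1 * x2 * x3 * m ^+ (3 * r) = p ^+ (3 * r) * (y1 * y2 * y3).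
Proof.
rewrite (_ : (3 * r = r + r + r)%N) ?exprD; last by lia.
move=> k1 k2 k3; transitivity (x1 * m ^+ r * (x2 * m ^+ r) * (x3 * m ^+ r)); first by ring.
by rewrite k1 k2 k3; ring.
Qed.

Lemma ratio_cancel (u u' d d' a a' m p : C) : u * d = a -> u' * d' = a' ->
  a' * m = p * a -> d' * m = p * d -> d != 0 -> p != 0 -> u = u'.
Proof.
move=> <- <- h1 h2 d0 p0; apply: (mulIf d0); apply: (mulfI p0).
by rewrite -h1 -mulrA h2; ring.
Qed.

Lemma rho2_le : rho2 <= rho1.
Proof. by rewrite ler_expR lerN2 ler_pM2l ?cc0 //; lra. Qed.

Lemma circle_inversion z : nrm z = rho1 -> exists n w,
  [/\ nrm w <= rw, 1 - w != 0, 1 + w != 0 & z = zeta ^+ n * ev Xw w] /\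
  nrm (ev Xw w) = rho1 /\ nrm (ev Xw (- w)) <= rho2.
Proof.
move=> /circle_point[n [u [hu ->]]]; have [w [wr wm wp ws wre]] := region erefl hu.
have wrN : nrm (- w) <= rw by rewrite nrmN.
have Rem (c : R) (v : C) : complex.Re (- c%:C * v) = - (c * complex.Re v).
  by case: v => a b /=; ring.
exists n, w; split; first by split; [exact: wr | exact: wm | exact: wp | rewrite (ev_Xw wr) ws].
split; first by rewrite (ev_Xw wr) ws nrm_cexp Rem /rho1.
rewrite (ev_Xw wrN) opprK nrm_cexp Rem.
by rewrite /rho2 ler_expR lerN2 ler_pM2l ?cc0.
Qed.

(** The product A of the three conjugates has weight 3r and order at least 6r + 24. Dividing by
    [Beta] to the power 6r, which has the same weight and no zero off the origin, leaves U of weight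
    0 and order at least 24, whose modulus is invariant under translation and inversion. Hence every
    value of |U| on the circle of radius [rho1] is attained in the smaller disc of radius [rho2],
    impossible for a nonzero function vanishing at the origin. *)
Theorem liouville r a1 a2 a3 (e1 e2 e3 : C) n1 n2 n3 :
  disc a1 -> disc a2 -> disc a3 -> zlaw r a1 a1 -> zlaw r a2 a3 -> zlaw r a3 a2 ->
  tw zeta a1 = fC e1 * a2 -> tw zeta a2 = fC e2 * a1 -> tw zeta a3 = fC e3 * a3 ->
  nrm e1 = 1 -> nrm e2 = 1 -> nrm e3 = 1 ->
  (forall n, (n < n1)%N -> a1 n = 0) -> (forall n, (n < n2)%N -> a2 n = 0) ->
  (forall n, (n < n3)%N -> a3 n = 0) -> (n1 + n2 + n3 = 6 * r + 24)%N ->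
  a1 * a2 * a3 = 0.
Proof.
move=> d1 d2 d3 z1 z2 z3 t1 t2 t3 ne1 ne2 ne3 o1 o2 o3 ord.
have /andP[r0 r1] := rho1_01; have r0' := ltW r0.
have r01 : 0 <= rho1 < 1 by rewrite r0'.
pose D : fps C := Beta ^+ (6 * r); pose A : fps C := a1 * a2 * a3.
rewrite -[LHS]/A.
have dA : disc A by apply: discM => //; apply: discM.
have dD : disc D by apply: discX; apply: disc_Beta.
have [MA hA] := dA _ r01.
have [w Aw] : exists w : fps C, A = fX C (6 * r + 24) * w.
  apply: fX_div => n lt; apply: (@mulf_low _ (a1 * a2) a3 (n1 + n2) n3) => //; last by rewrite ord.
  by move=> m ml; apply: (mulf_low o1 o2 ml).
have hw : nle rho1 w (MA / rho1 ^+ (6 * r + 24)) by apply: nle_div => //; rewrite -Aw.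
pose g := dil 24 (1 - eulerC).
have hg : nle rho1 g 3^-1 by apply: nle_dil => //; apply: nle_eulerC; apply: rho1_24.
have g0 : g 0%N = 0.
  rewrite /g [LHS](_ : _ = (1 - eulerC) 0%N) // fpsD fpsN fps1 [eulerC 0%N](_ : _ = (euler int 0)%:~R) //.
  by rewrite pentagonal (_ : (24 * 0 + 1 = 1 ^ 2)%N) // sqsE subrr.
have Bg : Beta = fX C 1 * (1 - g).
  have gE : g = 1 - dil 24 eulerC.
    rewrite /g dilD dil1 //; congr (_ + _); apply: fpsP => n.
    by rewrite fpsN /=; case: ifP; rewrite ?oppr0.
  by rewrite Beta_euler gE opprB addrC subrK.
have [bi hbi] : exists bi, (1 - g) * bi = 1.
  by apply: finv_exists; rewrite fpsD fpsN fps1 g0 subr0.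
have lt13 : (3 : R)^-1 < 1 by rewrite invf_lt1 // ltr1n.
have hb := nle_inv r0' lt13 hg hbi g0.
(* [bi] inverts [Beta] divided by its leading term, so U is the quotient A / Beta^(6r) as a
   series. *)
pose U := fX C 24 * w * bi ^+ (6 * r).
have UD : U * D = A.
  rewrite /U /D Bg exprMn fXX mul1n Aw fXD.
  have -> : fX C 24 * w * bi ^+ (6 * r) * (fX C (6 * r) * (1 - g) ^+ (6 * r)) =
    fX C (6 * r) * fX C 24 * w * ((1 - g) * bi) ^+ (6 * r) by rewrite [in RHS]exprMn; ring.
  by rewrite hbi expr1n mulr1.
have [MU hU] : exists M, nle rho1 U M.
  by eexists; exact: (nleM r0' (nleM r0' (nle_fX r0' 24) hw) (nleX r0' (6 * r) hb)).
have [MD hD] := dD _ r01.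
have AE v : nrm v < 1 -> ev A v = ev a1 v * ev a2 v * ev a3 v.
  by move=> v1; rewrite /A (evM_disc (discM d1 d2) d3 v1) (evM_disc d1 d2 v1).
have DE v : nrm v < 1 -> ev D v = ev Beta v ^+ (6 * r).
  by move=> v1; rewrite /D (evX_disc _ disc_Beta v1).
have [U' UE] : exists U', U = fX C 24 * U' by exists (w * bi ^+ (6 * r)); rewrite /U mulrA.
have zD : zlaw (3 * r) D D by exact: zlaw_Beta.
clearbody U D A.
have zeta0 : zeta != 0.
  by apply/eqP => h0; have := nrm_zeta; rewrite h0 nrm0 => /eqP; rewrite eq_sym oner_eq0.
have evUD z : nrm z <= rho1 -> ev U z * ev D z = ev A z.
  by move=> zr; rewrite -(evM r0' zr hU hD) UD.
have evD0 z : nrm z <= rho1 -> z != 0 -> ev D z != 0.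
  move=> zr z0; rewrite (DE _ (le_lt_trans zr r1)); apply: expf_neq0.
  have h1g := nleD r0' (@nle1 R rho1) (nleN hg).
  rewrite Bg (ev_fXM r0' _ zr h1g) expr1 mulf_neq0 //; apply/eqP => h0.
  have := evM r0' zr h1g hb; rewrite hbi h0 mul0r (ev1 r0') => /eqP.
  by rewrite oner_eq0.
have Tinv z : nrm z <= rho1 -> z != 0 -> nrm (ev U (zeta * z)) = nrm (ev U z).
  move=> zr z0; have z1' := le_lt_trans zr r1.
  have zr' : nrm (zeta * z) <= rho1 by rewrite nrmM nrm_zeta mul1r.
  have z1'' := le_lt_trans zr' r1.
  have hAz : nrm (ev A (zeta * z)) = nrm (ev A z).
    rewrite (AE _ z1'') (AE _ z1') (ev_tw_law t1 d2 z1') (ev_tw_law t2 d1 z1') (ev_tw_law t3 d3 z1').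
    move: (ev a1 z) (ev a2 z) (ev a3 z) => v1 v2 v3; rewrite !nrmM ne1 ne2 ne3 !mul1r.
    by rewrite [nrm v2 * _]mulrC.
  have hDz : nrm (ev D (zeta * z)) = nrm (ev D z).
    rewrite (DE _ z1'') (DE _ z1') (ev_tw_law tw_Beta disc_Beta z1').
    by move: (ev Beta z) => v; rewrite !nrmX nrmM nrm_zeta mul1r.
  have Dn : nrm (ev D z) != 0 by apply/eqP => /nrm_eq0/eqP; rewrite (negPf (evD0 _ zr z0)).
  exact: (nrm_cancel (evUD _ zr') (evUD _ zr) hAz hDz Dn).
have TinvX n z : nrm z <= rho1 -> z != 0 -> nrm (ev U (zeta ^+ n * z)) = nrm (ev U z).
  move=> zr z0; elim: n => [|n IHn]; first by rewrite expr0 mul1r.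
  rewrite exprS -mulrA; apply: etrans IHn; apply: Tinv.
    by rewrite nrmM nrmX nrm_zeta expr1n mul1r.
  by rewrite mulf_neq0 // expf_neq0.
have cexp0 s : cexp s != 0.
  by apply/eqP => h0; have := nrm_cexp s; rewrite h0 nrm0 => /esym/eqP; rewrite expR_eq0.
have Sinv z : nrm z = rho1 -> exists2 q, nrm q <= rho2 & nrm (ev U z) = nrm (ev U q).
  move=> /circle_inversion[n [w' [[wr wm wp ->] [nq nq']]]].
  have nq1 := le_trans nq' rho2_le.
  have qr : nrm (ev Xw w') <= rho1 by rewrite nq.
  have k1 := continuation d1 d1 z1 wr; have k2 := continuation d2 d3 z2 wr.
  have k3 := continuation d3 d2 z3 wr; have k4 := continuation dD dD zD wr.
  have q'0 : ev Xw (- w') != 0.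
    by rewrite (ev_Xw (_ : nrm (- w') <= rw)) ?nrmN // cexp0.
  have q0 : ev Xw w' != 0.
    by apply/eqP => h0; move: nq; rewrite h0 nrm0 => /eqP; rewrite lt_eqF.
  exists (ev Xw (- w')); first exact: nq'.
  apply: (etrans (TinvX n _ qr q0)).
  move: (ev Xw w') (ev Xw (- w')) nq nq' nq1 qr k1 k2 k3 k4 q'0 q0 => q q' nq nq' nq1 qr k1 k2 k3 k4 q'0 q0.
  have kA := triple_law k1 k2 k3.
  have p0 : (1 + w') ^+ (3 * r) != 0 by rewrite expf_neq0.
  have E1 := etrans (evUD _ qr) (AE _ (le_lt_trans qr r1)).
  have E2 := etrans (evUD _ nq1) (AE _ (le_lt_trans nq1 r1)).
  exact: (congr1 (@nrm R) (ratio_cancel E1 E2 kA k4 (evD0 _ qr q0) p0)).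
have [x [x0 x1 xE]] : exists x, [/\ 0 < x, x < 1 & rho2 = rho1 * x].
  have /andP[x0 x1] := rho21; exists (rho2 / rho1); split=> //.
  by rewrite mulrC divfK // gt_eqF.
(* Bounding a value by Cauchy's estimates for all coefficients loses a factor 1/(1 - x); a high
   power of U, of order at least 24 k, makes up for it with a factor 1/2 to spare. *)
have [k hk] : exists k, x ^+ (24 * k) <= (1 - x) / 2.
  have e0 : 0 < (1 - x) / 2 by rewrite divr_gt0 // subr_gt0.
  have : ((fun n => x ^+ n) @ \oo --> (0 : R))%classic by apply: cvg_expr; rewrite ger0_norm // ltW.
  move/cvg_eps/(_ _ e0) => [k /(_ (24 * k)%N)]; rewrite leq_pmull // => /(_ isT).
  by rewrite subr0 ger0_norm ?exprn_ge0 ?(ltW x0) //; exists k.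
pose V := U ^+ k; have hV := nleX r0' k hU.
have Vlow n : (n < 24 * k)%N -> V n = 0.
  by move=> lt; rewrite /V UE exprMn fXX fXM leqNgt lt.
have evV z : nrm z <= rho1 -> ev V z = ev U z ^+ k by move=> zr; rewrite (evX r0' k zr hU).
have VX : V = 0 -> U = 0 by exact: fps_X0.
rewrite -/V in hV; clearbody V.
pose P (b : R) := forall z, nrm z = rho1 -> nrm (ev V z) <= b.
(* A point of the circle is moved into the disc of radius [rho2], where term n of V is at most b x^n
   and only n >= 24 k occur. *)
have step (b : R) : P b -> P (b / 2).
  move=> Pb z hz; have b0 : 0 <= b by apply: le_trans (Pb z hz); apply: nrm_ge0.
  have [q hq e] := Sinv z hz.
  have r21 := rho2_le.
  have -> : nrm (ev V z) = nrm (ev V q).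
    have hzr : nrm z <= rho1 by rewrite hz.
    rewrite (evV _ hzr) (evV _ (le_trans hq r21)).
    by move: (ev U z) (ev U q) e => v v' e; rewrite !nrmX e.
  have r2 : 0 <= rho2 := expR_ge0 _.
  apply: (ev_le r2 hq) => K.
  apply: le_trans (_ : _ <= \sum_(i < K) b * x ^+ (24 * k) * x ^+ i) _.
    have t0 n : 0 <= nrm (V n) * rho2 ^+ n by rewrite mulr_ge0 ?nrm_ge0 ?exprn_ge0.
    apply: le_trans (_ : _ <= \sum_(n < 24 * k + K) nrm (V n) * rho2 ^+ n) _.
      rewrite (@big_ord_widen _ _ _ K (24 * k + K) (fun n => nrm (V n) * rho2 ^+ n)) ?leq_addl // [leLHS]big_mkcond.
      by apply: ler_sum => n _; case: ifP.
    rewrite big_split_ord /= [Z in Z + _]big1 ?add0r => [|i _]; last by rewrite Vlow ?nrm0 ?mul0r.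
    apply: ler_sum => i _; have ce := cauchy_estimate (24 * k + i) r0' hV Pb.
    rewrite -mulrA -exprD xE.
    by rewrite exprMn mulrA ler_wpM2r // exprn_ge0 // ltW.
  rewrite -mulr_sumr; have x01 : 0 <= x < 1 by rewrite (ltW x0).
  have hx0 : 0 <= b * x ^+ (24 * k) by rewrite mulr_ge0 // exprn_ge0 // ltW.
  apply: le_trans (ler_wpM2l hx0 (geom_le K x01)) _.
  rewrite ler_pdivrMr ?subr_gt0 // -mulrA ler_wpM2l //.
  by apply: le_trans hk _; rewrite mulrC.
have P0 : P (MU ^+ k) by move=> z hz; apply: (ev_le r0' _ hV); rewrite hz.
have Pn n : P (MU ^+ k / 2 ^+ n).
  by elim: n => [|n IHn]; rewrite ?expr0 ?divr1 // exprSr invfM mulrA; apply: step.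
have V0 : V = 0.
  apply: fpsP => n; apply: nrm_eq0; apply/eqP; rewrite eq_le nrm_ge0 andbT.
  have rn : 0 < rho1 ^+ n by rewrite exprn_gt0.
  rewrite -(pmulr_lle0 _ rn); apply: (cauchy_estimate n r0' hV) => z hz.
  apply: le_eps => e e0; rewrite add0r.
  have h2 : 0 <= (2^-1 : R) < 1 by rewrite invr_ge0 invf_lt1 // ltr1n ler0n.
  have : ((fun n => (2^-1 : R) ^+ n) @ \oo --> (0 : R))%classic.
    by apply: cvg_expr; rewrite ger0_norm; case/andP: h2.
  have M1 : 0 < MU ^+ k + 1 by rewrite ltr_wpDl // exprn_ge0 // (nle_ge0 hU).
  move/cvg_eps/(_ _ (divr_gt0 e0 M1)) => [j /(_ _ (leqnn j))].
  rewrite subr0 ger0_norm ?exprn_ge0 ?invr_ge0 // ler_pdivlMr // => hj.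
  apply: le_trans (Pn j z hz) _; rewrite -exprVn; apply: le_trans hj; rewrite mulrC.
  by rewrite ler_wpM2l ?exprn_ge0 ?invr_ge0 // lerDl.
by rewrite -UD (VX V0) mul0r.
Qed.

End Liouville.

(** * Hecke operators *)

Section Weighted.
Variable K : comNzRingType.

(* The forms x^t A^(2r-t) with B standing for the replacement of x^3 A^-1
   once t exceeds 2r; the order of vanishing is then t throughout. *)
Definition wform (x A B : K) r t : K := if (t <= 2 * r)%N then x ^+ t * A ^+ (2 * r - t)
  else x ^+ (6 * r - 2 * t) * B ^+ (t - 2 * r).

Variant wform_spec (x A B : K) r t : K -> Prop :=
  | WformLe of (t <= 2 * r)%N : wform_spec x A B r t (x ^+ t * A ^+ (2 * r - t))
  | WformGt of (2 * r < t)%N : wform_spec x A B r t (x ^+ (6 * r - 2 * t) * B ^+ (t - 2 * r)).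

Lemma wformP x A B r t : wform_spec x A B r t (wform x A B r t).
Proof. by rewrite /wform; case: leqP => h; constructor. Qed.

Lemma wform_le x A B r t : (t <= 2 * r)%N -> wform x A B r t = x ^+ t * A ^+ (2 * r - t).
Proof. by rewrite /wform => ->. Qed.
Lemma wform_gt x A B r t : (2 * r < t)%N -> wform x A B r t = x ^+ (6 * r - 2 * t) * B ^+ (t - 2 * r).
Proof. by rewrite /wform ltnNge => /negPf ->. Qed.

Definition hecke p r (a : fps K) : fps K := Fps (fun N => a (p * N)%N + (p ^ r.-1)%:R * dil p a N).

Lemma heckeE p r a N : hecke p r a N = a (p * N)%N + (p ^ r.-1)%:R * dil p a N.
Proof. by []. Qed.
Lemma hecke0 p r : hecke p r 0 = 0.
Proof. by apply: fpsP => N; rewrite heckeE /= if_same mulr0 addr0. Qed.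
Lemma heckeD p r a b : hecke p r (a + b) = hecke p r a + hecke p r b.
Proof. by apply: fpsP => N; rewrite fpsD !heckeE dilD !fpsD mulrDr addrACA. Qed.
Lemma heckeZ p r c a : hecke p r (fC c * a) = fC c * hecke p r a.
Proof.
apply: fpsP => N; rewrite fCM !heckeE fCM mulrDr mulrCA; congr (_ + _ * _).
by rewrite /dil /=; case: ifP => _; rewrite ?mulr0 -?fCM.
Qed.
Lemma hecke_sum p r n (F : nat -> fps K) :
  hecke p r (\sum_(i < n) F i) = \sum_(i < n) hecke p r (F i).
Proof. by apply: (big_morph _ (heckeD p r)); apply: hecke0. Qed.

Lemma hecke_supp p r m c a : coprime p m -> (p * p = 1 %[mod m])%N -> supp m c a -> supp m (p * c) (hecke p r a).
Proof.
move=> cp pp h N ne; rewrite heckeE.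
have p2 x : (p * (p * x) = x %[mod m])%N by rewrite mulnA -modnMml pp modnMml mul1n.
have -> : a (p * N)%N = 0.
  by apply: h; apply: contra ne => /eqP e; rewrite -(p2 N) -modnMmr e modnMmr.
rewrite add0r /dil /=; case: ifP => [/dvdnP[q eN]|_]; last by rewrite mulr0.
rewrite h ?mulr0 //; apply: contra ne => /eqP; rewrite eN.
have [->|p0] := posnP p; first by rewrite muln0 mul0n.
by rewrite mulnK // mulnC => e; rewrite -modnMmr e modnMmr.
Qed.

End Weighted.

Lemma fmap_hecke (K L : comNzRingType) (f : {rmorphism K -> L}) p r (a : fps K) :
  fmap f (hecke p r a) = hecke p r (fmap f a).
Proof.
apply: fpsP => N; rewrite fmapE !heckeE rmorphD rmorphM rmorph_nat fmapE; congr (_ + _ * _).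
by rewrite /dil /=; case: ifP => _; rewrite ?rmorph0.
Qed.

Lemma wform_morph (K L : comNzRingType) (f : {rmorphism K -> L}) x A B r t :
  f (wform x A B r t) = wform (f x) (f A) (f B) r t.
Proof. by rewrite /wform; case: ifP => _; rewrite rmorphM !rmorphXn. Qed.

Lemma fmapC (K L : comNzRingType) (f : {rmorphism K -> L}) c : fmap f (fC c) = fC (f c).
Proof. by apply: fpsP => -[|n] /=; rewrite ?rmorph0. Qed.

Lemma wexp1 r t : (t <= 3 * r)%N -> (2 * r < t)%N -> (6 * r - 2 * t + 3 * (t - 2 * r) = t)%N.
Proof. lia. Qed.
Lemma wexp2 r t : (t <= 2 * r)%N -> (t + 3 * (2 * r - t) = 6 * r - 2 * t)%N.
Proof. lia. Qed.
Lemma wexp3 r t : (t <= 3 * r)%N -> (2 * r < t)%N -> (6 * r - 2 * t + (t - 2 * r) * 2 = 2 * r)%N.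
Proof. lia. Qed.
Lemma wexp4 r t : (t <= 2 * r)%N -> (t + (2 * r - t) * 1 = 2 * r)%N.
Proof. lia. Qed.

Section Hecke.
Variable R : realType.
Local Notation C := R[i].
Local Open Scope complex_scope.
Local Notation ez := (@ez R).
Local Notation Beta := (Beta R).
Local Notation zeta := (zeta R).
Implicit Types (a b : fps C) (z w : C).

(** Half of theta_2, then theta_3 and theta_4, as series in e(z/24). *)
Definition T2 : fps C := th 3 (th2f R).
Definition T3 : fps C := th 3 (th3f R).
Definition T4 : fps C := th 3 (th4f R).

Lemma th2f_bound n : nrm (th2f R n) <= 1.
Proof.
rewrite /th2f; case: odd; last by rewrite nrm0.
by rewrite nrmV nrm_nat invf_le1 // ler1n.
Qed.
Lemma th3f_bound n : nrm (th3f R n) <= 1.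
Proof. by rewrite /th3f; case: odd; rewrite ?nrm0 ?nrm1. Qed.
Lemma th4f_bound n : nrm (th4f R n) <= 1.
Proof. by rewrite /th4f; case: odd; rewrite ?nrm0 // nrmX nrmN nrm1 expr1n. Qed.

Lemma disc_T2 : disc T2. Proof. exact: disc_th (isT : (0 < 3)%N) th2f_bound. Qed.
Lemma disc_T3 : disc T3. Proof. exact: disc_th (isT : (0 < 3)%N) th3f_bound. Qed.
Lemma disc_T4 : disc T4. Proof. exact: disc_th (isT : (0 < 3)%N) th4f_bound. Qed.

(** A single multiplier g serves eta and the three theta constants, the factors 2 being due to the
    halved theta_2. It follows that every product of weight r built from them has multiplier
    g^(2r). *)
Definition blaw (al : R) (u v g : C) :=
  [/\ slaw al u v 1 g Beta Beta, slaw al u v 1 g T3 T3,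
      slaw al u v 1 (2 * g) T4 T2 & slaw al u v 1 (g / 2) T2 T4].

Lemma th2f_per n : th2f R (n + 4) = th2f R n. Proof. by rewrite /th2f oddD addbF. Qed.
Lemma th3f_per n : th3f R (n + 4) = th3f R n. Proof. by rewrite /th3f oddD addbF. Qed.
Lemma th4f_per n : th4f R (n + 4) = th4f R n.
Proof.
rewrite /th4f oddD addbF; case: odd => //.
by rewrite halfD /= andbF add0n -signr_odd oddD addbF signr_odd.
Qed.
Lemma th2f_sym n : (n <= 4)%N -> th2f R (4 - n) = th2f R n.
Proof. by case: n => [|[|[|[|[|n]]]]]. Qed.
Lemma th3f_sym n : (n <= 4)%N -> th3f R (4 - n) = th3f R n.
Proof. by case: n => [|[|[|[|[|n]]]]]. Qed.
Lemma th4f_sym n : (n <= 4)%N -> th4f R (4 - n) = th4f R n.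
Proof. by case: n => [|[|[|[|[|n]]]]] // _; rewrite /th4f /= ?expr0 ?expr2 ?mulrNN ?mulr1. Qed.
Lemma sqrt4 : (Num.sqrt 4%:R)%:C = 2 :> C.
Proof.
have -> : (4%:R : R) = 2 ^+ 2 by rewrite -natrX.
by rewrite sqrtr_sqr ger0_norm // (rmorph_nat (real_complex R) 2).
Qed.

Lemma blaw1 : blaw 1 1 1 1.
Proof.
have n2 : (2 : C) != 0 by rewrite pnatr_eq0.
split; first exact: slaw_Beta.
- have := @slaw_base R 4 3 (th3f R) (th3f R) 2 1 erefl isT th3f_per th3f_sym (sum_th3 R) th3f_bound th3f_bound.
  by rewrite sqrt4 divff.
- have := @slaw_base R 4 3 (th4f R) (th2f R) 4 1 erefl isT th4f_per th4f_sym (sum_th4 R) th4f_bound th2f_bound.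
  by rewrite sqrt4 mulr1 (_ : 4 / 2 = 2) //; field.
- have := @slaw_base R 4 3 (th2f R) (th4f R) 1 1 erefl isT th2f_per th2f_sym (sum_th2 R) th2f_bound th4f_bound.
  by rewrite sqrt4.
Qed.

Section Prime.
Variable p : nat.
Hypotheses (p_pr : prime p) (p3 : (p %% 4 = 3)%N) (p_gt3 : (3 < p)%N).

Lemma p_mod3 : (p %% 3 != 0)%N.
Proof.
by apply/negP; rewrite -/(dvdn 3 p) dvdn_prime2 // => /eqP h3; move: p_gt3; rewrite -h3.
Qed.
Lemma p_odd : odd p. Proof. by move: p3; clear; lia. Qed.
Lemma pp24 : (p * p = 1 %[mod 24])%N.
Proof.
have h3 := p_mod3; have := p3; have : (p %% 12 \in [:: 7; 11])%N by rewrite !inE; move: h3 p3; clear; lia.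
rewrite !inE => h _; rewrite [in LHS](divn_eq p 12); move: (p %/ 12)%N => q.
move: h => /orP[] /eqP ->.
  by rewrite (_ : ((q * 12 + 7) * (q * 12 + 7) = (6 * q ^ 2 + 7 * q + 2) * 24 + 1)%N) ?modnMDl //; ring.
by rewrite (_ : ((q * 12 + 11) * (q * 12 + 11) = (6 * q ^ 2 + 11 * q + 5) * 24 + 1)%N) ?modnMDl //; ring.
Qed.
Lemma pp_dvd M : (M %| 24)%N -> (p * p = 1 %[mod M])%N.
Proof. by move=> d; rewrite -(modn_dvdm _ d) pp24 modn_dvdm. Qed.

Lemma chi12_p : (chi12 p)%:~R ^+ 2 = 1 :> C.
Proof.
have h3 := p_mod3; have : (p %% 12 \in [:: 7; 11])%N by rewrite !inE; move: h3 p3; clear; lia.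
by rewrite !inE /chi12 => /orP[] /eqP ->; rewrite ?mulrN1z ?sqrrN expr1n.
Qed.

(** Eta yields [chi12 p] times the normalised Gauss sum of j; the theta constants yield the Gauss
    sum of 3j, and [gauss_3] makes the two agree. For p = 3 (mod 4) the square of a Gauss sum is -p,
    hence g^2 = -1. *)
Lemma blaw_twist j j' : (p %| 576 * j * j' + 1)%N ->
  exists2 g : C, g ^+ 2 = -1 & blaw p%:R^-1 (ez p j) (ez p j') g.
Proof.
move=> jj; have n2 : (2 : C) != 0 by rewrite pnatr_eq0.
have pj : ~~ (p %| j)%N.
  apply/negP => d; move: jj; rewrite dvdn_addr ?dvdn1; first by move/eqP; move: p_gt3; clear; lia.
  by rewrite dvdn_mulr // dvdn_mull.
have sp : (Num.sqrt p%:R)%:C ^+ 2 = p%:R :> C.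
  by rewrite -rmorphXn sqr_sqrtr ?ler0n // (rmorph_nat (real_complex R)).
have pn0 : p%:R != 0 :> C by rewrite pnatr_eq0 -lt0n prime_gt0.
pose g : C := (chi12 p)%:~R * (gauss R p j / (Num.sqrt p%:R)%:C).
have g3 : gauss R p (j * 3) = (chi12 p)%:~R * gauss R p j by rewrite mulnC gauss_3.
have s12 : (Num.sqrt 12%:R)%:C != 0 :> C.
  by apply/eqP => /complexI /eqP; rewrite sqrtr_eq0 leNgt ltr0n.
exists g; first by rewrite /g exprMn chi12_p mul1r expr_div_n gauss_sqr // sp mulNr divff.
split.
- have := @slaw_twist R p 12 1 j j' (fun n => (chi12 n)%:~R / 2) (fun n => (chi12 n)%:~R / 2)
    ((chi12 p)%:~R * (Num.sqrt 12%:R)%:C) 1 p_pr p_gt3 erefl isT.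
  rewrite mulfK // muln1; apply=> //; try exact: chi12_bound.
  + by move=> n; rewrite -chi12_mod modnDr chi12_mod.
  + move=> n le; congr (_%:~R / _); by do 13! (case: n le => [|n] // le).
  + exact: pp_dvd.
  + by move=> k; rewrite sum_chi12 chi12M rmorphM /=; ring.
- have := @slaw_twist R p 4 3 j j' (th3f R) (th3f R) 2 1 p_pr p_gt3 erefl isT th3f_per th3f_sym (@pp_dvd 4 isT) _ jj th3f_bound th3f_bound.
  rewrite sqrt4 divff // mul1r g3 -mulrA; apply=> k.
  by rewrite sum_th3 th3f_odd // p_odd.
- have := @slaw_twist R p 4 3 j j' (th4f R) (th2f R) 4 1 p_pr p_gt3 erefl isT th4f_per th4f_sym (@pp_dvd 4 isT) _ jj th4f_bound th2f_bound.
  rewrite sqrt4 (_ : 4 / 2 = 2 :> C); last by field.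
  rewrite g3 -[_ * _ / _]mulrA; apply=> k.
  by rewrite sum_th4 th2f_odd // p_odd.
- have := @slaw_twist R p 4 3 j j' (th2f R) (th4f R) 1 1 p_pr p_gt3 erefl isT th2f_per th2f_sym (@pp_dvd 4 isT) _ jj th2f_bound th4f_bound.
  rewrite sqrt4 mul1r [2^-1 * _]mulrC g3 -[_ * _ / (Num.sqrt _)%:C]mulrA; apply=> k.
  by rewrite sum_th2 th4f_odd // p_odd.
Qed.

End Prime.

(** The three conjugates have theta_3, theta_4, theta_2 in the place of A; B is eta^3 / A by
    Jacobi's identity T2 T3 T4 = eta^3. The factors 2 and 1/2 in [E3] free the inversion laws of
    constants. *)
Definition E1 r t : fps C := wform Beta T3 (T2 * T4) r t.
Definition E2 r t : fps C := wform Beta T4 (T2 * T3) r t.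
Definition E3 r t : fps C := wform Beta (fC 2 * T2) (fC 2^-1 * (T3 * T4)) r t.

Lemma disc_wform (x A B : fps C) r t : disc x -> disc A -> disc B -> disc (wform x A B r t).
Proof. by move=> dx dA dB; case: wformP => _; apply: discM; apply: discX. Qed.
Lemma disc_E1 r t : disc (E1 r t).
Proof. rewrite /E1; exact: disc_wform (@disc_Beta R) disc_T3 (discM disc_T2 disc_T4). Qed.
Lemma disc_E2 r t : disc (E2 r t).
Proof. rewrite /E2; exact: disc_wform (@disc_Beta R) disc_T4 (discM disc_T2 disc_T3). Qed.
Lemma disc_cT2 : disc (fC 2 * T2). Proof. exact: discM (disc_fC _) disc_T2. Qed.
Lemma disc_cT34 : disc (fC 2^-1 * (T3 * T4)).
Proof. exact: discM (disc_fC _) (discM disc_T3 disc_T4). Qed.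
Lemma disc_E3 r t : disc (E3 r t).
Proof. rewrite /E3; exact: disc_wform (@disc_Beta R) disc_cT2 disc_cT34. Qed.

Section Laws.
Variables (al : R) (u v g : C).
Hypotheses (al0 : 0 < al) (u1 : nrm u = 1) (v1 : nrm v = 1).

Lemma slawCr m k c a a' : disc a' -> slaw al u v m (c * k) a a' -> slaw al u v m k a (fC c * a').
Proof.
move=> d h y y0; have q1 : nrm (Qy (al * y)) < 1 := nrm_Qy (mulr_gt0 al0 y0).
rewrite (h y y0) twZ (evZ_disc c (disc_tw v1 d) q1).
by move: (ev _ _) (_%:C) => s w; ring.
Qed.
Lemma slawCl m k c a a' : disc a -> slaw al u v m k a a' -> slaw al u v m (c * k) (fC c * a) a'.
Proof.
move=> d h y y0; have q1 : nrm (Qy (al / y)) < 1 := nrm_Qy (divr_gt0 al0 y0).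
rewrite twZ (evZ_disc c (disc_tw u1 d) q1) (h y y0).
by move: (ev _ _) (_%:C) => s w; ring.
Qed.

Lemma slaw_comb t n k a a' b b' m : disc a -> disc a' -> disc b -> disc b' ->
  slaw al u v 1 g a a' -> slaw al u v k (g ^+ k) b b' -> (t + n * k = m)%N ->
  slaw al u v m (g ^+ m) (a ^+ t * b ^+ n) (a' ^+ t * b' ^+ n).
Proof.
move=> da da' db db' ha h <-.
have := slawM al0 u1 v1 (discX t da) (discX t da') (discX n db) (discX n db')
  (slawX t al0 u1 v1 da da' ha) (slawX n al0 u1 v1 db db' h).
by rewrite muln1 exprD [(n * k)%N]mulnC exprM.
Qed.

Lemma slaw2 a a' b b' k l : disc a -> disc a' -> disc b -> disc b' ->
  slaw al u v 1 k a a' -> slaw al u v 1 l b b' -> slaw al u v 2 (k * l) (a * b) (a' * b').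
Proof. by move=> da da' db db' ha h; exact: (slawM al0 u1 v1 da da' db db' ha h). Qed.

Lemma slaw_wform x A B A' B' r t : disc x -> disc A -> disc A' -> disc B -> disc B' ->
  slaw al u v 1 g x x -> slaw al u v 1 g A A' -> slaw al u v 2 (g ^+ 2) B B' -> (t <= 3 * r)%N ->
  slaw al u v (2 * r) (g ^+ (2 * r)) (wform x A B r t) (wform x A' B' r t).
Proof.
move=> dx dA dA' dB dB' hx hA hB le; have [le2|lt2] := leqP t (2 * r).
  rewrite !wform_le //; apply: (slaw_comb (k := 1) dx dx dA dA' hx _ (wexp4 le2)).
  by rewrite expr1.
rewrite !wform_gt //; exact: (slaw_comb (k := 2) dx dx dB dB' hx hB (wexp3 le lt2)).
Qed.

Hypothesis hb : blaw al u v g.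
Let n2 : (2 : C) != 0. Proof. by rewrite pnatr_eq0. Qed.

Lemma slaw_E1 r t : (t <= 3 * r)%N -> slaw al u v (2 * r) (g ^+ (2 * r)) (E1 r t) (E1 r t).
Proof.
case: hb => hB h3 h4 h2; have d := discM disc_T2 disc_T4.
move=> le; rewrite /E1; apply: (slaw_wform (@disc_Beta R) disc_T3 disc_T3 d d hB h3 _ le).
have := slaw2 disc_T2 disc_T4 disc_T4 disc_T2 h2 h4.
by rewrite [T4 * T2]mulrC (_ : g / 2 * (2 * g) = g ^+ 2) //; field.
Qed.

Lemma slaw_E2 r t : (t <= 3 * r)%N -> slaw al u v (2 * r) (g ^+ (2 * r)) (E2 r t) (E3 r t).
Proof.
case: hb => hB h3 h4 h2.
move=> le; rewrite /E2 /E3; apply: (slaw_wform (@disc_Beta R) disc_T4 disc_cT2 (discM disc_T2 disc_T3) disc_cT34 hB (slawCr disc_T2 h4) _ le).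
apply: (slawCr (discM disc_T3 disc_T4)).
have := slaw2 disc_T2 disc_T4 disc_T3 disc_T3 h2 h3.
by rewrite [T4 * T3]mulrC (_ : g / 2 * g = 2^-1 * g ^+ 2) //; field.
Qed.

Lemma slaw_E3 r t : (t <= 3 * r)%N -> slaw al u v (2 * r) (g ^+ (2 * r)) (E3 r t) (E2 r t).
Proof.
case: hb => hB h3 h4 h2.
have hA : slaw al u v 1 g (fC 2 * T2) T4.
  by have := slawCl 2 disc_T2 h2; rewrite mulrC divfK.
move=> le; rewrite /E2 /E3; apply: (slaw_wform (@disc_Beta R) disc_cT2 disc_T4 disc_cT34 (discM disc_T2 disc_T3) hB hA _ le).
have := slawCl 2^-1 (discM disc_T3 disc_T4) (slaw2 disc_T3 disc_T3 disc_T4 disc_T2 h3 h4).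
by rewrite [T3 * T2]mulrC (_ : 2^-1 * (g * (2 * g)) = g ^+ 2) //; field.
Qed.

End Laws.

(** * The Hecke operator under inversion *)

Definition up p a : fps C := Fps (fun N => a (p * N)%N).

Lemma bernoulli (x : R) n : 0 <= x <= 1 -> 1 - n%:R * x <= (1 - x) ^+ n.
Proof.
move=> /andP[x0 x1]; elim: n => [|n IHn]; first by rewrite expr0 mul0r subr0.
rewrite exprS; apply: le_trans (_ : _ <= (1 - x) * (1 - n%:R * x)) _; last by rewrite ler_wpM2l // subr_ge0.
rewrite -natr1; have : 0 <= n%:R * x ^+ 2 by rewrite mulr_ge0 ?sqr_ge0.
by move: (n%:R) => m h; nra.
Qed.

(** Taking every p-th coefficient enlarges the disc: with x = (1 - rho)/p, Bernoulli's inequality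
    gives rho <= (1-x)^p, so the norm at rho is bounded by that of a at 1 - x. *)
Lemma disc_up p a : (0 < p)%N -> disc a -> disc (up p a).
Proof.
move=> p0 da rho /andP[r0 r1].
have pR : 0 < p%:R :> R by rewrite ltr0n.
pose x : R := (1 - rho) / p%:R.
have x0 : 0 < x by rewrite divr_gt0 // subr_gt0.
have x1 : x <= 1.
  by rewrite ler_pdivrMr // mul1r (@le_trans _ _ 1) ?ler1n // lerBlDr lerDl.
have hr : 0 <= 1 - x < 1 by rewrite subr_ge0 x1 /= gtrBl.
have rp : rho <= (1 - x) ^+ p.
  apply: le_trans (bernoulli p _); last by rewrite (ltW x0).
  by rewrite /x mulrC divfK ?gt_eqF // opprB addrC subrK.
have [M hM] := da _ hr; exists M => K.
apply: le_trans (_ : _ <= \sum_(n < K) nrm (a (n * p)%N) * (1 - x) ^+ (n * p)) _.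
  apply: ler_sum => n _; rewrite [up p a n](_ : _ = a (n * p)%N); last by rewrite mulnC.
  by rewrite ler_wpM2l ?nrm_ge0 // [(n * p)%N]mulnC exprM lerXn2r // ?nnegrE // exprn_ge0 // subr_ge0.
case: K => [|K]; first by rewrite big_ord0; apply: nle_ge0 hM.
rewrite -(big_mkord predT (fun n => nrm (a (n * p)%N) * (1 - x) ^+ (n * p))).
rewrite -(sum_multiples (fun n => nrm (a n) * (1 - x) ^+ n)) //.
apply: le_trans (hM (K * p).+1).
rewrite big_mkcond big_mkord; apply: ler_sum => n _; case: ifP => // _.
by rewrite mulr_ge0 ?nrm_ge0 // exprn_ge0 // subr_ge0.
Qed.

Lemma disc_dil p a : (0 < p)%N -> disc a -> disc (dil p a).
Proof.
move=> p0 da rho /andP[r0 r1].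
have [|M hM] := da (rho ^+ p); first by rewrite exprn_ge0 //= exprn_ilt1 // -lt0n.
by exists M; apply: nle_dil.
Qed.

Lemma ev_disc_hsum a z : disc a -> nrm z < 1 -> hsum (fun n => a n * z ^+ n) (ev a z).
Proof.
move=> da z1; have [|M hM] := da (nrm z); first by rewrite nrm_ge0.
exact: (ev_hsum (nrm_ge0 z) (lexx _) hM).
Qed.

Lemma ev_dil p a z : (0 < p)%N -> disc a -> nrm z < 1 -> ev (dil p a) z = ev a (z ^+ p).
Proof.
move=> p0 da z1.
have zp1 : nrm (z ^+ p) < 1 by rewrite nrmX exprn_ilt1 ?nrm_ge0 // -lt0n.
have h1 := ev_disc_hsum (disc_dil p0 da) z1; have h2 := ev_disc_hsum da zp1.
move: h1 h2; move: (ev (dil p a) z) (ev a _) => s s' h1 h2.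
apply: (@hsum_uniq R (fun n => a n * (z ^+ p) ^+ n) s s' _ h2) => e e0.
have hu k : (k <= (k * p).+1)%N by rewrite leqW // leq_pmulr.
have [K0 hK] := hsum_sub hu h1 e0; exists K0.+1 => -[//|K] leK.
rewrite (_ : \sum_(n < K.+1) _ = \sum_(n < (K * p).+1) dil p a n * z ^+ n); first exact: hK.
rewrite -(big_mkord predT (fun n => dil p a n * z ^+ n)) (bigID (fun i => p %| i)%N) /=.
rewrite [X in _ = _ + X]big1 ?addr0; last by move=> i /negPf ->; rewrite mul0r.
rewrite (sum_multiples (fun n => dil p a n * z ^+ n)) // big_mkord.
by apply: eq_bigr => n _; rewrite /dil /= dvdn_mull // mulnK // [(n * p)%N]mulnC exprM.
Qed.

Lemma sum_tw p a : (0 < p)%N -> \sum_(j < p) tw (ez p j) a = fC p%:R * dil p (up p a).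
Proof.
move=> p0; apply: fpsP => N; rewrite fps_sum fCM.
rewrite (eq_bigr (fun j : 'I_p => ez p (N * j) * a N)); last first.
  by move=> j _; rewrite mulnC ezM.
rewrite -mulr_suml ez_sum // /dil /=; case: ifP => [/dvdnP[q ->]|_]; last by rewrite mul0r mulr0.
by rewrite mulnK // mulnC.
Qed.

Lemma ev_sum_disc n (F : nat -> fps C) z : (forall i, disc (F i)) -> nrm z < 1 ->
  ev (\sum_(i < n) F i) z = \sum_(i < n) ev (F i) z /\ disc (\sum_(i < n) F i).
Proof.
move=> d z1; elim: n => [|n [IHe IHd]].
  rewrite !big_ord0; split; first exact: ev0.
  by have -> : 0 = fC 0 :> fps C; [apply: fpsP => -[|n] | exact: disc_fC].
rewrite !big_ord_recr /=; split; last exact: discD.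
by rewrite (evD_disc IHd (d n) z1) IHe.
Qed.

Lemma Qy_pow (y : R) n : Qy y ^+ n = Qy (n%:R * y).
Proof.
rewrite /Qy -rmorphXn /= -expRM_natl; congr ((expR _)%:C).
by field.
Qed.

Lemma disc_hecke p r a : (0 < p)%N -> disc a -> disc (hecke p r a).
Proof.
move=> p0 da; have -> : hecke p r a = up p a + fC (p ^ r.-1)%:R * dil p a.
  by apply: fpsP => N; rewrite fpsD fCM.
exact: discD (disc_up p0 da) (discM (disc_fC _) (disc_dil p0 da)).
Qed.

(** By orthogonality, p times the part a(pN) is the sum of the p translates of a at height y/p; the
    other part is a at height p y. *)
Lemma ev_hecke p r a (y : R) : (0 < p)%N -> (0 < r)%N -> 0 < y -> disc a ->
  p%:R * ev (hecke p r a) (Qy y) =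
    \sum_(j < p) ev (tw (ez p j) a) (Qy (y / p%:R)) + (p ^ r)%:R * ev a (Qy (p%:R * y)).
Proof.
move=> p0 r0 y0 da; have pR : 0 < p%:R :> R by rewrite ltr0n.
have q1 := nrm_Qy y0; have qp1 := nrm_Qy (divr_gt0 y0 pR).
have -> : hecke p r a = up p a + fC (p ^ r.-1)%:R * dil p a.
  by apply: fpsP => N; rewrite fpsD fCM.
have dd := disc_dil p0 da; have du := disc_up p0 da.
rewrite (evD_disc du (discM (disc_fC _) dd) q1) (evZ_disc _ dd q1) (ev_dil p0 da q1) Qy_pow mulrDr.
congr (_ + _); last by rewrite mulrA -natrM -expnS prednK.
have [<- _] := @ev_sum_disc p (fun j => tw (ez p j) a) _ (fun j => disc_tw (nrm_ez R p j) da) qp1.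
rewrite sum_tw // (evZ_disc _ (disc_dil p0 du) qp1) (ev_dil p0 du qp1) Qy_pow.
by have -> : p%:R * (y / p%:R) = y :> R by rewrite mulrC divfK ?gt_eqF.
Qed.

(** The relation c j j' = -1 (mod p) permutes the nonzero classes; the class 0 is split off on both
    sides. *)
Lemma sum_inverse p c (f g : nat -> C) (Y : C) : prime p -> ~~ (p %| c)%N ->
  (forall j j', (p %| c * j * j' + 1)%N -> f j = Y * g j') ->
  \sum_(j < p) f j = f 0%N + Y * (\sum_(j < p) g j - g 0%N).
Proof.
move=> p_pr nc h; rewrite !(sum_Fp p_pr).
rewrite (bigD1 (0 : 'F_p)) //= [in RHS](bigD1 (0 : 'F_p)) //= [g 0%N + _]addrC addrK; congr (_ + _).
have c0 : (c%:R : 'F_p) != 0 by rewrite -(dvdn_pcharf (pchar_Fp p_pr)).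
rewrite [in RHS](reindex_inj (h := fun x : 'F_p => - (c%:R * x)^-1)); last first.
  by move=> x1 x2 /oppr_inj /invr_inj /(mulfI c0).
rewrite mulr_sumr; apply: eq_big => [x|x x0].
  by rewrite oppr_eq0 invr_eq0 mulf_eq0 (negPf c0).
apply: h.
rewrite (dvdn_pcharf (pchar_Fp p_pr)) natrD !natrM !natr_Zp.
by rewrite mulrN (mulfV (mulf_neq0 c0 x0)) addNr.
Qed.

Lemma ndvd576 p : prime p -> (3 < p)%N -> ~~ (p %| 576)%N.
Proof.
move=> p_pr p_gt3; rewrite (_ : 576 = 2 ^ 6 * 3 ^ 2)%N //.
by rewrite Euclid_dvdM // !Euclid_dvdX // !dvdn_prime2 // !andbT; move: p_gt3; clear; lia.
Qed.

(** Inversion exchanges the untwisted term at y/p with the term at p y and permutes the twisted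
    terms. The twist e(j/p) of a series in e(z/24) is the translation of z by 24 j / p, whence the
    constant 576 = 24^2. *)
Lemma hecke_law p r a a' : prime p -> (3 < p)%N -> (0 < r)%N -> disc a -> disc a' ->
  slaw 1 1 1 (2 * r) 1 a a' ->
  (forall j j', (p %| 576 * j * j' + 1)%N -> slaw p%:R^-1 (ez p j) (ez p j') (2 * r) 1 a a') ->
  zlaw r (hecke p r a) (hecke p r a').
Proof.
move=> p_pr p_gt3 r0 da da' h0 hj y y0; have p0 := prime_gt0 p_pr.
have pR : 0 < p%:R :> R by rewrite ltr0n.
have pC : (p%:R : C) != 0 by rewrite pnatr_eq0 -lt0n.
have z0 := zlaw_slaw h0.
have e1 := ev_hecke p0 r0 (divr_gt0 ltr01 y0) da; have e2 := ev_hecke p0 r0 y0 da'.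
apply: (mulfI pC); apply: (etrans e1); apply: (etrans _ (mulrCA _ _ _)); rewrite e2 mulrDr {e1 e2}.
have E3 : 1 / y / p%:R = 1 / (y * p%:R) :> R by rewrite -mulrA -invfM.
have E4 : p%:R * (1 / y) = 1 / (y / p%:R) :> R by rewrite !mul1r invf_div.
have E5 : 1 / y / p%:R = p%:R^-1 / y :> R by rewrite mul1r mulrC.
have E6 : p%:R^-1 * y = y / p%:R :> R by rewrite mulrC.
have S : forall j j', (p %| 576 * j * j' + 1)%N -> ev (tw (ez p j) a) (Qy (1 / y / p%:R)) =
    (y ^+ r)%:C * ev (tw (ez p j') a') (Qy (y / p%:R)).
  by move=> j j' jj; have := hj j j' jj y y0; rewrite (sqrt_pow r y0) mulr1 E6 -E5.
have tw1id (b : fps C) : tw 1 b = b by apply: fpsP => N; rewrite /tw /= expr1n mul1r.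
have S1 := @sum_inverse p 576 (fun j => ev (tw (ez p j) a) (Qy (1 / y / p%:R)))
  (fun j => ev (tw (ez p j) a') (Qy (y / p%:R))) _ p_pr (ndvd576 p_pr p_gt3) S.
apply: (etrans (congr1 (fun s => s + _) S1)); rewrite {S S1} ez0 !tw1id E3 E4.
rewrite (z0 _ (mulr_gt0 y0 pR)) (z0 _ (divr_gt0 y0 pR)) [y * p%:R]mulrC.
move: (\sum_(j < p) _) (ev a' (Qy (p%:R * y))) (ev a' (Qy (y / p%:R))) => T A B.
have -> : ((p%:R * y) ^+ r)%:C = p%:R ^+ r * (y ^+ r)%:C :> C.
  by rewrite exprMn rmorphM rmorphXn (rmorph_nat (real_complex R)).
have -> : ((y / p%:R) ^+ r)%:C = (y ^+ r)%:C / p%:R ^+ r :> C.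
  by rewrite expr_div_n rmorphM fmorphV [in X in _ / X]rmorphXn (rmorph_nat (real_complex R)).
rewrite natrX; have : (p%:R ^+ r : C) != 0 by rewrite expf_neq0.
by move: (p%:R ^+ r) ((y ^+ r)%:C) => P Y P0; field.
Qed.

End Hecke.

(** * Integral forms and elimination *)

Definition phip : fps int := sqs (fun n => if n == 0%N then 1 else 2).
Definition eta24 : fps int := sqs chi12.
Definition t2i : fps int := dil 3 (sqs oddf).
Definition t3i : fps int := dil 12 phip.
Definition t4i : fps int := dil 12 phim.
Definition e1i r t : fps int := wform eta24 t3i (t2i * t4i) r t.

Lemma dil4_sqs (K : comNzRingType) (f : nat -> K) :
  dil 4 (sqs f) = sqs (fun n => if odd n then 0 else f n./2).
Proof.
apply: fpsP => N; rewrite [LHS](_ : _ = if (4 %| N)%N then sqs f (N %/ 4)%N else 0) //.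
have [[k ->]|h] := sq_cases N.
  rewrite sqsE; case: (boolP (odd k)) => ok.
    have -> : (4 %| k ^ 2)%N = false by apply/negbTE; rewrite -(odd_double_half k) ok; move: (k./2); clear => m; rewrite -muln2; apply/negP => /dvdnP[q]; nia.
    by [].
  have -> : (k = k./2 * 2)%N by rewrite -{1}(odd_double_half k) (negPf ok) -muln2.
  by rewrite expnMn dvdn_mull // mulnK // sqsE muln2 doubleK.
rewrite [RHS]sqs0 //; case: ifP => // /dvdnP[q eN].
rewrite sqs0 // => x; apply/negP => /eqP e; have := h (x * 2)%N.
by rewrite expnMn e eN mulnK // eqxx.
Qed.

Lemma dilE (K : comNzRingType) m (a : fps K) n : dil m a n = if (m %| n)%N then a (n %/ m)%N else 0.
Proof. by []. Qed.

Lemma dil_mul (K : comNzRingType) m (a : fps K) n : (0 < m)%N -> dil m a (m * n)%N = a n.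
Proof. by move=> m0; rewrite dilE dvdn_mulr // mulKn. Qed.

Lemma eta24_low n : (n < 1)%N -> eta24 n = 0.
Proof. by case: n => // _; rewrite -[0%N](_ : 0 ^ 2 = _)%N // sqsE. Qed.
Lemma eta24_lead : eta24 1%N = 1.
Proof. exact: (sqsE chi12 1). Qed.
Lemma t2i_low n : (n < 3)%N -> t2i n = 0.
Proof.
by case: n => [|[|[|n]]] // _; rewrite dilE; exact: (sqsE oddf 0).
Qed.
Lemma t2i_lead : t2i 3%N = 1.
Proof. by rewrite -[3%N](_ : 3 * 1 ^ 2 = _)%N // dil_mul // sqsE. Qed.
Lemma t3i_lead : t3i 0%N = 1.
Proof. by rewrite -[0%N](_ : 12 * 0 ^ 2 = _)%N // dil_mul // sqsE. Qed.
Lemma t4i_lead : t4i 0%N = 1.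
Proof. by rewrite -[0%N](_ : 12 * 0 ^ 2 = _)%N // dil_mul // sqsE. Qed.

Section Order.
Variable K : comNzRingType.
Implicit Types a b : fps K.

Definition unitary n a := (forall k, (k < n)%N -> a k = 0) /\ a n = 1.

Lemma unitaryM i j a b : unitary i a -> unitary j b -> unitary (i + j) (a * b).
Proof.
case=> la ha [lb hb]; split; last by rewrite mulf_lead // ha hb mulr1.
by move=> k; apply: mulf_low.
Qed.
Lemma unitary1 : unitary 0 (1 : fps K). Proof. by split. Qed.
Lemma unitaryX i a k : unitary i a -> unitary (k * i) (a ^+ k).
Proof.
move=> h; elim: k => [|k IHk]; first exact: unitary1.
by rewrite exprS mulSn; apply: unitaryM.
Qed.

Lemma unitary_wform (x A B : fps K) r t : unitary 1 x -> unitary 0 A -> unitary 3 B ->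
  (t <= 3 * r)%N -> unitary t (wform x A B r t).
Proof.
move=> hx hA hB le; case: wformP => h.
  by have := unitaryM (unitaryX t hx) (unitaryX (2 * r - t) hA); rewrite muln1 muln0 addn0.
have := unitaryM (unitaryX (6 * r - 2 * t) hx) (unitaryX (t - 2 * r) hB).
by rewrite muln1 [((t - _) * 3)%N]mulnC wexp1.
Qed.

Lemma supp_wform (x A B : fps K) r t : supp 12 1 x -> supp 12 0 A -> supp 12 3 B ->
  (t <= 3 * r)%N -> supp 12 t (wform x A B r t).
Proof.
move=> hx hA hB le; case: wformP => h.
  by have := suppM (suppX (k := t) hx) (suppX (k := 2 * r - t) hA); rewrite muln1 muln0 addn0.
have := suppM (suppX (k := 6 * r - 2 * t) hx) (suppX (k := t - 2 * r) hB).
by rewrite muln1 [((t - _) * 3)%N]mulnC wexp1.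
Qed.

Lemma supp_residual m n d (f : nat -> fps K) a (c : nat -> K) :
  (forall s, (s < n)%N -> supp m s (f s)) -> supp m d a -> (forall s, (s != d %[mod m])%N -> c s = 0) ->
  supp m d (a - \sum_(s < n) fC (c s) * f s).
Proof.
move=> hs ha c0 N hN; rewrite fpsD fpsN fps_sum ha // big1 ?subrr // => s _; rewrite fCM.
have [e|ne] := eqVneq (s %% m)%N (d %% m)%N; last by rewrite c0 // mul0r.
by rewrite (hs s (ltn_ord s)) ?mulr0 // e.
Qed.

(** Triangular elimination without division, all leading coefficients being 1. The residual keeps
    its exponent class, so a form of another class is never subtracted. *)
Lemma eliminate m n d (f : nat -> fps K) a :
  (forall s, (s < n)%N -> unitary s (f s)) -> (forall s, (s < n)%N -> supp m s (f s)) -> supp m d a ->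
  exists c : nat -> K, (forall s, (s != d %[mod m])%N -> c s = 0) /\
   forall k, (k < n)%N -> (a - \sum_(s < n) fC (c s) * f s) k = 0.
Proof.
move=> hu hs ha; elim: n hu hs => [|n IHn] hu hs; first by exists (fun _ => 0).
have hs' s : (s < n)%N -> supp m s (f s) by move/ltnW/hs.
have [s /ltnW/hu //|//|c [c0 hc]] := IHn.
pose b := a - \sum_(s < n) fC (c s) * f s.
have sb : supp m d b := supp_residual hs' ha c0.
pose c' s := if s == n then b n else c s.
have e : a - \sum_(s < n.+1) fC (c' s) * f s = b - fC (b n) * f n.
  rewrite big_ord_recr /= /c' eqxx opprD addrA; congr (_ - _ - _).
  by apply: eq_bigr => s _; rewrite ltn_eqF.
exists c'; split=> [s ne|k].
  by rewrite /c'; case: eqP => [es|_]; [apply: sb; rewrite -es | apply: c0].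
rewrite e fpsD fpsN fCM ltnS leq_eqVlt => /orP[/eqP ->|lt].
  by rewrite (proj2 (hu n (ltnSn n))) mulr1 subrr.
by rewrite (proj1 (hu n (ltnSn n))) // mulr0 subr0; apply: hc.
Qed.

End Order.

Lemma supp_dil_mul (K : comNzRingType) m q (a : fps K) : (m %| q)%N -> supp m 0 (dil q a).
Proof.
move=> mq n; rewrite mod0n dilE => ne; case: ifP => // d.
by case/negP: ne; apply: dvdn_trans d.
Qed.
Lemma supp_eta24 : supp 24 1 eta24. Proof. by move=> n ne; apply: sqs_chi12. Qed.
Lemma supp_t2i : supp 24 3 t2i.
Proof.
move=> N ne; rewrite dilE; case: ifP => // /dvdnP[q eN]; rewrite eN mulnK //.
have [[k ek]|h] := sq_cases q; last exact: sqs0.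
rewrite ek sqsE /oddf; case: (boolP (odd k)) => // ok; case/negP: ne.
have hq : (q %% 8 = 1)%N.
  rewrite ek -(odd_double_half k) ok; move: (k./2); clear => m.
  rewrite (_ : ((true + m.*2) ^ 2 = (m * m.+1) * 4 + 1)%N); last by rewrite -muln2 /=; ring.
  have /dvdnP[s ->] : (2 %| m * m.+1)%N by rewrite dvdn2 oddM /= andbN.
  by rewrite -mulnA modnMDl.
by move: eN hq; clear; lia.
Qed.
Lemma supp_sub (K : comNzRingType) m q c (a : fps K) : (m %| q)%N -> supp q c a -> supp m c a.
Proof.
move=> mq h n ne; apply: h; apply: contra ne => /eqP e.
by rewrite -(modn_dvdm n mq) e modn_dvdm.
Qed.
Lemma supp_t3i : supp 12 0 t3i. Proof. exact: supp_dil_mul. Qed.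
Lemma supp_t4i : supp 12 0 t4i. Proof. exact: supp_dil_mul. Qed.

Lemma unitary_e1i r t : (t <= 3 * r)%N -> unitary t (e1i r t).
Proof.
apply: unitary_wform; split=> //; [exact: eta24_low | exact: eta24_lead | exact: t3i_lead | |].
  by move=> k k3; apply: (@mulf_low _ t2i t4i 3 0); rewrite ?addn0 //; exact: t2i_low.
have := @mulf_lead _ t2i t4i 3 0 t2i_low; rewrite addn0 => -> //.
by rewrite t2i_lead t4i_lead.
Qed.
Lemma supp_e1i r t : (t <= 3 * r)%N -> supp 12 t (e1i r t).
Proof.
apply: supp_wform; [exact: supp_sub supp_eta24 | exact: supp_t3i |].
exact: (suppM (supp_sub _ supp_t2i) supp_t4i).
Qed.

(** * Translation by one on the three conjugates *)

Section Twists.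
Variable R : realType.
Local Notation C := R[i].
Local Open Scope complex_scope.
Local Notation ez := (@ez R).
Local Notation Beta := (Beta R).
Local Notation zeta := (zeta R).
Local Notation T2 := (T2 R).
Local Notation T3 := (T3 R).
Local Notation T4 := (T4 R).
Local Notation E1 := (@E1 R).
Local Notation E2 := (@E2 R).
Local Notation E3 := (@E3 R).
Implicit Types (a b : fps C).
Local Notation toC := (fmap (intr : {rmorphism int -> C})).

Lemma toC_eta24 : toC eta24 = Beta.
Proof. by apply: fpsP => N; rewrite fmapE Beta_coef. Qed.

Lemma toC_th mu (f : nat -> int) (B : nat -> C) : (forall n, (f n)%:~R = B n * (wt R n)%:C) ->
  toC (dil mu (sqs f)) = th mu B.
Proof.
move=> h; apply: fpsP => N; rewrite fmapE /th !dilE; case: ifP => // _.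
have [[k ->]|hk] := sq_cases (N %/ mu); first by rewrite !sqsE -h.
by rewrite !sqs0.
Qed.

Lemma toC_t2i : toC t2i = T2.
Proof.
apply: toC_th => n; rewrite /oddf /th2f; case: (boolP (odd n)) => on; last by rewrite mul0r.
case: n on => // n _; rewrite /wt (rmorph_nat (real_complex R) 2) mulVf //.
by rewrite pnatr_eq0.
Qed.

Lemma dil12_sqs (f : nat -> int) : dil 12 (sqs f) = dil 3 (sqs (fun n => if odd n then 0 else f n./2)).
Proof. by rewrite -dil4_sqs dil_dil. Qed.

Lemma toC_t3i : toC t3i = T3.
Proof.
rewrite /t3i /phip dil12_sqs; apply: toC_th => n; rewrite /th3f; case: (boolP (odd n)) => on; first by rewrite mul0r.
rewrite mul1r; case: n on => [|[|n]] //= _; by rewrite (rmorph_nat (real_complex R) 2).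
Qed.
Lemma toC_t4i : toC t4i = T4.
Proof.
rewrite /t4i /phim dil12_sqs; apply: toC_th => n; rewrite /th4f; case: (boolP (odd n)) => on; first by rewrite mul0r.
case: n on => [|[|n]] //= _; rewrite ?mulr1 // (rmorph_nat (real_complex R) 2) /sgn2 /=.
by rewrite intrM rmorphXn rmorphN1 mulrC.
Qed.

Lemma toC_e1i r t : toC (e1i r t) = E1 r t.
Proof. rewrite /e1i /E1 -toC_eta24 -toC_t2i -toC_t3i -toC_t4i -rmorphM.
exact: (wform_morph (fmap (intr : {rmorphism int -> C}))). Qed.

Lemma twE u a N : tw u a N = u ^+ N * a N. Proof. by []. Qed.

Lemma zeta_eqm m n : (m = n %[mod 24])%N -> zeta ^+ m = zeta ^+ n.
Proof. by move=> e; rewrite /zeta -!ezM !mul1n; apply: ez_eqm. Qed.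

Lemma zeta12 : zeta ^+ 12 = -1.
Proof.
have e : (zeta ^+ 12) ^+ 2 = 1 by rewrite -exprM (@zeta_eqm _ 0).
have /eqP := e; rewrite sqrf_eq1 => /orP[/eqP h|/eqP //].
by have := @ez_neq1 R 24 12 isT isT; rewrite -[12%N]mul1n ezM -/zeta h eqxx.
Qed.

Lemma tw_supp24 c a : supp 24 c a -> tw zeta a = fC (zeta ^+ c) * a.
Proof.
move=> h; apply: fpsP => N; rewrite fCM twE.
have [e|ne] := eqVneq (N %% 24)%N (c %% 24)%N; last by rewrite h // !mulr0.
by rewrite (zeta_eqm e).
Qed.

Lemma supp_toC m c (a : fps int) : supp m c a -> supp m c (toC a).
Proof. by move=> h n ne; rewrite fmapE h // rmorph0. Qed.

Lemma tw_T2 : tw zeta T2 = fC (zeta ^+ 3) * T2.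
Proof. by apply: tw_supp24; rewrite -toC_t2i; apply/supp_toC/supp_t2i. Qed.

(** Exponents of both series are 12 k^2, and zeta^12 = -1 contributes the sign (-1)^k that separates
    theta_3 from theta_4. *)
Lemma tw_T34 : tw zeta T3 = T4 /\ tw zeta T4 = T3.
Proof.
have z2 n : (-1) ^+ (n ^ 2) = (-1) ^+ n :> C by rewrite -signr_odd oddX /= signr_odd.
suff h N : zeta ^+ N * T3 N = T4 N /\ zeta ^+ N * T4 N = T3 N by split; apply: fpsP => N; rewrite twE; have [] := h N.
rewrite -toC_t3i -toC_t4i !fmapE !dilE; case: ifP => [/dvdnP[q ->]|_]; last by rewrite rmorph0 mulr0.
rewrite mulnK // [(q * 12)%N]mulnC exprM zeta12.
have [[k ->]|h] := sq_cases q; last by rewrite !sqs0 // rmorph0 mulr0.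
rewrite !sqsE z2; case: k => [|k]; first by rewrite /sgn2 expr0 mul1r.
have e2 : (if k.+1 == 0%N then 1 else 2) = 2 :> int by [].
have e4 : sgn2 k.+1 = 2 * (-1) ^+ k.+1 by [].
rewrite !e2 !e4 rmorphM rmorphXn rmorphN1.
have uu : (-1) ^+ k.+1 * (-1) ^+ k.+1 = 1 :> C by rewrite -exprMn mulrNN mulr1 expr1n.
by split; [rewrite mulrC | rewrite mulrCA uu mulr1].
Qed.

Lemma tw_wform (x A B A' B' : fps C) (u : C) e i j n r t : tw u x = fC e * x -> tw u A = fC (e ^+ i) * A' -> tw u B = fC (e ^+ j) * B' ->
  ((t <= 2 * r)%N -> (t + i * (2 * r - t) = n)%N) ->
  ((2 * r < t)%N -> (6 * r - 2 * t + j * (t - 2 * r) = n)%N) ->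
  tw u (wform x A B r t) = fC (e ^+ n) * wform x A' B' r t.
Proof.
move=> hx hA hB h1 h2; have CM (c d : C) : fC c * fC d = fC (c * d).
  by apply: fpsP => N; rewrite fCM !fCE; case: eqP; rewrite ?mulr0.
have [le|lt] := leqP t (2 * r).
  rewrite !wform_le // -(h1 le) twM !twX hx hA !exprMn !fCX mulrACA CM -exprM exprD.
  by [].
rewrite !wform_gt // -(h2 lt) twM !twX hx hB !exprMn !fCX mulrACA CM -exprM exprD.
by [].
Qed.

Lemma fC1 : fC 1 = 1 :> fps C. Proof. by apply: fpsP => -[|n]. Qed.

Lemma tw_E1 r t : (t <= 3 * r)%N -> tw zeta (E1 r t) = fC (zeta ^+ t) * E2 r t.
Proof.
move=> le; have [t3 t4] := tw_T34; rewrite /E1 /E2.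
apply: (@tw_wform _ _ _ _ _ _ _ 0 3); rewrite ?tw_Beta //; last exact: wexp1.
- by rewrite expr0 fC1 mul1r.
- by rewrite twM t4 tw_T2 mulrA.
- by rewrite mul0n addn0.
Qed.
Lemma tw_E2 r t : (t <= 3 * r)%N -> tw zeta (E2 r t) = fC (zeta ^+ t) * E1 r t.
Proof.
move=> le; have [t3 t4] := tw_T34; rewrite /E1 /E2.
apply: (@tw_wform _ _ _ _ _ _ _ 0 3); rewrite ?tw_Beta //; last exact: wexp1.
- by rewrite expr0 fC1 mul1r.
- by rewrite twM t3 tw_T2 mulrA.
- by rewrite mul0n addn0.
Qed.
Lemma tw_E3 r t : (t <= 3 * r)%N -> tw zeta (E3 r t) = fC (zeta ^+ (6 * r - 2 * t)) * E3 r t.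
Proof.
move=> le; have [t3 t4] := tw_T34; rewrite /E3.
apply: (@tw_wform _ _ _ _ _ _ _ 3 0); rewrite ?tw_Beta //; last 2 first.
- exact: wexp2.
- by rewrite mul0n addn0.
- by rewrite twZ tw_T2 mulrCA.
- by rewrite twZ twM t3 t4 expr0 fC1 mul1r [T4 * T3]mulrC.
Qed.

Lemma tw_pow_odd e a b m : tw zeta a = fC e * b -> tw zeta b = fC e * a ->
  tw (zeta ^+ (2 * m + 1)) a = fC (e ^+ (2 * m + 1)) * b.
Proof.
move=> ha hb.
have ea N : zeta ^+ N * a N = e * b N by rewrite -twE ha fCM.
have eb N : zeta ^+ N * b N = e * a N by rewrite -twE hb fCM.
apply: fpsP => N; rewrite twE fCM -exprM [((2 * m + 1) * N)%N]mulnC exprM.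
move: (zeta ^+ N) (a N) (b N) (ea N) (eb N) => Z A B hA hB; elim: m => [|m IHm].
  by rewrite !expr1.
rewrite (_ : (2 * m.+1 + 1 = (2 * m + 1).+2)%N); last by ring.
move: (2 * m + 1)%N IHm => k IHk.
have -> : Z ^+ k.+2 * A = Z * (Z * (Z ^+ k * A)) by rewrite !exprS !mulrA.
rewrite IHk (mulrCA Z (e ^+ k)) hB (mulrCA Z (e ^+ k)) (mulrCA Z e) hA !exprS.
by ring.
Qed.

(** Since p^2 = 1 (mod 24), translation by 1 after the Hecke operator is translation by p before
    it. *)
Lemma tw_hecke p r a : (p * p = 1 %[mod 24])%N -> (0 < p)%N ->
  tw zeta (hecke p r a) = hecke p r (tw (zeta ^+ p) a).
Proof.
move=> pp p0; apply: fpsP => N; rewrite twE !heckeE twE mulrDr; congr (_ + _).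
  by rewrite -exprM mulnA (@zeta_eqm (p * p * N) N) // -modnMml pp modnMml mul1n.
rewrite !dilE; case: ifP => [/dvdnP[q ->]|_]; last by rewrite !mulr0.
by rewrite mulnK // twE -exprM mulrCA [(q * p)%N]mulnC.
Qed.

End Twists.

(** * Decomposition of Hecke images *)

Lemma next_residue a b : exists d, [/\ (0 < d <= 12)%N, (a + d = b %[mod 12])%N &
  forall N, (a < N < a + d)%N -> (N != b %[mod 12])%N].
Proof. by exists (12 - (a + 11 * b) %% 12)%N; split; [lia | lia |] => N; lia. Qed.

Section Decomposition.
Variable R : realType.
Local Notation C := R[i].
Local Open Scope complex_scope.
Local Notation ez := (@ez R).
Local Notation Beta := (Beta R).
Local Notation zeta := (zeta R).
Local Notation E1 := (@E1 R).
Local Notation E2 := (@E2 R).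
Local Notation E3 := (@E3 R).
Implicit Types (a b : fps C).
Local Notation toC := (fmap (intr : {rmorphism int -> C})).

Lemma zlawZ r c a b : disc a -> disc b -> zlaw r a b -> zlaw r (fC c * a) (fC c * b).
Proof.
move=> da db h y y0; rewrite (evZ_disc c da (nrm_Qy (divr_gt0 ltr01 y0))).
by rewrite (evZ_disc c db (nrm_Qy y0)) (h y y0) mulrCA.
Qed.
Lemma zlawD r a b a' b' : disc a -> disc b -> disc a' -> disc b' -> zlaw r a b -> zlaw r a' b' ->
  zlaw r (a + a') (b + b').
Proof.
move=> da db da' db' h h' y y0; have q1 := nrm_Qy (divr_gt0 ltr01 y0).
by rewrite (evD_disc da da' q1) (evD_disc db db' (nrm_Qy y0)) (h y y0) (h' y y0) mulrDr.
Qed.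

Definition lin n (c : nat -> C) (f : nat -> fps C) : fps C := \sum_(s < n) fC (c s) * f s.

Lemma lin0 c f : lin 0 c f = fC 0.
Proof. by rewrite /lin big_ord0; apply: fpsP => -[|n]. Qed.
Lemma linS n c f : lin n.+1 c f = lin n c f + fC (c n) * f n.
Proof. by rewrite /lin big_ord_recr. Qed.

Lemma disc_lin n c f : (forall s, disc (f s)) -> disc (lin n c f).
Proof.
move=> h; elim: n => [|n IHn]; first by rewrite lin0; apply: disc_fC.
by rewrite linS; apply: discD => //; apply: discM => //; apply: disc_fC.
Qed.

Lemma zlaw_lin r n c f g : (forall s, disc (f s)) -> (forall s, disc (g s)) ->
  (forall s, (s < n)%N -> zlaw r (f s) (g s)) -> zlaw r (lin n c f) (lin n c g).
Proof.
move=> df dg; elim: n => [|n IHn] h.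
  by rewrite !lin0 => y y0; rewrite (_ : fC 0 = 0) ?ev0 ?mulr0 //; apply: fpsP => -[|n].
have dfn := disc_lin n c df; have dgn := disc_lin n c dg.
rewrite !linS; apply: zlawD => //; try by apply: discM => //; apply: disc_fC.
  by apply: IHn => s /ltnW; apply: h.
by apply: zlawZ => //; apply: h.
Qed.

Lemma zlaw_residual r n c f g a b : disc a -> disc b -> (forall s, disc (f s)) ->
  (forall s, disc (g s)) -> zlaw r a b -> (forall s, (s < n)%N -> zlaw r (f s) (g s)) ->
  zlaw r (a - lin n c f) (b - lin n c g).
Proof.
move=> da db df dg h hl; have dfn := disc_lin n c df; have dgn := disc_lin n c dg.
have e1 : fC (-1) = -1 :> fps C by apply: fpsP => -[|k]; rewrite fpsN fps1 //= oppr0.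
have := zlawZ (-1) dfn dgn (zlaw_lin c df dg hl); rewrite e1 !mulN1r => hN.
exact: zlawD da db (discN dfn) (discN dgn) h hN.
Qed.

Lemma tw_residual n (c c' w : nat -> C) (f g : nat -> fps C) a b e :
  tw zeta a = fC e * b -> (forall s, (s < n)%N -> tw zeta (f s) = fC (w s) * g s) ->
  (forall s, (s < n)%N -> c s * w s = e * c' s) ->
  tw zeta (a - lin n c f) = fC e * (b - lin n c' g).
Proof.
move=> ha hf hc; apply: fpsP => N.
have eN : zeta ^+ N * a N = e * b N by rewrite -twE ha fCM.
rewrite twE fCM !fpsD !fpsN !mulrBr eN; congr (_ - _).
rewrite /lin !fps_sum !mulr_sumr; apply: eq_bigr => s _.
have hfN : zeta ^+ N * f s N = w s * g s N by rewrite -twE hf // fCM.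
by rewrite !fCM mulrCA hfN mulrA hc // mulrA.
Qed.

Lemma nrm_zetaX n : nrm (zeta ^+ n) = 1.
Proof. by rewrite nrmX nrm_zeta expr1n. Qed.
Lemma zetaX_neq0 n : zeta ^+ n != 0.
Proof. by apply/eqP => h; have := nrm_zetaX n; rewrite h nrm0 => /eqP; rewrite eq_sym oner_eq0. Qed.
Lemma zeta_inj m n : zeta ^+ m = zeta ^+ n -> (m = n %[mod 24])%N.
Proof.
move=> e; have h : ez 24 (m + 23 * n) = 1.
  rewrite -[(m + _)%N]mul1n ezM -/zeta exprD e -exprD (@zeta_eqm R _ 0) //; clear; lia.
have : (24 %| m + 23 * n)%N by apply: contraTT isT => /(@ez_neq1 R 24 _ isT); rewrite h eqxx.
by clear; lia.
Qed.

Lemma tw_coef0 m a b k : tw zeta a = fC (zeta ^+ m) * b -> (a k = 0 <-> b k = 0).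
Proof.
move=> h; have : zeta ^+ k * a k = zeta ^+ m * b k by rewrite -twE h fCM.
move: (zeta ^+ k) (zeta ^+ m) (zetaX_neq0 k) (zetaX_neq0 m) => u v u0 v0 e.
split=> z; [move: e; rewrite z mulr0 => /esym | move: e; rewrite z mulr0] => /eqP;
  by rewrite mulf_eq0 ?(negPf u0) ?(negPf v0) => /eqP.
Qed.
Lemma tw_eigen m a k : tw zeta a = fC (zeta ^+ m) * a -> (k != m %[mod 24])%N -> a k = 0.
Proof.
move=> h ne; have : zeta ^+ k * a k = zeta ^+ m * a k by rewrite -twE h fCM.
have nz : zeta ^+ k - zeta ^+ m != 0.
  by rewrite subr_eq0; apply: contra ne => /eqP /zeta_inj ->.
move: (zeta ^+ k) (zeta ^+ m) nz => u v uv /eqP; rewrite -subr_eq0 -mulrBl mulf_eq0 (negPf uv).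
by move/eqP.
Qed.

Lemma zlaw_zero r a b : disc a -> zlaw r a b -> b = 0 -> a = 0.
Proof.
move=> da h b0; have [|M hM] := da (1 / 2); first by lra.
apply: (ev_small _ hM) => [|x /andP[x0 x1]]; first by lra.
have lx : 0 < - ln x by rewrite oppr_gt0 ln_lt0 // x0 /=; lra.
pose y : R := pi / 12 / (- ln x).
have y0 : 0 < y by rewrite !divr_gt0 ?pi_gt0.
have <- : Qy (1 / y) = x%:C.
  rewrite /Qy (_ : - (pi * (1 / y) / 12) = ln x) ?lnK //.
  have p0 : pi != 0 :> R by rewrite gt_eqF ?pi_gt0.
  rewrite -[RHS]opprK /y; congr (- _); move: (- ln x) (pi : R) lx p0 => L P /lt0r_neq0 L0 P0.
  have n12 : (12 : R) != 0 by rewrite pnatr_eq0.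
  by rewrite -(mulrA P 12^-1) -invfM mul1r invf_div mulrCA mulfV // mulr1 mulrC mulKf.
by rewrite (h y y0) b0 ev0 mulr0.
Qed.

Section Prime.
Variables p r : nat.
Hypotheses (p_pr : prime p) (p3 : (p %% 4 = 3)%N) (p_gt3 : (3 < p)%N).
Hypotheses (r_even : ~~ odd r) (r_gt0 : (0 < r)%N).

Lemma zlaw_forms s : (s <= 3 * r)%N ->
  [/\ zlaw r (E1 r s) (E1 r s), zlaw r (E2 r s) (E3 r s) & zlaw r (E3 r s) (E2 r s)].
Proof.
move=> le.
have h1 := slaw_E1 ltr01 (nrm1 R) (nrm1 R) (blaw1 R) le.
have h2 := slaw_E2 ltr01 (nrm1 R) (nrm1 R) (blaw1 R) le.
have h3 := slaw_E3 ltr01 (nrm1 R) (nrm1 R) (blaw1 R) le.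
rewrite !expr1n in h1 h2 h3.
by split; [exact: zlaw_slaw h1 | exact: zlaw_slaw h2 | exact: zlaw_slaw h3].
Qed.

Lemma hecke_forms t : (t <= 3 * r)%N ->
  [/\ zlaw r (hecke p r (E1 r t)) (hecke p r (E1 r t)),
      zlaw r (hecke p r (E2 r t)) (hecke p r (E3 r t)) &
      zlaw r (hecke p r (E3 r t)) (hecke p r (E2 r t))].
Proof.
move=> le; have pR : 0 < p%:R^-1 :> R by rewrite invr_gt0 ltr0n prime_gt0.
have h1 := slaw_E1 ltr01 (nrm1 R) (nrm1 R) (blaw1 R) le.
have h2 := slaw_E2 ltr01 (nrm1 R) (nrm1 R) (blaw1 R) le.
have h3 := slaw_E3 ltr01 (nrm1 R) (nrm1 R) (blaw1 R) le.
rewrite !expr1n in h1 h2 h3.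
have g1 (g : C) : g ^+ 2 = -1 -> g ^+ (2 * r) = 1.
  by move=> e; rewrite exprM e -signr_odd (negPf r_even).
have tws j j' : (p %| 576 * j * j' + 1)%N ->
    [/\ slaw p%:R^-1 (ez p j) (ez p j') (2 * r) 1 (E1 r t) (E1 r t),
        slaw p%:R^-1 (ez p j) (ez p j') (2 * r) 1 (E2 r t) (E3 r t) &
        slaw p%:R^-1 (ez p j) (ez p j') (2 * r) 1 (E3 r t) (E2 r t)].
  move=> /(blaw_twist R p_pr p3 p_gt3)[g /g1 e hb].
  have k1 := slaw_E1 pR (nrm_ez R p j) (nrm_ez R p j') hb le.
  have k2 := slaw_E2 pR (nrm_ez R p j) (nrm_ez R p j') hb le.
  have k3 := slaw_E3 pR (nrm_ez R p j) (nrm_ez R p j') hb le.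
  by rewrite e in k1 k2 k3.
have d1 := @disc_E1 R r t; have d2 := @disc_E2 R r t; have d3 := @disc_E3 R r t.
split.
- by apply: (hecke_law p_pr p_gt3 r_gt0 d1 d1 h1) => j j' /tws[].
- by apply: (hecke_law p_pr p_gt3 r_gt0 d2 d3 h2) => j j' /tws[].
- by apply: (hecke_law p_pr p_gt3 r_gt0 d3 d2 h3) => j j' /tws[].
Qed.

Let p0 : (0 < p)%N := prime_gt0 p_pr.
Let pE : exists m, p = (2 * m + 1)%N.
Proof. by exists (p %/ 2)%N; move: p3; clear; lia. Qed.
Let pp : (p * p = 1 %[mod 24])%N. Proof. exact: pp24. Qed.

Lemma tw_hecke_E t : (t <= 3 * r)%N ->
  [/\ tw zeta (hecke p r (E1 r t)) = fC (zeta ^+ (p * t)) * hecke p r (E2 r t),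
      tw zeta (hecke p r (E2 r t)) = fC (zeta ^+ (p * t)) * hecke p r (E1 r t) &
      tw zeta (hecke p r (E3 r t)) = fC (zeta ^+ (p * (6 * r - 2 * t))) * hecke p r (E3 r t)].
Proof.
move=> le; have [m pm] := pE.
have t1 := tw_E1 R le; have t2 := tw_E2 R le; have t3 := tw_E3 R le.
have h1 := tw_pow_odd m t1 t2; have h2 := tw_pow_odd m t2 t1; have h3 := tw_pow_odd m t3 t3.
rewrite -!pm -!exprM ![(_ * p)%N]mulnC in h1 h2 h3.
have H e a b : tw (zeta ^+ p) a = fC e * b -> tw zeta (hecke p r a) = fC e * hecke p r b.
  by move=> h; rewrite tw_hecke // h heckeZ.
by split; [exact: H h1 | exact: H h2 | exact: H h3].
Qed.

(** Y + 2X = 6 r p, and 24 divides 6 r (p - 1) because r is even and p odd. *)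
Lemma arith_r X Y t : (t <= 3 * r)%N -> X = (p * t)%N -> Y = (p * (6 * r - 2 * t))%N ->
  exists Z, (Y + 2 * X = 24 * Z + 6 * r)%N.
Proof.
move=> le -> ->; have [m pm] := pE; have : (r = r./2 * 2)%N by rewrite -{1}(odd_double_half r) (negPf r_even) -muln2.
move: (r./2) => q rq; exists (m * q)%N; rewrite (mulnCA 2 p t) -mulnDr subnK; last by move: le; clear; lia.
by rewrite pm rq; ring.
Qed.

(** Elimination cancels all coefficients up to 3r; the exponent class modulo 12 then moves the first
    possible one to 3r + d. The residuals R1 and R2 both reach this order, being translates of each
    other, while R3 is an eigenvector of translation and starts at 24 - 2d at the earliest. The
    orders add up to 6r + 24 whatever d is, so [liouville] applies and one residual, hence R1,
    vanishes. *)
Theorem hecke_decomposition t : (t <= 3 * r)%N -> exists c : nat -> int,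
  (forall s, (s != p * t %[mod 12])%N -> c s = 0) /\
  hecke p r (e1i r t) = \sum_(s < (3 * r).+1) fC (c s) * e1i r s.
Proof.
move=> le; have pp12 : (p * p = 1 %[mod 12])%N by apply: (pp_dvd p_pr p3 p_gt3).
have cp : coprime p 12.
  have h3 := p_mod3 p_pr p_gt3; rewrite (_ : 12 = 2 ^ 2 * 3)%N // coprimeMr coprimeXr.
    by rewrite coprime_sym prime_coprime // h3.
  by rewrite coprimen2 p_odd.
have su := hecke_supp r cp pp12 (supp_e1i le).
have hu s : (s < (3 * r).+1)%N -> unitary s (e1i r s) by rewrite ltnS; apply: unitary_e1i.
have hs s : (s < (3 * r).+1)%N -> supp 12 s (e1i r s) by rewrite ltnS; apply: supp_e1i.
have [c [c0 hc]] := eliminate hu hs su; exists c; split=> //.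
have sr := supp_residual hs su c0.
set rho := _ - _ in hc sr; suff rho0 : rho = 0 by apply/eqP; rewrite -subr_eq0 -/rho rho0.
pose cC s : C := (c s)%:~R.
(* Translation multiplies the form s by zeta^s but the Hecke image by zeta^(pt), so the conjugate
   coefficients carry the quotient. It is a sign, as s = p t (mod 12) whenever c s is nonzero. *)
pose w s : C := cC s * (zeta ^+ s / zeta ^+ (p * t)).
pose n := (3 * r).+1.
pose R1 : fps C := hecke p r (E1 r t) - lin n cC (E1 r).
pose R2 : fps C := hecke p r (E2 r t) - lin n w (E2 r).
pose R3 : fps C := hecke p r (E3 r t) - lin n w (E3 r).
have R1E : R1 = toC rho.
  rewrite /R1 /rho rmorphB /= fmap_hecke toC_e1i; congr (_ - _).
  rewrite /lin rmorph_sum; apply: eq_bigr => s _ /=; rewrite rmorphM /= fmapC.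
  by rewrite -toC_e1i.
suff R10 : R1 = 0.
  apply: fpsP => N; apply/eqP; rewrite -(intr_eq0 C).
  by rewrite -[_%:~R]/(toC rho N) -R1E R10 fps0.
have d1 : disc R1 by apply: discD; [apply/disc_hecke/disc_E1 | apply/discN/disc_lin/disc_E1].
have d2 : disc R2 by apply: discD; [apply/disc_hecke/disc_E2 | apply/discN/disc_lin/disc_E2].
have d3 : disc R3 by apply: discD; [apply/disc_hecke/disc_E3 | apply/discN/disc_lin/disc_E3].
have [z1 z2 z3] := hecke_forms le.
have [l1 l2 l3] : [/\ zlaw r R1 R1, zlaw r R2 R3 & zlaw r R3 R2].
  have dh1 := disc_hecke r p0 (@disc_E1 R r t); have dh2 := disc_hecke r p0 (@disc_E2 R r t).
  have dh3 := disc_hecke r p0 (@disc_E3 R r t).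
  split.
  - by apply: (zlaw_residual _ dh1 dh1 (@disc_E1 R r) (@disc_E1 R r) z1) => s; rewrite ltnS => /zlaw_forms[].
  - by apply: (zlaw_residual _ dh2 dh3 (@disc_E2 R r) (@disc_E3 R r) z2) => s; rewrite ltnS => /zlaw_forms[].
  - by apply: (zlaw_residual _ dh3 dh2 (@disc_E3 R r) (@disc_E2 R r) z3) => s; rewrite ltnS => /zlaw_forms[].
have [h1 h2 h3] := tw_hecke_E le.
have [Z hZ] := arith_r le (erefl _) (erefl _).
have zpt := zetaX_neq0 (p * t).
have ccase s : c s = 0 \/ (s = p * t %[mod 12])%N.
  by have [e|ne] := eqVneq (s %% 12)%N ((p * t) %% 12)%N; [right | left; apply: c0].
have t1 : tw zeta R1 = fC (zeta ^+ (p * t)) * R2.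
  apply: (tw_residual h1 (w := fun s => zeta ^+ s)) => s; first by rewrite ltnS => /(tw_E1 R) ->.
  by move=> _; rewrite /w mulrCA; congr (_ * _); rewrite mulrC divfK.
have t2 : tw zeta R2 = fC (zeta ^+ (p * t)) * R1.
  apply: (tw_residual h2 (w := fun s => zeta ^+ s)) => s; first by rewrite ltnS => /(tw_E2 R) ->.
  move=> _; rewrite /w /cC; have [->|e] := ccase s; first by rewrite !mul0r mulr0.
  rewrite -mulrA [RHS]mulrC; congr (_ * _); rewrite mulrAC -exprD (@zeta_eqm R (s + s) (p * t + p * t)) ?exprD ?mulfK //.
  by move: e; move: (p * t)%N; clear; lia.
have t3 : tw zeta R3 = fC (zeta ^+ (p * (6 * r - 2 * t))) * R3.
  apply: (tw_residual h3 (w := fun s => zeta ^+ (6 * r - 2 * s))) => s.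
    by rewrite ltnS => /(tw_E3 R) ->.
  rewrite ltnS => les; rewrite /w /cC; have [->|e] := ccase s; first by rewrite !mul0r mulr0.
  rewrite mulrC; congr (_ * _); apply: zeta_eqm.
  by move: hZ e les; move: (p * t)%N (p * _)%N; clear; lia.
have [d [d12 dN dlow]] := next_residue (3 * r) (p * t).
have o1 k : (k < 3 * r + d)%N -> R1 k = 0.
  move=> lt; rewrite R1E fmapE; have [lk|lk] := leqP k (3 * r); first by rewrite hc ?rmorph0.
  by rewrite sr ?rmorph0 // dlow // lk.
have o2 k : (k < 3 * r + d)%N -> R2 k = 0 by move=> /o1 /(tw_coef0 k t1).
(* The exponents of R3 are p(6r - 2t) modulo 24. By [hZ] and 3r + d = p t (mod 12) this is the class
   of -2d, whose first member is 24 - 2d. *)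
have o3 k : (k < 24 - 2 * d)%N -> R3 k = 0.
  move=> lt; apply: (tw_eigen t3).
  by move: hZ dN lt d12; move: (p * t)%N (p * _)%N; clear; lia.
have := liouville d1 d2 d3 l1 l2 l3 t1 t2 t3 (nrm_zetaX _) (nrm_zetaX _) (nrm_zetaX _) o1 o2 o3.
have -> : (3 * r + d + (3 * r + d) + (24 - 2 * d) = 6 * r + 24)%N by move: d12; clear; lia.
move/(_ erefl); move: R1 R2 R3 t1 l2 d2 {R1E d1 d3 l1 l3 t2 t3 o1 o2 o3} => a1 a2 a3 t1 l2 d2.
have a20 : a2 = 0 -> a1 = 0.
  by move=> e; apply: fpsP => N; apply/(tw_coef0 N t1); rewrite e.
by move=> /fps_domain[/fps_domain[//|]|/(zlaw_zero d2 l2)].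
Qed.

End Prime.
End Decomposition.

(** * Nilpotency modulo two *)

Local Notation E := (euler int).
Local Notation to2 := (fmap (intr : {rmorphism int -> 'F_2})).

Section FmapMorph.
Variables (K L : comNzRingType) (f : {rmorphism K -> L}).
Lemma fmapM a b : fmap f (a * b) = fmap f a * fmap f b.
Proof. exact: (rmorphM (fmap f)). Qed.
Lemma fmap_sum n (F : nat -> fps K) : fmap f (\sum_(i < n) F i) = \sum_(i < n) fmap f (F i).
Proof. exact: (rmorph_sum (fmap f)). Qed.
End FmapMorph.

Lemma even_F2 (x : int) : (x%:~R == 0 :> 'F_2) = (2 %| x)%Z.
Proof. by rewrite -(dvdz_pcharf (pchar_Fp (isT : prime 2))). Qed.

Lemma natr_F2 n : n%:R = (odd n)%:R :> 'F_2.
Proof.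
rewrite -{1}(odd_double_half n) natrD -muln2 natrM (pchar_Fp_0 (isT : prime 2)).
by rewrite mulr0 addr0.
Qed.

Lemma signr_F2 n : (-1) ^+ n = 1 :> 'F_2.
Proof. by have -> : -1 = 1 :> 'F_2; [apply/val_inj | rewrite expr1n]. Qed.

Lemma to2_theta m (f : nat -> int) : (0 < m)%N -> f 0%N = 1 -> (forall n, (2 %| f n.+1)%Z) ->
  to2 (dil m (sqs f)) = 1.
Proof.
move=> m0 f0 f2; apply: fpsP => N; rewrite fmapE fps1 dilE.
case: N => [|N]; first by rewrite dvdn0 div0n (sqsE f 0) f0.
case: ifP => [/dvdnP[q eN]|_]; last by rewrite rmorph0.
have -> : (N.+1 %/ m)%N = q by rewrite eN mulnK.
have [[k eq]|h] := sq_cases q; last by rewrite sqs0 // rmorph0.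
case: k eq => [|k] eq; first by rewrite eq mul0n in eN.
by rewrite eq sqsE; apply/eqP; rewrite [_ == _]even_F2.
Qed.

Lemma to2_t3i : to2 t3i = 1.
Proof. exact: to2_theta. Qed.
Lemma to2_t4i : to2 t4i = 1.
Proof.
apply: to2_theta => // n; rewrite (_ : sgn2 n.+1 = 2 * (-1) ^+ n.+1) //.
by rewrite dvdz_mulr.
Qed.

Lemma eta24_euler : eta24 = fX int 1 * dil 24 E.
Proof.
apply: fpsP => N; rewrite fXM; case: N => [|N]; first exact: (sqsE chi12 0).
rewrite ltn0Sn subn1 succnK dilE; case: ifP => [/dvdnP[q eN]|nd].
  by rewrite eN mulnK // pentagonal mulnC addn1.
by apply: sqs_chi12; move: nd; clear; lia.
Qed.

Lemma eta24_cube : eta24 ^+ 3 = fX int 3 * dil 24 jac.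
Proof. by rewrite eta24_euler exprMn fXX -dilX // jacobi_cube. Qed.

(** Jacobi's formula expands eta^3 as a sum of signed odd n times q^(3 n^2); modulo 2 these
    coefficients are all 1. *)
Lemma to2_t2i : to2 t2i = to2 eta24 ^+ 3.
Proof.
rewrite -rmorphXn eta24_cube; apply: fpsP => N; rewrite !fmapE.
have [e|ne] := eqVneq (N %% 24)%N 3%N; last first.
  rewrite supp_t2i // fXM; case: ifP => // le; rewrite dilE; case: ifP => // d.
  by exfalso; move: ne le d; clear; lia.
have [q ->] : exists q, N = (24 * q + 3)%N by exists (N %/ 24)%N; move: e; clear; lia.
rewrite fXM leq_addl addnK dil_mul // (_ : 24 * q + 3 = 3 * (8 * q + 1))%N; last by ring.
rewrite dil_mul // (_ : jac q = sqs jacf (8 * q + 1)%N) //.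
have [[k ->]|h] := sq_cases (8 * q + 1); last by rewrite !sqs0.
rewrite !sqsE /oddf /jacf; case: (boolP (odd k)) => ok; last by [].
by rewrite rmorphM rmorphXn rmorphN1 signr_F2 mul1r !rmorph_nat (natr_F2 k) ok.
Qed.

(** Modulo 2, theta_3 and theta_4 are 1 and half of theta_2 is eta^3, so both shapes of the form
    reduce to eta^t and r disappears. *)
Lemma to2_e1i r t : (t <= 3 * r)%N -> to2 (e1i r t) = to2 eta24 ^+ t.
Proof.
move=> le; have -> : to2 (e1i r t) = wform (to2 eta24) (to2 t3i) (to2 (t2i * t4i)) r t.
  exact: (wform_morph (fmap (intr : {rmorphism int -> 'F_2}))).
rewrite fmapM to2_t3i to2_t4i mulr1 to2_t2i; case: wformP => h.
  by rewrite expr1n mulr1.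
by rewrite -exprM -exprD wexp1.
Qed.

Lemma to2_hecke p r a : odd p -> to2 (hecke p r a) = hecke p 1 (to2 a).
Proof.
move=> op; rewrite fmap_hecke; apply: fpsP => N; rewrite !heckeE; congr (_ + _ * _).
by rewrite !natrX (natr_F2 p) op !expr1n.
Qed.

Lemma unitary_free (K : comNzRingType) n (f : nat -> fps K) (c : nat -> K) :
  (forall s, unitary s (f s)) -> \sum_(s < n) fC (c s) * f s = 0 -> forall s, (s < n)%N -> c s = 0.
Proof.
move=> hu h; elim/ltn_ind => s IHs lt.
have : (\sum_(i < n) fC (c i) * f i) s = 0 by rewrite h.
rewrite fps_sum (bigD1 (Ordinal lt)) // big1.
  by move=> /(etrans (esym (addr0 _))); rewrite fCM; change (c s * f s s = 0 -> c s = 0); rewrite (proj2 (hu s)) mulr1.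
move=> i ne; rewrite fCM; case: (ltngtP i s) => his.
- by rewrite IHs ?mul0r.
- by rewrite (proj1 (hu i)) ?mulr0.
- by case/negP: ne; apply/eqP/val_inj.
Qed.

Lemma unitary_eta : unitary 1 (to2 eta24).
Proof.
by split=> [k k1|]; rewrite fmapE ?eta24_lead // eta24_low // rmorph0.
Qed.

Definition cop6 s := odd s && (s %% 3 != 0)%N.

Lemma cop6_mod p s u : (p %% 4 = 3)%N -> (p %% 3 != 0)%N -> cop6 s -> (u = p * s %[mod 12])%N -> cop6 u.
Proof.
move=> p4 p3 /andP[os s3] e.
have [pp ss] : (p %% 12 = 7 \/ p %% 12 = 11)%N /\ (s %% 12 \in [:: 1; 5; 7; 11])%N.
  by rewrite !inE; split; move: p4 p3 os s3; clear; lia.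
move: e; rewrite -modnMm; move: ss; rewrite !inE /cop6.
by case: pp => -> /or4P[] /eqP ->; clear; lia.
Qed.

(** Such a p is 7 or 11 modulo 12, and multiplication by either exchanges {1, 5} with {7, 11}; a
    block of six consecutive exponents contains only one of these two pairs of classes. *)
Lemma block_drop p s u b : (p %% 4 = 3)%N -> (p %% 3 != 0)%N -> cop6 s -> (6 * b < s <= 6 * b.+1)%N ->
  (6 * b < u <= 6 * b.+1)%N -> (u != p * s %[mod 12])%N.
Proof.
move=> p4 p3 /andP[os s3] hs hu.
have [pp ss] : (p %% 12 = 7 \/ p %% 12 = 11)%N /\ (s %% 12 \in [:: 1; 5; 7; 11])%N.
  by rewrite !inE; split; move: p4 p3 os s3; clear; lia.
rewrite -[((p * s) %% 12)%N]modnMm; move: ss; rewrite !inE.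
case: pp => -> /or4P[] /eqP e; rewrite e; move: e hs hu; clear; lia.
Qed.

Section Nilpotent.
Variable R : realType.
Variable r : nat.
Hypotheses (r_even : ~~ odd r) (r_gt0 : (0 < r)%N).

Let rE : (r = 2 * r./2)%N.
Proof. by rewrite -{1}(odd_double_half r) (negPf r_even) mul2n. Qed.

Definition comb (c : nat -> int) : fps int := \sum_(s < (3 * r).+1) fC (c s) * e1i r s.

Lemma combE c N : comb c N = \sum_(s < (3 * r).+1) c s * e1i r s N.
Proof. by rewrite /comb fps_sum; apply: eq_bigr => s _; rewrite fCM. Qed.

Lemma to2_comb c : to2 (comb c) = \sum_(s < (3 * r).+1) fC (c s)%:~R * to2 eta24 ^+ s.
Proof.
rewrite /comb (fmap_sum _ _ (fun s => fC (c s) * e1i r s)); apply: eq_bigr => s _.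
by rewrite fmapM fmapC to2_e1i // -ltnS.
Qed.

(** Modulo 2 the form is eta^s, which also occurs in the weight 2 [be] for the least [be] with s <=
    6 [be]. There the Hecke image involves exponents up to 6 [be] only, and [block_drop] excludes
    the top block. Distinct powers of eta being independent modulo 2, the parities found in the
    small weight are those of c. *)
Lemma hecke_parity p s b c : good_prime p -> (s <= 3 * r)%N -> cop6 s -> (s <= 6 * b.+1)%N ->
  hecke p r (e1i r s) = comb c -> forall u, (6 * b < u <= 3 * r)%N -> (2 %| c u)%Z.
Proof.
move=> /and3P[p_pr /eqP p3 p_gt3] le cs sb hc u /andP[bu ur].
have pm3 := p_mod3 p_pr p_gt3; have op := p_odd p3.
(* s/6 rounded up, the number of the block of s. *)
pose be := ((s + 5) %/ 6)%N.
have hbe : (6 * be.-1 < s <= 6 * be)%N /\ (0 < be)%N.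
  by rewrite /be; case/andP: cs => os _; move: os; clear; lia.
have [d [d0 hd]] : exists d : nat -> int, (forall v, (v != p * s %[mod 12])%N -> d v = 0) /\
    hecke p (2 * be) (e1i (2 * be) s) = \sum_(v < (3 * (2 * be)).+1) fC (d v) * e1i (2 * be) v.
  by apply: (hecke_decomposition R p_pr p3 p_gt3); move: hbe; rewrite ?oddM //; clear; lia.
have le' : (s <= 3 * (2 * be))%N by move: hbe; clear; lia.
have lebr : (3 * (2 * be) <= 3 * r)%N by move: hbe le; rewrite rE; clear; lia.
pose d' v := if (v <= 3 * (2 * be))%N then d v else 0.
have e : \sum_(v < (3 * r).+1) fC ((c v)%:~R - (d' v)%:~R : 'F_2) * to2 eta24 ^+ v = 0.
  have e1 : to2 (comb c) = to2 (\sum_(v < (3 * (2 * be)).+1) fC (d v) * e1i (2 * be) v).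
    by rewrite -hc -hd !(to2_hecke _ _ op) !to2_e1i.
  rewrite to2_comb in e1.
  have e2 : to2 (\sum_(v < (3 * (2 * be)).+1) fC (d v) * e1i (2 * be) v) =
      \sum_(v < (3 * r).+1) fC (d' v)%:~R * to2 eta24 ^+ v.
    rewrite (fmap_sum _ _ (fun v => fC (d v) * e1i (2 * be) v)) (@big_ord_widen _ _ _ _ (3 * r).+1 (fun v => fmap (intr : {rmorphism int -> 'F_2}) (fC (d v) * e1i (2 * be) v))) //.
    rewrite big_mkcond; apply: eq_bigr => v _; rewrite /d' ltnS; case: ifP => lev.
      by rewrite fmapM fmapC to2_e1i.
    by rewrite rmorph0; apply: fpsP => N; rewrite fCM mul0r.
  rewrite e2 in e1.
  rewrite -[RHS](subrr (\sum_(v < (3 * r).+1) fC (d' v)%:~R * to2 eta24 ^+ v)) -{1}e1 -sumrB.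
  by apply: eq_bigr => v _; apply: fpsP => N; rewrite fpsD fpsN !fCM mulrBl.
have uX v : unitary v (to2 eta24 ^+ v) by have := unitaryX v unitary_eta; rewrite muln1.
have ult : (u < (3 * r).+1)%N by [].
have /eqP := @unitary_free _ _ (fun v => to2 eta24 ^+ v) (fun v => (c v)%:~R - (d' v)%:~R) uX e u ult; rewrite subr_eq0 => /eqP ecd.
rewrite -even_F2 ecd /d'; case: ifP => // ub; rewrite d0 ?rmorph0 //.
by apply: (@block_drop p s u b) => //; move: hbe sb bu ub; clear; lia.
Qed.

(** Modulo 2 only the first b blocks of six exponents remain. For b = r/2 the second condition is
    empty, since 3r = 6 (r/2). *)
Definition filt b (c : nat -> int) := (forall s, ~~ cop6 s -> c s = 0) /\
  (forall s, (6 * b < s <= 3 * r)%N -> (2 %| c s)%Z).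

Lemma hecke_step p b c : good_prime p -> filt b.+1 c ->
  exists c', filt b c' /\ hecke p r (comb c) = comb c'.
Proof.
move=> gp [c6 c2]; have /and3P[p_pr /eqP p3 p_gt3] := gp.
have pm3 := p_mod3 p_pr p_gt3.
have [|D hD] := @choice nat (nat -> int) (fun s d => (s <= 3 * r)%N ->
   (forall u, (u != p * s %[mod 12])%N -> d u = 0) /\ hecke p r (e1i r s) = comb d).
  move=> s; have [le|lt] := leqP s (3 * r); last by exists (fun _ => 0).
  by have [d hd] := hecke_decomposition R p_pr p3 p_gt3 r_even r_gt0 le; exists d.
exists (fun u => \sum_(s < (3 * r).+1) c s * D s u); split; last first.
  rewrite [comb c]/comb (hecke_sum p r (3 * r).+1 (fun s => fC (c s) * e1i r s)); apply: fpsP => N.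
  rewrite combE fps_sum.
  rewrite (eq_bigr (fun s : 'I__ => \sum_(u < (3 * r).+1) c s * (D s u * e1i r u N))); last first.
    move=> s _; have [_ hs] := hD s (ltn_ord s : (s <= 3 * r)%N).
    by rewrite heckeZ fCM hs combE mulr_sumr.
  rewrite exchange_big; apply: eq_bigr => u _; rewrite mulr_suml.
  by apply: eq_bigr => s _; rewrite mulrA.
split=> [u nu|u hu].
  rewrite big1 // => s _; have [cs|/c6 ->] := boolP (cop6 s); last by rewrite mul0r.
  have [d0 _] := hD s (ltn_ord s : (s <= 3 * r)%N); rewrite d0 ?mulr0 //.
  by apply: contra nu => /eqP; apply: (cop6_mod p3 pm3 cs).
apply: rpred_sum => s _; have [cs|/c6 ->] := boolP (cop6 s); last by rewrite mul0r dvdz0.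
have le : (s <= 3 * r)%N := ltn_ord s; have [_ hs] := hD s le.
have [sb|bs] := leqP s (6 * b.+1).
  by apply: dvdz_mull; exact: (hecke_parity gp le cs sb hs hu).
by apply: dvdz_mulr; apply: c2; rewrite bs.
Qed.

Definition exactly N p := (p %| N)%N && ~~ (p ^ 2 %| N)%N.

(** At N/p the second term of the operator is a coefficient of index N/p^2, absent when p^2 does not
    divide N. *)
Lemma hecke_exact p (a : fps int) N : prime p -> exactly N p -> hecke p r a (N %/ p)%N = a N.
Proof.
move=> p_pr /andP[/dvdnP[q ->] ne]; have p0 := prime_gt0 p_pr.
rewrite heckeE mulnK // mulnC dilE; case: ifP => [d|_]; last by rewrite mulr0 addr0 mulnC.
by case/negP: ne; rewrite expnS expn1 dvdn_pmul2r.
Qed.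

Lemma exactly_div p q N : prime p -> prime q -> p != q -> exactly N p -> exactly N q ->
  exactly (N %/ p) q.
Proof.
move=> p_pr q_pr pq /andP[/dvdnP[m ->] _] /andP[d nd]; rewrite mulnK ?prime_gt0 //.
apply/andP; split; last by apply: contra nd; apply: dvdn_mulr.
by move: d; rewrite Euclid_dvdM // (dvdn_prime2 q_pr p_pr) [q == p]eq_sym (negPf pq) orbF.
Qed.

(** Outer induction on the power of 2, inner induction on the number of blocks. Each prime removes a
    block; when none is left all coefficients are even, and the halved combination starts again with
    r/2 blocks. Exact divisibility by the other primes survives the division of N by p. *)
Lemma comb_vanish K b c ps N : filt b c -> size ps = (b + r./2 * K)%N -> uniq ps ->
  all good_prime ps -> all (exactly N) ps -> (((2 ^ K.+1)%N%:Z) %| comb c N)%Z.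
Proof.
elim: K b c ps N => [|K IHK] b c ps N.
all: elim: b c ps N => [|b IHb] c ps N hf sz un gd ex; last first.
1,3: case: ps sz un gd ex => [|p ps]; rewrite ?addSn // => -[sz] /= /andP[np un] /andP[gp gd] /andP[ep ex].
1,2: have [c' [hf' e]] := hecke_step gp hf; have /and3P[p_pr _ _] := gp.
1,2: rewrite -(hecke_exact (comb c) p_pr ep) e; apply: (IHb c' ps) => //.
1,2: apply/allP => q qps; apply: exactly_div => //; [by case/and3P: (allP gd q qps) | by apply: contraNneq np => -> | exact: (allP ex)].
all: have [c6 c2] := hf.
all: have c2' s : (s <= 3 * r)%N -> (2 %| c s)%Z.
1,3: by case: s => [|s] ls; [rewrite c6 // dvdz0 | apply: c2].
all: have e : comb c N = 2 * comb (fun s => (c s %/ 2)%Z) N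
  by rewrite !combE mulr_sumr; apply: eq_bigr => s _; rewrite mulrA [2 * _]mulrC divzK // c2' // -ltnS.
  by rewrite e dvdz_mulr.
rewrite e expnS PoszM dvdz_mul2l //.
apply: (IHK r./2 _ ps) => //; last by rewrite sz add0n mulnS.
split=> [s /c6 ->|s]; first by rewrite div0z.
by rewrite {2}rE; clear; lia.
Qed.

Lemma e1i_vanish K ps N : size ps = (r./2 * K.+1)%N -> uniq ps ->
  all good_prime ps -> all (exactly N) ps -> (((2 ^ K.+1)%N%:Z) %| e1i r 1 N)%Z.
Proof.
move=> sz un gd ex.
have -> : e1i r 1 = comb (fun s => (s == 1%N)%:R).
  have lt : (1 < (3 * r).+1)%N by move: r_gt0; clear; lia.
  rewrite /comb (bigD1 (Ordinal lt)) //= big1 ?addr0.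
    by apply: fpsP => n; rewrite fCM mul1r.
  move=> s ne; rewrite (_ : (s == 1%N :> nat) = false); first by apply: fpsP => n; rewrite fCM mul0r.
  by apply/negbTE; apply: contra ne => /eqP e; apply/eqP/val_inj.
apply: (@comb_vanish K r./2 _ ps) => //; last by rewrite sz mulnS.
split=> s; first by case: (s =P 1%N) => // ->.
by rewrite {2}rE; clear; lia.
Qed.

End Nilpotent.

(** * The congruence for the odd minimal excludants and its density *)

Definition alt (a : fps int) : fps int := Fps (fun n => (-1) ^+ n * a n).
Lemma altE a n : alt a n = (-1) ^+ n * a n. Proof. by []. Qed.

Lemma altM a b : alt (a * b) = alt a * alt b.
Proof.
apply: fpsP => n; rewrite altE !fpsM mulr_sumr; apply: eq_bigr => i _.
rewrite !altE mulrACA -exprD subnKC // -ltnS; exact: ltn_ord.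
Qed.
Lemma alt1 : alt 1 = 1.
Proof. by apply: fpsP => -[|n]; rewrite altE fps1 ?mul1r ?mulr0. Qed.
Lemma altX a k : alt (a ^+ k) = alt a ^+ k.
Proof. by elim: k => [|k IHk]; rewrite ?alt1 // !exprS altM IHk. Qed.
Lemma alt_phip : alt phip = phim.
Proof.
apply: fpsP => N; rewrite altE; have [[k ->]|h] := sq_cases N; last by rewrite !sqs0 ?mulr0.
rewrite !sqsE /sgn2 -signr_odd oddX /= signr_odd; case: k => [|k] //=.
by rewrite mulrC.
Qed.
Lemma alt_dil2 a : alt (dil 2 a) = dil 2 a.
Proof.
apply: fpsP => N; rewrite altE dilE; case: ifP => [d|_]; last by rewrite mulr0.
by rewrite -signr_odd -[odd N]negbK -dvdn2 d expr0 mul1r.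
Qed.

(** The substitution of -q for q fixes the even factor E_2 and turns phi(-q) into phi(q); replacing
    q by q^12 and multiplying by q then gives eta(24 z) theta(12 z)^(2r-1), whence the index 12 n +
    1. *)
Lemma phim_e1i r n : (0 < r)%N ->
  (dil 2 E * phim ^+ (2 * r - 1)) n = (-1) ^+ n * e1i r 1 (12 * n + 1)%N.
Proof.
move=> r0; rewrite -alt_phip -[dil 2 E]alt_dil2 -altX -altM altE; congr (_ * _).
rewrite /e1i wform_le; last by move: r0; clear; lia.
rewrite expr1 eta24_euler /t3i -dilX // (_ : 24 = 12 * 2)%N // -dil_dil // -mulrA -dilM //.
by rewrite fXM addnC leq_addr addKn dil_mul.
Qed.

Lemma sum2sq p x y : prime p -> (p %% 4 = 3)%N -> (3 < p)%N -> (p %| x ^ 2 + y ^ 2)%N -> (p %| x)%N.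
Proof.
move=> p_pr p3 p_gt3; have ch := pchar_Fp p_pr; rewrite !(dvdn_pcharf ch) natrD !natrX.
move: (x%:R : 'F_p) (y%:R : 'F_p) => X Y e.
have [Y0|Y0] := eqVneq Y 0.
  by move: e; rewrite Y0 expr0n addr0 expf_eq0.
have := Fp_sqN1 (card_Fp p_pr) p_pr ch p3 p_gt3 (X / Y).
have e' : X ^+ 2 = - Y ^+ 2 by apply/eqP; rewrite -addr_eq0.
by rewrite expr_div_n e' mulNr divff ?eqxx // expf_neq0.
Qed.

Lemma euler_sq_hits p n : good_prime p -> hits p n -> (E ^+ 2) n = 0.
Proof.
move=> /and3P[p_pr /eqP p3 p_gt3] /andP[d nd]; rewrite expr2 fpsM big1 // => i _.
rewrite !pentagonal.
have [[x ex]|h] := sq_cases (24 * i + 1); last by rewrite [sqs chi12 (24 * i + 1)%N]sqs0 ?mul0r.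
have [[y ey]|h] := sq_cases (24 * (n - i) + 1); last by rewrite [X in _ * X]sqs0 ?mulr0.
have exy : (x ^ 2 + y ^ 2 = 2 * (12 * n + 1))%N.
  by rewrite -ex -ey; have := ltn_ord i; clear; lia.
have dxy : (p %| x ^ 2 + y ^ 2)%N by rewrite exy dvdn_mull.
have dx := sum2sq p_pr p3 p_gt3 dxy; rewrite addnC in dxy; have dy := sum2sq p_pr p3 p_gt3 dxy.
case/negP: nd; rewrite -(@Gauss_dvdr _ 2); first by rewrite -exy dvdn_add // dvdn_exp2r.
by rewrite coprimeXl // coprimen2 p_odd.
Qed.

Lemma phim_pow k : exists T : fps int, phim ^+ (2 ^ k) = 1 + 2 ^+ k.+1 * T.
Proof.
elim: k => [|k [T IHk]].
  exists (Fps (fun n => if n is 0 then 0 else sqs (fun x => (-1) ^+ x) n)); rewrite !expr1.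
  apply: fpsP => N; rewrite fpsD fps1 mulr2n mulrDl mul1r fpsD.
  case: N => [|N]; first by rewrite [RHS]/= !addr0; exact: (sqsE sgn2 0).
  rewrite add0r [in RHS]/= -/(sqs _ N.+1).
  have [[x ex]|h] := sq_cases N.+1; last by rewrite -![\sum_(x < _) _]/(sqs _ N.+1) !sqs0 // addr0.
  rewrite ex /phim sqsE -![\sum_(x0 < _) _]/(sqs _ (x ^ 2)%N) sqsE.
  by case: x ex => // x _; rewrite /sgn2 /= mulrDl mul1r.
exists (T + 2 ^+ k * T ^+ 2); rewrite expnS mulnC exprM IHk !exprS.
by ring.
Qed.

Lemma fps_pow2 (T : fps int) m n : (2 ^+ m * T) n = 2 ^+ m * T n.
Proof. by rewrite -(natrX _ 2 m) mulr_natl fpsMn -(natrX int 2 m) mulr_natl. Qed.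

Lemma G_o_hits (R : realType) k n : (0 < k)%N -> good_hits (2 ^ k.-1 * k.+1) n ->
  (((2 ^ k)%N%:Z) %| G_o n)%Z.
Proof.
move=> k0 [ps [sz un gd ht]].
have r0 : (0 < 2 ^ k)%N by rewrite expn_gt0.
have re : ~~ odd (2 ^ k) by rewrite oddX; case: k k0 {sz r0}.
have rh : ((2 ^ k)./2 = 2 ^ k.-1)%N by case: k k0 {sz r0 re} => // k _; rewrite expnS mul2n doubleK.
have e1 : (((2 ^ k.+1)%N%:Z) %| (dil 2 E * phim ^+ (2 * 2 ^ k - 1)%N) n)%Z.
  rewrite phim_e1i // dvdz_mull //; apply: (@e1i_vanish R (2 ^ k) re r0 k ps) => //.
  by rewrite rh.
have e2 : (E ^+ 2) n = 0.
  case: ps sz un gd ht => [|p ps] /=.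
    by move/esym/eqP; rewrite muln_eq0 expn_eq0.
  by move=> _ _ /andP[gp _] /andP[hp _]; apply: euler_sq_hits hp.
have [T hT] := phim_pow k.+1.
(* The identity for 2 G_o phi is multiplied by phi^(2r-1): as phi^(2r) = 1 + 2^(k+2) T, this power
   inverts phi modulo 2^(k+2), and [euler_sq] rewrites E_2 phi as E^2. *)
have key : Gser + Gser = E ^+ 2 + dil 2 E * phim ^+ (2 * 2 ^ k - 1) +
    2 ^+ k.+1 * (2 * T * (E ^+ 2 - Gser - Gser)).
  have m1 : (2 ^ k.+1 = (2 * 2 ^ k - 1).+1)%N by rewrite expnS; move: r0; clear; lia.
  have := Gser_phim; move/(congr1 ( *%R^~ (phim ^+ (2 * 2 ^ k - 1)))).
  have p1 : phim ^+ (2 * 2 ^ k - 1) * phim = 1 + 2 ^+ k.+2 * T by rewrite -hT m1 exprSr.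
  move: p1; rewrite euler_sq exprS; move: (phim ^+ _) (2 ^+ k.+1) (dil 2 E) => Q U D p1 e.
  have e' : (Gser + Gser) * (1 + 2 * U * T) = D * phim * (1 + 2 * U * T) + D * Q.
    by rewrite -p1; have := e; move: (phim) Gser => F G {}e; rewrite mulrA mulrAC e; ring.
  move: e'; move: (D * phim) (D * Q) Gser => A B G e'.
  have -> : G + G = (G + G) * (1 + 2 * U * T) - (G + G) * (2 * U * T) by ring.
  by rewrite e'; ring.
have kn : G_o n + G_o n = (dil 2 E * phim ^+ (2 * 2 ^ k - 1)) n +
    2 ^+ k.+1 * (2 * T * (E ^+ 2 - Gser - Gser)) n.
  by rewrite -fps_pow2 -[LHS]/((Gser + Gser) n) {1}key !fpsD e2 add0r.
have : (((2 ^ k.+1)%N%:Z) %| G_o n + G_o n)%Z.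
  rewrite kn; apply: rpredD => //; apply: dvdz_mulr.
  by rewrite -natrX natz.
have -> : G_o n + G_o n = 2 * G_o n by ring.
by rewrite expnS PoszM dvdz_mul2l.
Qed.

Theorem theorem1p3 (R : realType) (k : nat) (hk : (0 < k)%N) : lacunary_mod R G_o (2 ^ k)%N.
Proof.
rewrite /lacunary_mod; apply/cvgrPdist_le => e e0.
have e20 : 0 < e / 2 by lra.
have [C hC] := bad_density (2 ^ k.-1 * k.+1) e20.
(* Beyond m the quantity e X/2 exceeds |C| + e + 1. This absorbs the constant of the sieve as well
   as the discrepancy between the X + 1 integers counted and the divisor X. *)
have [m hm] : exists m : nat, (`|C| + e + 1) * (2 / e) <= m%:R.
  exists (Num.truncn ((`|C| + e + 1) * (2 / e))).+1.
  by apply: ltW; apply: truncnS_gt.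
exists m.+1 => // X /= leX.
have X0 : 0 < X%:R :> R by rewrite ltr0n; apply: leq_trans leX.
set c := count_zero_mod _ _ _.
have cle : (c <= X.+1)%N by rewrite /c /count_zero_mod; apply: leq_trans (max_card _) _; rewrite card_ord.
have cge : (X.+1 <= c + \sum_(0 <= n < X.+1) ~~ `[< good_hits (2 ^ k.-1 * k.+1) n >])%N.
  rewrite /c /count_zero_mod -sum1dep_card big_mkord big_mkcond -big_split /=.
  rewrite -[X in (X <= _)%N]card_ord -sum1_card; apply: leq_sum => n _.
  case: (asboolP (good_hits _ _)) => [/(G_o_hits R hk) d|_]; last by rewrite addn1.
  by rewrite addn0 (_ : (G_o n == 0 %[mod (2 ^ k)%N])%Z) // mod0z; apply/eqP/dvdz_mod0P.
have h1 : c%:R <= X%:R + 1 :> R by rewrite natr1 ler_nat.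
have h2 : X%:R + 1 <= c%:R + (e / 2 * (X%:R + 1) + C) :> R.
  apply: le_trans (_ : _ <= c%:R + (\sum_(0 <= n < X.+1) ~~ `[< good_hits (2 ^ k.-1 * k.+1) n >])%:R) _.
    by rewrite natr1 -natrD ler_nat.
  by rewrite lerD2l natr1.
have h3 : (`|C| + e + 1) <= e / 2 * X%:R.
  have : (`|C| + e + 1) * (2 / e) <= X%:R by apply: le_trans hm _; rewrite ler_nat ltnW.
  move/(ler_wpM2l (ltW e20)); rewrite mulrCA -[e / 2 * _]mulrA (_ : e / 2 * (2 / e) = 1) ?mulr1 //.
  by field; rewrite gt_eqF.
have C1 : C <= `|C| := ler_norm C; have C0 : 0 <= `|C| := normr_ge0 C.
rewrite ler_distl -(ler_pM2r X0) -[X in _ && X](ler_pM2r X0) mulrBl mulrDl divfK ?gt_eqF //.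
move: (X%:R) (c%:R : R) (`|C|) X0 h1 h2 h3 C1 C0 => x y z x0 h1 h2 h3 C1 C0.
by apply/andP; split; lra.
Qed.
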